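(* Assume (H1), (H2), (H3). 1. For any non-negative function $\psi:\mathbb X\to\mathbb R_+$, $a>0$, $x\in\mathbb X$, $y\in\mathbb R$ and $z\geqslant0$, \[ \lim_{n\to\infty} n^{3/2}\,\mathbb E_x\big(\psi(X_n)\,;\,y+S_n\in[z,z+a],\ \tau_y>n\big)=\frac{2V(x,y)}{\sqrt{2\pi}\,\sigma^3}\int_z^{z+a}\mathbb E^*_{\nu}\big(\psi(X_1^* )\,V^*(X_1^*,z'+S_1^* )\,;\,\tau^*_{z'}>1\big)\,dz'. \] 2. There exists $c>0$ such that for any $a>0$, any non-negative $\psi:\mathbb X\to\mathbb R_+$, $y\in\mathbb R$, $z\geqslant0$ and $n\geqslant1$, \[ \sup_{x\in\mathbb X}\mathbb E_x\big(\psi(X_n)\,;\,y+S_n\in[z,z+a],\ \tau_y>n\big)\leqslant\frac{c\,\|\psi\|_\infty}{n^{3/2}}(1+a^3)(1+z)(1+\max(y,0)). \]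
   Context: Let $\mathbb X$ be a finite set and $(X_n)_{n\geqslant0}$ a homogeneous Markov chain on $\mathbb X$ with transition matrix $\mathbf P$; $\mathbb P_x,\mathbb E_x$ denote probability and expectation when $X_0=x$; $\|g\|_\infty=\max_x|g(x)|$, $\mathbf Pg(x)=\sum_{x'}g(x')\mathbf P(x,x')$. (H1): there exists $k_0\geqslant1$ with $\mathbf P^{k_0}g(x)>0$ for all $x$ and every non-negative, not identically zero $g$. Then $\mathbf P$ has a unique invariant probability $\nu$, positive everywhere; $\nu(g)=\sum_xg(x)\nu(x)$. Let $f:\mathbb X\to\mathbb R$, $S_0=0$, $S_n=\sum_{k=1}^nf(X_k)$, $\tau_y=\inf\{k\geqslant1: y+S_k\leqslant0\}$. (H2): $\nu(f)=0$. (H3): for every $(\theta,a)\in\mathbb R^2$ there exist $n\geqslant0$ and $x_0,\dots,x_n$ with $\mathbf P(x_0,x_1)\cdots\mathbf P(x_{n-1},x_n)\mathbf P(x_n,x_0)>0$ and $f(x_0)+\dots+f(x_n)-(n+1)\theta\notin a\mathbb Z$. $\sigma^2=\nu(f^2)+2\sum_{n\geqslant1}\nu(f\mathbf P^nf)>0$. Under (H1)–(H3) the limit $\lim_n\sqrt n\,\mathbb P_x(\tau_y>n)$ exists and is finite, and $V(x,y):=\frac{\sqrt{2\pi}\sigma}{2}\lim_n\sqrt n\,\mathbb P_x(\tau_y>n)$. Dual chain: $\mathbf P^*(x,x^* )=\frac{\nu(x^* )}{\nu(x)}\mathbf P(x^*,x)$; $(X_n^* )_{n\geqslant0}$ is a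 Markov chain with transition matrix $\mathbf P^*$ (independent of $(X_n)$), $S_0^*=0$, $S_n^*=-\sum_{k=1}^nf(X_k^* )$, $\tau^*_z=\inf\{k\geqslant1: z+S_k^*\leqslant0\}$; $\mathbb P^*_x,\mathbb E^*_x$ refer to $X_0^*=x$ and $\mathbb E^*_\nu$ to $X_0^*$ distributed as $\nu$. The dual chain also satisfies (H1)–(H3) (with $-f$) with the same $\nu$ and $\sigma$, and $V^*(x,z):=\frac{\sqrt{2\pi}\sigma}{2}\lim_n\sqrt n\,\mathbb P^*_x(\tau^*_z>n)$. *)

(* Defs.v *)
From HB Require Import structures.
From mathcomp Require Import all_boot all_order all_algebra.
From mathcomp Require Import all_classical all_reals all_analysis.
Set Implicit Arguments. Unset Strict Implicit. Unset Printing Implicit Defensive.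
Import Order.TTheory GRing.Theory Num.Theory.
Import numFieldNormedType.Exports.
Local Open Scope ring_scope.

Section MarkovDefs.
Variables (R : realType) (X : finType).

(* A trajectory of length n starting at x: X_0 = x, (X_1,...,X_n) = w. *)
Definition Xk n (x : X) (w : n.-tuple X) (k : nat) : X := nth x (x :: val w) k.

Definition pathw (Q : X -> X -> R) n (x : X) (w : n.-tuple X) : R :=
  \prod_(i < n) Q (Xk x w i) (Xk x w i.+1).

Definition Sk (g : X -> R) n (x : X) (w : n.-tuple X) (k : nat) : R :=
  \sum_(1 <= i < k.+1) g (Xk x w i).

(* the event {tau_y > n}, i.e. y + S_k > 0 for all 1 <= k <= n *)
Definition surv (g : X -> R) (y : R) n (x : X) (w : n.-tuple X) : bool :=
  [forall k : 'I_n, 0 < y + Sk g x w k.+1].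

Definition Eexp (Q : X -> X -> R) n (x : X) (F : n.-tuple X -> R) : R :=
  \sum_(w : n.-tuple X) pathw Q x w * F w.

Definition surv_prob (Q : X -> X -> R) (g : X -> R) (x : X) (y : R) (n : nat) : R :=
  Eexp Q x (fun w : n.-tuple X => (surv g y x w)%:R).

Definition Piter (Q : X -> X -> R) (n : nat) (h : X -> R) : X -> R :=
  iter n (fun h' x => \sum_(x' : X) Q x x' * h' x') h.

Definition nu_int (nu : X -> R) (g : X -> R) : R := \sum_(x : X) g x * nu x.

Definition sigma2 (Q : X -> X -> R) (nu : X -> R) (f : X -> R) : R :=
  nu_int nu (fun x => f x ^+ 2)
  + 2 * limn (fun N => \sum_(1 <= k < N) nu_int nu (fun x => f x * Piter Q k f x)).

Definition sigma (Q : X -> X -> R) (nu : X -> R) (f : X -> R) : R :=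
  Num.sqrt (sigma2 Q nu f).

Definition Vfun (Q : X -> X -> R) (g : X -> R) (s : R) (x : X) (y : R) : R :=
  Num.sqrt (2 * pi) * s / 2 * limn (fun n => Num.sqrt n%:R * surv_prob Q g x y n).

Definition Pstar (Q : X -> X -> R) (nu : X -> R) (x x' : X) : R :=
  nu x' / nu x * Q x' x.

Definition stochastic (Q : X -> X -> R) : Prop :=
  (forall x x', 0 <= Q x x') /\ (forall x, \sum_(x' : X) Q x x' = 1).

Definition invariant_prob (Q : X -> X -> R) (nu : X -> R) : Prop :=
  (forall x, 0 <= nu x) /\ \sum_(x : X) nu x = 1 /\
  (forall x', \sum_(x : X) nu x * Q x x' = nu x').

Definition H1 (Q : X -> X -> R) : Prop :=
  exists k0 : nat, (1 <= k0)%N /\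
    forall g : X -> R, (forall x, 0 <= g x) -> (exists x, g x != 0) ->
      forall x, 0 < Piter Q k0 g x.

Definition H2 (nu : X -> R) (f : X -> R) : Prop := nu_int nu f = 0.

Definition H3 (Q : X -> X -> R) (f : X -> R) : Prop :=
  forall theta a : R, exists (n : nat) (xs : nat -> X),
    0 < (\prod_(i < n) Q (xs i) (xs i.+1)) * Q (xs n) (xs 0%N) /\
    ~ (exists k : int, \sum_(i < n.+1) f (xs i) - n.+1%:R * theta = a * k%:~R).

Definition supnorm (g : X -> R) : R := \big[Num.max/0]_(x : X) `|g x|.

End MarkovDefs.

(* Main.v *)
Require Import Defs.
From HB Require Import structures.
From mathcomp Require Import all_boot all_order all_algebra.
From mathcomp Require Import all_classical all_reals all_analysis.
From mathcomp Require Import measurable_realfun ring lra zify.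
Set Implicit Arguments. Unset Strict Implicit. Unset Printing Implicit Defensive.
Import Order.TTheory GRing.Theory Num.Theory.
Import numFieldNormedType.Exports.
Local Open Scope classical_set_scope.
Local Open Scope ring_scope.

(** The walk killed on leaving the positive half-line is studied through the
    operator K acting on functions of the state and the height.  The Poisson
    equation gives a nonnegative function V that is harmonic for K and close
    to the height; the heat solution erf (V / (sigma sqrt t)) and its even
    space derivatives are then carried by K with a summable error, which
    yields the order n^(-1/2) of the survival probability.

    (H3) provides loops of equal length whose sums differ by an arbitrarily
    small d > 0; alternating them makes the free iterates almost invariant
    under the shift by d.  For a cell (z, z + d], time reversal turns the
    Gaussian average of the killed mass near a point w of order sqrt n into a
    killed expectation of the dual chain, known from the heat comparison, and
    the shift invariance removes the average.  The mass started from w is thus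
    governed by the second space derivative of the heat solution, times the
    dual harmonic function at z.  Carrying this profile through the first half
    of the time interval gives the factor V and the order n^(-3/2); summing
    over cells produces Darboux sums of a monotone function. *)

(** * One-step operators, free and killed *)

Section Operators.
Variables (R : realType) (X : finType).
Implicit Types (F G : X -> R -> R).

(** Since (H3) carries no rate, regularity in the height comes from coin tossing between loops,
    which makes shifts of order 1/n. Only even space derivatives of the heat solution are used: they
    are odd in V, hence vanish on the absorbing boundary. The obstacle to carrying them is that the
    increments of V are not homogeneous near the boundary; but V minus the martingale height is a
    bounded martingale until death, so the defect has bounded total quadratic variation, and Young's
    inequality with a free parameter l balances it against the time sqrt n spent alive. Heat
    solutions are singular at time 0, so they are started at time ka^2 n, at a relative cost O(ka),
    with ka small after n is large. Time reversal moves endpoints inside a cell, which leaves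
    two-sided bounds with the dual harmonic function at z and at z + d; they meet only as d tends to
    0. The exponent 3/2 is that of the profile v t^(-3/2) near the boundary; below height eta sqrt
    n, where the reversal argument gives nothing, an a priori bound of the same order replaces
    it. *)

Definition step (Q : X -> X -> R) (f : X -> R) F (x : X) (y : R) : R :=
  \sum_(x' : X) Q x x' * F x' (y + f x').

(* The killing acts at departure: a position [y <= 0] is dead. *)
Definition kill (Q : X -> X -> R) (f : X -> R) F (x : X) (y : R) : R :=
  (0 < y)%R%:R * step Q f F x y.

Definition alive : X -> R -> R := fun _ y => (0 < y)%R%:R.

(** Departures at times 0 to n - 1 are tested by [kill], the arrival at time n by [alive]. The start
    is thus tested too, unlike in [surv_prob], which at n + 1 is one free step followed by [srv] at
    n. *)
Definition srv (Q : X -> X -> R) (f : X -> R) (n : nat) : X -> R -> R :=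
  iter n (kill Q f) alive.

Variables (Q : X -> X -> R) (f : X -> R).
Hypothesis SQ : stochastic Q.

Let Q0 x x' : 0 <= Q x x'. Proof. by case: SQ. Qed.
Let Q1 x : \sum_(x' : X) Q x x' = 1. Proof. by case: SQ. Qed.

Local Notation T := (step Q f).
Local Notation K := (kill Q f).
Local Notation s := (srv Q f).

Lemma sumQ_cst x (c : R) : \sum_(x' : X) Q x x' * c = c.
Proof. by rewrite -mulr_suml Q1 mul1r. Qed.

Lemma sumQ_le x (g h : X -> R) : (forall x', g x' <= h x') ->
  \sum_(x' : X) Q x x' * g x' <= \sum_(x' : X) Q x x' * h x'.
Proof. by move=> gh; apply: ler_sum => x' _; apply: ler_wpM2l. Qed.

Lemma sumQ_norm x (g : X -> R) (c : R) : (forall x', `|g x'| <= c) ->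
  `|\sum_(x' : X) Q x x' * g x'| <= c.
Proof.
move=> gc; apply: le_trans (ler_norm_sum _ _ _) _.
apply: le_trans (_ : \sum_(x' : X) Q x x' * c <= _); last by rewrite sumQ_cst.
by apply: ler_sum => x' _; rewrite normrM ger0_norm// ler_wpM2l.
Qed.

Lemma alive_ge0 x y : 0 <= alive x y. Proof. by rewrite /alive ler0n. Qed.

Lemma alive_le1 x y : alive x y <= 1.
Proof. by rewrite /alive lern1; case: (0 < y). Qed.

Lemma killN F x y : y <= 0 -> K F x y = 0.
Proof. by move=> y0; rewrite /kill ltNge y0 mul0r. Qed.

Lemma killP F x y : 0 < y -> K F x y = T F x y.
Proof. by move=> y0; rewrite /kill y0 mul1r. Qed.

Lemma step_le F G x y : (forall x y, F x y <= G x y) -> T F x y <= T G x y.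
Proof. by move=> FG; apply: sumQ_le => x'. Qed.

Lemma kill_le F G x y : (forall x y, F x y <= G x y) -> K F x y <= K G x y.
Proof. by move=> FG; apply: ler_wpM2l; rewrite ?ler0n//; exact: step_le. Qed.

Lemma iter_kill_le F G n : (forall x y, F x y <= G x y) ->
  forall x y, iter n K F x y <= iter n K G x y.
Proof. by move=> FG; elim: n => //= n IH x y; exact: kill_le. Qed.

Lemma step_lin (a b : R) F G x y :
  T (fun x y => a * F x y + b * G x y) x y = a * T F x y + b * T G x y.
Proof.
rewrite /step !mulr_sumr -big_split; apply: eq_bigr => x' _ /=.
by ring.
Qed.

Lemma kill_lin (a b : R) F G x y :
  K (fun x y => a * F x y + b * G x y) x y = a * K F x y + b * K G x y.
Proof. by rewrite /kill step_lin; ring. Qed.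

Lemma step_ext F G : (forall x y, F x y = G x y) ->
  forall x y, T F x y = T G x y.
Proof. by move=> FG x y; apply: eq_bigr => x' _; rewrite FG. Qed.

Lemma kill_ext F G : (forall x y, F x y = G x y) ->
  forall x y, K F x y = K G x y.
Proof. by move=> FG x y; rewrite /kill (step_ext FG). Qed.

Lemma iter_kill_ext F G n : (forall x y, F x y = G x y) ->
  forall x y, iter n K F x y = iter n K G x y.
Proof. by move=> FG; elim: n => //= n IH x y; exact: kill_ext. Qed.

Lemma iter_kill_lin (a b : R) F G n x y :
  iter n K (fun x y => a * F x y + b * G x y) x y =
  a * iter n K F x y + b * iter n K G x y.
Proof.
elim: n x y => //= n IH x y.
by rewrite (kill_ext IH) kill_lin.
Qed.

Lemma iter_step_lin (a b : R) F G n x y :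
  iter n T (fun x y => a * F x y + b * G x y) x y =
  a * iter n T F x y + b * iter n T G x y.
Proof.
elim: n x y => //= n IH x y.
by rewrite (step_ext IH) step_lin.
Qed.

Lemma iter_kill_scale (a : R) F n x y :
  iter n K (fun x y => a * F x y) x y = a * iter n K F x y.
Proof.
have := iter_kill_lin a 0 F F n x y; rewrite mul0r addr0 => <-.
by apply: iter_kill_ext => ? ?; rewrite mul0r addr0.
Qed.

Lemma step_sum (I : Type) (r : seq I) (P : pred I) (c : I -> R)
    (F : I -> X -> R -> R) x y :
  T (fun x y => \sum_(i <- r | P i) c i * F i x y) x y =
  \sum_(i <- r | P i) c i * T (F i) x y.
Proof.
rewrite /step; under eq_bigr do rewrite mulr_sumr.
rewrite exchange_big; apply: eq_bigr => i _.
by rewrite mulr_sumr; apply: eq_bigr => x' _; rewrite mulrCA.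
Qed.

Lemma kill_sum (I : Type) (r : seq I) (P : pred I) (c : I -> R)
    (F : I -> X -> R -> R) x y :
  K (fun x y => \sum_(i <- r | P i) c i * F i x y) x y =
  \sum_(i <- r | P i) c i * K (F i) x y.
Proof.
rewrite /kill step_sum mulr_sumr; apply: eq_bigr => i _.
by rewrite mulrCA.
Qed.

Lemma iter_kill_sum (I : Type) (r : seq I) (P : pred I) (c : I -> R)
    (F : I -> X -> R -> R) n x y :
  iter n K (fun x y => \sum_(i <- r | P i) c i * F i x y) x y =
  \sum_(i <- r | P i) c i * iter n K (F i) x y.
Proof.
elim: n x y => //= n IH x y.
by rewrite (kill_ext IH) kill_sum.
Qed.

Lemma kill_ge0 F x y : (forall x y, 0 <= F x y) -> 0 <= K F x y.
Proof.
move=> F0; apply: mulr_ge0; rewrite ?ler0n//.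
by apply: sumr_ge0 => x' _; exact: mulr_ge0.
Qed.

Lemma iter_kill_ge0 F n : (forall x y, 0 <= F x y) ->
  forall x y, 0 <= iter n K F x y.
Proof. by move=> F0; elim: n => //= n IH x y; exact: kill_ge0. Qed.

Lemma iter_step_ge0 F n : (forall x y, 0 <= F x y) ->
  forall x y, 0 <= iter n T F x y.
Proof.
move=> F0; elim: n => //= n IH x y.
by apply: sumr_ge0 => x' _; exact: mulr_ge0.
Qed.

Lemma iter_step_ub F n c : (forall x y, F x y <= c) ->
  forall x y, iter n T F x y <= c.
Proof.
move=> Fc; elim: n => //= n IH x y.
by rewrite -(sumQ_cst x c); apply: sumQ_le.
Qed.

Lemma srv_ge0 n x y : 0 <= s n x y.
Proof. by apply: iter_kill_ge0; exact: alive_ge0. Qed.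

Lemma srvN n x y : y <= 0 -> s n x y = 0.
Proof. by case: n => [|n] y0; [rewrite /srv /= /alive ltNge y0|exact: killN]. Qed.

Lemma srvSP n x y : 0 < y -> s n.+1 x y = T (s n) x y.
Proof. by move=> y0; rewrite /srv /= killP. Qed.

Lemma srv_le1 n x y : s n x y <= 1.
Proof.
elim: n x y => [|n IH] x y; first exact: alive_le1.
have [y0|y0] := ltP 0 y; last by rewrite srvN.
by rewrite srvSP// -(sumQ_cst x 1); apply: sumQ_le.
Qed.

Lemma iter_kill_norm_le F G n : (forall x y, `|F x y| <= G x y) ->
  forall x y, `|iter n K F x y| <= iter n K G x y.
Proof.
move=> FG x y; rewrite ler_norml; apply/andP; split.
  rewrite -mulN1r -iter_kill_scale; apply: iter_kill_le => {}x {}y.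
  by rewrite mulN1r; have := FG x y; rewrite ler_norml => /andP[].
by apply: iter_kill_le => {}x {}y; have := FG x y; rewrite ler_norml => /andP[].
Qed.

Lemma iter_kill_bound F c n : (forall x y, `|F x y| <= c * alive x y) ->
  forall x y, `|iter n K F x y| <= c * s n x y.
Proof.
move=> FG x y; rewrite -iter_kill_scale; exact: iter_kill_norm_le.
Qed.

Lemma srv_monoy n x y y' : y <= y' -> s n x y <= s n x y'.
Proof.
elim: n x y y' => [|n IH] x y y' yy'.
  rewrite /srv /= /alive ler_nat; case: (ltP 0 y) => // y0.
  by rewrite (lt_le_trans y0 yy').
have [y0|y0] := ltP 0 y; last by rewrite srvN// srv_ge0.
rewrite !srvSP// ?(lt_le_trans y0 yy')//; apply: sumQ_le => x'.
by apply: IH; rewrite lerD2r.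
Qed.

Lemma kill_le_step F x y : (forall x y, 0 <= F x y) -> K F x y <= T F x y.
Proof.
move=> F0; have [y0|y0] := ltP 0 y; first by rewrite killP.
by rewrite killN//; apply: sumr_ge0 => x' _; exact: mulr_ge0.
Qed.

Lemma iter_kill_le_step F n : (forall x y, 0 <= F x y) ->
  forall x y, iter n K F x y <= iter n T F x y.
Proof.
move=> F0; elim: n => //= n IH x y.
apply: le_trans (kill_le_step _ _ _) _; first exact: iter_kill_ge0.
exact: step_le.
Qed.

(** Free and killed iterates differ only through the paths that die by time n, each contributing at
    most c. Regularity of free iterates passes in this way to killed ones at heights where death is
    unlikely. *)
Lemma iter_step_kill_diff F c n : 0 <= c -> (forall x y, 0 <= F x y) ->
    (forall x y, F x y <= c * alive x y) ->
  forall x y, iter n T F x y - iter n K F x y <= c * (1 - s n x y).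
Proof.
move=> c0 F0 Fc; elim: n => [|n IH] x y.
  by rewrite subrr mulr_ge0// subr_ge0 srv_le1.
have [y0|y0] := ltP 0 y; last first.
  rewrite srvN// subr0 mulr1 [X in _ - X]killN// subr0.
  apply: iter_step_ub => x1 y1; apply: le_trans (Fc x1 y1) _.
  by rewrite ler_piMr// alive_le1.
rewrite srvSP// iterS iterS killP//.
have -> : T (iter n T F) x y - T (iter n K F) x y =
    \sum_x' Q x x' * (iter n T F x' (y + f x') - iter n K F x' (y + f x')).
  by rewrite -sumrB; apply: eq_bigr => x' _; rewrite mulrBr.
have -> : c * (1 - T (s n) x y) =
    \sum_x' Q x x' * (c * (1 - s n x' (y + f x'))).
  rewrite -{1}(Q1 x) -sumrB mulr_sumr; apply: eq_bigr => x' _; ring.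
by apply: sumQ_le => x'.
Qed.

(** As m > 0, the inner iterate vanishes at dead positions, so c may be multiplied by [alive] before
    the other n steps are run. A sup bound over one part of the time thus combines with survival
    over the other. *)
Lemma iter_kill_split F c n m : (forall x y, 0 <= F x y) ->
    (forall x y, iter m K F x y <= c) ->
  (0 < m)%N -> forall x y, iter (n + m) K F x y <= c * s n x y.
Proof.
move=> F0 Fc m0 x y; rewrite iterD -iter_kill_scale.
apply: iter_kill_le => {}x {}y; rewrite /alive.
have [y0|y0] := ltP 0 y; first by rewrite mulr1.
by case: m m0 {Fc} => // m _; rewrite /= killN// mulr0.
Qed.

End Operators.

(** * Bounds on finite sets and limits of sequences *)

Section FiniteBounds.
Variables (R : realType) (I : finType).

Lemma fin_ub (g : I -> R) : exists2 c : R, 0 < c & forall i, `|g i| <= c.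
Proof.
exists (1 + \sum_i `|g i|); first by rewrite ltr_pwDl// sumr_ge0.
move=> i; rewrite (bigD1 i)//= [leRHS]addrCA lerDl addr_ge0//.
by rewrite sumr_ge0.
Qed.

Lemma fin_lb (g : I -> R) : (forall i, 0 < g i) ->
  exists2 c : R, 0 < c < 1 & forall i, c <= g i.
Proof.
move=> g0; have [c c0 cg] := fin_ub (fun i => (g i)^-1).
have c1 : 0 < 1 + c by lra.
exists (1 + c)^-1; first by rewrite invr_gt0 c1/= invf_lt1// ltrDl.
move=> i; rewrite -[g i]invrK lef_pV2 ?posrE ?invr_gt0//.
by apply: le_trans (ler_norm _) _; apply: le_trans (cg i) _; rewrite lerDr.
Qed.
End FiniteBounds.

Section Limits.
Variable R : realType.
Implicit Type u : nat -> R.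

Lemma cvgn_eps u l : (forall e : R, 0 < e ->
    exists N, forall n, (N <= n)%N -> `|u n - l| <= e) -> u @ \oo --> l.
Proof.
move=> H; apply/cvgrPdist_le => e e0; have [N HN] := H e e0.
by near=> n; rewrite distrC; apply: HN; near: n; exact: nbhs_infty_ge.
Unshelve. all: by end_near. Qed.

Lemma cvgn_epsP u l : u @ \oo --> l -> forall e : R, 0 < e ->
    exists N, forall n, (N <= n)%N -> `|u n - l| <= e.
Proof.
move=> /cvgrPdist_le H e e0; have [N _ HN] := H e e0.
by exists N => n Nn; rewrite distrC; exact: HN.
Qed.

Lemma geo_small (a e : R) : 0 <= a < 1 -> 0 < e -> exists n, a ^+ n <= e.
Proof.
move=> /andP[a0 a1] e0.
have /cvgn_epsP : (fun n => a ^+ n) @ \oo --> (0 : R).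
  by apply: cvg_expr; rewrite ger0_norm.
move=> /(_ e e0)[N /(_ N (leqnn N))]; rewrite subr0 => H; exists N.
exact: le_trans (ler_norm _) H.
Qed.
End Limits.

(** * Ergodicity and the Poisson equation *)

Section Chain.
Variables (R : realType) (X : finType).

(** Bundled so that every estimate can be instantiated both for the chain and for its dual, which is
    again a [chain], for -f. *)
Record chain (Q : X -> X -> R) (nu : X -> R) (f : X -> R) : Prop := Chain {
  chain_stoch : stochastic Q;
  chain_inv : invariant_prob Q nu;
  chain_H1 : H1 Q;
  chain_H2 : H2 nu f;
  chain_H3 : H3 Q f }.

Variables (Q : X -> X -> R) (nu : X -> R) (f : X -> R).
Hypothesis CH : chain Q nu f.

Let SQ := chain_stoch CH.
Let Q0 x x' : 0 <= Q x x'. Proof. by case: SQ. Qed.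
Let nu0 x : 0 <= nu x. Proof. by case: (chain_inv CH). Qed.
Let nu1 : \sum_x nu x = 1. Proof. by case: (chain_inv CH) => _ []. Qed.
Let nuQ x' : \sum_x nu x * Q x x' = nu x'.
Proof. by case: (chain_inv CH) => _ []. Qed.

Local Notation Pn := (Piter Q).

Lemma PiterS n h x : Pn n.+1 h x = \sum_x' Q x x' * Pn n h x'.
Proof. by []. Qed.

Lemma Piter_lin n (a b : R) g h x :
  Pn n (fun x => a * g x + b * h x) x = a * Pn n g x + b * Pn n h x.
Proof.
elim: n x => //= n IH x; rewrite !mulr_sumr -big_split.
by apply: eq_bigr => x' _ /=; rewrite IH; ring.
Qed.

Lemma Piter_delta n h x :
  Pn n h x = \sum_x' Pn n (fun z => (z == x')%:R) x * h x'.
Proof.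
elim: n x => [|n IH] x.
  rewrite /= (bigD1 x)//= eqxx mul1r big1 ?addr0// => x' /negPf.
  by rewrite eq_sym => ->; rewrite mul0r.
rewrite PiterS; under eq_bigr do rewrite IH mulr_sumr.
rewrite exchange_big /=; apply: eq_bigr => x' _.
by rewrite mulr_suml; apply: eq_bigr => z _; rewrite mulrA.
Qed.

Lemma Piter_ge0 n h x : (forall x, 0 <= h x) -> 0 <= Pn n h x.
Proof.
move=> h0; elim: n x => //= n IH x.
by apply: sumr_ge0 => x' _; apply: mulr_ge0.
Qed.

Lemma Piter_norm n h c x : (forall x, `|h x| <= c) -> `|Pn n h x| <= c.
Proof. by move=> hc; elim: n x => //= n IH x; exact: (sumQ_norm SQ). Qed.

Lemma Piter_add n m h x : Pn (n + m) h x = Pn n (Pn m h) x.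
Proof. by rewrite /Piter iterD. Qed.

Lemma Piter_cst n c x : Pn n (fun=> c) x = c.
Proof.
elim: n x => //= n IH x; under eq_bigr do rewrite IH.
by rewrite (sumQ_cst SQ).
Qed.

Lemma nu_sum h : nu_int nu (fun x => \sum_x' Q x x' * h x') = nu_int nu h.
Proof.
rewrite /nu_int; under eq_bigr do rewrite mulr_suml.
rewrite exchange_big; apply: eq_bigr => x' _ /=.
rewrite -nuQ mulr_sumr; apply: eq_bigr => x _; ring.
Qed.

Lemma nu_Piter n h : nu_int nu (Pn n h) = nu_int nu h.
Proof. by elim: n => // n <-; exact: nu_sum. Qed.

Lemma nu_lin (a b : R) g h :
  nu_int nu (fun x => a * g x + b * h x) = a * nu_int nu g + b * nu_int nu h.
Proof.
rewrite /nu_int !mulr_sumr -big_split; apply: eq_bigr => x _ /=; ring.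
Qed.

Lemma nu_cst c : nu_int nu (fun=> c) = c.
Proof. by rewrite /nu_int -mulr_sumr nu1 mulr1. Qed.

Lemma nu_norm h c : (forall x, `|h x| <= c) -> `|nu_int nu h| <= c.
Proof.
move=> hc; apply: le_trans (ler_norm_sum _ _ _) _.
rewrite -[leRHS]nu_cst; apply: ler_sum => x _.
by rewrite normrM (ger0_norm (nu0 x)) ler_wpM2r.
Qed.

Lemma Piter_pos : exists2 k0 : nat, (0 < k0)%N &
  forall x x', 0 < Pn k0 (fun z => (z == x')%:R) x.
Proof.
have [k0 [k00 H]] := chain_H1 CH; exists k0 => // x x'; apply: H.
  by move=> z; rewrite ler0n.
by exists x'; rewrite eqxx oner_eq0.
Qed.

(** Stationarity gives nu = nu P^k0, and P^k0 has positive entries. *)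
Lemma nu_gt0 x : 0 < nu x.
Proof.
have [k0 _ H] := Piter_pos.
have : nu_int nu (fun z => (z == x)%:R) = nu x.
  rewrite /nu_int (bigD1 x)//= eqxx mul1r big1 ?addr0// => z /negPf ->.
  by rewrite mul0r.
rewrite -(nu_Piter k0) => <-.
have [x1 _ x10] : exists2 x1, true & 0 < nu x1.
  have /negP : ~~ [forall x1, nu x1 == 0].
    apply/negP => /forallP H0; have := nu1; rewrite big1 => [/eqP|i _].
      by rewrite eq_sym oner_eq0.
    by apply/eqP.
  move=> H1; apply: contrapT => H2; apply: H1; apply/forallP => x1.
  apply/negPn/negP => H3; apply: H2; exists x1 => //.
  by rewrite lt_def H3 nu0.
rewrite /nu_int (bigD1 x1)//= ltr_pwDl// ?mulr_gt0//.
by apply: sumr_ge0 => z _; rewrite mulr_ge0// ltW.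
Qed.

Lemma nu_le1 x : nu x <= 1.
Proof. by rewrite -nu1 (bigD1 x)//= lerDl sumr_ge0. Qed.

(** Doeblin minorization: the entries of P^k0 are at least some d > 0, hence at least d nu. Removing
    d nu from each row changes nothing on functions of mean 0 and leaves nonnegative weights of
    total 1 - d, so P^k0 contracts the sup norm by 1 - d on such functions. *)
Lemma Piter_cvg0 h : nu_int nu h = 0 -> forall e : R, 0 < e ->
  exists N, forall n, (N <= n)%N -> forall x, `|Pn n h x| <= e.
Proof.
have [k0 _ H] := Piter_pos.
have [d /andP[d0 d1] dH] := fin_lb (fun p : X * X => H p.1 p.2).
have contr g c : nu_int nu g = 0 -> (forall x, `|g x| <= c) ->
    forall x, `|Pn k0 g x| <= (1 - d) * c.
  move=> g0 gc x.
  have -> : Pn k0 g x =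
      \sum_x' (Pn k0 (fun z => (z == x')%:R) x - d * nu x') * g x'.
    rewrite Piter_delta; under [RHS]eq_bigr do rewrite mulrBl.
    rewrite sumrB; under [X in _ - X]eq_bigr do rewrite -mulrA [nu _ * _]mulrC.
    by rewrite -mulr_sumr -/(nu_int nu g) g0 mulr0 subr0.
  have pd x' : 0 <= Pn k0 (fun z => (z == x')%:R) x - d * nu x'.
    rewrite subr_ge0; apply: le_trans (dH (x, x')).
    by rewrite ger_pMr// nu_le1.
  apply: le_trans (ler_norm_sum _ _ _) _.
  apply: le_trans (_ : \sum_x' (Pn k0 (fun z => (z == x')%:R) x - d * nu x') * c <= _).
    by apply: ler_sum => x' _; rewrite normrM ger0_norm ?pd// ler_wpM2l.
  rewrite -mulr_suml sumrB -mulr_sumr nu1 mulr1.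
  have -> : \sum_x' Pn k0 (fun z => (z == x')%:R) x = 1; last exact: lexx.
  rewrite -[RHS](Piter_cst k0 1 x) Piter_delta.
  by apply: eq_bigr => x' _; rewrite mulr1.
move=> h0; have [c c0 hc] := fin_ub h.
have main j : forall x, `|Pn (j * k0) h x| <= (1 - d) ^+ j * c.
  elim: j => [|j IH] x; first by rewrite expr0 mul1r hc.
  rewrite mulSn Piter_add exprS -mulrA; apply: contr => //.
  by rewrite nu_Piter.
move=> e e0; have [||j Hj] := @geo_small R (1 - d) (e / c); rewrite ?divr_gt0//.
  by apply/andP; split; lra.
exists (j * k0)%N => n /subnK <- x; rewrite Piter_add.
apply: Piter_norm => z; apply: le_trans (main j z) _.
by rewrite -ler_pdivlMr.
Qed.

(** I - P + 1 nu is injective: integration against nu shows that a kernel element has mean 0, so it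
    is P-invariant, and it is 0 because its iterates converge to 0. In finite dimension it is
    therefore invertible, and integrating the solution shows that the rank-one term drops out. *)
Lemma poisson h : nu_int nu h = 0 ->
  exists2 q : X -> R, (forall x, q x - \sum_x' Q x x' * q x' = h x) &
    nu_int nu q = 0.
Proof.
move=> h0; pose n := #|X|; pose ev : 'I_n -> X := @enum_val X X.
(* The transpose of I - P + 1 nu, since functions are row vectors multiplied on the right. *)
pose B : 'M[R]_n := \matrix_(j, i)
  ((i == j)%:R - Q (ev i) (ev j) + nu (ev j)).
have reidx (g : X -> R) : \sum_x g x = \sum_(i < n) g (ev i).
  by rewrite (reindex ev)//; apply: onW_bij; exact: enum_val_bij.
have Bmul (u : 'rV[R]_n) (g : X -> R) : (forall i, u 0 i = g (ev i)) ->
    forall i, (u *m B) 0 i =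
      g (ev i) - \sum_x Q (ev i) x * g x + nu_int nu g.
  move=> ug i; rewrite mxE /nu_int !reidx.
  under eq_bigr do rewrite mxE ug mulrDr mulrBr.
  rewrite big_split sumrB /=; congr (_ - _ + _).
    rewrite (bigD1 i)//= eqxx mulr1 big1 ?addr0// => j /negPf.
    by rewrite eq_sym => ->; rewrite mulr0.
  by apply: eq_bigr => j _; rewrite mulrC.
have nuB g : nu_int nu (fun x => g x - \sum_x' Q x x' * g x' + nu_int nu g) =
    nu_int nu g.
  have -> : (fun x => g x - \sum_x' Q x x' * g x' + nu_int nu g) =
    (fun x => 1 * (1 * g x + (-1) * \sum_x' Q x x' * g x') + 1 * nu_int nu g).
    by apply/funext => x; ring.
  rewrite (nu_lin 1 1 (fun x => 1 * g x + (-1) * _)) (nu_lin 1 (-1)).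
  by rewrite nu_sum nu_cst; ring.
have injB (u : 'rV[R]_n) : u *m B = 0 -> u = 0.
  move=> uB; pose g x := u 0 (enum_rank x).
  have ug i : u 0 i = g (ev i) by rewrite /g /ev enum_valK.
  have Hg x : g x - \sum_x' Q x x' * g x' + nu_int nu g = 0.
    rewrite -[x](enum_rankK x) -/(ev (enum_rank x)).
    by rewrite -(Bmul u g ug) uB mxE.
  have g0 : nu_int nu g = 0.
    rewrite -(nuB g) /nu_int big1// => x _.
    by rewrite -/(nu_int nu g) Hg mul0r.
  have gP k x : Pn k g x = g x.
    elim: k x => // k IH x; rewrite PiterS; under eq_bigr do rewrite IH.
    by have := Hg x; rewrite g0 addr0 => /eqP; rewrite subr_eq0 => /eqP.
  apply/rowP => i; rewrite mxE ug; apply/eqP; rewrite -normr_eq0.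
  apply/eqP/le_anti; rewrite normr_ge0 andbT.
  apply/ler_addgt0Pl => e e0; rewrite addr0.
  have [N HN] := Piter_cvg0 g0 e0.
  by rewrite -(gP N); exact: HN.
have Bu : B \in unitmx.
  rewrite -row_free_unit -kermx_eq0; apply/eqP/row_matrixP => i.
  rewrite row0; apply: injB; rewrite -row_mul mulmx_ker row0 //.
pose u : 'rV[R]_n := (\row_i h (ev i)) *m invmx B.
pose g x := u 0 (enum_rank x).
have ug i : u 0 i = g (ev i) by rewrite /g /ev enum_valK.
have Hg x : g x - \sum_x' Q x x' * g x' + nu_int nu g = h x.
  rewrite -[x](enum_rankK x) -/(ev (enum_rank x)).
  by rewrite -(Bmul u g ug) mulmxKV// mxE.
have g0 : nu_int nu g = 0.
  have E : (fun x => g x - \sum_x' Q x x' * g x' + nu_int nu g) = h.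
    by apply/funext => x; exact: Hg.
  by have := nuB g; rewrite E h0.
by exists g => // x; rewrite -Hg g0 addr0.
Qed.

End Chain.

(** * Correctors and positivity of the variance *)

Section ChainData.
Variables (R : realType) (X : finType).
Variables (Q : X -> X -> R) (nu : X -> R) (f : X -> R).
Hypothesis CH : chain Q nu f.

Let SQ := chain_stoch CH.
Let Q0 x x' : 0 <= Q x x'. Proof. by case: SQ. Qed.
Let Q1 x : \sum_(x' : X) Q x x' = 1. Proof. by case: SQ. Qed.

Lemma prod_gt0_factor n (F : 'I_n -> R) : (forall i, 0 <= F i) ->
  0 < \prod_(i < n) F i -> forall i, 0 < F i.
Proof.
move=> F0 + i; rewrite (bigD1 i)//= => H.
rewrite lt_def F0 andbT; apply/eqP => Fi; move: H.
by rewrite Fi mul0r ltxx.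
Qed.

(** r is the sum of P^k f over k >= 1, since partial sums telescope to r - P^N r. Hence sigma^2 =
    nu(f^2) + 2 nu(f r), which is the expanded mean square of the martingale increment f(x') + r(x')
    - r(x). *)
Lemma sigma2_poisson (r : X -> R) :
  (forall x, \sum_x' Q x x' * (f x' + r x') = r x) -> nu_int nu r = 0 ->
  sigma2 Q nu f =
  nu_int nu (fun x => \sum_x' Q x x' * (f x' + r x' - r x) ^+ 2).
Proof.
move=> Hr r0.
have HP N x : \sum_(1 <= k < N.+1) Piter Q k f x = r x - Piter Q N r x.
  elim: N => [|N IH]; first by rewrite big_geq// /= subrr.
  rewrite big_nat_recr//= IH.
  have -> : \sum_x' Q x x' * Piter Q N f x' =
      Piter Q N (fun x => 1 * r x + (-1) * (\sum_x' Q x x' * r x')) x.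
    have -> : (fun x => 1 * r x + (-1) * (\sum_x' Q x x' * r x')) =
        (fun x => \sum_x' Q x x' * f x').
      apply/funext => z; rewrite -[r z in LHS]Hr.
      under [in LHS]eq_bigr do rewrite mulrDr.
      by rewrite big_split/=; ring.
    by rewrite -[LHS]/(Piter Q N.+1 f x) -addn1 Piter_add.
  rewrite Piter_lin -[\sum_x' Q x x' * _]/(Piter Q N.+1 r x).
  by rewrite -addn1 Piter_add /=; ring.
have -> : nu_int nu (fun x => \sum_x' Q x x' * (f x' + r x' - r x) ^+ 2) =
    nu_int nu (fun x => 1 * (f x ^+ 2) + 2 * (f x * r x)).
  have -> : (fun x => \sum_x' Q x x' * (f x' + r x' - r x) ^+ 2) =
    (fun x => 1 * (\sum_x' Q x x' * (f x' + r x') ^+ 2) + (-1) * (r x) ^+ 2).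
    apply/funext => x.
    transitivity (\sum_x' (Q x x' * (f x' + r x') ^+ 2
       - 2 * r x * (Q x x' * (f x' + r x')) + r x ^+ 2 * Q x x')).
      by apply: eq_bigr => x' _; ring.
    by rewrite big_split sumrB /= -!mulr_sumr Hr Q1; ring.
  rewrite (nu_lin nu 1 (-1) (fun x => \sum_x' Q x x' * (f x' + r x') ^+ 2)).
  have /= -> := nu_sum CH (fun x => (f x + r x) ^+ 2).
  rewrite -(nu_lin nu 1 (-1) (fun x => (f x + r x) ^+ 2)).
  by congr (nu_int nu _); apply/funext => x; ring.
rewrite nu_lin mul1r /sigma2; congr (_ + 2 * _).
apply/cvg_lim => //; apply: cvgn_eps => e e0.
have [c c0 fc] := fin_ub f.
have [N HN] := Piter_cvg0 CH r0 (divr_gt0 e0 c0).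
exists N.+1 => -[//|n] Nn.
have -> : \sum_(1 <= k < n.+1) nu_int nu (fun x => f x * Piter Q k f x) =
    nu_int nu (fun x => f x * (r x - Piter Q n r x)).
  rewrite /nu_int exchange_big /=; apply: eq_bigr => x _.
  by rewrite -HP mulr_sumr mulr_suml.
have -> : nu_int nu (fun x => f x * (r x - Piter Q n r x)) -
    nu_int nu (fun x => f x * r x) = nu_int nu (fun x => - (f x * Piter Q n r x)).
  by rewrite /nu_int -sumrB; apply: eq_bigr => x _; ring.
apply: (nu_norm CH) => x; rewrite normrN normrM.
rewrite -(divfK (lt0r_neq0 c0) e) mulrC; apply: ler_pM => //.
exact: HN.
Qed.

(** r makes y + r(x) a martingale. q solves a second Poisson equation, for the conditional variance
    minus its mean, so that (y + r)^2 + q gains exactly sigma^2 at each step. If sigma vanished, f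
    would be a coboundary along edges and all cycle sums would be 0, against (H3). *)
Lemma chain_data : exists r q : X -> R,
  [/\ forall x, \sum_x' Q x x' * (f x' + r x') = r x,
      0 < sigma Q nu f &
      forall x, \sum_x' Q x x' * ((f x' + r x' - r x) ^+ 2 + q x') =
                q x + sigma Q nu f ^+ 2].
Proof.
have nuf0 : nu_int nu (fun x => \sum_x' Q x x' * f x') = 0.
  by rewrite (nu_sum CH); exact: (chain_H2 CH).
have [r Hr0 r0] := poisson CH nuf0.
have Hr x : \sum_x' Q x x' * (f x' + r x') = r x.
  under eq_bigr do rewrite mulrDr.
  by rewrite big_split/= -Hr0; ring.
pose b x := \sum_x' Q x x' * (f x' + r x' - r x) ^+ 2.
have s2 : sigma2 Q nu f = nu_int nu b by exact: sigma2_poisson.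
have b0 x : 0 <= b x by apply: sumr_ge0 => x' _; rewrite mulr_ge0// sqr_ge0.
have s20 : 0 < sigma2 Q nu f.
  rewrite lt_def s2; apply/andP; split; last first.
    by apply: sumr_ge0 => x _; rewrite mulr_ge0// ltW// (nu_gt0 CH).
  apply/eqP => nub.
  have bx x : b x = 0.
    have H : forall i, i \in index_enum X -> true -> b i * nu i = 0.
      move=> i ii _; apply: (@psumr_eq0P R X xpredT (fun i => b i * nu i)) => //.
      by move=> j _; rewrite mulr_ge0// ltW// (nu_gt0 CH).
    have /eqP := H x (mem_index_enum x) isT.
    by rewrite mulf_eq0 (gt_eqF (nu_gt0 CH x)) orbF => /eqP.
  have edge x x' : 0 < Q x x' -> f x' = r x - r x'.
    move=> Qx; have := @psumr_eq0P R X xpredT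
      (fun x' => Q x x' * (f x' + r x' - r x) ^+ 2).
    move=> /(_ (fun i _ => mulr_ge0 (Q0 x i) (sqr_ge0 _)) (bx x) x' isT)/eqP.
    rewrite mulf_eq0 (gt_eqF Qx)/= sqrf_eq0 subr_eq0 => /eqP <-; ring.
  (* At theta = 0 and a = 0, (H3) provides a cycle with nonzero sum. *)
  have [n [xs [pos]]] := chain_H3 CH 0 0; apply.
  exists 0; rewrite mulr0 mulr0 subr0.
  have pr0 : 0 <= \prod_(i < n) Q (xs i) (xs i.+1) by apply: prodr_ge0.
  have qn : 0 < Q (xs n) (xs 0%N).
    by rewrite lt_def Q0 andbT; apply/eqP => E; move: pos; rewrite E mulr0 ltxx.
  have prp : 0 < \prod_(i < n) Q (xs i) (xs i.+1) by move: pos; rewrite pmulr_lgt0.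
  rewrite big_ord_recl (edge _ _ qn).
  have -> : \sum_(i < n) f (xs (lift ord0 i)) =
      \sum_(0 <= i < n) (r (xs i) - r (xs i.+1)).
    rewrite big_mkord; apply: eq_bigr => i _ /=; apply: edge.
    exact: (prod_gt0_factor (fun i => Q0 _ _) prp i).
  rewrite (@telescope_sumr_eq _ 0 n (fun i => - r (xs i)))// => [|i _]; last by ring.
  by ring.
have nuh : nu_int nu (fun x => 1 * b x + (-1) * sigma2 Q nu f) = 0.
  by rewrite (nu_lin nu 1 (-1) b (fun=> _)) (nu_cst CH) -s2; ring.
have [q Hq _] := poisson CH nuh.
exists r, q; split => //; first by rewrite sqrtr_gt0.
move=> x; rewrite sqr_sqrtr ?ltW//.
under eq_bigr do rewrite mulrDr.
by rewrite big_split /= -/(b x); have := Hq x => ?; lra.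
Qed.

End ChainData.

(** * The dual chain *)

Section Dual.
Variables (R : realType) (X : finType).
Variables (Q : X -> X -> R) (nu : X -> R) (f : X -> R).
Hypothesis CH : chain Q nu f.

Let SQ := chain_stoch CH.
Let Q0 x x' : 0 <= Q x x'. Proof. by case: SQ. Qed.
Let Q1 x : \sum_(x' : X) Q x x' = 1. Proof. by case: SQ. Qed.
Let nup x : 0 < nu x. Proof. exact: (nu_gt0 CH). Qed.
Let nun x : nu x != 0. Proof. by rewrite gt_eqF. Qed.

Lemma nu_Pstar x x' : nu x * Pstar Q nu x x' = nu x' * Q x' x.
Proof. by rewrite /Pstar; field. Qed.

Lemma Piter_adjoint n g h :
  nu_int nu (fun x => h x * Piter (Pstar Q nu) n g x) =
  nu_int nu (fun x => Piter Q n h x * g x).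
Proof.
elim: n g h => // n IH g h.
have -> : nu_int nu (fun x => Piter Q n.+1 h x * g x) =
    nu_int nu (fun x => (\sum_x' Q x x' * h x') * Piter (Pstar Q nu) n g x).
  by rewrite IH -addn1; congr nu_int; apply/funext => x; rewrite Piter_add.
rewrite /nu_int /=.
under eq_bigr do rewrite mulrAC mulr_sumr.
under [RHS]eq_bigr do rewrite 2!mulr_suml.
rewrite exchange_big; apply: eq_bigr => x _; apply: eq_bigr => x' _ /=.
transitivity (h x' * (nu x' * Pstar Q nu x' x) * Piter (Pstar Q nu) n g x).
  by ring.
by rewrite nu_Pstar; ring.
Qed.

(** Positivity of the iterates passes through adjointness in L^2(nu), tested on a point mass. A
    cycle read backwards is a cycle of the dual chain, and the sign of f is absorbed by using (H3)
    at -theta. *)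
Lemma dual_chain : chain (Pstar Q nu) nu (fun x => - f x).
Proof.
split.
- split=> [x x'|x]; first by rewrite mulr_ge0// divr_ge0 ?ltW.
  apply: (mulfI (nun x)); rewrite mulr1 mulr_sumr.
  under eq_bigr do rewrite nu_Pstar.
  by case: (chain_inv CH) => _ [].
- case: (chain_inv CH) => H1 [H2 H3]; split => //; split => // x'.
  by under eq_bigr do rewrite nu_Pstar; rewrite -mulr_sumr Q1 mulr1.
- have [k0 k00 H] := Piter_pos CH; exists k0; split => // g g0 [x1 gx1] x.
  have E : nu_int nu (fun z => (z == x)%:R * Piter (Pstar Q nu) k0 g z) =
      Piter (Pstar Q nu) k0 g x * nu x.
    rewrite /nu_int (bigD1 x)//= eqxx mul1r big1 ?addr0// => z /negPf ->.
    by rewrite !mul0r.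
  rewrite -(pmulr_lgt0 _ (nup x)) -E Piter_adjoint /nu_int (bigD1 x1)//=.
  apply: ltr_pwDl; first by rewrite !mulr_gt0// lt_def gx1 g0.
  by apply: sumr_ge0 => z _; rewrite !mulr_ge0// ltW.
- rewrite /H2 /nu_int; under eq_bigr do rewrite mulNr.
  by rewrite sumrN -/(nu_int nu f) (chain_H2 CH) oppr0.
- move=> th a; have [n [xs [pos Hn]]] := chain_H3 CH (- th) a.
  have pr0 : 0 <= \prod_(i < n) Q (xs i) (xs i.+1) by apply: prodr_ge0.
  have qn : 0 < Q (xs n) (xs 0%N).
    by rewrite lt_def Q0 andbT; apply/eqP => E; move: pos; rewrite E mulr0 ltxx.
  have prp : 0 < \prod_(i < n) Q (xs i) (xs i.+1) by move: pos; rewrite pmulr_lgt0.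
  exists n, (fun i => xs (n - i)%N); split.
    rewrite subnn subn0 mulr_gt0//; last by rewrite mulr_gt0// divr_gt0.
    apply: prodr_gt0 => i _; rewrite mulr_gt0 ?divr_gt0//.
    have := prod_gt0_factor (fun i => Q0 _ _) prp (rev_ord i).
    rewrite /= => H; have <- : (n - i.+1).+1 = (n - i)%N by have ilt := ltn_ord i; lia.
    exact: H.
  move=> [k Hk]; apply: Hn; exists (- k); rewrite intrN [RHS]mulrN -Hk.
  rewrite (reindex_inj rev_ord_inj)/=.
  have -> : \sum_(i < n.+1) f (xs (n.+1 - i.+1)%N) =
    \sum_(i < n.+1) - - f (xs (n - i)%N) by apply: eq_bigr => i _; rewrite opprK subSS.
  by rewrite sumrN; ring.
Qed.

(** Adjointness identifies the correlations of order k of both chains, and the two signs of -f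
    cancel. *)
Lemma sigma_dual : sigma (Pstar Q nu) nu (fun x => - f x) = sigma Q nu f.
Proof.
have E : (fun N => \sum_(1 <= k < N) nu_int nu
    (fun x => - f x * Piter (Pstar Q nu) k (fun x => - f x) x)) =
  (fun N => \sum_(1 <= k < N) nu_int nu (fun x => f x * Piter Q k f x)).
  apply/funext => N; apply: eq_bigr => k _.
  rewrite (Piter_adjoint k (fun x => - f x)); congr nu_int; apply/funext => x.
  have -> : (fun x => - f x) = (fun x => (-1) * f x + 0 * f x).
    by apply/funext => z; ring.
  by rewrite Piter_lin; ring.
rewrite /sigma /sigma2 E; congr (Num.sqrt (_ + _)).
by congr nu_int; apply/funext => x; rewrite sqrrN.
Qed.

End Dual.

(** * Subgroups of the real line *)

Section Subgroup.
Variable R : realType.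

(** Instead of an infimum, u is an element of (0, n e) with n minimal. A nonzero remainder w of v
    modulo u would be at least (n - 1) e by minimality, and u - w would fall in (0, e). *)
Lemma subgroup_dense_or_cyclic (G : R -> Prop) (e : R) : G 0 ->
    (forall u v, G u -> G v -> G (u - v)) -> 0 < e ->
    ~ (exists2 d, G d & 0 < d < e) ->
  exists a : R, forall u, G u -> exists k : int, u = a * k%:~R.
Proof.
move=> G0 GB e0 nd.
have GN u : G u -> G (- u) by move=> Gu; rewrite -sub0r; exact: GB.
have [[g Gg g0]|np] := pselect (exists2 g, G g & 0 < g); last first.
  exists 0 => u Gu; exists 0; rewrite mulr0.
  apply/eqP; case: ltgtP => // u0; exfalso; apply: np; last by exists u.
  by exists (- u); [exact: GN|rewrite oppr_gt0].
pose P n := `[< exists2 u, G u & 0 < u < n%:R * e >].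
have exP : exists n, P n.
  exists (Num.bound (g / e)); apply/asboolP; exists g => //.
  by rewrite g0/= -ltr_pdivrMr// archi_boundP// divr_ge0 ?ltW.
case: (ex_minnP exP) => n /asboolP[u Gu /andP[u0 un]] minn.
have Gk k : G (u * k%:~R).
  have Gnat m : G (u * m%:R).
    elim: m => [|m IH]; first by rewrite mulr0.
    rewrite -natr1 mulrDr mulr1 -[X in _ + X]opprK; apply: GB => //; exact: GN.
  case: k => m; first exact: Gnat.
  by rewrite NegzE intrN mulrN; apply: GN; exact: Gnat.
exists u => v Gv; exists (Num.floor (v / u)).
set k := Num.floor _.
have lo : u * k%:~R <= v by rewrite mulrC -ler_pdivlMr// floor_le.
have hi : v - u * k%:~R < u.
  have := floorD1_gt (v / u); rewrite -/k ltr_pdivrMr// intrD mulrDl mul1r.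
  by rewrite [_ * u]mulrC => ?; lra.
apply/eqP; rewrite -subr_eq0; apply/eqP; set w := v - _ in hi *.
have Gw : G w by apply: GB.
have w0 : 0 <= w by rewrite subr_ge0.
apply/eqP; apply: contrapT => /negP wn; apply: nd; exists (u - w); first exact: GB.
have wp : 0 < w by rewrite lt_def wn.
apply/andP; split; first by lra.
have n0 : (0 < n)%N by case: n un {minn} => //; rewrite mul0r => ?; lra.
have : n.-1%:R * e <= w.
  rewrite leNgt; apply/negP => H; have : P n.-1.
    by apply/asboolP; exists w => //; rewrite wp.
  by move/minn; lia.
by move: un; rewrite -[in n%:R](prednK n0) -natr1 mulrDl mul1r => ? ?; lra.
Qed.
End Subgroup.

(** * Loops of equal length with slightly different sums *)

Section Loops.
Variables (R : realType) (X : finType).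
Variables (Q : X -> X -> R) (nu : X -> R) (f : X -> R).
Hypothesis CH : chain Q nu f.

Let SQ := chain_stoch CH.
Let Q0 x x' : 0 <= Q x x'. Proof. by case: SQ. Qed.

Definition edge : rel X := fun a b => 0 < Q a b.
Definition wsum (s : seq X) : R := \sum_(a <- s) f a.

Lemma wsum_cat s t : wsum (s ++ t) = wsum s + wsum t.
Proof. by rewrite /wsum big_cat. Qed.

Lemma sum_gt0_ex (g : X -> R) : (forall x, 0 <= g x) -> 0 < \sum_x g x ->
  exists x, 0 < g x.
Proof.
move=> g0 H; apply: contrapT => N; move: H; rewrite big1 ?ltxx// => x _.
apply/eqP; apply: contrapT => /negP gx; apply: N; exists x.
by rewrite lt_def gx g0.
Qed.

Lemma Piter_path n x x' : 0 < Piter Q n (fun z => (z == x')%:R) x ->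
  exists s, [/\ size s = n, path edge x s & last x s = x'].
Proof.
elim: n x => [|n IH] x /=.
  by case: eqP => [<-|] _; [exists [::]|rewrite ?ltxx].
have P0 z : 0 <= Piter Q n (fun w => (w == x')%:R) z.
  by apply: (Piter_ge0 CH) => ?; rewrite ler0n.
move=> /sum_gt0_ex[z|z H]; first by rewrite mulr_ge0.
have Qz : 0 < Q x z.
  by rewrite lt_def Q0 andbT; apply/eqP => E; move: H; rewrite E mul0r ltxx.
have [t [<- pt <-]] : exists s, [/\ size s = n, path edge z s & last z s = x'].
  by apply: IH; move: H; rewrite pmulr_rgt0.
by exists (z :: t); split => //=; rewrite pt /edge Qz.
Qed.

Lemma exists_path : exists2 k0 : nat, (0 < k0)%N & forall x x',
  exists s, [/\ size s = k0, path edge x s & last x s = x'].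
Proof.
by have [k0 k00 H] := Piter_pos CH; exists k0 => // x x'; exact: Piter_path.
Qed.

Definition loop_at x0 (c : seq X) := path edge x0 c && (last x0 c == x0).

Lemma loop_cat x0 c c' : loop_at x0 c -> loop_at x0 c' -> loop_at x0 (c ++ c').
Proof.
move=> /andP[pc /eqP lc] /andP[pc' /eqP lc'].
by rewrite /loop_at cat_path last_cat lc pc pc' lc' eqxx.
Qed.

Fixpoint rep n (c : seq X) := if n is m.+1 then c ++ rep m c else [::].

Lemma rep_loop x0 n c : loop_at x0 c -> loop_at x0 (rep n c).
Proof.
by move=> lc; elim: n => [|n IH] /=; [rewrite /loop_at /= eqxx|exact: loop_cat].
Qed.

Lemma size_rep n c : size (rep n c) = (n * size c)%N.
Proof. by elim: n => //= n IH; rewrite size_cat IH mulSn. Qed.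

Lemma wsum_rep n c : wsum (rep n c) = n%:R * wsum c.
Proof.
elim: n => [|n IH] /=; first by rewrite /wsum big_nil mul0r.
by rewrite wsum_cat IH -natr1 mulrDl mul1r addrC.
Qed.

(* Differences of sums of equally long loops form a subgroup; if it were
   cyclic, every cycle sum would satisfy the congruence excluded by (H3). *)
Lemma small_loops (x0 : X) (e : R) : 0 < e -> exists d c c',
  [/\ 0 < d < e, loop_at x0 c, loop_at x0 c', size c = size c' &
      wsum c' = wsum c + d].
Proof.
move=> e0; pose G u := exists c c', [/\ loop_at x0 c, loop_at x0 c',
  size c = size c' & wsum c' - wsum c = u].
have [[d [c [c' [lc lc' scc dd]]] de]|nd] := pselect (exists2 d, G d & 0 < d < e).
  by exists d, c, c'; split => //; rewrite -dd; ring.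
exfalso.
have l0 : loop_at x0 [::] by rewrite /loop_at /= eqxx.
have G0 : G 0 by exists [::], [::]; split => //; rewrite subrr.
have GB u v : G u -> G v -> G (u - v).
  move=> [c [c' [lc lc' scc <-]]] [b [b' [lb lb' sbb <-]]].
  exists (c ++ b'), (c' ++ b); split; try exact: loop_cat.
    by rewrite !size_cat scc sbb.
  by rewrite !wsum_cat; ring.
have [a Ha] := subgroup_dense_or_cyclic G0 GB e0 nd.
have [k0 k00 Hp] := exists_path.
have [c1 [sc1 pc1 lc1]] := Hp x0 x0.
have [x1 Qx1] : exists x1, 0 < Q x0 x1.
  by apply: sum_gt0_ex => //; rewrite (proj2 SQ).
have [t [st pt lt]] := Hp x1 x0.
pose c2 := x1 :: t.
have L1 : loop_at x0 c1 by rewrite /loop_at pc1 lc1 eqxx.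
have L2 : loop_at x0 c2 by rewrite /loop_at /= /edge Qx1 pt lt eqxx.
(* [c2] is one step longer than [c1], so exchanging them compensates one step of length at the price
   [th]: this is the drift submitted to (H3). *)
pose th := wsum c2 - wsum c1.
have Hth c : loop_at x0 c -> G (wsum c - (size c)%:R * th).
  move=> lc; exists (rep (size c) c2), (c ++ rep (size c) c1); split.
  - exact: rep_loop.
  - by apply: loop_cat => //; exact: rep_loop.
  - by rewrite size_cat !size_rep /= sc1 st mulnS.
  - by rewrite wsum_cat !wsum_rep /th; ring.
have [n [xs [pos]]] := chain_H3 CH th a; apply.
have pr0 : 0 <= \prod_(i < n) Q (xs i) (xs i.+1) by apply: prodr_ge0.
have qn : 0 < Q (xs n) (xs 0%N).
  by rewrite lt_def Q0 andbT; apply/eqP => E; move: pos; rewrite E mulr0 ltxx.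
have prp : 0 < \prod_(i < n) Q (xs i) (xs i.+1) by move: pos; rewrite pmulr_lgt0.
have Qi i : (i < n)%N -> 0 < Q (xs i) (xs i.+1).
  by move=> i_n; exact: (prod_gt0_factor (fun i => Q0 _ _) prp (Ordinal i_n)).
pose c := rcons (mkseq (fun i => xs i.+1) n) (xs 0%N).
have pm m : (m <= n)%N -> path edge (xs 0%N) (mkseq (fun i => xs i.+1) m) /\
    last (xs 0%N) (mkseq (fun i => xs i.+1) m) = xs m.
  elim: m => // m IH mn; have [pm lm] := IH (ltnW mn).
  by rewrite mkseqS rcons_path last_rcons pm lm /= /edge Qi.
have [pn ln] := pm n (leqnn n).
have pc : path edge (xs 0%N) c by rewrite rcons_path pn ln /edge qn.
have lc : last (xs 0%N) c = xs 0%N by rewrite last_rcons.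
have sc : size c = n.+1 by rewrite size_rcons size_mkseq.
have wc : wsum c = \sum_(i < n.+1) f (xs i).
  rewrite /c -cats1 wsum_cat {2}/wsum big_seq1 big_ord_recl addrC; congr (_ + _).
  rewrite /wsum /mkseq big_map -{1}(subn0 n) -/(index_iota 0 n) big_mkord.
  by apply: eq_bigr.
(* The cycle need not meet [x0]; it is inserted into a loop at [x0], and the same loop without it is
   subtracted. *)
have [al [sal pal lal]] := Hp x0 (xs 0%N).
have [be [sbe pbe lbe]] := Hp (xs 0%N) x0.
have Lab : loop_at x0 (al ++ be).
  by rewrite /loop_at cat_path last_cat pal lal pbe lbe eqxx.
have Lacb : loop_at x0 (al ++ c ++ be).
  by rewrite /loop_at !cat_path !last_cat pal lal lc pbe lbe pc eqxx.
have [k Hk] := Ha _ (GB _ _ (Hth _ Lacb) (Hth _ Lab)).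
exists k; rewrite -Hk -wc !wsum_cat !size_cat sc !natrD; ring.
Qed.

End Loops.

(** * Flatness of binomial weights *)

Section Binomial.

Lemma bin_incr n j : (j.*2.+1 <= n)%N -> ('C(n, j) <= 'C(n, j.+1))%N.
Proof.
move=> jn; rewrite -(leq_pmul2l (ltn0Sn j)) mul_bin_left leq_mul2r.
by apply/orP; right; lia.
Qed.

Lemma bin_incr_half n j i : (j <= i)%N -> (i.*2 <= n)%N -> ('C(n, j) <= 'C(n, i))%N.
Proof.
move=> /subnK <-; elim: (i - j)%N => // k IH H.
apply: leq_trans (IH _) _; first lia.
by rewrite addSn; apply: bin_incr; lia.
Qed.

Lemma bin_unimodal n j i : (j <= i)%N -> (i + j <= n)%N ->
  ('C(n, j) <= 'C(n, i))%N.
Proof.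
move=> ji ijn; have [H|H] := leqP i.*2 n; first exact: bin_incr_half.
rewrite -(bin_sub (_ : i <= n)%N); last lia.
by apply: bin_incr_half; lia.
Qed.

(** By unimodality the n - 2j coefficients of index j to n - j - 1 are all at least C(n, j), and the
    whole row sums to 2^n. *)
Lemma bin_dist_le n j : (j.*2 <= n)%N -> ((n - j.*2) * 'C(n, j) <= 2 ^ n)%N.
Proof.
move=> jn; rewrite -[2%N]/(1 + 1)%N expnDn.
rewrite -(big_mkord xpredT (fun i => 'C(n, i) * (1 ^ (n - i) * 1 ^ i)))%N.
rewrite (@big_cat_nat _ _ _ j)//=; last lia.
rewrite (@big_cat_nat _ _ _ (n - j) j n.+1)//=; [|lia|lia].
apply: leq_trans (leq_addl _ _); apply: leq_trans (leq_addr _ _).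
apply: leq_trans (_ : \sum_(j <= i < n - j) 'C(n, j) <= _)%N.
  by rewrite sum_nat_const_nat leq_mul2r; apply/orP; right; lia.
rewrite big_nat_cond [leqRHS]big_nat_cond; apply: leq_sum => i.
by move=> /andP[/andP[ji ij] _]; rewrite !exp1n !muln1 bin_unimodal//; lia.
Qed.

Variable R : realType.

(** Multiplied by k + 1, the difference is (2i + 1 - k) C(k + 1, i + 1), a coefficient times its
    distance to the middle of the row. Neighbouring weights thus differ by O(1/k), although the
    largest weights are of order 1/sqrt k. *)
Lemma bin_diff_le k i :
  k.+1%:R * `|'C(k, i)%:R - 'C(k, i.+1)%:R| <= 2 ^+ k.+1 :> R.
Proof.
have [ki|ki] := ltnP k i.
  by rewrite !bin_small ?subrr ?normr0 ?mulr0 ?exprn_ge0//; lia.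
rewrite -[X in X * _]ger0_norm// -normrM mulrBr -!natrM.
have /= -> := mul_bin_diag k.+1 i.
have /= -> := mul_bin_down k.+1 i.+1.
rewrite !natrM -mulrBl normrM [`|'C(_, _)%:R|]ger0_norm//.
have [H|H] := leqP i.+1.*2 k.+1.
  rewrite -normrN ger0_norm; last by rewrite opprB subr_ge0 ler_nat; lia.
  rewrite opprB -natrB; last lia.
  have -> : (k.+1 - i.+1 - i.+1)%N = (k.+1 - i.+1.*2)%N by lia.
  by rewrite -natrM -natrX ler_nat bin_dist_le.
rewrite ger0_norm; last by rewrite subr_ge0 ler_nat; lia.
rewrite -natrB; last lia.
rewrite -natrM -natrX ler_nat -(@bin_sub k.+1 i.+1); last lia.
apply: leq_trans (@bin_dist_le k.+1 (k.+1 - i.+1)%N _); last lia.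
by rewrite leq_mul2r; apply/orP; right; lia.
Qed.

Lemma bin_sum_shift k (a : nat -> R) :
  \sum_(i < k.+1) 'C(k, i)%:R * (a i + a i.+1) =
  \sum_(i < k.+2) 'C(k.+1, i)%:R * a i.
Proof.
rewrite [RHS]big_ord_recl /= bin0 mul1r.
under [in RHS]eq_bigr do rewrite /bump /= add1n binS natrD mulrDl.
rewrite big_split /= addrA.
have -> : a 0%N + \sum_(i < k.+1) 'C(k, i.+1)%:R * a i.+1 =
    \sum_(i < k.+1) 'C(k, i)%:R * a i.
  rewrite big_ord_recr /= bin_small// mul0r addr0.
  rewrite [RHS]big_ord_recl /= bin0 mul1r; congr (_ + _).
by rewrite -big_split; apply: eq_bigr => i _; rewrite mulrDr.
Qed.

(** Summation by parts moves the difference from a to the weights. *)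
Lemma bin_sum_diff k (a : nat -> R) :
  `|\sum_(i < k.+1) 'C(k, i)%:R * (a i.+1 - a i)| <=
  2 ^+ k.+1 / k.+1%:R * \sum_(i < k.+2) `|a i|.
Proof.
have -> : \sum_(i < k.+1) 'C(k, i)%:R * (a i.+1 - a i) =
  \sum_(i < k.+1) ('C(k, i)%:R - 'C(k, i.+1)%:R) * a i.+1 - a 0%N.
  under eq_bigr do rewrite mulrBr.
  under [in RHS]eq_bigr do rewrite mulrBl.
  rewrite !sumrB -[RHS]addrA; congr (_ + _); rewrite -opprD; congr (- _).
  rewrite [RHS]addrC [in RHS]big_ord_recr /= bin_small// mul0r addr0.
  by rewrite big_ord_recl /= bin0 mul1r; congr (_ + _).
apply: le_trans (ler_normB _ _) _.
rewrite [X in _ * X]big_ord_recl mulrDr addrC; apply: lerD.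
  rewrite ler_peMl// ler_pdivlMr// mul1r -natrX ler_nat.
  by apply: ltnW; exact: ltn_expl.
apply: le_trans (ler_norm_sum _ _ _) _; rewrite mulr_sumr.
apply: ler_sum => i _; rewrite normrM ler_wpM2r//.
by rewrite ler_pdivlMr// mulrC bin_diff_le.
Qed.

End Binomial.

(** * Shift regularity of the free iterates *)

Section Regularity.
Variables (R : realType) (X : finType).
Variables (Q : X -> X -> R) (f : X -> R).
Hypothesis SQ : stochastic Q.
Implicit Types F G : X -> R -> R.

Let Q0 x x' : 0 <= Q x x'. Proof. by case: SQ. Qed.
Local Notation T := (step Q f).

(** An l1 bound along all progressions of step d. Free steps preserve it, and it is the norm against
    which shifts by d of the n-th iterate are O(1/n). *)
Definition lat (d : R) F (M : R) := forall x y (J : nat),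
  \sum_(j < J) `|F x (y + j%:R * d)| <= M.

Lemma lat_ge0 d F M (x : X) : lat d F M -> 0 <= M.
Proof. by move=> /(_ x 0 0%N); rewrite big_ord0. Qed.

Lemma step_shift F c x y : T (fun x y => F x (y + c)) x y = T F x (y + c).
Proof. by apply: eq_bigr => x' _; rewrite addrAC. Qed.

Lemma iter_step_ext F G n : (forall x y, F x y = G x y) ->
  forall x y, iter n T F x y = iter n T G x y.
Proof. by move=> FG; elim: n => //= n IH x y; exact: step_ext. Qed.

Lemma iter_step_shift F c n x y :
  iter n T (fun x y => F x (y + c)) x y = iter n T F x (y + c).
Proof.
elim: n x y => //= n IH x y; rewrite -step_shift; exact: step_ext.
Qed.

Lemma iter_step_sum (I : Type) (r : seq I) (F : I -> X -> R -> R) n x y :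
  iter n T (fun x y => \sum_(i <- r) F i x y) x y =
  \sum_(i <- r) iter n T (F i) x y.
Proof.
elim: n x y => //= n IH x y; rewrite (step_ext _ _ IH).
have := @step_sum _ _ Q f I r xpredT (fun=> 1) (fun i => iter n T (F i)) x y.
under [X in _ = X]eq_bigr do rewrite mul1r.
by move <-; apply: step_ext => ? ?; under [RHS]eq_bigr do rewrite mul1r.
Qed.

Lemma lat_iter_step d F M n : lat d F M -> lat d (iter n T F) M.
Proof.
move=> FM; elim: n => // n IH x y J.
apply: le_trans (_ : \sum_(j < J) \sum_x' Q x x' * `|iter n T F x' (y + f x' + j%:R * d)| <= _).
  apply: ler_sum => j _; apply: le_trans (ler_norm_sum _ _ _) _.
  by apply: ler_sum => x' _; rewrite normrM ger0_norm// addrAC.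
rewrite exchange_big /= -[leRHS](sumQ_cst SQ x M); apply: ler_sum => x' _.
by rewrite -mulr_sumr; apply: ler_wpM2l => //; exact: IH.
Qed.

(** A fair coin decides whether to shift by d. *)
Definition avg (d : R) F (x : X) (y : R) : R := (F x y + F x (y + d)) / 2.

Lemma avg_ext d F G : (forall x y, F x y = G x y) ->
  forall x y, avg d F x y = avg d G x y.
Proof. by move=> FG x y; rewrite /avg !FG. Qed.

Lemma iter_avg_ext d F G n : (forall x y, F x y = G x y) ->
  forall x y, iter n (avg d) F x y = iter n (avg d) G x y.
Proof. by move=> FG; elim: n => //= n IH x y; exact: avg_ext. Qed.

Lemma iter_avgE d F k x y : iter k (avg d) F x y =
  2 ^- k * \sum_(i < k.+1) 'C(k, i)%:R * F x (y + i%:R * d).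
Proof.
elim: k F => [|k IH] F.
  by rewrite /= big_ord1 bin0 expr0 invr1 !mul1r mul0r addr0.
rewrite iterSr IH; have <- := bin_sum_shift k (fun i => F x (y + i%:R * d)).
rewrite exprS invfM -mulrA 3!mulr_sumr.
apply: eq_bigr => i _; rewrite /avg.
have -> : y + i%:R * d + d = y + i.+1%:R * d by rewrite -natr1; ring.
by ring.
Qed.

Lemma iter_avg_diff d F M k x y : lat d F M ->
  `|iter k (avg d) F x (y + d) - iter k (avg d) F x y| <= 2 * M / k.+1%:R.
Proof.
move=> FM; rewrite !iter_avgE -mulrBr -sumrB normrM.
have -> : \sum_(i < k.+1) ('C(k, i)%:R * F x (y + d + i%:R * d) -
    'C(k, i)%:R * F x (y + i%:R * d)) =
  \sum_(i < k.+1) 'C(k, i)%:R *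
    ((fun i : nat => F x (y + i%:R * d)) i.+1 - (fun i : nat => F x (y + i%:R * d)) i).
  apply: eq_bigr => i _; rewrite mulrBr; congr (_ * F x _ - _).
  by rewrite -natr1; ring.
rewrite ger0_norm ?invr_ge0 ?exprn_ge0//.
rewrite -ler_pdivlMl ?invr_gt0 ?exprn_gt0// invrK.
apply: le_trans (bin_sum_diff k (fun i => F x (y + i%:R * d))) _; rewrite exprS.
have -> : 2 ^+ k * (2 * M / k.+1%:R) = 2 * 2 ^+ k / k.+1%:R * M by ring.
by apply: ler_wpM2l; rewrite ?divr_ge0 ?mulr_ge0 ?exprn_ge0//; exact: FM.
Qed.

Section Minorized.
Variables (d al : R) (L : nat) (x0 : X) (sh : X -> R).
Hypothesis al0 : 0 < al.
Hypothesis minor : forall F, (forall x y, 0 <= F x y) -> forall x y,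
  al * (F x0 (y + sh x) + F x0 (y + sh x + d)) <= iter L T F x y.

Let A F x y := F x0 (y + sh x).
(** What remains of L steps once the two alternative loops, each of weight al, are taken out: a
    positive operator of mass 1 - 2 al. *)
Let rest F x y := iter L T F x y - al * (A F x y + A F x (y + d)).

Let al2 : 2 * al <= 1.
Proof.
have := @minor (fun _ _ => 1) (fun _ _ => ler01) x0 0.
move=> /le_trans/(_ (@iter_step_ub _ _ _ f SQ _ L 1 (fun _ _ => lexx _) x0 0)).
by move=> ?; lra.
Qed.

Let rest_ge0 F : (forall x y, 0 <= F x y) -> forall x y, 0 <= rest F x y.
Proof. by move=> F0 x y; rewrite subr_ge0 /A addrAC minor. Qed.

Let rest_lin (a b : R) F G x y :
  rest (fun x y => a * F x y + b * G x y) x y = a * rest F x y + b * rest G x y.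
Proof. by rewrite /rest iter_step_lin /A; ring. Qed.

Let rest_cst c x y : rest (fun _ _ => c) x y = (1 - 2 * al) * c.
Proof.
rewrite /rest /A; suff -> : iter L T (fun _ _ => c) x y = c by ring.
elim: L x y => //= n IH x y; rewrite (step_ext _ _ IH).
exact: (sumQ_cst SQ).
Qed.

Let lat_A F M : lat d F M -> lat d (A F) M.
Proof.
move=> FM x y J; rewrite /A; apply: le_trans (FM x0 (y + sh x) J).
by apply: ler_sum => j _; rewrite addrAC.
Qed.

Let lat_rest F M : lat d F M -> lat d (rest F) ((1 - 2 * al) * M).
Proof.
move=> FM x y J.
apply: le_trans (_ : \sum_(j < J) rest (fun x y => `|F x y|) x (y + j%:R * d) <= _).
  apply: ler_sum => j _; rewrite ler_norml; apply/andP; split.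
    rewrite -subr_ge0 opprK -[X in X + _]mul1r -[X in _ + X]mul1r -rest_lin.
    apply: rest_ge0 => x1 y1; rewrite !mul1r.
    by have := ler_norm (- F x1 y1); rewrite normrN => ?; lra.
  rewrite -subr_ge0 -[X in _ - X]mul1r -[X in X - _]mul1r -mulNr -rest_lin.
  by apply: rest_ge0 => x1 y1; rewrite mul1r mulN1r subr_ge0 ler_norm.
pose G x y := \sum_(j < J) `|F x (y + j%:R * d)|.
have -> : \sum_(j < J) rest (fun x y => `|F x y|) x (y + j%:R * d) = rest G x y.
  rewrite /rest /G sumrB; congr (_ - _).
    rewrite iter_step_sum; apply: eq_bigr => j _.
    by rewrite (iter_step_shift (fun x y => `|F x y|)).
  rewrite -mulr_sumr big_split /=; congr (_ * (_ + _)); apply: eq_bigr => j _.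
    by rewrite /A addrAC.
  by rewrite /A; congr `|F _ _|; ring.
rewrite -(rest_cst M x y) -subr_ge0 -[X in _ - X]mul1r -[X in X - _]mul1r.
rewrite -mulNr -rest_lin; apply: rest_ge0 => x1 y1.
by rewrite mul1r mulN1r subr_ge0; exact: FM.
Qed.

Let iter_step_avg F k n x y :
  iter n T (iter k (avg d) F) x y = iter k (avg d) (iter n T F) x y.
Proof.
elim: k F x y => // k IH F x y; rewrite iterSr IH iterSr.
apply: iter_avg_ext => x1 y1; rewrite /avg.
rewrite -[X in (_ + X) / _](iter_step_shift F).
rewrite mulrDl ![_ / 2]mulrC -iter_step_lin.
by apply: iter_step_ext => ? ?; rewrite -mulrDr mulrC.
Qed.

(** With weight 2 al a block of L steps adds one coin toss; otherwise it acts through [rest]. Tosses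
    accumulate because averaging commutes with the steps. *)
Let decomp F k x y : iter L T (iter k (avg d) F) x y =
  2 * al * iter k.+1 (avg d) (A F) x y + 1 * iter k (avg d) (rest F) x y.
Proof.
rewrite iter_step_avg iterSr.
have -> : iter k (avg d) (iter L T F) x y =
  iter k (avg d) (fun x y => 2 * al * avg d (A F) x y + 1 * rest F x y) x y.
  by apply: iter_avg_ext => x1 y1; rewrite /rest /avg; field.
move: (rest F) (avg d (A F)) => G1 G2.
elim: k x y => [|k IH] x y; first by [].
rewrite iterS (avg_ext _ IH) [in RHS]iterS [in RHS]iterS /avg; ring.
Qed.

(* The bound solves the recursion
   [2 al B(N, k+1) + (1 - 2 al) B(N, k) <= B(N+1, k)]. *)
Let reg_aux N : forall k F M, lat d F M -> forall x y,
  `|iter (N * L) T (iter k (avg d) F) x (y + d) -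
    iter (N * L) T (iter k (avg d) F) x y| <= 2 * M / (k.+1%:R + al * N%:R).
Proof.
elim: N => [|N IH] k F M FM x y.
  by rewrite mul0n mulr0 addr0; exact: iter_avg_diff.
have dec z : iter (N.+1 * L) T (iter k (avg d) F) x z =
  2 * al * iter (N * L) T (iter k.+1 (avg d) (A F)) x z +
  1 * iter (N * L) T (iter k (avg d) (rest F)) x z.
  rewrite mulSnr iterD -iter_step_lin; apply: iter_step_ext => x1 y1.
  exact: decomp.
have M0 : 0 <= M := lat_ge0 x FM.
rewrite !dec.
set a1 := iter _ _ _ _ (y + d); set a2 := iter _ _ _ _ (y + d).
set b1 := iter _ _ _ _ y; set b2 := iter _ _ _ _ y.
have -> : 2 * al * a1 + 1 * a2 - (2 * al * b1 + 1 * b2) =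
  2 * al * (a1 - b1) + (a2 - b2) by ring.
have al20 : 0 <= 2 * al by rewrite mulr_ge0// ltW.
apply: le_trans (ler_normD _ _) _; rewrite normrM (ger0_norm al20).
have H1 := IH k.+1 _ _ (lat_A FM) x y.
have H2 := IH k _ _ (lat_rest FM) x y.
rewrite -/a1 -/b1 in H1; rewrite -/a2 -/b2 in H2.
have a0 := ltW al0.
apply: le_trans (lerD (ler_wpM2l _ H1) H2) _; first by lra.
rewrite -[N.+1%:R]natr1 -[k.+2%:R]natr1.
have z0 : 0 <= al * N%:R by rewrite mulr_ge0.
have k1 : 1 <= k.+1%:R :> R by rewrite ler1n.
set z := k.+1%:R + al * N%:R.
have z1 : 1 <= z by rewrite /z; lra.
have -> : k.+1%:R + 1 + al * N%:R = z + 1 by rewrite /z; ring.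
have -> : k.+1%:R + al * (N%:R + 1) = z + al by rewrite /z; ring.
have -> : 2 * al * (2 * M / (z + 1)) + 2 * ((1 - 2 * al) * M) / z =
  2 * M * ((z + 1 - 2 * al) / (z * (z + 1))).
  by field; rewrite !gt_eqF//; lra.
apply: ler_wpM2l; first by lra.
rewrite ler_pdivrMr; last by nra.
rewrite [leRHS]mulrC ler_pdivlMr; last by lra.
by have := al2 => ?; nra.
Qed.

(** Each block tosses a coin with weight 2 al, so n steps contain of order n tosses, and k tosses
    make the shift O(1/k). Steps left over after the last full block are free of charge, [lat] being
    preserved. *)
Lemma reg_minorized : (0 < L)%N -> exists2 C : R, 0 < C & forall F M, lat d F M ->
  forall n x y, `|iter n T F x (y + d) - iter n T F x y| <= C * M / n.+1%:R.
Proof.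
move=> L0; exists (2 * L%:R / al); first by rewrite divr_gt0// mulr_gt0// ltr0n.
move=> F M FM n x y; have M0 := lat_ge0 x FM.
rewrite {1 2}(divn_eq n L) iterD -[iter (n %% L) T F]/(iter 0 (avg d) (iter (n %% L) T F)).
apply: le_trans (reg_aux _ _ (lat_iter_step _ FM) _ _) _.
set N := (n %/ L)%N.
have -> : 2 * L%:R / al * M / n.+1%:R = 2 * M * (L%:R / (al * n.+1%:R)).
  by have := ltr0Sn R n; move: n.+1%:R => t t0; field; rewrite !gt_eqF.
have aN : 0 <= al * N%:R by rewrite mulr_ge0// ltW.
apply: ler_wpM2l; first by lra.
rewrite -[leLHS]div1r ler_pdivrMr; last by lra.
rewrite mulrAC ler_pdivlMr ?mulr_gt0// mul1r.
have : n.+1%:R <= L%:R * (N%:R + 1) :> R.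
  rewrite natr1 -natrM ler_nat mulnC mulSn {1}(divn_eq n L) -/N.
  by have := ltn_pmod n L0; lia.
move=> H; apply: le_trans (ler_wpM2l (ltW al0) H) _.
have := al2 => al2'; have L1 : 1 <= L%:R :> R by rewrite ler1n.
have N0 : 0 <= N%:R :> R by [].
nra.
Qed.

End Minorized.
End Regularity.

(** * Smoothing for the chain *)

Section Smoothing.
Variables (R : realType) (X : finType).
Variables (Q : X -> X -> R) (nu : X -> R) (f : X -> R).
Hypothesis CH : chain Q nu f.
Implicit Types F G : X -> R -> R.

Let SQ := chain_stoch CH.
Let Q0 x x' : 0 <= Q x x'. Proof. by case: SQ. Qed.
Local Notation T := (step Q f).

Lemma chain_inhab : exists x : X, true.
Proof.
apply: contrapT => N; have [_ [H _]] := chain_inv CH; move: H.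
rewrite big1 => [/eqP|x _]; first by rewrite eq_sym oner_eq0.
by exfalso; apply: N; exists x.
Qed.

Lemma path_lower x s : path (edge Q) x s -> exists2 w : R, 0 < w &
  forall F, (forall x y, 0 <= F x y) -> forall y,
  w * F (last x s) (y + wsum f s) <= iter (size s) T F x y.
Proof.
elim: s x => [|z s IH] x /=.
  by exists 1 => // F F0 y; rewrite /wsum big_nil addr0 mul1r.
move=> /andP[Qz /IH[w w0 H]]; exists (Q x z * w); first exact: mulr_gt0.
move=> F F0 y; rewrite /step (bigD1 z)//= ler_wpDr//.
  by apply: sumr_ge0 => x' _; rewrite mulr_ge0// (iter_step_ge0 f SQ).
rewrite /wsum big_cons -mulrA ler_wpM2l// addrA; exact: H.
Qed.

Definition smoothing (d C : R) := [/\ 0 < d, 0 < C &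
  forall F M, lat d F M -> forall n x y,
    `|iter n T F x (y + d) - iter n T F x y| <= C * M / n.+1%:R].

(** From every state a path of the fixed length k0 leads to [x0], where either loop can follow.
    Equal lengths make both alternatives end at the same time, d apart, and finiteness of the state
    space gives one lower weight. That d can be small is what closes the gap between the final upper
    and lower sums. *)
Lemma exists_smoothing (e : R) : 0 < e ->
  exists d C, smoothing d C /\ d < e.
Proof.
move=> e0; have [x0 _] := chain_inhab.
have [d [c [c' [/andP[d0 de] /andP[pc /eqP lc] /andP[pc' /eqP lc'] scc wcc]]]] :=
  small_loops CH x0 e0.
have [k0 k00 Hp] := exists_path CH.
have Hx x : exists (sw : R * R), 0 < sw.2 /\ forall F, (forall x y, 0 <= F x y) ->
    forall y, sw.2 * (F x0 (y + sw.1) + F x0 (y + sw.1 + d)) <=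
      iter (k0 + size c) T F x y.
  have [s [ss ps ls]] := Hp x x0.
  have P1 : path (edge Q) x (s ++ c) by rewrite cat_path ps ls pc.
  have P2 : path (edge Q) x (s ++ c') by rewrite cat_path ps ls pc'.
  have [w1 w10 H1] := path_lower P1; have [w2 w20 H2] := path_lower P2.
  exists (wsum f (s ++ c), Num.min w1 w2 / 2); split => /=.
    by rewrite divr_gt0// lt_min w10.
  move=> F F0 y; have := H1 F F0 y; have := H2 F F0 y.
  rewrite !size_cat !last_cat ls lc lc' ss -scc !wsum_cat wcc !addrA.
  have := F0 x0 (y + wsum f s + wsum f c).
  have := F0 x0 (y + wsum f s + wsum f c + d).
  move: (F x0 _) (F x0 _) (iter _ _ _ _ _) => a b t a0 b0 h1 h2.
  have m1 : Num.min w1 w2 <= w1 by rewrite ge_min lexx.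
  have m2 : Num.min w1 w2 <= w2 by rewrite ge_min lexx orbT.
  have m0 : 0 < Num.min w1 w2 by rewrite lt_min w10.
  by nra.
have [sw Hsw] := choice Hx.
have [al /andP[al0 _] Hal] := fin_lb (fun x => proj1 (Hsw x)).
have minor F : (forall x y, 0 <= F x y) -> forall x y,
    al * (F x0 (y + (sw x).1) + F x0 (y + (sw x).1 + d)) <= iter (k0 + size c) T F x y.
  move=> F0 x y; apply: le_trans (proj2 (Hsw x) F F0 y).
  by apply: ler_wpM2r => //; rewrite addr_ge0.
have [|C C0 HC] := reg_minorized SQ al0 minor; first by rewrite addn_gt0 k00.
by exists d, C.
Qed.

Variables (d C : R).
Hypothesis SM : smoothing d C.

Let d0 : 0 < d. Proof. by case: SM. Qed.
Let C0 : 0 < C. Proof. by case: SM. Qed.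

Lemma smoothing_shift F M (j : nat) n x y : lat d F M ->
  `|iter n T F x (y + j%:R * d) - iter n T F x y| <= j%:R * (C * M / n.+1%:R).
Proof.
case: SM => _ _ H FM; elim: j => [|j IH]; first by rewrite !mul0r addr0 subrr normr0.
have -> : y + j.+1%:R * d = y + j%:R * d + d by rewrite -natr1; ring.
rewrite -natr1 mulrDl mul1r.
have := H F M FM n x (y + j%:R * d); move: IH.
set a := iter n T F x (y + j%:R * d); set b := iter n T F x y.
set c := iter n T F x _ => h1 h2.
have -> : c - b = (a - b) + (c - a) by ring.
by apply: le_trans (ler_normD _ _) _; exact: lerD.
Qed.

Lemma smoothing_sup F M n x y : lat d F M ->
  `|iter n T F x y| <= (1 + 2 * C) * M / Num.sqrt n.+1%:R.
Proof.
move=> FM; have M0 := lat_ge0 x FM.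
set t := Num.sqrt _; have t1 : 1 <= t by rewrite -sqrtr1 ler_wsqrtr// ler1n.
have tt : t ^+ 2 = n.+1%:R by rewrite sqr_sqrtr.
pose J := (Num.truncn t).+1.
have J1 : t <= J%:R by rewrite ltW// truncnS_gt.
have J2 : J%:R <= 2 * t.
  rewrite /J -natr1; have : (Num.truncn t)%:R <= t by rewrite truncn_le//; lra.
  by move=> ?; lra.
set a := iter n T F x y.
have H : J%:R * `|a| <= M + J%:R * (J%:R * (C * M / n.+1%:R)).
  apply: le_trans (_ : \sum_(j < J) (`|iter n T F x (y + j%:R * d)| +
     J%:R * (C * M / n.+1%:R)) <= _).
    have -> : J%:R * `|a| = \sum_(j < J) `|a|.
      by rewrite sumr_const card_ord mulr_natl.
    apply: ler_sum => j _.
    have := @smoothing_shift F M j n x y FM; rewrite -/a => h.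
    have h2 : j%:R * (C * M / n.+1%:R) <= J%:R * (C * M / n.+1%:R).
      apply: ler_wpM2r; last by rewrite ler_nat ltnW.
      by rewrite divr_ge0// mulr_ge0// ltW.
    have h3 : `|a| <= `|iter n T F x (y + j%:R * d)| +
       `|iter n T F x (y + j%:R * d) - a|.
      rewrite -[X in `|X| <= _](subKr (iter n T F x (y + j%:R * d))).
      exact: ler_normB.
    by apply: le_trans h3 _; rewrite lerD2l; exact: le_trans h h2.
  rewrite big_split /=; apply: lerD; first by exact: (lat_iter_step f SQ n FM).
  by rewrite sumr_const card_ord [leRHS]mulr_natl.
have Jp : 0 < J%:R :> R by lra.
have H2 : `|a| <= M / J%:R + J%:R * (C * M / n.+1%:R).
  rewrite -(ler_pM2l Jp) mulrDr [J%:R * (M / _)]mulrC divfK ?gt_eqF//.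
rewrite -tt in H2; apply: le_trans H2 _.
have h1 : M / J%:R <= M / t.
  by rewrite ler_wpM2l// lef_pV2// posrE; lra.
have h2 : J%:R * (C * M / t ^+ 2) <= 2 * t * (C * M / t ^+ 2).
  by apply: ler_wpM2r => //; rewrite mulr_ge0 ?invr_ge0 ?sqr_ge0// mulr_ge0// ltW.
have -> : (1 + 2 * C) * M / t = M / t + 2 * t * (C * M / t ^+ 2).
  by field; rewrite gt_eqF//; lra.
exact: lerD.
Qed.

End Smoothing.

(** * Square roots of integers *)

Section SqrtFacts.
Variable R : realType.

Lemma eqle (a b : R) : a = b -> a <= b.
Proof. by move->. Qed.

Lemma sqrtSn_gt0 n : 0 < Num.sqrt n.+1%:R :> R.
Proof. by rewrite sqrtr_gt0 ltr0n. Qed.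

Lemma sqrtSn_ge1 n : 1 <= Num.sqrt n.+1%:R :> R.
Proof. by rewrite -[leLHS]sqrtr1 ler_wsqrtr// ler1n. Qed.

Lemma sqr_sqrtSn n : Num.sqrt n.+1%:R ^+ 2 = n.+1%:R :> R.
Proof. by rewrite sqr_sqrtr. Qed.

Lemma inv_sqrt_small (e : R) : 0 < e ->
  exists N, forall n, (N <= n)%N -> (Num.sqrt n.+1%:R)^-1 <= e.
Proof.
move=> e0; exists (Num.bound (e^-1 ^+ 2)) => n Nn.
rewrite -[e]invrK lef_pV2 ?posrE ?invr_gt0 ?sqrtSn_gt0//.
have ei : 0 <= e^-1 by rewrite invr_ge0 ltW.
rewrite -[leLHS](ger0_norm ei) -sqrtr_sqr ler_wsqrtr//.
apply: ltW; apply: lt_le_trans (archi_boundP _) _; first by rewrite sqr_ge0.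
by rewrite ler_nat; apply: leq_trans Nn _.
Qed.

Lemma sqrtSn_double n m : (n < 2 * m.+1)%N ->
  Num.sqrt n.+1%:R <= 2 * Num.sqrt m.+1%:R :> R.
Proof.
move=> nm; rewrite -[2 in leRHS]ger0_norm// -sqrtr_sqr -sqrtrM ?sqr_ge0//.
by rewrite ler_wsqrtr// -natrX -natrM ler_nat; lia.
Qed.

End SqrtFacts.

(** * Survival bounds and the harmonic function *)

Section Survival.
Variables (R : realType) (X : finType).
Variables (Q : X -> X -> R) (f r q : X -> R) (sg B : R).
Hypothesis SQ : stochastic Q.
Hypothesis Hr : forall x, \sum_x' Q x x' * (f x' + r x') = r x.
Hypothesis sg0 : 0 < sg.
Hypothesis Hq : forall x, \sum_x' Q x x' * ((f x' + r x' - r x) ^+ 2 + q x') =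
  q x + sg ^+ 2.
Hypothesis B0 : 0 < B.
Hypothesis fB : forall x, `|f x| <= B.
Hypothesis rB : forall x, `|r x| <= B.
Hypothesis qB : forall x, `|q x| <= B.

Let Q1 x : \sum_(x' : X) Q x x' = 1. Proof. by case: SQ. Qed.
Let fl x : - B <= f x. Proof. by have := fB x; rewrite ler_norml => /andP[]. Qed.
Let fu x : f x <= B. Proof. by have := fB x; rewrite ler_norml => /andP[]. Qed.
Let rl x : - B <= r x. Proof. by have := rB x; rewrite ler_norml => /andP[]. Qed.
Let ru x : r x <= B. Proof. by have := rB x; rewrite ler_norml => /andP[]. Qed.
Let ql x : - B <= q x. Proof. by have := qB x; rewrite ler_norml => /andP[]. Qed.
Let qu x : q x <= B. Proof. by have := qB x; rewrite ler_norml => /andP[]. Qed.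

Local Notation T := (step Q f).
Local Notation K := (kill Q f).
Local Notation s := (srv Q f).

(** Both martingales at once: y + r has no drift, (y + r)^2 + q gains sg^2. The supersolutions below
    are of this form. *)
Lemma exp_quad (a b c : R) x y :
  \sum_x' Q x x' * (a * (y + f x' + r x') + b * ((y + f x' + r x') ^+ 2 + q x') + c) =
  a * (y + r x) + b * ((y + r x) ^+ 2 + q x + sg ^+ 2) + c.
Proof.
transitivity (\sum_x' ((a + b * 2 * (y + r x)) * (Q x x' * (f x' + r x')) +
  (b * (Q x x' * ((f x' + r x' - r x) ^+ 2 + q x')) +
   (a * y + b * (y + r x) ^+ 2 - b * 2 * (y + r x) * r x + c) * Q x x'))).
  by apply: eq_bigr => x' _; ring.
by rewrite !big_split /= -!mulr_sumr Hr Hq Q1; ring.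
Qed.

(** Gambler's ruin below h = sqrt n: to survive, the walk must reach the top first, which the linear
    term bounds, or stay in the strip, which the mean exit time divided by n bounds. The sum is a
    supersolution; the shifts by 2 B absorb r and the overshoot. *)
Lemma srv_strip n : (0 < n)%N -> let h := Num.sqrt n%:R in
  forall k x y, (k <= n)%N -> - B <= y <= h + B ->
  s k x y <= (y + r x + 2 * B) / h +
   ((y + r x + 2 * B) * (h + 2 * B - (y + r x)) + B - q x + sg ^+ 2 * (n%:R - k%:R))
   / (sg ^+ 2 * n%:R).
Proof.
move=> n0 h; have h0 : 0 < h by rewrite sqrtr_gt0 ltr0n.
have N0 : 0 < n%:R :> R by rewrite ltr0n.
have D0 : 0 < sg ^+ 2 * n%:R by rewrite mulr_gt0// exprn_gt0.
have nonneg k x y : (k <= n)%N -> - B <= y <= h + B ->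
    0 <= (y + r x + 2 * B) * (h + 2 * B - (y + r x)) + B - q x +
      sg ^+ 2 * (n%:R - k%:R).
  move=> kn /andP[y1 y2].
  have h1 : 0 <= sg ^+ 2 * (n%:R - k%:R).
    by rewrite mulr_ge0 ?sqr_ge0// subr_ge0 ler_nat.
  have h2 : 0 <= (y + r x + 2 * B) * (h + 2 * B - (y + r x)).
    by have := rl x; have := ru x => ? ?; rewrite mulr_ge0//; lra.
  by have := qu x => ?; lra.
have first0 x y : - B <= y <= h + B -> 0 <= (y + r x + 2 * B) / h.
  by move=> /andP[y1 y2]; have := rl x => ?; rewrite divr_ge0//; lra.
elim=> [|k IH] x y kn yh.
all: have [y0|y0] := leP y 0; first by rewrite srvN// addr_ge0 ?first0// divr_ge0 ?nonneg// ltW.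
all: have [yh'|yh'] := leP h y; first (apply: le_trans (srv_le1 _ SQ _ _ _) _;
  rewrite ler_wpDr ?divr_ge0 ?nonneg//; [exact: ltW|
  rewrite ler_pdivlMr// mul1r; have := rl x => ?; lra]).
- apply: le_trans (srv_le1 _ SQ _ _ _) _.
  rewrite ler_wpDl ?first0// ler_pdivlMr// mul1r.
  have := @nonneg n x y (leqnn n) yh; rewrite subrr mulr0 addr0 subr0 => ?; lra.
- rewrite srvSP//.
  have -> : (y + r x + 2 * B) / h + ((y + r x + 2 * B) * (h + 2 * B - (y + r x)) + B - q x +
      sg ^+ 2 * (n%:R - k.+1%:R)) / (sg ^+ 2 * n%:R) =
    (h^-1 + h / (sg ^+ 2 * n%:R)) * (y + r x) +
    (- (sg ^+ 2 * n%:R)^-1) * ((y + r x) ^+ 2 + q x + sg ^+ 2) +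
    (2 * B / h + (2 * B * (h + 2 * B) + B + sg ^+ 2 * (n%:R - k%:R)) / (sg ^+ 2 * n%:R)).
    rewrite -[k.+1%:R]natr1; field.
    by rewrite !gt_eqF ?exprn_gt0.
  rewrite -exp_quad; apply: (sumQ_le SQ) => x'.
  have y' : - B <= y + f x' <= h + B.
    by have := fl x'; have := fu x' => ? ?; apply/andP; split; lra.
  apply: le_trans (IH x' (y + f x') (ltnW kn) y') _.
  apply: eqle; field.
  by rewrite !gt_eqF ?exprn_gt0.
Qed.

Lemma srv_bound : exists2 C : R, 0 < C &
  forall n x y, s n x y <= C * (1 + `|y|) / Num.sqrt n.+1%:R.
Proof.
have Bp := B0.
pose C1 := (1 + 3 * B) + ((1 + 3 * B) ^+ 2 + 2 * B) / sg ^+ 2.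
have C11 : 1 <= C1.
  have : 0 <= ((1 + 3 * B) ^+ 2 + 2 * B) / sg ^+ 2.
    by rewrite divr_ge0 ?addr_ge0 ?sqr_ge0 ?mulr_ge0// ltW.
  by rewrite /C1 => ?; lra.
have C10 : 0 < C1 by lra.
exists (2 * C1); first by rewrite mulr_gt0.
move=> n x y; have yp := normr_ge0 y.
have sp := @sqrtSn_gt0 R n.
case: n sp => [|n] sp.
  rewrite sqrtr1 divr1; apply: le_trans (srv_le1 _ SQ _ _ _) _; nra.
have [y0|y0] := leP y 0.
  by rewrite srvN// divr_ge0 ?ltW// !mulr_gt0//; lra.
rewrite ger0_norm; last exact: ltW.
pose h : R := Num.sqrt n.+1%:R.
have h1 : 1 <= h := sqrtSn_ge1 R n.
have hh : h ^+ 2 = n.+1%:R := sqr_sqrtSn R n.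
have dbl : Num.sqrt n.+2%:R <= 2 * h by apply: sqrtSn_double; lia.
suff H : s n.+1 x y <= C1 * (1 + y) / h.
  apply: le_trans H _; rewrite ler_pdivrMr; last by lra.
  rewrite mulrAC ler_pdivlMr//.
  have Cy : 0 <= C1 * (1 + y) by nra.
  by have := ler_wpM2l Cy dbl => ?; lra.
have [yh|yh] := leP h y.
  apply: le_trans (srv_le1 _ SQ _ _ _) _; rewrite ler_pdivlMr; last by lra.
  by nra.
have yy : - B <= y <= h + B by apply/andP; split; lra.
have := @srv_strip n.+1 isT n.+1 x y (leqnn _) yy.
rewrite -/h subrr mulr0 addr0 -hh => /le_trans; apply.
have := rl x; have := ru x; have := ql x => qx r1 r2.
have s20 : 0 < sg ^+ 2 by rewrite exprn_gt0.
have -> : C1 * (1 + y) / h = (1 + 3 * B) * (1 + y) / h +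
   (((1 + 3 * B) ^+ 2 + 2 * B) * (1 + y) * h) / (sg ^+ 2 * h ^+ 2).
  by rewrite /C1; field; rewrite !gt_eqF//; lra.
apply: lerD.
  by rewrite ler_pM2r ?invr_gt0; [nra|lra].
rewrite ler_pM2r; last by rewrite invr_gt0 mulr_gt0// exprn_gt0//; lra.
have e1 : 0 <= y + r x + 2 * B <= (1 + 3 * B) * (1 + y).
  by apply/andP; split; nra.
have e2 : 0 <= h + 2 * B - (y + r x) <= (1 + 3 * B) * h.
  by apply/andP; split; nra.
move: e1 e2 => /andP[e1 e1'] /andP[e2 e2'].
have := ler_pM e1 e2 e1' e2'.
have : 2 * B <= 2 * B * (1 + y) * h.
  have : 1 <= (1 + y) * h by nra.
  by move=> ?; nra.
by move=> ? ?; nra.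
Qed.

(** A maximal inequality: the square of y1 + r - (y + 2 B), corrected by q + B, is at least y^2 at
    death and gains sg^2 per step. At the start it is at most 9 B^2 + 2 B, since |r - 2 B| <= 3
    B. *)
Lemma exit_bound k x y : 0 < y ->
  1 - s k x y <= (9 * B ^+ 2 + 2 * B + sg ^+ 2 * k%:R) / y ^+ 2.
Proof.
move=> y0; have Bp := B0; pose c := y + 2 * B.
have yy : 0 < y ^+ 2 by rewrite exprn_gt0.
have main j : forall x1 y1, 1 - s j x1 y1 <=
    ((y1 + r x1 - c) ^+ 2 + q x1 + B + sg ^+ 2 * j%:R) / y ^+ 2.
  have low j1 x1 y1 : y1 <= 0 -> 1 - s j1 x1 y1 <=
    ((y1 + r x1 - c) ^+ 2 + q x1 + B + sg ^+ 2 * j1%:R) / y ^+ 2.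
    move=> y10; rewrite srvN// subr0 ler_pdivlMr// mul1r.
    have := ql x1; have := ru x1 => r1 q1.
    have : 0 <= sg ^+ 2 * j1%:R by rewrite mulr_ge0// sqr_ge0.
    have : y ^+ 2 <= (y1 + r x1 - c) ^+ 2 by rewrite /c; nra.
    by move=> ? ?; lra.
  elim: j => [|j IH] x1 y1; have [y10|y10] := leP y1 0; try exact: low.
  - rewrite /srv /= /alive y10 subrr divr_ge0 ?sqr_ge0//.
    rewrite mulr0 addr0.
    by have := ql x1; have := sqr_ge0 (y1 + r x1 - c) => ? ?; lra.
  - rewrite srvSP//.
    have -> : 1 - T (s j) x1 y1 = \sum_x' Q x1 x' * (1 - s j x' (y1 + f x')).
      by rewrite -{1}(Q1 x1) -sumrB; apply: eq_bigr => x' _; rewrite mulrBr mulr1.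
    have -> : ((y1 + r x1 - c) ^+ 2 + q x1 + B + sg ^+ 2 * j.+1%:R) / y ^+ 2 =
      (- 2 * c / y ^+ 2) * (y1 + r x1) + (y ^+ 2)^-1 * ((y1 + r x1) ^+ 2 + q x1 + sg ^+ 2)
       + (c ^+ 2 + B + sg ^+ 2 * j%:R) / y ^+ 2.
      by rewrite -[j.+1%:R]natr1; field; rewrite gt_eqF.
    rewrite -exp_quad; apply: (sumQ_le SQ) => x'.
    apply: le_trans (IH x' (y1 + f x')) _; apply: eqle.
    by field; rewrite gt_eqF.
apply: le_trans (main k x y) _; rewrite ler_pM2r ?invr_gt0// lerD2r.
have := rl x; have := ru x; have := qu x => qx r1 r2.
by rewrite /c; nra.
Qed.

(** Finite-horizon approximations of V: the mean of the martingale height on survival. *)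
Let L n : X -> R -> R := iter n K (fun x y => (0 < y)%R%:R * (y + r x)).

(** y + r being a martingale, only the paths that die at the next step contribute, and there |y + r|
    <= 2 B. *)
Let L_step n x y : `|L n.+1 x y - L n x y| <= 2 * B * (s n x y - s n.+1 x y).
Proof.
have Bp := B0.
have base x1 y1 : `|1 * L 1 x1 y1 + (-1) * L 0 x1 y1| <=
    2 * B * (1 * alive x1 y1 + (-1) * s 1 x1 y1).
  rewrite mul1r mulN1r mul1r mulN1r.
  have [y0|y0] := leP y1 0.
    by rewrite srvN// /L /= killN// /alive ltNge y0 !mul0r subr0 normr0 mulr0.
  rewrite srvSP// /L /= killP// /alive y0 mul1r.
  have -> : T (fun x y => (0 < y)%R%:R * (y + r x)) x1 y1 - (y1 + r x1) =
    \sum_x' Q x1 x' * (((0 < y1 + f x')%R%:R - 1) * (y1 + f x' + r x')).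
    have -> : y1 + r x1 = \sum_x' Q x1 x' * (y1 + f x' + r x').
      transitivity (1 * (y1 + r x1) + 0 * ((y1 + r x1) ^+ 2 + q x1 + sg ^+ 2) + 0).
        by ring.
      by rewrite -exp_quad; apply: eq_bigr => x' _; ring.
    by rewrite /step -sumrB; apply: eq_bigr => x' _; ring.
  have -> : 2 * B * (1 - T (s 0) x1 y1) =
    \sum_x' Q x1 x' * (2 * B * (1 - (0 < y1 + f x')%R%:R)).
    rewrite -[X in X - _](Q1 x1) /step -sumrB mulr_sumr; apply: eq_bigr => x' _.
    by rewrite /srv /= /alive; ring.
  apply: le_trans (ler_norm_sum _ _ _) _; apply: ler_sum => x' _.
  rewrite normrM ger0_norm; last by case: SQ.
  apply: ler_wpM2l; first by case: SQ.
  have := fl x'; have := fu x'; have := rl x'; have := ru x' => a1 a2 a3 a4.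
  case: ltP => y1f /=; first by rewrite subrr mul0r normr0 mulr0.
  by rewrite sub0r mulN1r normrN subr0 mulr1 ler_norml; apply/andP; split; lra.
have -> : L n.+1 x y - L n x y = iter n K (fun x y => 1 * L 1 x y + (-1) * L 0 x y) x y.
  by rewrite iter_kill_lin /L iterSr mul1r mulN1r.
have -> : s n x y - s n.+1 x y = iter n K (fun x y => 1 * alive x y + (-1) * s 1 x y) x y.
  by rewrite iter_kill_lin /srv iterSr mul1r mulN1r.
rewrite -iter_kill_scale; exact: (iter_kill_norm_le f SQ).
Qed.

Let L_dist n m x y : `|L (m + n) x y - L n x y| <= 2 * B * (s n x y - s (m + n) x y).
Proof.
elim: m => [|m IH]; first by rewrite !subrr normr0 mulr0.
have := L_step (m + n) x y; rewrite -addSn.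
set a := L (m.+1 + n) x y; set b := L (m + n) x y => h.
have -> : a - L n x y = (a - b) + (b - L n x y) by ring.
apply: le_trans (ler_normD _ _) _; apply: le_trans (lerD h IH) _.
by rewrite -mulrDr; apply: eqle; congr (_ * _); ring.
Qed.

Lemma srv_cvg0 x y (e : R) : 0 < e ->
  exists N, forall n, (N <= n)%N -> s n x y <= e.
Proof.
move=> e0; have [C C0 HC] := srv_bound.
have yp := normr_ge0 y.
have D0 : 0 < C * (1 + `|y|) by rewrite mulr_gt0//; lra.
have [N HN] := inv_sqrt_small (divr_gt0 e0 D0).
exists N => n Nn; apply: le_trans (HC n x y) _.
by rewrite mulrC -ler_pdivlMr// HN.
Qed.

(** By [L_step] the sequence L n + 2 B srv n decreases, so L n converges with error 2 B srv n, which
    tends to 0. This passes harmonicity and the sign to the limit; the distance to y + r is the same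
    error at n = 0. *)
Lemma exists_harmonic : exists V : X -> R -> R, [/\
  forall x y, y <= 0 -> V x y = 0,
  forall x y, 0 <= V x y,
  forall x y, K V x y = V x y &
  forall x y, `|V x y - (0 < y)%R%:R * (y + r x)| <= 2 * B * alive x y].
Proof.
have Bp := B0.
have HV (p : X * R) : exists v : R, forall n, `|L n p.1 p.2 - v| <= 2 * B * s n p.1 p.2.
  case: p => x y /=.
  pose u n := L n x y + 2 * B * s n x y.
  have ui : nonincreasing_seq u.
    apply/nonincreasing_seqP => n; rewrite /u.
    by have := L_step n x y; rewrite ler_norml => /andP[_ ?]; lra.
  have ulb : has_lbound (range u).
    exists (L 0 x y - 2 * B); move=> _ [n _ <-]; rewrite /u.
    have := L_dist 0 n x y; rewrite addn0 ler_norml => /andP[h _].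
    have := srv_le1 f SQ 0 x y; have := srv_ge0 f SQ n x y => ? ?; nra.
  have cu : u @ \oo --> inf (range u) by exact: nonincreasing_cvgn.
  exists (inf (range u)) => n; apply/ler_addgt0Pr => e e0.
  have [N1 H1] := cvgn_epsP cu (divr_gt0 e0 (ltr0n _ 2)).
  have B4 : 0 < 4 * B by lra.
  have [N2 H2] := srv_cvg0 x y (divr_gt0 e0 B4).
  pose m := (N1 + N2)%N.
  have h1 := H1 (m + n)%N ltac:(rewrite /m; lia).
  have h2 := H2 (m + n)%N ltac:(rewrite /m; lia).
  have h3 := L_dist n m x y.
  rewrite ler_pdivlMr// in h2.
  have h4 := mulr_ge0 (ltW B0) (srv_ge0 f SQ (m + n) x y).
  move: h1 h3; rewrite /u !ler_norml => /andP[? ?] /andP[? ?].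
  by apply/andP; split; lra.
have [V0 HV0] := choice HV.
pose V x y := V0 (x, y).
have VL n x y : `|L n x y - V x y| <= 2 * B * s n x y by exact: (HV0 (x, y)).
have Vlow x y : y <= 0 -> V x y = 0.
  move=> y0; have := VL 1 x y; rewrite srvN// mulr0 /L /= killN// sub0r normrN.
  by rewrite normr_le0 => /eqP.
exists V; split => //.
- move=> x y; rewrite leNgt; apply/negP => V0'.
  have B3 : 0 < 6 * B by lra.
  have nV : 0 < - V x y by rewrite oppr_gt0.
  have [N HN] := srv_cvg0 x y (divr_gt0 nV B3).
  have := HN N (leqnn N); rewrite ler_pdivlMr// => h.
  have := VL N x y; rewrite ler_norml => /andP[_ h2].
  have : - B * s N x y <= L N x y.
    rewrite -iter_kill_scale; apply: (iter_kill_le f SQ) => x1 y1.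
    rewrite /alive; have := rl x1 => ?.
    by case: ltP => /= ?; [rewrite mulr1 mul1r; lra|rewrite mulr0 mul0r].
  by have := srv_ge0 f SQ N x y => ? ?; nra.
- move=> x y; apply/eqP; rewrite -subr_eq0 -normr_le0.
  apply/ler_addgt0Pl => e e0; rewrite addr0.
  have B4 : 0 < 4 * B by lra.
  have [N HN] := srv_cvg0 x y (divr_gt0 e0 B4).
  have := HN N.+1 (leqnSn _); rewrite ler_pdivlMr// => h.
  have h2 := VL N.+1 x y.
  have h3 : `|K V x y - L N.+1 x y| <= 2 * B * s N.+1 x y.
    have -> : K V x y - L N.+1 x y = K (fun x y => 1 * V x y + (-1) * L N x y) x y.
      by rewrite kill_lin mul1r mulN1r.
    have h4 x1 y1 : `|1 * V x1 y1 + (-1) * L N x1 y1| <= 2 * B * s N x1 y1.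
      by rewrite mul1r mulN1r distrC VL.
    have := @iter_kill_norm_le _ _ Q f SQ _ _ 1 h4 x y.
    by rewrite (iter_kill_scale Q f _ (s N) 1).
  have -> : K V x y - V x y = (K V x y - L N.+1 x y) + (L N.+1 x y - V x y) by ring.
  by apply: le_trans (ler_normD _ _) _; lra.
- by move=> x y; rewrite distrC; have := VL 0%N x y.
Qed.

End Survival.

(** * Mean value inequalities *)

Section MeanValue.
Variable R : realType.
Implicit Types (g dg : R -> R) (a b M : R).

Lemma mvt_ex g dg a b : a <= b ->
  (forall z, a <= z <= b -> is_derive z 1 g (dg z)) ->
  exists2 c, a <= c <= b & g b - g a = dg c * (b - a).
Proof.
move=> ab dg_g; have [||c] := @MVT_segment R g dg a b ab.
- by move=> z; rewrite in_itv /= => /andP[az zb]; apply: dg_g; rewrite !ltW.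
- apply: derivable_within_continuous => z; rewrite in_itv /= => zab.
  by have [] := dg_g z zab.
- by rewrite in_itv /= => cab; exists c.
Qed.

Lemma mvt_bound g dg a b M : a <= b ->
  (forall z, a <= z <= b -> is_derive z 1 g (dg z)) ->
  (forall z, a <= z <= b -> `|dg z| <= M) -> `|g b - g a| <= M * (b - a).
Proof.
move=> ab Hd HM; have [c cab ->] := mvt_ex ab Hd.
by rewrite normrM [`|b - a|]ger0_norm ?subr_ge0// ler_wpM2r ?subr_ge0// HM.
Qed.

Lemma mvt_bound_glob g dg M : (forall z : R, is_derive z (1 : R) g (dg z)) ->
  (forall z, `|dg z| <= M) -> forall a b, `|g b - g a| <= M * `|b - a|.
Proof.
move=> Hd HM a b; have [ab|ba] := leP a b.
  by rewrite [`|b - a|]ger0_norm ?subr_ge0//; apply: mvt_bound.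
rewrite distrC [`|b - a|]distrC [`|a - b|]ger0_norm ?subr_ge0 ?(ltW ba)//.
by apply: mvt_bound; rewrite ?(ltW ba).
Qed.

Lemma mvt_incr g dg a b : a <= b -> (forall z : R, is_derive z (1 : R) g (dg z)) ->
  (forall z, 0 <= dg z) -> g a <= g b.
Proof.
move=> ab Hd H0; have [c _ E] := mvt_ex ab (fun z _ => Hd z).
by rewrite -subr_ge0 E mulr_ge0 ?subr_ge0.
Qed.

Lemma mvt_const g : (forall z : R, is_derive z (1 : R) g 0) -> forall a b, g a = g b.
Proof.
move=> Hd a b; have := mvt_bound_glob (M := 0) Hd.
move=> /(_ (fun _ => _) b a); rewrite normr0 mul0r normr_le0 subr_eq0.
by move=> /(_ (lexx 0))/eqP.
Qed.

End MeanValue.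

(** * The error function and its derivatives *)

Section Erf.
Variable R : realType.

(** On the half-line, the density of |N| for a standard Gaussian N. So [erf] below is normalised by
    variance 1, unlike the classical error function. *)
Definition gs (z : R) : R := 2 / Num.sqrt (2 * pi) * expR (- (z ^+ 2 / 2)).

Lemma sqrt2pi_gt0 : 0 < Num.sqrt (2 * pi) :> R.
Proof. by rewrite sqrtr_gt0 mulr_gt0// pi_gt0. Qed.

Lemma gs_gt0 z : 0 < gs z.
Proof. by rewrite mulr_gt0 ?expR_gt0// divr_gt0// sqrt2pi_gt0. Qed.

Lemma is_derive_gs (z : R) : is_derive z (1 : R) gs (- z * gs z).
Proof.
rewrite /gs; apply: is_derive_eq.
rewrite /= ?scaler0 ?addr0 ?scaler1 /GRing.scale /=; field.
by rewrite gt_eqF// sqrt2pi_gt0.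
Qed.

Lemma exists_erf : exists E0 : R -> R, [/\ forall z : R, is_derive z (1:R) E0 (gs z), E0 0 = 0 &
  forall e, 0 < e -> exists2 A, 0 < A & forall z, A <= z -> `|E0 z - 1| <= e].
Proof.
pose mu := @lebesgue_measure R.
pose G (x : R) : R := (\int[mu]_(t in [set` Interval -oo%O (BRight x)]) gauss_fun t)%R.
have ig : mu.-integrable [set: R] (EFin \o gauss_fun) := integrableT_gauss.
have igx x : mu.-integrable [set` Interval -oo%O (BRight x)] (EFin \o gauss_fun).
  by apply: integrableS ig => //.
have dG x : is_derive x (1 : R) G (gauss_fun x).
  have [||||dF eF] := @continuous_FTC1 R gauss_fun -oo%O x (x + 1).
  - by rewrite ltrDl.
  - exact: igx.
  - by rewrite /= ltNyr.
  - exact: continuous_gauss_fun.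
  by apply: DeriveDef; [exact: dF|rewrite -derive1E; exact: eF].
have Gi x : 0 <= x -> G x - G 0 = gauss_integral_proof.integral0_gauss x.
  move=> x0; rewrite /G Rintegral_itvB//.
  rewrite Rintegral_itv_obnd_cbnd//.
  by apply: integrableS ig.
have cI : gauss_integral_proof.integral0_gauss x @[x --> +oo] --> (Num.sqrt pi / 2 : R).
  have : Num.sqrt (gauss_integral_proof.integral0_gauss x ^+ 2) @[x --> +oo]
      --> (Num.sqrt (pi / 4) : R).
    apply: continuous_cvg => //;
      [exact: sqrt_continuous|exact: gauss_integral_proof.cvg_integral0_gauss_sqr].
  rewrite sqrtrM ?pi_ge0// sqrtrV// (_ : 4 = 2 ^+ 2); last by rewrite expr2 -natrM.
  rewrite sqrtr_sqr ger0_norm//.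
  rewrite (_ : (fun _ => Num.sqrt _) = (@gauss_integral_proof.integral0_gauss R))//.
  apply/funext => r; rewrite sqrtr_sqr// ger0_norm//.
  exact: gauss_integral_proof.integral0_gauss_ge0.
have sp : 0 < Num.sqrt pi :> R by rewrite sqrtr_gt0 pi_gt0.
have s2 : 0 < Num.sqrt 2 :> R by rewrite sqrtr_gt0.
(* The primitive [G] is that of exp(-t^2), whence the rescaling by sqrt 2. *)
exists (fun z => 2 / Num.sqrt pi * (G ((Num.sqrt 2)^-1 * z) - G 0)); split.
- move=> z.
  have := dG ((Num.sqrt 2)^-1 * z) => dGz.
  have d1 : is_derive z (1 : R) (fun z => (Num.sqrt 2)^-1 * z) (Num.sqrt 2)^-1.
    by apply: is_derive_eq; rewrite /= /GRing.scale /=; ring.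
  have d2 := @is_derive1_comp R G (fun z => (Num.sqrt 2)^-1 * z) z _ _ dGz d1.
  apply: is_derive_eq.
  rewrite /= subr0 /GRing.scale /= /gs /gauss_fun sqrtrM// exprMn exprVn sqr_sqrtr//.
  have -> : - (2^-1 * z ^+ 2) = - (z ^+ 2 / 2) by ring.
  by field; rewrite !gt_eqF.
- by rewrite mulr0 subrr mulr0.
- move=> e e0.
  have e1 : 0 < e / (2 / Num.sqrt pi) by rewrite !divr_gt0.
  move/cvgrPdist_le : cI => /(_ _ e1)[A [Ar HA]].
  exists (Num.sqrt 2 * (`|A| + 1)); first by rewrite mulr_gt0// ltr_wpDl.
  move=> z Az; have z1 : `|A| + 1 <= (Num.sqrt 2)^-1 * z.
    by rewrite mulrC ler_pdivlMr// mulrC.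
  rewrite Gi; last by apply: le_trans z1; rewrite addr_ge0.
  have zA : A < (Num.sqrt 2)^-1 * z.
    by apply: lt_le_trans z1; rewrite ltr_pwDr// ler_norm.
  have := HA _ zA; rewrite ler_pdivlMr ?divr_gt0// distrC.
  set I := gauss_integral_proof.integral0_gauss _ => H.
  have -> : 2 / Num.sqrt pi * I - 1 = (I - Num.sqrt pi / 2) * (2 / Num.sqrt pi).
    by field; rewrite gt_eqF.
  rewrite normrM; have p2 : 0 <= 2 / Num.sqrt pi :> R by rewrite divr_ge0// ltW.
  by rewrite (ger0_norm p2).
Qed.

Definition erf : R -> R := sval (cid exists_erf).

Lemma is_derive_erf (z : R) : is_derive z (1 : R) erf (gs z).
Proof. by rewrite /erf; case: cid => E0 []. Qed.

Lemma erf0 : erf 0 = 0.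
Proof. by rewrite /erf; case: cid => E0 []. Qed.

Lemma erf_cvg (e : R) : 0 < e ->
  exists2 A, 0 < A & forall z, A <= z -> `|erf z - 1| <= e.
Proof. by move=> e0; rewrite /erf; case: cid => E0 /= [_ _ H]; exact: H. Qed.

Lemma erf_incr (a b : R) : a <= b -> erf a <= erf b.
Proof.
by move=> ab; apply: (mvt_incr ab is_derive_erf) => z; exact/ltW/gs_gt0.
Qed.

Lemma erf_le1 z : erf z <= 1.
Proof.
apply/ler_addgt0Pr => e e0; have [A A0 HA] := erf_cvg e0.
have := HA (Num.max A z); rewrite le_max lexx => /(_ isT).
rewrite ler_norml => /andP[_ H]; apply: le_trans (erf_incr _) (_ : erf (Num.max A z) <= _).
  by rewrite le_max lexx orbT.
by lra.
Qed.

Lemma gsN z : gs (- z) = gs z.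
Proof. by rewrite /gs sqrrN. Qed.

Lemma erfN z : erf (- z) = - erf z.
Proof.
have D (w : R) : is_derive w (1 : R) (fun w => erf w + erf (- w)) 0.
  have dN : is_derive w (1 : R) (fun w : R => - w) (- 1) by apply: is_derive_eq.
  have d0 := is_derive_erf w.
  have d1 := @is_derive1_comp R erf (fun w => - w) w _ _ (is_derive_erf (- w)) dN.
  by apply: is_derive_eq; rewrite gsN; ring.
have := mvt_const D z 0; rewrite oppr0 erf0 addr0 => /eqP.
by rewrite addrC addr_eq0 => /eqP.
Qed.

Lemma erf_norm z : `|erf z| <= 1.
Proof.
by rewrite ler_norml erf_le1 andbT -[leRHS]opprK lerN2 -erfN erf_le1.
Qed.

(* [hm i] is the i-th derivative of [erf]. *)
Fixpoint hm (i : nat) (z : R) : R :=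
  match i with
  | 0 => erf z
  | k.+1 => match k with
            | 0 => gs z
            | j.+1 => - z * hm k z - j%:R * hm j z
            end
  end.

Lemma hmSS i z : hm i.+2 z = - z * hm i.+1 z - i%:R * hm i z.
Proof. by []. Qed.

Lemma is_derive_hm i (z : R) : is_derive z (1 : R) (hm i) (hm i.+1 z).
Proof.
suff: (forall z : R, is_derive z (1 : R) (hm i) (hm i.+1 z)) /\
      (forall z : R, is_derive z (1 : R) (hm i.+1) (hm i.+2 z)) by case.
elim: i {z} => [|i [IH1 IH2]].
  split=> z; first exact: is_derive_erf.
  have -> : hm 2 z = - z * gs z by rewrite hmSS mul0r subr0.
  exact: is_derive_gs.
split => // z.
have -> : hm i.+2 = (fun z => - z * hm i.+1 z - i%:R * hm i z) by apply/funext => w.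
have d1 := IH1 z; have d2 := IH2 z.
apply: is_derive_eq.
rewrite /GRing.scale /= [in RHS]/hm -/hm -[i.+1%:R]natr1; ring.
Qed.

Lemma pow_gauss_bound k : exists2 C, 0 < C &
  forall z : R, `|z| ^+ k * gs z <= C.
Proof.
set c := 2 / Num.sqrt (2 * pi) : R.
have c0 : 0 < c by rewrite divr_gt0// sqrt2pi_gt0.
pose D : R := 2 ^+ k.+1 * k.+1`!%:R.
have D0 : 0 < D by rewrite mulr_gt0 ?exprn_gt0// ltr0n fact_gt0.
exists (c * (1 + D)); first by rewrite mulr_gt0//; lra.
move=> z; rewrite /gs mulrCA ler_pM2l//.
set w := z ^+ 2 / 2; have w0 : 0 <= w by rewrite divr_ge0// sqr_ge0.
rewrite expRN ler_pdivrMr ?expR_gt0//.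
have H := @expR_ge1Dxn R w k w0.
have E1 : 1 <= expR w by rewrite -expR0 ler_expR.
have H2 : `|z| ^+ k.+1.*2 <= D * expR w.
  have -> : `|z| ^+ k.+1.*2 = 2 ^+ k.+1 * w ^+ k.+1.
    by rewrite /w exprMn exprVn -exprM mul2n -normrX ger0_norm
      ?exprn_even_ge0 ?odd_double// mulrCA divff ?mulr1// expf_neq0.
  rewrite /D -mulrA ler_pM2l ?exprn_gt0// mulrC -ler_pdivrMr ?ltr0n ?fact_gt0//.
  by lra.
have [z1|z1] := leP `|z| 1.
  have : `|z| ^+ k <= 1 by apply: exprn_ile1.
  by move=> ?; nra.
have : `|z| ^+ k <= `|z| ^+ k.+1.*2.
  by rewrite ler_weXn2l ?ltW//; lia.
by move=> ?; nra.
Qed.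

Lemma hm_pow_bound i k : exists2 C, 0 < C &
  forall z : R, `|z| ^+ k * `|hm i.+1 z| <= C.
Proof.
suff: forall k, (exists2 C, 0 < C & forall z : R, `|z| ^+ k * `|hm i.+1 z| <= C) /\
      (exists2 C, 0 < C & forall z : R, `|z| ^+ k * `|hm i.+2 z| <= C).
  by move=> /(_ k)[].
elim: i {k} => [|i IH] k.
  have P j : exists2 C, 0 < C & forall z : R, `|z| ^+ j * `|hm 1 z| <= C.
    have [C C0 H] := pow_gauss_bound j; exists C => // z.
    by rewrite /= (ger0_norm (ltW (gs_gt0 z))).
  split; first exact: P.
  have [C C0 H] := P k.+1; exists C => // z.
  by rewrite hmSS mul0r subr0 normrM normrN mulrA -exprSr H.
have [_ P2] := IH k; split => //.
have [[C1 C10 H1] _] := IH k; have [_ [C2 C20 H2]] := IH k.+1.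
exists (C2 + i.+1%:R * C1); first by rewrite addr_gt0// mulr_gt0.
move=> z; rewrite hmSS.
apply: le_trans (ler_wpM2l _ (ler_normB _ _)) _; first by rewrite exprn_ge0.
rewrite mulrDr; apply: lerD.
  by rewrite normrM normrN mulrA -exprSr H2.
by rewrite normrM [`|i.+1%:R|]ger0_norm// mulrCA ler_wpM2l.
Qed.

Lemma hm_bound i : exists2 C, 0 < C & forall z : R, `|hm i z| <= C.
Proof.
case: i => [|i]; first by exists 1 => // z; exact: erf_norm.
by have [C C0 H] := hm_pow_bound i 0; exists C => // z; have := H z; rewrite expr0 mul1r.
Qed.

(** Even derivatives are odd, hence vanish at 0; this makes them compatible with absorption. *)
Lemma hm_parity i z : hm i (- z) = (-1) ^+ i.+1 * hm i z.
Proof.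
suff: hm i (- z) = (-1) ^+ i.+1 * hm i z /\ hm i.+1 (- z) = (-1) ^+ i.+2 * hm i.+1 z.
  by case.
elim: i => [|i [IH1 IH2]].
  by rewrite /= erfN gsN expr1 sqrrN expr1n mulN1r mul1r.
split => //; rewrite !hmSS IH1 IH2 !exprS; ring.
Qed.

End Erf.

(** * Heat solutions and their one-step expansion *)

Section Heat.
Variable R : realType.

(* Space derivatives of the half-line heat solution [erf (v / sqrt t)]. *)
Definition he (i : nat) (t v : R) : R :=
  (Num.sqrt t)^-1 ^+ i * hm i (v * (Num.sqrt t)^-1).

Lemma is_derive_pow (g : R -> R) (t dg : R) n : is_derive t (1 : R) g dg ->
  is_derive t (1 : R) (fun t => g t ^+ n) (n%:R * g t ^+ n.-1 * dg).
Proof.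
move=> d; elim: n => [|n IH].
  rewrite !mul0r; have -> : (fun t => g t ^+ 0) = cst 1 by apply/funext => z.
  exact: is_derive_cst.
have -> : (fun t => g t ^+ n.+1) = (fun t => g t * g t ^+ n).
  by apply/funext => z; rewrite exprS.
apply: is_derive_eq; rewrite /GRing.scale /=.
by case: n {IH} => [|n] /=; rewrite ?expr0 -?natr1 ?exprS; ring.
Qed.

Lemma is_derive_he_v i (t v : R) :
  is_derive v (1 : R) (he i t) (he i.+1 t v).
Proof.
rewrite /he; set w := (Num.sqrt t)^-1.
have d1 : is_derive v (1 : R) (fun v => v * w) w.
  by apply: is_derive_eq; rewrite /= /GRing.scale /=; ring.
have d2 := @is_derive1_comp R (hm i) (fun v => v * w) v _ _ (is_derive_hm i (v * w)) d1.
by apply: is_derive_eq; rewrite /= /GRing.scale /= exprS; ring.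
Qed.

(** The heat equation for every space derivative: the recursion [hmSS] is what equates the
    derivative of the scaling in t with half the second space derivative. *)
Lemma is_derive_he_t i (t v : R) : 0 < t ->
  is_derive t (1 : R) (fun t => he i t v) (he i.+2 t v / 2).
Proof.
move=> t0; rewrite /he.
have s0 : 0 < Num.sqrt t by rewrite sqrtr_gt0.
have ds := is_derive1_sqrt t0.
have dw : is_derive t (1 : R) (fun t => (Num.sqrt t)^-1) (- (Num.sqrt t)^-1 ^+ 3 / 2).
  have sn : Num.sqrt t != 0 by rewrite gt_eqF.
  have := @is_deriveV R (@Num.sqrt R) t _ _ sn ds => H.
  apply: (is_derive_eq H); rewrite /GRing.scale /= -exprVn; field.
  by rewrite gt_eqF.
set w := (Num.sqrt t)^-1 in dw *.
have dv : is_derive t (1 : R) (fun t => v * (Num.sqrt t)^-1) (v * (- w ^+ 3 / 2)).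
  by apply: is_derive_eq; rewrite /= /GRing.scale /=; ring.
have d2 := @is_derive1_comp R (hm i) (fun t => v * (Num.sqrt t)^-1) t _ _
  (is_derive_hm i (v * w)) dv.
have dX := is_derive_pow i dw.
apply: is_derive_eq.
rewrite hmSS -/w; case: i {d2 dX} => [|i]; rewrite /GRing.scale /= -/w !exprS; ring.
Qed.

Lemma he_bound i : exists2 C : R, 0 < C & forall t v : R, 0 < t ->
  `|he i t v| <= C * (Num.sqrt t)^-1 ^+ i.
Proof.
have [C C0 H] := hm_bound R i; exists C => // t v t0.
rewrite /he normrM mulrC [`|_ ^+ i|]ger0_norm ?exprn_ge0 ?invr_ge0 ?sqrtr_ge0//.
by rewrite ler_wpM2r ?exprn_ge0 ?invr_ge0 ?sqrtr_ge0.
Qed.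

Lemma he_parity i t v : he i t (- v) = (-1) ^+ i.+1 * he i t v.
Proof. by rewrite /he mulNr hm_parity; ring. Qed.

Lemma he_even0 i t : ~~ odd i -> he i t 0 = 0.
Proof.
move=> oi; have := he_parity i t 0; rewrite oppr0 -signr_odd /= (negbTE oi) expr1.
by move=> ?; lra.
Qed.

Lemma isqrt_le (t t' : R) : 0 < t -> t / 4 <= t' ->
  (Num.sqrt t')^-1 <= 2 * (Num.sqrt t)^-1.
Proof.
move=> t0 tt'; have t'0 : 0 < t' by lra.
have s0 : 0 < Num.sqrt t by rewrite sqrtr_gt0.
have s'0 : 0 < Num.sqrt t' by rewrite sqrtr_gt0.
rewrite -[leRHS]invrK invfM invrK lef_pV2 ?posrE// ?mulr_gt0 ?invr_gt0//.
rewrite mulrC ler_pdivrMr//.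
have E1 : Num.sqrt t ^+ 2 = t by rewrite sqr_sqrtr// ltW.
have E2 : Num.sqrt t' ^+ 2 = t' by rewrite sqr_sqrtr// ltW.
by rewrite leNgt; apply/negP => N; nra.
Qed.

Lemma he_bound_near i : exists2 C : R, 0 < C & forall t t' v : R, 0 < t ->
  t / 4 <= t' -> `|he i t' v| <= C * (Num.sqrt t)^-1 ^+ i.
Proof.
have [C C0 H] := he_bound i; exists (C * 2 ^+ i); first by rewrite mulr_gt0// exprn_gt0.
move=> t t' v t0 tt'; have t'0 : 0 < t' by lra.
apply: le_trans (H t' v t'0) _; rewrite -mulrA -exprMn ler_pM2l//.
apply: lerXn2r; rewrite ?nnegrE ?mulr_ge0 ?invr_ge0 ?sqrtr_ge0//.
exact: isqrt_le.
Qed.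

Lemma taylor3 (g g1 g2 g3 : R -> R) (M : R) :
  (forall z : R, is_derive z (1 : R) g (g1 z)) ->
  (forall z : R, is_derive z (1 : R) g1 (g2 z)) ->
  (forall z : R, is_derive z (1 : R) g2 (g3 z)) ->
  (forall z, `|g3 z| <= M) -> forall v h,
  `|g (v + h) - g v - h * g1 v - h ^+ 2 / 2 * g2 v| <= M * `|h| ^+ 3.
Proof.
move=> d0 d1 d2 M3 v h; have M0 : 0 <= M by apply: le_trans (M3 0).
have aff (th : R) : is_derive th (1 : R) (fun th : R => v + th * h) h.
  by apply: is_derive_eq; rewrite /= /GRing.scale /=; ring.
have c0 th := @is_derive1_comp R g (fun th : R => v + th * h) th _ _ (d0 _) (aff th).
have c1 th := @is_derive1_comp R g1 (fun th : R => v + th * h) th _ _ (d1 _) (aff th).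
have B1 th : 0 <= th <= 1 ->
    `|g1 (v + th * h) - g1 v - th * h * g2 v| <= M * `|h| ^+ 2.
  move=> /andP[th0 th1].
  pose p th := g1 (v + th * h) - th * h * g2 v.
  have dp z : is_derive z (1 : R) p (h * (g2 (v + z * h) - g2 v)).
    rewrite /p; have := c1 z => c1z; apply: is_derive_eq.
    by rewrite /= /GRing.scale /=; ring.
  have := @mvt_bound R p _ 0 th (M * `|h| ^+ 2) th0 (fun z _ => dp z).
  rewrite /p !mul0r addr0 !subr0 => H.
  have -> : g1 (v + th * h) - g1 v - th * h * g2 v =
    g1 (v + th * h) - th * h * g2 v - g1 v by ring.
  apply: le_trans (H _) _; last by rewrite ler_piMr// mulr_ge0// exprn_ge0.
  move=> z /andP[z0 z1]; rewrite normrM expr2 mulrCA.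
  apply: ler_wpM2l => //.
  apply: le_trans (mvt_bound_glob d2 M3 _ _) _; apply: ler_wpM2l => //.
  have -> : v + z * h - v = z * h by ring.
  by rewrite normrM ger0_norm// ler_piMl//; lra.
pose p th := g (v + th * h) - th * h * g1 v - th ^+ 2 * h ^+ 2 / 2 * g2 v.
have dp z : is_derive z (1 : R) p (h * (g1 (v + z * h) - g1 v - z * h * g2 v)).
  rewrite /p; have := c0 z => c0z; apply: is_derive_eq.
  by rewrite /= /GRing.scale /=; field.
have := @mvt_bound R p _ 0 1 (M * `|h| ^+ 3) ler01 (fun z _ => dp z).
rewrite /p !mul1r !mul0r expr0n expr1n /= !mul0r mul1r addr0 !subr0 mulr1 => H.
have -> : g (v + h) - g v - h * g1 v - h ^+ 2 / 2 * g2 v =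
  g (v + h) - h * g1 v - h ^+ 2 / 2 * g2 v - g v by ring.
apply: H => z /B1 H; rewrite normrM [_ ^+ 3]exprS mulrCA.
exact: ler_wpM2l.
Qed.

(** The heat equation trades the unit of time for half a second space derivative. What remains at
    second order is linear in h and in h^2 - 1, both of mean 0 when h is centred with variance 1;
    the error gains three powers of t^(-1/2). *)
Lemma he_step i (H : R) : 0 < H -> exists2 C : R, 0 < C & forall t v h : R, 2 <= t ->
  `|h| <= H ->
  `|he i (t - 1) (v + h) - he i t v - h * he i.+1 t v
    - (h ^+ 2 - 1) / 2 * he i.+2 t v| <= C * (Num.sqrt t)^-1 ^+ i.+3.
Proof.
move=> H0.
have [C3 C30 B3] := he_bound_near i.+3; have [C4 C40 B4] := he_bound_near i.+4.
exists (C3 * H ^+ 3 + C4 + H * C3 + H ^+ 2 * C4).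
  by rewrite !addr_gt0 ?mulr_gt0 ?exprn_gt0.
move=> t v h t2 hH; have t0 : 0 < t by lra.
set w := (Num.sqrt t)^-1.
have w0 : 0 <= w by rewrite invr_ge0 sqrtr_ge0.
have w1 : w <= 1.
  rewrite -[leRHS]invr1 lef_pV2 ?posrE ?sqrtr_gt0// -[leLHS]sqrtr1 ler_wsqrtr//; lra.
have w4 : w ^+ i.+4 <= w ^+ i.+3 by rewrite exprS ler_piMl// exprn_ge0.
have t1 z : t - 1 <= z <= t -> t / 4 <= z by move=> /andP[? ?]; lra.
have T3 := @taylor3 (he i (t - 1)) _ _ _ (C3 * w ^+ i.+3)
  (is_derive_he_v i (t - 1)) (is_derive_he_v i.+1 (t - 1)) (is_derive_he_v i.+2 (t - 1)).
have {}T3 : `|he i (t - 1) (v + h) - he i (t - 1) v - h * he i.+1 (t - 1) v -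
     h ^+ 2 / 2 * he i.+2 (t - 1) v| <= C3 * H ^+ 3 * w ^+ i.+3.
  apply: le_trans (T3 _ _ _) _; first by move=> z; apply: B3 => //; lra.
  rewrite mulrAC ler_wpM2r ?exprn_ge0// ler_pM2l//.
  by apply: lerXn2r; rewrite ?nnegrE// ltW.
have Dt k z : t - 1 <= z <= t -> is_derive z (1 : R) (fun t => he k t v) (he k.+2 z v / 2).
  by move=> /andP[? ?]; apply: is_derive_he_t; lra.
have D1 k : forall z, t - 1 <= z <= t -> forall C, 0 < C -> (forall z, t - 1 <= z <= t ->
    `|he k.+2 z v| <= C * w ^+ k.+2) -> `|he k t v - he k z v| <= C * w ^+ k.+2.
  move=> z /andP[z1 z2] C C0 HC.
  apply: le_trans (@mvt_bound R (fun t => he k t v) _ z t (C * w ^+ k.+2) z2 _ _) _.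
  - by move=> z' /andP[? ?]; apply: Dt; apply/andP; split; lra.
  - move=> z' /andP[? ?]; rewrite normrM [`|2^-1|]ger0_norm//.
    have := HC z'; have -> : t - 1 <= z' <= t by apply/andP; split; lra.
    by move=> /(_ isT) ?; have := normr_ge0 (he k.+2 z' v) => ?; lra.
  by apply: ler_piMr; [rewrite mulr_ge0 ?exprn_ge0// ltW|lra].
have b3 z : t - 1 <= z <= t -> `|he i.+3 z v| <= C3 * w ^+ i.+3.
  by move=> /t1 ?; apply: B3.
have b4 z : t - 1 <= z <= t -> `|he i.+4 z v| <= C4 * w ^+ i.+4.
  by move=> /t1 ?; apply: B4.
have in1 : t - 1 <= t - 1 <= t by apply/andP; split; lra.
have d1 := D1 i.+1 _ in1 C3 C30 b3.
have d2 := D1 i.+2 _ in1 C4 C40 b4.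
have d0 : `|he i t v - he i (t - 1) v - he i.+2 t v / 2| <= C4 * w ^+ i.+4.
  pose p z := he i z v - z * (he i.+2 t v / 2).
  have := @mvt_bound R p (fun z => (he i.+2 z v - he i.+2 t v) / 2) (t - 1) t
     (C4 * w ^+ i.+4).
  have -> : p t - p (t - 1) = he i t v - he i (t - 1) v - he i.+2 t v / 2.
    by rewrite /p; ring.
  have -> : t - (t - 1) = 1 by ring.
  rewrite mulr1; apply; first by lra.
    move=> z zt; rewrite /p; have := Dt i z zt => dz; apply: is_derive_eq.
    by rewrite /= /GRing.scale /=; ring.
  move=> z zt; rewrite normrM [`|2^-1|]ger0_norm// distrC.
  have := D1 i.+2 _ zt C4 C40 b4 => ?.
  by have := normr_ge0 (he i.+2 t v - he i.+2 z v) => ?; lra.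
have h2 : h ^+ 2 <= H ^+ 2.
  by rewrite -[h ^+ 2]ger0_norm ?sqr_ge0// normrX; apply: lerXn2r; rewrite ?nnegrE// ltW.
have -> : he i (t - 1) (v + h) - he i t v - h * he i.+1 t v -
    (h ^+ 2 - 1) / 2 * he i.+2 t v =
  (he i (t - 1) (v + h) - he i (t - 1) v - h * he i.+1 (t - 1) v -
     h ^+ 2 / 2 * he i.+2 (t - 1) v) - (he i t v - he i (t - 1) v - he i.+2 t v / 2)
  - h * (he i.+1 t v - he i.+1 (t - 1) v)
  - h ^+ 2 / 2 * (he i.+2 t v - he i.+2 (t - 1) v) by ring.
apply: le_trans (ler_normB _ _) _; rewrite !mulrDl; apply: lerD.
  apply: le_trans (ler_normB _ _) _; apply: lerD.
    apply: le_trans (ler_normB _ _) _; apply: lerD => //.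
    by apply: le_trans d0 _; rewrite ler_pM2l.
  by rewrite normrM -mulrA; apply: ler_pM.
rewrite normrM -mulrA; apply: ler_pM => //.
  by have := sqr_ge0 h => ?; rewrite ger0_norm; [lra|rewrite divr_ge0].
by apply: le_trans d2 _; rewrite ler_pM2l.
Qed.

Lemma he_lip_v i : exists2 C : R, 0 < C & forall t v v' : R, 0 < t ->
  `|he i t v - he i t v'| <= C * (Num.sqrt t)^-1 ^+ i.+1 * `|v - v'|.
Proof.
have [C C0 H] := he_bound i.+1; exists C => // t v v' t0.
by apply: (mvt_bound_glob (is_derive_he_v i t)) => z; exact: H.
Qed.

Lemma he_lip_t i : exists2 C : R, 0 < C & forall t t' v : R, 0 < t -> t / 4 <= t' ->
  `|he i t' v - he i t v| <= C * (Num.sqrt t)^-1 ^+ i.+2 * `|t' - t|.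
Proof.
have [C C0 H] := he_bound_near i.+2; exists C => // t t' v t0 tt'.
have B z : t / 4 <= z -> `|he i.+2 z v / 2| <= C * (Num.sqrt t)^-1 ^+ i.+2.
  move=> tz; rewrite normrM [`|2^-1|]ger0_norm//.
  have := H t z v t0 tz => ?; have := normr_ge0 (he i.+2 z v) => ?; lra.
have D (z : R) : t / 4 <= z -> is_derive z (1 : R) (fun t => he i t v) (he i.+2 z v / 2).
  by move=> ?; apply: is_derive_he_t; lra.
have [le|le] := leP t t'.
  rewrite [`|t' - t|]ger0_norm ?subr_ge0//.
  apply: (@mvt_bound R (fun t => he i t v)) => // z /andP[? ?]; [apply: D|apply: B]; lra.
rewrite distrC [`|t' - t|]distrC [`|t - t'|]ger0_norm ?subr_ge0 ?(ltW le)//.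
apply: (@mvt_bound R (fun t => he i t v)); first exact: ltW.
  by move=> z /andP[? ?]; apply: D; lra.
by move=> z /andP[? ?]; apply: B; lra.
Qed.

Lemma he_lip i (H : R) : 0 < H -> exists2 C : R, 0 < C & forall t v h : R, 2 <= t ->
  `|h| <= H -> `|he i (t - 1) (v + h) - he i t v| <= C * (Num.sqrt t)^-1 ^+ i.+1.
Proof.
move=> H0; have [C1 C10 B1] := he_lip_t i; have [C2 C20 B2] := he_bound_near i.+1.
exists (C1 + C2 * H); first by rewrite addr_gt0// mulr_gt0.
move=> t v h t2 hH; have t0 : 0 < t by lra.
set w := (Num.sqrt t)^-1.
have w0 : 0 <= w by rewrite invr_ge0 sqrtr_ge0.
have w1 : w <= 1.
  rewrite -[leRHS]invr1 lef_pV2 ?posrE ?sqrtr_gt0// -[leLHS]sqrtr1 ler_wsqrtr//; lra.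
have -> : he i (t - 1) (v + h) - he i t v = (he i (t - 1) v - he i t v) +
  (he i (t - 1) (v + h) - he i (t - 1) v) by ring.
apply: le_trans (ler_normD _ _) _; rewrite mulrDl; apply: lerD.
  apply: le_trans (B1 t (t - 1) v t0 _) _; first by lra.
  have -> : t - 1 - t = -1 by ring.
  by rewrite normrN normr1 mulr1 ler_pM2l// exprS ler_piMl// exprn_ge0.
rewrite mulrAC; apply: le_trans (@mvt_bound_glob R _ _ (C2 * w ^+ i.+1)
   (is_derive_he_v i (t - 1)) _ _ _) _.
  by move=> z; apply: B2 => //; lra.
have -> : v + h - v = h by ring.
by rewrite ler_wpM2l// mulr_ge0 ?exprn_ge0// ltW.
Qed.

End Heat.

(** * The data attached to a chain *)

Section Walk.
Variables (R : realType) (X : finType).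

(** Correctors, variance, a common bound B and the harmonic function, to be instantiated for the
    chain and for its dual with the same sigma. *)
Record walk (Q : X -> X -> R) (f r q : X -> R) (sg B : R) (V : X -> R -> R) : Prop := Walk {
  walk_stoch : stochastic Q;
  walk_r : forall x, \sum_x' Q x x' * (f x' + r x') = r x;
  walk_sg : 0 < sg;
  walk_q : forall x, \sum_x' Q x x' * ((f x' + r x' - r x) ^+ 2 + q x') = q x + sg ^+ 2;
  walk_B : 0 < B;
  walk_fB : forall x, `|f x| <= B;
  walk_rB : forall x, `|r x| <= B;
  walk_qB : forall x, `|q x| <= B;
  walk_Vneg : forall x y, y <= 0 -> V x y = 0;
  walk_V0 : forall x y, 0 <= V x y;
  walk_harm : forall x y, kill Q f V x y = V x y;
  walk_dist : forall x y, `|V x y - (0 < y)%R%:R * (y + r x)| <= 2 * B * alive x y }.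

Lemma exists_walk (Q : X -> X -> R) (nu f : X -> R) : chain Q nu f ->
  exists r q B V, walk Q f r q (sigma Q nu f) B V.
Proof.
move=> CH; have SQ := chain_stoch CH.
have [r [q [Hr sg0 Hq]]] := chain_data CH.
have [b1 b10 H1] := fin_ub f; have [b2 b20 H2] := fin_ub r.
have [b3 b30 H3] := fin_ub q.
pose B := b1 + b2 + b3.
have B0 : 0 < B by rewrite /B; lra.
have fB x : `|f x| <= B by apply: le_trans (H1 x) _; rewrite /B; lra.
have rB x : `|r x| <= B by apply: le_trans (H2 x) _; rewrite /B; lra.
have qB x : `|q x| <= B by apply: le_trans (H3 x) _; rewrite /B; lra.
have [V [V1 V2 V3 V4]] := exists_harmonic SQ Hr sg0 Hq B0 fB rB qB.
by exists r, q, B, V.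
Qed.

Lemma sum_isqrt k : \sum_(j < k) (Num.sqrt j.+1%:R)^-1 <= 2 * Num.sqrt k%:R :> R.
Proof.
elim: k => [|k IH]; first by rewrite big_ord0 mulr_ge0// sqrtr_ge0.
rewrite big_ord_recr /=; apply: le_trans (lerD IH (lexx _)) _.
have b0 := @sqrtSn_gt0 R k; have b2 := @sqr_sqrtSn R k.
have a0 := @sqrtr_ge0 R k%:R.
have a2 : Num.sqrt k%:R ^+ 2 = k%:R :> R by rewrite sqr_sqrtr.
rewrite -natr1 in b0 b2 *.
move: (Num.sqrt (k%:R + 1)) (Num.sqrt k%:R) b0 b2 a0 a2 => b a b0 b2 a0 a2.
rewrite -(ler_pM2r b0) mulrDl mulVf ?gt_eqF//; nra.
Qed.

End Walk.

(** * Carrying heat solutions by the killed walk *)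

Section Propagation.
Variables (R : realType) (X : finType).
Variables (Q : X -> X -> R) (f r q : X -> R) (sg B : R) (V : X -> R -> R).
Hypothesis W : walk Q f r q sg B V.

Let SQ := walk_stoch W.
Let Hr := walk_r W.
Let sg0 := walk_sg W.
Let Hq := walk_q W.
Let B0 := walk_B W.
Let Q0 x x' : 0 <= Q x x'. Proof. by case: SQ. Qed.
Let fl x : - B <= f x. Proof. by have := walk_fB W x; rewrite ler_norml => /andP[]. Qed.
Let fu x : f x <= B. Proof. by have := walk_fB W x; rewrite ler_norml => /andP[]. Qed.
Let rl x : - B <= r x. Proof. by have := walk_rB W x; rewrite ler_norml => /andP[]. Qed.
Let ru x : r x <= B. Proof. by have := walk_rB W x; rewrite ler_norml => /andP[]. Qed.

Local Notation T := (step Q f).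
Local Notation K := (kill Q f).
Local Notation s := (srv Q f).

(** The gap between V and the martingale height. Both are martingales until death, hence so is [ee],
    which is bounded at all heights reached from positive ones. *)
Let ee x y := V x y - y - r x.

Let ee_bound x y : - B <= y -> `|ee x y| <= 2 * B.
Proof.
move=> yB; have := walk_dist W x y; rewrite /alive /ee; have [y0|y0] := ltP 0 y => /=.
  by rewrite mul1r mulr1 opprD addrA.
rewrite (walk_Vneg W)// => _; have := rl x; have := ru x => ? ?.
by rewrite ler_norml; apply/andP; split; lra.
Qed.

Let dl x y x' := ee x' (y + f x') - ee x y.

Let dl_bound x y x' : 0 < y -> `|dl x y x'| <= 4 * B.
Proof.
move=> y0; have Bp := B0; have fx := fl x'.
have h1 : `|ee x' (y + f x')| <= 2 * B by apply: ee_bound; lra.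
have h2 : `|ee x y| <= 2 * B by apply: ee_bound; lra.
by apply: le_trans (ler_normB _ _) _; lra.
Qed.

Let V_step x y x' : V x' (y + f x') = V x y + (f x' + r x' - r x) + dl x y x'.
Proof. by rewrite /dl /ee; ring. Qed.

Lemma exp_V x y : 0 < y -> \sum_x' Q x x' * V x' (y + f x') = V x y.
Proof. by move=> y0; rewrite -[RHS](walk_harm W) killP. Qed.

Let exp_a x : \sum_x' Q x x' * (f x' + r x' - r x) = 0.
Proof.
under eq_bigr do rewrite mulrBr.
by rewrite sumrB Hr (sumQ_cst SQ) subrr.
Qed.

Let exp_dl x y : 0 < y -> \sum_x' Q x x' * dl x y x' = 0.
Proof.
move=> y0; transitivity (\sum_x' Q x x' * V x' (y + f x') -
  (\sum_x' Q x x' * V x y + \sum_x' Q x x' * (f x' + r x' - r x))).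
  by rewrite -big_split -sumrB; apply: eq_bigr => x' _ /=; rewrite (V_step x y); ring.
by rewrite exp_V// exp_a (sumQ_cst SQ); ring.
Qed.

Let D x y := (0 < y)%R%:R * \sum_x' Q x x' * dl x y x' ^+ 2.

Let D_ge0 x y : 0 <= D x y.
Proof.
by rewrite mulr_ge0 ?ler0n// sumr_ge0// => x' _; rewrite mulr_ge0// sqr_ge0.
Qed.

Let D_eq x y : 0 < y -> D x y =
  \sum_x' Q x x' * ee x' (y + f x') ^+ 2 - ee x y ^+ 2.
Proof.
move=> y0; rewrite /D y0 mul1r.
have E x' : Q x x' * ee x' (y + f x') ^+ 2 =
  Q x x' * dl x y x' ^+ 2 + 2 * ee x y * (Q x x' * dl x y x') + Q x x' * ee x y ^+ 2.
  by rewrite /dl; ring.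
under [in RHS]eq_bigr do rewrite E.
by rewrite !big_split /= -mulr_sumr exp_dl// (sumQ_cst SQ); ring.
Qed.

Lemma sum_iter_kill_S F k x y : \sum_(j < k.+1) iter j K F x y =
  F x y + K (fun x y => \sum_(j < k) iter j K F x y) x y.
Proof.
rewrite big_ord_recl; congr (_ + _).
have := @kill_sum _ _ Q f 'I_k (index_enum _) xpredT (fun=> 1) (fun j => iter j K F) x y.
under eq_bigr do rewrite mul1r.
by move=> <-; apply: kill_ext => ? ?; apply: eq_bigr => ? _; rewrite mul1r.
Qed.

(* [ee] is a bounded martingale until the killing time, so its quadratic
   variation has bounded expectation. *)
Let sumD k x y : \sum_(j < k) iter j K D x y <= 4 * B ^+ 2.
Proof.
suff H : \sum_(j < k) iter j K D x y <= alive x y * (4 * B ^+ 2 - ee x y ^+ 2).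
  apply: le_trans H _; rewrite /alive.
  have := sqr_ge0 (ee x y); have := sqr_ge0 B => ? ?.
  by case: (0 < y); rewrite ?mul1r ?mul0r; lra.
have ee2 x1 y1 : - B <= y1 -> ee x1 y1 ^+ 2 <= 4 * B ^+ 2.
  move=> /(ee_bound x1); rewrite ler_norml => /andP[? ?].
  by have := B0 => ?; nra.
elim: k x y => [|k IH] x y.
  rewrite big_ord0 /alive; case: ltP => y0; rewrite ?mul0r// mul1r subr_ge0 ee2//.
  by have := B0 => ?; lra.
rewrite sum_iter_kill_S /alive; have [y0|y0] := ltP 0 y; last first.
  by rewrite killN// /D ltNge y0 !mul0r addr0.
rewrite mul1r killP// D_eq//.
have : T (fun x y => \sum_(j < k) iter j K D x y) x y <=
    \sum_x' Q x x' * (4 * B ^+ 2 - ee x' (y + f x') ^+ 2).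
  apply: (sumQ_le SQ) => x'; apply: le_trans (IH _ _) _.
  rewrite ler_piMl ?alive_le1// subr_ge0 ee2//.
  by have := fl x'; have := y0 => ? ?; lra.
under eq_bigr do rewrite mulrBr.
by rewrite sumrB (sumQ_cst SQ) => ?; lra.
Qed.

(** Bounds the increments of V / sg: 3 B comes from f and r, 4 B from the increment of [ee]. *)
Definition stepH : R := 7 * B / sg.

Lemma stepH_gt0 : 0 < stepH.
Proof. by rewrite divr_gt0// mulr_gt0// B0. Qed.

(** What the argument uses of a heat solution u of order p with second derivative u2: the one-step
    expansion, the sizes, and vanishing at 0, which makes the killing invisible. Isolating it covers
    the even derivatives [he] and, with a constant free of the pole, the Dirichlet kernels [hd]. *)
Record testfn (p : nat) (Cu : R) (u u1 u2 : R -> R -> R) : Prop := Testfn {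
  tf_C : 0 <= Cu;
  tf_0 : forall t, u t 0 = 0;
  tf_20 : forall t, u2 t 0 = 0;
  tf_step : forall t v h, 2 <= t -> `|h| <= stepH ->
    `|u (t - 1) (v + h) - u t v - h * u1 t v - (h ^+ 2 - 1) / 2 * u2 t v|
      <= Cu * (Num.sqrt t)^-1 ^+ p.+3;
  tf_2step : forall t v h, 2 <= t -> `|h| <= stepH ->
    `|u2 (t - 1) (v + h) - u2 t v| <= Cu * (Num.sqrt t)^-1 ^+ p.+3;
  tf_2 : forall t v, 0 < t -> `|u2 t v| <= Cu * (Num.sqrt t)^-1 ^+ p.+2 }.

Definition nv x y := V x y / sg.

Section OneFunction.
Variables (p : nat) (Cu : R) (u u1 u2 : R -> R -> R).
Hypothesis U : testfn p Cu u u1 u2.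

Let c2 := (2 * sg ^+ 2)^-1.
(** The term in q compensates the dependence of the conditional variance on the state. *)
Let Phi t x y := u t (nv x y) + u2 t (nv x y) * (q x * c2).

Let Phi_neg t x y : y <= 0 -> Phi t x y = 0.
Proof.
by move=> y0; rewrite /Phi /nv (walk_Vneg W)// mul0r (tf_0 U) (tf_20 U) mul0r addr0.
Qed.

(** In the mean, what is left at second order involves [dl], mainly the cross term between [dl] and
    the homogeneous increment. Young's inequality bounds |dl|, up to constants, by l dl^2 + 1/l: the
    first part has bounded total by [sumD], the second costs 1/l per step survived. *)
Let one_step t x y l : 2 <= t -> 0 < y -> 0 < l ->
  `|K (Phi (t - 1)) x y - Phi t x y| <=
   Cu * (1 + B * c2) * (Num.sqrt t)^-1 ^+ p.+3 +
   Cu * (5 * B * c2) * (Num.sqrt t)^-1 ^+ p.+2 * (l * D x y + l^-1).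
Proof.
move=> t2 y0 l0; have Bp := B0; have sgp := sg0.
have t0 : 0 < t by lra.
have c20 : 0 < c2 by rewrite invr_gt0 mulr_gt0// exprn_gt0.
rewrite killP//; set v := nv x y; set w := (Num.sqrt t)^-1.
pose h x' := (f x' + r x' - r x + dl x y x') / sg.
have vh x' : nv x' (y + f x') = v + h x'.
  by rewrite /nv /v /h (V_step x y) /nv; ring.
have hB x' : `|h x'| <= stepH.
  rewrite /h /stepH normrM [`|sg^-1|]ger0_norm; last by rewrite invr_ge0 ltW.
  rewrite ler_pM2r ?invr_gt0//.
  have := dl_bound x x' y0; have := fl x'; have := fu x'.
  have := rl x'; have := ru x'; have := rl x; have := ru x => ? ? ? ? ? ?.
  by rewrite !ler_norml => /andP[? ?]; apply/andP; split; lra.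
pose rem x' := (u (t - 1) (v + h x') - u t v - h x' * u1 t v -
   (h x' ^+ 2 - 1) / 2 * u2 t v) + (u2 (t - 1) (v + h x') - u2 t v) * (q x' * c2).
have rem_b x' : `|rem x'| <= Cu * (1 + B * c2) * w ^+ p.+3.
  apply: le_trans (ler_normD _ _) _; rewrite mulrDr mulr1 mulrDl; apply: lerD.
    exact: (tf_step U).
  rewrite normrM mulrAC; apply: ler_pM => //; first exact: (tf_2step U).
  by rewrite normrM [`|c2|]ger0_norm ?(ltW c20)// ler_pM2r// (walk_qB W).
pose cr x' := 2 * (f x' + r x' - r x) * dl x y x' + dl x y x' ^+ 2.
have E x' : u (t - 1) (v + h x') + u2 (t - 1) (v + h x') * (q x' * c2) =
   rem x' + (u t v - u2 t v / 2) + (u1 t v / sg) * (f x' + r x' - r x) +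
   (u1 t v / sg) * dl x y x' +
   u2 t v * c2 * ((f x' + r x' - r x) ^+ 2 + q x') + u2 t v * c2 * cr x'.
  by rewrite /rem /cr /h /c2; field; rewrite gt_eqF.
have -> : T (Phi (t - 1)) x y - Phi t x y =
   \sum_x' Q x x' * rem x' + u2 t v * c2 * \sum_x' Q x x' * cr x'.
  have -> : T (Phi (t - 1)) x y = \sum_x' (Q x x' * rem x' +
     Q x x' * (u t v - u2 t v / 2) +
     (u1 t v / sg) * (Q x x' * (f x' + r x' - r x)) +
     (u1 t v / sg) * (Q x x' * dl x y x') +
     u2 t v * c2 * (Q x x' * ((f x' + r x' - r x) ^+ 2 + q x')) +
     u2 t v * c2 * (Q x x' * cr x')).
    by apply: eq_bigr => x' _; rewrite /Phi vh E; ring.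
  rewrite !big_split /= -!mulr_sumr exp_a exp_dl// Hq (sumQ_cst SQ) /Phi -/v.
  by rewrite /c2; field; rewrite gt_eqF.
apply: le_trans (ler_normD _ _) _; apply: lerD; first exact: (sumQ_norm SQ).
have cr_b : `|\sum_x' Q x x' * cr x'| <= 5 * B * (l * D x y + l^-1).
  apply: le_trans (ler_norm_sum _ _ _) _.
  have -> : 5 * B * (l * D x y + l^-1) =
      \sum_x' Q x x' * (5 * B * (l * dl x y x' ^+ 2 + l^-1)).
    rewrite /D y0 mul1r -[l^-1 in LHS](sumQ_cst SQ x) mulr_sumr -big_split mulr_sumr.
    by apply: eq_bigr => x' _ /=; ring.
  apply: ler_sum => x' _; rewrite normrM ger0_norm//; apply: ler_wpM2l => //.
  have := dl_bound x x' y0; have := fl x'; have := fu x'.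
  have := rl x'; have := ru x'; have := rl x; have := ru x => ? ? ? ? ? ?.
  rewrite /cr; set d := dl x y x'; set a := f x' + r x' - r x => dB.
  have aB : `|a| <= 3 * B by rewrite ler_norml; apply/andP; split; rewrite /a; lra.
  have -> : 2 * a * d + d ^+ 2 = (2 * a + d) * d by ring.
  have h1 : `|2 * a + d| <= 10 * B.
    apply: le_trans (ler_normD _ _) _; rewrite normrM [`|2|]ger0_norm//.
    by move: dB aB => ? ?; lra.
  have h2 : 2 * `|d| <= l * d ^+ 2 + l^-1.
    have -> : l * d ^+ 2 = (l * `|d|) ^+ 2 / l.
      by rewrite exprMn -normrX [`|d ^+ 2|]ger0_norm ?sqr_ge0//; field; rewrite gt_eqF.
    rewrite -[X in _ + X]mul1r -mulrDl ler_pdivlMr//.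
    by have := sqr_ge0 (l * `|d| - 1) => ?; nra.
  rewrite normrM; have := normr_ge0 d => d0.
  have h3 : `|2 * a + d| * `|d| <= 10 * B * `|d| by rewrite ler_wpM2r.
  by nra.
rewrite normrM normrM [`|c2|]ger0_norm ?(ltW c20)//.
have -> : Cu * (5 * B * c2) * w ^+ p.+2 * (l * D x y + l^-1) =
  Cu * w ^+ p.+2 * c2 * (5 * B * (l * D x y + l^-1)) by ring.
apply: ler_pM => //; first by rewrite mulr_ge0// ltW.
by rewrite ler_pM2r//; exact: (tf_2 U).
Qed.

Let many_steps t k l : 1 <= t -> 0 < l -> forall x y,
  `|iter k K (Phi t) x y - Phi (t + k%:R) x y| <=
   (Cu * (1 + B * c2) * (Num.sqrt t)^-1 ^+ p.+3 +
   Cu * (5 * B * c2) * (Num.sqrt t)^-1 ^+ p.+2 * l^-1) * \sum_(j < k) s j x y +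
   Cu * (5 * B * c2) * (Num.sqrt t)^-1 ^+ p.+2 * l * \sum_(j < k) iter j K D x y.
Proof.
move=> t1 l0; have Bp := B0; have Cu0 := tf_C U.
have c20 : 0 < c2 by rewrite invr_gt0 mulr_gt0// exprn_gt0.
have b1 : 0 <= 1 + B * c2 by rewrite addr_ge0// mulr_ge0// ltW.
have b5 : 0 <= 5 * B * c2 by rewrite mulr_ge0 ?(ltW c20)// mulr_ge0// ltW.
have wm m : 0 <= (Num.sqrt t)^-1 ^+ m by rewrite exprn_ge0// invr_ge0 sqrtr_ge0.
have l0' : 0 <= l := ltW l0.
have li : 0 <= l^-1 by rewrite invr_ge0.
set a := Cu * (1 + B * c2) * _ + _; set b := Cu * (5 * B * c2) * _ * l.
have a_ge0 : 0 <= a := addr_ge0 (mulr_ge0 (mulr_ge0 Cu0 b1) (wm _))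
  (mulr_ge0 (mulr_ge0 (mulr_ge0 Cu0 b5) (wm _)) li).
have b_ge0 : 0 <= b := mulr_ge0 (mulr_ge0 (mulr_ge0 Cu0 b5) (wm _)) l0'.
elim: k => [|k IH] x y.
  by rewrite !big_ord0 !mulr0 !addr0 subrr normr0.
have [y0|y0] := ltP 0 y; last first.
  rewrite Phi_neg// iterS killN// subr0 normr0.
  have h1 : 0 <= \sum_(j < k.+1) s j x y by apply: sumr_ge0 => j _; exact: srv_ge0.
  have h2 : 0 <= \sum_(j < k.+1) iter j K D x y.
    by apply: sumr_ge0 => j _; exact: iter_kill_ge0.
  by rewrite addr_ge0// mulr_ge0.
have e1 : \sum_(j < k.+1) s j x y = s 0 x y + K (fun x y => \sum_(j < k) s j x y) x y.
  exact: (sum_iter_kill_S (@alive R X)).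
rewrite e1 sum_iter_kill_S.
have -> : iter k.+1 K (Phi t) x y - Phi (t + k.+1%:R) x y =
   K (fun x y => 1 * iter k K (Phi t) x y + (-1) * Phi (t + k%:R) x y) x y +
   (K (Phi (t + k.+1%:R - 1)) x y - Phi (t + k.+1%:R) x y).
  rewrite kill_lin -[k.+1%:R]natr1 iterS.
  have -> : t + (k%:R + 1) - 1 = t + k%:R by ring.
  by ring.
apply: le_trans (ler_normD _ _) _.
have h1 : `|K (fun x y => 1 * iter k K (Phi t) x y + (-1) * Phi (t + k%:R) x y) x y| <=
   a * K (fun x y => \sum_(j < k) s j x y) x y + b * K (fun x y => \sum_(j < k) iter j K D x y) x y.
  rewrite -kill_lin; apply: (@iter_kill_norm_le _ _ Q f SQ _ _ 1) => x1 y1.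
  by rewrite mul1r mulN1r; exact: IH.
have kp : 1 <= k.+1%:R :> R by rewrite ler1n.
have tk : 2 <= t + k.+1%:R by lra.
have h2 := one_step x tk y0 l0.
have ww : (Num.sqrt (t + k.+1%:R))^-1 <= (Num.sqrt t)^-1.
  by rewrite lef_pV2 ?posrE ?sqrtr_gt0; [rewrite ler_wsqrtr//; lra|lra|lra].
have wp m : (Num.sqrt (t + k.+1%:R))^-1 ^+ m <= (Num.sqrt t)^-1 ^+ m.
  by apply: lerXn2r; rewrite ?nnegrE ?invr_ge0 ?sqrtr_ge0.
have h3 : `|K (Phi (t + k.+1%:R - 1)) x y - Phi (t + k.+1%:R) x y| <= a * s 0 x y + b * D x y.
  apply: le_trans h2 _; rewrite /srv /= /alive y0 mulr1 /a /b.
  apply: le_trans (_ : Cu * (1 + B * c2) * (Num.sqrt t)^-1 ^+ p.+3 +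
    Cu * (5 * B * c2) * (Num.sqrt t)^-1 ^+ p.+2 * (l * D x y + l^-1) <= _); last first.
    by apply: eqle; ring.
  apply: lerD; first by apply: ler_wpM2l => //; exact: mulr_ge0.
  apply: ler_wpM2r; first by rewrite addr_ge0// mulr_ge0.
  by apply: ler_wpM2l => //; exact: mulr_ge0.
by move: h1 h3 => ? ?; lra.
Qed.

Lemma propagation_aux Cs t k l x y : 0 < Cs ->
  (forall n x y, s n x y <= Cs * (1 + `|y|) / Num.sqrt n.+1%:R) -> 1 <= t -> 0 < l ->
  `|iter k K (fun x y => u t (nv x y)) x y - u (t + k%:R) (nv x y)| <=
  Cu * (2 * B * c2 + (1 + B * c2) * (2 * Cs) + 10 * B * c2 * Cs + 20 * B ^+ 3 * c2) *
  (1 + `|y|) * ((Num.sqrt t)^-1 ^+ p.+2 * (1 + l + Num.sqrt k.+1%:R / l) +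
   (Num.sqrt t)^-1 ^+ p.+3 * Num.sqrt k.+1%:R).
Proof.
move=> Cs0 HCs t1 l0; have Bp := B0; have Cu0 := tf_C U.
have t0 : 0 < t by lra.
have c20 : 0 < c2 by rewrite invr_gt0 mulr_gt0// exprn_gt0.
have k0 : 0 <= k%:R :> R by [].
set w := (Num.sqrt t)^-1.
have wm m : 0 <= w ^+ m by rewrite exprn_ge0// invr_ge0 sqrtr_ge0.
have rho1 := sqrtSn_ge1 R k; set rho := Num.sqrt k.+1%:R in rho1 *.
have y1 : 1 <= 1 + `|y| by rewrite lerDl.
set Y := 1 + `|y| in y1 *.
have Bc : 0 <= B * c2 by rewrite mulr_ge0// ltW.
have main := many_steps k t1 l0 x y; rewrite -/w in main.
have S1 : \sum_(j < k) s j x y <= 2 * Cs * Y * rho.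
  apply: le_trans (_ : \sum_(j < k) Cs * Y / Num.sqrt j.+1%:R <= _).
    by apply: ler_sum => j _; exact: HCs.
  rewrite -mulr_sumr; apply: le_trans (ler_wpM2l _ (sum_isqrt R k)) _.
    by rewrite mulr_ge0 ?(ltW Cs0)//; lra.
  have : Num.sqrt k%:R <= rho by rewrite ler_wsqrtr// ler_nat.
  have : 0 <= Cs * Y by rewrite mulr_ge0 ?(ltW Cs0)//; lra.
  by move=> ? ?; nra.
have S2 := sumD k x y.
have ub t' x1 y1' : t <= t' -> `|u2 t' (nv x1 y1') * (q x1 * c2)| <= Cu * w ^+ p.+2 * (B * c2).
  move=> tt'; rewrite normrM; apply: ler_pM => //.
    apply: le_trans (tf_2 U _ _) _; first by lra.
    apply: ler_wpM2l => //; apply: lerXn2r; rewrite ?nnegrE ?invr_ge0 ?sqrtr_ge0//.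
    by rewrite lef_pV2 ?posrE ?sqrtr_gt0; [rewrite ler_wsqrtr|lra|].
  by rewrite normrM [`|c2|]ger0_norm ?(ltW c20)// ler_pM2r// (walk_qB W).
have e1 : iter k K (Phi t) x y = iter k K (fun x y => u t (nv x y)) x y +
    iter k K (fun x y => u2 t (nv x y) * (q x * c2)) x y.
  have := iter_kill_lin Q f 1 1 (fun x y => u t (nv x y))
    (fun x y => u2 t (nv x y) * (q x * c2)) k x y.
  rewrite !mul1r => <-; apply: iter_kill_ext => ? ?.
  by rewrite /Phi !mul1r.
have e2 : `|iter k K (fun x y => u2 t (nv x y) * (q x * c2)) x y| <= Cu * w ^+ p.+2 * (B * c2).
  apply: le_trans (_ : Cu * w ^+ p.+2 * (B * c2) * s k x y <= _); last first.
    by rewrite ler_piMr ?(srv_le1 f SQ)//; exact: (mulr_ge0 (mulr_ge0 Cu0 (wm _)) Bc).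
  apply: (iter_kill_bound f SQ) => x1 y1'; rewrite /alive; have [y0|y0] := ltP 0 y1'.
    by rewrite mulr1 ub.
  by rewrite /nv (walk_Vneg W)// mul0r (tf_20 U) mul0r normr0 mulr0.
have e3 := ub (t + k%:R) x y ltac:(lra).
rewrite e1 /Phi in main.
set A := iter k K (fun x y => u t (nv x y)) x y in main *.
set A2 := iter k K _ x y in main e2 *.
set A3 := u2 (t + k%:R) (nv x y) * (q x * c2) in main e3 *.
have -> : A - u (t + k%:R) (nv x y) = (A + A2 - (u (t + k%:R) (nv x y) + A3)) - A2 + A3 by ring.
apply: le_trans (ler_normD _ _) _; apply: le_trans (lerD (ler_normB _ _) (lexx _)) _.
have li : 0 <= l^-1 by rewrite invr_ge0 ltW.
have b1 : 0 <= 1 + B * c2 by rewrite addr_ge0.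
have b5 : 0 <= 5 * B * c2 by rewrite -mulrA mulr_ge0.
have w2 := wm p.+2; have w3 := wm p.+3.
apply: le_trans (lerD (lerD main e2) e3) _.
apply: le_trans (_ : (Cu * (1 + B * c2) * w ^+ p.+3 + Cu * (5 * B * c2) * w ^+ p.+2 * l^-1) *
   (2 * Cs * Y * rho) + Cu * (5 * B * c2) * w ^+ p.+2 * l * (4 * B ^+ 2) +
   Cu * w ^+ p.+2 * (B * c2) + Cu * w ^+ p.+2 * (B * c2) <= _).
  rewrite !lerD2r; apply: lerD; apply: ler_wpM2l => //.
    exact: (addr_ge0 (mulr_ge0 (mulr_ge0 Cu0 b1) w3)
      (mulr_ge0 (mulr_ge0 (mulr_ge0 Cu0 b5) w2) li)).
  exact: (mulr_ge0 (mulr_ge0 (mulr_ge0 Cu0 b5) w2) (ltW l0)).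
set w2' := w ^+ p.+2 in w2 *; set w3' := w ^+ p.+3 in w3 *.
move: w2' w3' w2 w3 {main e2 e3 ub} => w2' w3' w2 w3; set tau := w2' * (1 + l + rho / l) + w3' * rho.
have rho0 : 0 <= rho by lra.
have l0' : 0 <= l := ltW l0.
have p1 : 0 <= w3' * rho := mulr_ge0 w3 rho0.
have p2 : 0 <= w2' * rho * l^-1 := mulr_ge0 (mulr_ge0 w2 rho0) li.
have p3 : 0 <= w2' * l := mulr_ge0 w2 l0'.
have tauE : tau = w3' * rho + w2' * rho * l^-1 + w2' * l + w2' by rewrite /tau; ring.
have B3 : 0 <= B ^+ 3 * c2 by rewrite mulr_ge0 ?exprn_ge0// ltW.
have q1 : (1 + B * c2) * (2 * Cs) * (w3' * rho) <= (1 + B * c2) * (2 * Cs) * tau.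
  apply: ler_wpM2l; first exact: (mulr_ge0 b1 (mulr_ge0 (ler0n _ 2) (ltW Cs0))).
  by rewrite tauE -!addrA lerDl !addr_ge0.
have q2 : 10 * (B * c2) * Cs * (w2' * rho * l^-1) <= 10 * (B * c2) * Cs * tau.
  by apply: ler_wpM2l; [rewrite !mulr_ge0//; lra|lra].
have q3 : 20 * (B ^+ 3 * c2) * (w2' * l) <= 20 * (B ^+ 3 * c2) * tau.
  by apply: ler_wpM2l; [rewrite mulr_ge0|lra].
have q4 : 2 * (B * c2) * w2' <= 2 * (B * c2) * tau.
  by apply: ler_wpM2l; [rewrite mulr_ge0|lra].
have q5 : 20 * (B ^+ 3 * c2) * (w2' * l) <= 20 * (B ^+ 3 * c2) * (w2' * l) * Y.
  by rewrite ler_peMr// mulr_ge0// mulr_ge0.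
have q6 : 2 * (B * c2) * w2' <= 2 * (B * c2) * w2' * Y.
  by rewrite ler_peMr// mulr_ge0// mulr_ge0.
apply: le_trans (_ : Cu * ((1 + B * c2) * (2 * Cs) * (w3' * rho) * Y +
   10 * (B * c2) * Cs * (w2' * rho * l^-1) * Y + 20 * (B ^+ 3 * c2) * (w2' * l)
   + 2 * (B * c2) * w2') <= _); first by apply: eqle; ring.
apply: le_trans (_ : Cu * ((1 + B * c2) * (2 * Cs) * (w3' * rho) +
   10 * (B * c2) * Cs * (w2' * rho * l^-1) + 20 * (B ^+ 3 * c2) * (w2' * l)
   + 2 * (B * c2) * w2') * Y <= _).
  by rewrite -[leRHS]mulrA; apply: ler_wpM2l => //; rewrite [leRHS]mulrDl [X in _ <= X + _]mulrDl [X in _ <= X + _ + _]mulrDl; lra.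
have Y0 : 0 <= Y by lra.
apply: le_trans (_ : Cu * (((1 + B * c2) * (2 * Cs) * tau +
   10 * (B * c2) * Cs * tau + 20 * (B ^+ 3 * c2) * tau + 2 * (B * c2) * tau)) * Y <= _).
  by apply: ler_wpM2r => //; apply: ler_wpM2l => //; lra.
by apply: eqle; ring.
Qed.

End OneFunction.

Lemma walk_srv : exists2 C : R, 0 < C &
  forall n x y, s n x y <= C * (1 + `|y|) / Num.sqrt n.+1%:R.
Proof. exact: (srv_bound SQ Hr sg0 Hq B0 (walk_fB W) (walk_rB W) (walk_qB W)). Qed.

Lemma walk_exit k x y : 0 < y ->
  1 - s k x y <= (9 * B ^+ 2 + 2 * B + sg ^+ 2 * k%:R) / y ^+ 2.
Proof. exact: (exit_bound SQ Hr Hq B0 (walk_rB W) (walk_qB W)). Qed.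

(** Survival probabilities over k steps sum to O(sqrt k). For t and k of the same order n, the value
    at a fixed point is of order n^(-(p+1)/2); the error is that order times 1/l, plus terms smaller
    by sqrt n. A large fixed l thus makes the relative error as small as desired. *)
Lemma propagation : exists2 C : R, 0 < C & forall p Cu u u1 u2,
  testfn p Cu u u1 u2 -> forall t k l x y, 1 <= t -> 0 < l ->
  `|iter k K (fun x y => u t (nv x y)) x y - u (t + k%:R) (nv x y)| <=
  Cu * C * (1 + `|y|) *
  ((Num.sqrt t)^-1 ^+ p.+2 * (1 + l + Num.sqrt k.+1%:R / l) +
   (Num.sqrt t)^-1 ^+ p.+3 * Num.sqrt k.+1%:R).
Proof.
have [Cs Cs0 HCs] := walk_srv; have Bp := B0.
have c20 : 0 < (2 * sg ^+ 2)^-1 by rewrite invr_gt0 mulr_gt0// exprn_gt0.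
set c2 := (2 * sg ^+ 2)^-1 in c20.
exists (2 * B * c2 + (1 + B * c2) * (2 * Cs) + 10 * B * c2 * Cs + 20 * B ^+ 3 * c2).
  by rewrite !addr_gt0// !mulr_gt0// ?addr_gt0 ?mulr_gt0 ?exprn_gt0.
move=> p Cu u u1 u2 U t k l x y t1 l0; exact: (propagation_aux U).
Qed.

Lemma testfn_he i : ~~ odd i -> exists Cu, testfn i Cu (he i) (he i.+1) (he i.+2).
Proof.
move=> oi; have [C1 C10 H1] := he_step i stepH_gt0.
have [C2 C20 H2] := he_lip i.+2 stepH_gt0; have [C3 C30 H3] := he_bound R i.+2.
exists (C1 + C2 + C3); split.
- by lra.
- by move=> t; rewrite he_even0.
- by move=> t; rewrite he_even0//= negbK.
- move=> t v h t2 hH; apply: le_trans (H1 t v h t2 hH) _.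
  by rewrite ler_wpM2r ?exprn_ge0 ?invr_ge0 ?sqrtr_ge0//; lra.
- move=> t v h t2 hH; apply: le_trans (H2 t v h t2 hH) _.
  by rewrite ler_wpM2r ?exprn_ge0 ?invr_ge0 ?sqrtr_ge0//; lra.
- move=> t v t0; apply: le_trans (H3 t v t0) _.
  by rewrite ler_wpM2r ?exprn_ge0 ?invr_ge0 ?sqrtr_ge0//; lra.
Qed.

(* Dirichlet heat kernel, twice normalised. *)
Definition hd i (w t v : R) : R := he i t (v - w) - he i t (v + w).

(** The images are translates of [he], so the constants do not see the pole w, which can then move
    at scale sqrt n. *)
Lemma testfn_hd : exists Cu, forall w, testfn 1 Cu (hd 1 w) (hd 2 w) (hd 3 w).
Proof.
have [C1 C10 H1] := he_step 1 stepH_gt0.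
have [C2 C20 H2] := he_lip 3 stepH_gt0; have [C3 C30 H3] := he_bound R 3.
have hd0 i w t : odd i -> hd i w t 0 = 0.
  move=> oi; rewrite /hd sub0r add0r he_parity -signr_odd /= oi /=.
  by rewrite expr0 mul1r subrr.
exists (2 * (C1 + C2 + C3)) => w; split.
- by lra.
- by move=> t; rewrite hd0.
- by move=> t; rewrite hd0.
- move=> t v h t2 hH; rewrite /hd.
  have a1 := H1 t (v - w) h t2 hH; have a2 := H1 t (v + w) h t2 hH.
  have -> : v + h - w = v - w + h by ring.
  have -> : v + h + w = v + w + h by ring.
  set W1 := _ ^+ 4 in a1 a2 *.
  have W0 : 0 <= W1 by rewrite exprn_ge0 ?invr_ge0 ?sqrtr_ge0.
  rewrite [X in `|X|](_ : _ = (he 1 (t - 1) (v - w + h) - he 1 t (v - w) -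
     h * he 2 t (v - w) - (h ^+ 2 - 1) / 2 * he 3 t (v - w)) -
    (he 1 (t - 1) (v + w + h) - he 1 t (v + w) -
     h * he 2 t (v + w) - (h ^+ 2 - 1) / 2 * he 3 t (v + w))); last by ring.
  apply: le_trans (ler_normB _ _) _; apply: le_trans (lerD a1 a2) _; nra.
- move=> t v h t2 hH; rewrite /hd.
  have a1 := H2 t (v - w) h t2 hH; have a2 := H2 t (v + w) h t2 hH.
  have -> : v + h - w = v - w + h by ring.
  have -> : v + h + w = v + w + h by ring.
  set W1 := _ ^+ 4 in a1 a2 *.
  have W0 : 0 <= W1 by rewrite exprn_ge0 ?invr_ge0 ?sqrtr_ge0.
  rewrite [X in `|X|](_ : _ = (he 3 (t - 1) (v - w + h) - he 3 t (v - w)) -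
    (he 3 (t - 1) (v + w + h) - he 3 t (v + w))); last by ring.
  apply: le_trans (ler_normB _ _) _; apply: le_trans (lerD a1 a2) _; nra.
- move=> t v t0; rewrite /hd.
  have a1 := H3 t (v - w) t0; have a2 := H3 t (v + w) t0.
  set W1 := _ ^+ 3 in a1 a2 *.
  have W0 : 0 <= W1 by rewrite exprn_ge0 ?invr_ge0 ?sqrtr_ge0.
  apply: le_trans (ler_normB _ _) _; apply: le_trans (lerD a1 a2) _; nra.
Qed.

End Propagation.

(** * Asymptotics of the survival probability *)

Lemma sqr_succ_bounds (R : realType) (a c : R) : 0 <= a -> 0 <= c -> a ^+ 2 = c ^+ 2 + 1 ->
  [/\ 1 <= a, c <= a & a <= c + 1].
Proof. by move=> a0 c0 ac; split; rewrite leNgt; apply/negP => h; nra. Qed.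

Section KillLat.
Variables (R : realType) (X : finType).

Lemma lat_interval (a l d : R) : 0 < d -> 0 <= l ->
  lat d (fun (_ : X) (y : R) => (a < y <= a + l)%R%:R) (l / d + 1).
Proof.
move=> d0 l0 _ y J.
(* [c] clips z - a to [0, l + d]. A step d taken from a point of the interval raises it by d, so the
   count telescopes. *)
pose c (z : R) := Num.max 0 (Num.min (z - a) (l + d)).
have cb z : 0 <= c z <= l + d.
  by rewrite /c le_max lexx /= ge_max ge_min lexx orbT andbT; lra.
have mono z z' : z <= z' -> c z <= c z'.
  move=> zz; rewrite /c ge_max le_max lexx /= le_max; apply/orP; right.
  rewrite le_min !ge_min lexx orbT andbT; apply/orP; left; lra.
have stepc z : (a < z <= a + l)%R%:R * d <= c (z + d) - c z.
  have [/andP[az za]|_] /= := boolP (a < z <= a + l); last first.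
    by rewrite mul0r subr_ge0 mono//; lra.
  rewrite mul1r /c.
  have -> : Num.min (z - a) (l + d) = z - a by apply/min_idPl; lra.
  have -> : Num.min (z + d - a) (l + d) = z + d - a by apply/min_idPl; lra.
  have -> : Num.max 0 (z - a) = z - a by apply/max_idPr; lra.
  have -> : Num.max 0 (z + d - a) = z + d - a by apply/max_idPr; lra.
  by lra.
have H : \sum_(j < J) `|(a < y + j%:R * d <= a + l)%R%:R| * d <= c (y + J%:R * d) - c y.
  elim: J => [|J IH]; first by rewrite big_ord0 mul0r addr0 subrr.
  rewrite big_ord_recr /=; have := stepc (y + J%:R * d).
  rewrite [`|_%:R|]ger0_norm ?ler0n//.
  have -> : y + J%:R * d + d = y + J.+1%:R * d by rewrite -natr1; ring.
  by move: IH; set S := bigop _ _ _ => ? ?; lra.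
rewrite -(ler_pM2r d0) mulr_suml; apply: le_trans H _.
have /andP[h1 h2] := cb (y + J%:R * d); have /andP[h3 h4] := cb y.
by rewrite mulrDl divfK ?gt_eqF// mul1r; lra.
Qed.

Lemma lat_sup d (F : X -> R -> R) M x y : lat d F M -> `|F x y| <= M.
Proof. by move=> /(_ x y 1%N); rewrite big_ord1 mul0r addr0. Qed.

Variables (Q : X -> X -> R) (nu f r q : X -> R) (sg B : R) (V : X -> R -> R).
Hypothesis CH : chain Q nu f.
Hypothesis W : walk Q f r q sg B V.
Variables (d Csm : R).
Hypothesis SM : smoothing Q f d Csm.
Let SQ := walk_stoch W.
Local Notation K := (kill Q f).
Local Notation s := (srv Q f).

(** Half of the time smooths, giving M / sqrt n by [smoothing_sup]; the other half only survives,
    giving (1 + |y|) / sqrt n. *)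
Lemma kill_lat_bound : exists2 C : R, 0 < C & forall F M, (forall x y, 0 <= F x y) ->
  lat d F M -> forall n x y, iter n K F x y <= C * M * (1 + `|y|) / n.+1%:R.
Proof.
have [Cs Cs0 HCs] := walk_srv W.
have C00 : 0 < Csm by case: SM.
exists (4 * (1 + 2 * Csm) * Cs + 2).
  by rewrite addr_gt0// !mulr_gt0//; lra.
move=> F M F0 FM n x y; have M0 := lat_ge0 x FM.
have Y1 : 1 <= 1 + `|y| by rewrite lerDl.
set Y := 1 + `|y| in Y1 *.
have P0 : 0 <= 4 * (1 + 2 * Csm) * Cs by rewrite ltW// !mulr_gt0//; lra.
have N0 : 0 < n.+1%:R :> R by [].
have [n1|n1] := leqP n 1.
  rewrite ler_pdivlMr//.
  have h1 : iter n K F x y <= M.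
    apply: le_trans (iter_kill_le_step f SQ n F0 x y) _.
    apply: (iter_step_ub f SQ) => x1 y1; apply: le_trans (ler_norm _) _.
    exact: lat_sup FM.
  have h2 : n.+1%:R <= 2 :> R by rewrite (ler_nat _ _ 2); lia.
  have h0 : 0 <= iter n K F x y by exact: iter_kill_ge0.
  have h3 : iter n K F x y * n.+1%:R <= M * 2 by apply: ler_pM.
  apply: le_trans h3 _; have MY : M <= M * Y by rewrite ler_peMr.
  have : 0 <= 4 * (1 + 2 * Csm) * Cs * (M * Y) by rewrite mulr_ge0// mulr_ge0//; lra.
  by move=> ?; nra.
pose m := n./2; pose n1' := (n - m)%N.
have nE : n = (n1' + m)%N by rewrite /n1' /m; lia.
have m0 : (0 < m)%N by rewrite /m; lia.
have Hm x1 y1 : iter m K F x1 y1 <= (1 + 2 * Csm) * M / Num.sqrt m.+1%:R.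
  apply: le_trans (iter_kill_le_step f SQ m F0 x1 y1) _.
  by apply: le_trans (ler_norm _) _; exact: (smoothing_sup CH SM).
have := @iter_kill_split _ _ Q f SQ F _ n1' m F0 Hm m0 x y; rewrite -nE.
move=> H; apply: le_trans H _.
have D1 : Num.sqrt n.+1%:R <= 2 * Num.sqrt m.+1%:R :> R by apply: sqrtSn_double; rewrite /m; lia.
have D2 : Num.sqrt n.+1%:R <= 2 * Num.sqrt n1'.+1%:R :> R.
  by apply: sqrtSn_double; rewrite /n1' /m; lia.
have r0 := sqrtSn_gt0 R n; have r1 := sqrtSn_gt0 R m; have r2 := sqrtSn_gt0 R n1'.
apply: le_trans (ler_wpM2l _ (HCs n1' x y)) _.
  by rewrite divr_ge0 ?mulr_ge0 ?(ltW r1)//; lra.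
rewrite -/Y -(@sqr_sqrtSn R n).
have i1 : (Num.sqrt m.+1%:R)^-1 <= 2 / Num.sqrt n.+1%:R :> R.
  by rewrite ler_pdivlMr// mulrC ler_pdivrMr.
have i2 : (Num.sqrt n1'.+1%:R)^-1 <= 2 / Num.sqrt n.+1%:R :> R.
  by rewrite ler_pdivlMr// mulrC ler_pdivrMr.
have i3 : (Num.sqrt m.+1%:R)^-1 * (Num.sqrt n1'.+1%:R)^-1 <=
   2 / Num.sqrt n.+1%:R * (2 / Num.sqrt n.+1%:R) :> R.
  by apply: ler_pM => //; rewrite invr_ge0 ltW.
have c0 : 0 <= (1 + 2 * Csm) * Cs * M * Y by rewrite !mulr_ge0//; try lra; exact: ltW.
apply: le_trans (_ : (1 + 2 * Csm) * Cs * M * Y *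
  ((Num.sqrt m.+1%:R)^-1 * (Num.sqrt n1'.+1%:R)^-1) <= _); first by apply: eqle; ring.
apply: le_trans (ler_wpM2l c0 i3) _.
apply: le_trans (_ : 4 * (1 + 2 * Csm) * Cs * M * Y / Num.sqrt n.+1%:R ^+ 2 <= _).
  by apply: eqle; field; rewrite gt_eqF.
rewrite ler_pM2r ?invr_gt0 ?exprn_gt0// ler_wpM2r//; first by lra.
by rewrite ler_wpM2r//; lra.
Qed.

Lemma erf_lin : exists2 M : R, 0 < M & forall z : R, `|erf z - gs 0 * z| <= M * `|z| ^+ 3.
Proof.
have [M M0 HM] := hm_bound R 3; exists M => // z.
have := taylor3 (is_derive_hm 0) (is_derive_hm 1) (is_derive_hm 2) HM 0 z.
have -> : hm 2 0 = 0 :> R by rewrite hmSS; ring.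
by rewrite add0r /= erf0 mulr0 !subr0 [z * _]mulrC.
Qed.

Lemma erf_ge0 (z : R) : 0 <= z -> 0 <= erf z.
Proof. by move=> z0; rewrite -(erf0 R) erf_incr. Qed.

Lemma nv_ge0 x y : 0 <= nv sg V x y.
Proof. by rewrite divr_ge0 ?(walk_V0 W)// ltW// (walk_sg W). Qed.

(** Replacing the indicator of survival by the heat solution at time t errs by at most de above
    height A sg sqrt t + 3 B; below it, [kill_lat_bound] measures the killed mass of an interval.
    For t near ka^2 n that mass is of order ka / sqrt n. *)
Lemma srv_minus_erf : exists2 C : R, 0 < C & forall (de A t : R), 0 < de -> 0 < A -> 0 < t ->
  (forall z, A <= z -> `|erf z - 1| <= de) -> forall n x y,
  0 <= s n x y - iter n K (fun x y => he 0 t (nv sg V x y)) x y <=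
    C * ((A * sg * Num.sqrt t + 3 * B) / d + 1) * (1 + `|y|) / n.+1%:R + de * s n x y.
Proof.
have [Ck Ck0 HCk] := kill_lat_bound; exists Ck => // de A t de0 A0 t0 HA n x y.
have sg0 := walk_sg W; have B0 := walk_B W.
have d0 : 0 < d by case: SM.
have st0 : 0 < Num.sqrt t by rewrite sqrtr_gt0.
pose l := A * sg * Num.sqrt t + 3 * B.
have l0 : 0 <= l by rewrite addr_ge0 ?mulr_ge0 ?ltW.
pose F1 (x : X) (y : R) : R := (0 < y <= 0 + l)%R%:R.
have F10 x1 y1 : 0 <= F1 x1 y1 by rewrite /F1 ler0n.
have L1 := @lat_interval 0 l d d0 l0.
pose G x y := 1 * alive x y + (-1) * he 0 t (nv sg V x y).
have -> : s n x y - iter n K (fun x y => he 0 t (nv sg V x y)) x y = iter n K G x y.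
  by rewrite /G iter_kill_lin mul1r mulN1r.
have heE x1 y1 : he 0 t (nv sg V x1 y1) = erf (nv sg V x1 y1 / Num.sqrt t).
  by rewrite /he expr0 mul1r.
have vt x1 y1 : 0 <= nv sg V x1 y1 / Num.sqrt t by rewrite divr_ge0 ?nv_ge0 ?ltW.
have G0 x1 y1 : 0 <= G x1 y1.
  rewrite /G mul1r mulN1r subr_ge0 heE /alive; have [y0|y0] := ltP 0 y1.
    exact: erf_le1.
  by rewrite /nv (walk_Vneg W)// !mul0r erf0.
have GF x1 y1 : G x1 y1 <= 1 * F1 x1 y1 + de * alive x1 y1.
  rewrite /G !mul1r mulN1r heE /F1 /alive add0r.
  have [y0|y0] := ltP 0 y1; last first.
    by rewrite /nv (walk_Vneg W)// !mul0r erf0 /= !add0r oppr0 mulr0.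
  rewrite /= mulr1; have := erf_ge0 (vt x1 y1) => ep.
  have [yl|yl] := leP y1 l; first by rewrite /=; lra.
  rewrite /= add0r.
  have := walk_dist W x1 y1; rewrite /alive y0 mul1r mulr1 ler_norml => /andP[h1 _].
  have := walk_rB W x1; rewrite ler_norml => /andP[h2 _].
  have VA : A <= nv sg V x1 y1 / Num.sqrt t.
    by rewrite ler_pdivlMr// /nv ler_pdivlMr// mulrAC; move: yl; rewrite /l => ?; lra.
  by have := HA _ VA; rewrite ler_norml => /andP[? ?]; lra.
apply/andP; split; first exact: iter_kill_ge0.
apply: le_trans (iter_kill_le f SQ n GF x y) _.
rewrite iter_kill_lin mul1r lerD2r; exact: HCk.
Qed.

Let asymp_budget (z1 z2 z3 k2 k3 E : R) : 0 < E -> z1 + z2 + z3 <= E -> k2 <= E -> k3 <= E ->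
  k2 + z2 + E + (z1 + E) + (z3 + k3) <= 8 * E.
Proof. by move=> *; lra. Qed.

(** [srv_minus_erf] charges O(ka) for starting the heat solution at a positive time, [propagation] a
    constant over l once ka is fixed, and everything else vanishes with n. The parameters are fixed
    in the order de, A, ka, l, n. *)
Lemma srv_asymp x y :
  (fun n => Num.sqrt n.+1%:R * s n x y) @ \oo --> gs 0 * nv sg V x y.
Proof.
apply: cvgn_eps => e e0.
have [y0|y0] := leP y 0.
  by exists 0%N => n _; rewrite srvN// /nv (walk_Vneg W)// mul0r !mulr0 subrr normr0 ltW.
have sg0 := walk_sg W; have B0 := walk_B W.
have d0 : 0 < d by case: SM.
have [Cs Cs0 HCs] := walk_srv W.
have [Ck Ck0 HCk] := srv_minus_erf.
have [Cu HU] := @testfn_he _ _ _ _ _ _ _ _ _ W 0 isT.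
have Cu0 := tf_C HU.
have [C C0 HC] := propagation W.
have [M M0 HM] := erf_lin.
have Y1 : 1 <= 1 + `|y| by rewrite lerDl.
set Y := 1 + `|y| in Y1.
have Y0 : 0 < Y by lra.
pose v := nv sg V x y; have v0 : 0 <= v := nv_ge0 x y.
pose e8 := e / 8; have e80 : 0 < e8 by rewrite /e8; lra.
have de0 : 0 < e8 / (Cs * Y) by rewrite divr_gt0// mulr_gt0.
have [A A0 HA] := erf_cvg de0.
set de := e8 / (Cs * Y) in de0 HA.
pose k1 := Ck * Y * (A * sg / d).
have k10 : 0 < k1 by rewrite mulr_gt0 ?divr_gt0 ?mulr_gt0.
have g0 := gs_gt0 (0 : R).
have gv0 : 0 <= gs 0 * v by rewrite mulr_ge0// ltW.
pose D := 1 + k1 + gs 0 * v + e8.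
have D0 : 0 < D by rewrite /D; lra.
pose ka := e8 / D.
have ka0 : 0 < ka by rewrite divr_gt0.
have kaD : ka * D = e8 by rewrite /ka divfK// gt_eqF.
have ka1 : ka * k1 <= e8 by rewrite -kaD ler_pM2l// /D; lra.
have ka2 : ka * (gs 0 * v) <= e8 by rewrite -kaD ler_pM2l// /D; lra.
pose U1 := Cu * C * Y.
have U10 : 0 <= U1 by rewrite !mulr_ge0 ?(ltW C0) ?(ltW Y0).
have U1p : 0 < U1 + 1 by rewrite ltr_wpDl.
pose l := (U1 + 1) / (ka ^+ 2 * e8).
have l0 : 0 < l := divr_gt0 U1p (mulr_gt0 (exprn_gt0 _ ka0) e80).
have lE : U1 / (ka ^+ 2 * l) <= e8.
  have -> : ka ^+ 2 * l = (U1 + 1) / e8 by rewrite /l; field; rewrite !gt_eqF.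
  by rewrite invf_div mulrA ler_pdivrMr// mulrC ler_pM2l// lerDl.
pose Z := U1 * ((1 + l) / ka ^+ 2 + (ka ^+ 3)^-1) +
  Ck * Y * ((A * sg + 3 * B) / d + 1) + M * v ^+ 3.
have zz1 : 0 <= (1 + l) / ka ^+ 2 + (ka ^+ 3)^-1.
  have ki : 0 <= (ka ^+ 3)^-1 by rewrite invr_ge0 exprn_ge0// ltW.
  exact: (addr_ge0 (divr_ge0 (addr_ge0 ler01 (ltW l0)) (sqr_ge0 _)) ki).
have zz2 : 0 <= (A * sg + 3 * B) / d + 1.
  by rewrite addr_ge0// divr_ge0 ?(ltW d0)// addr_ge0// mulr_ge0// ltW.
have Z0 : 0 <= Z := addr_ge0 (addr_ge0 (mulr_ge0 U10 zz1)
  (mulr_ge0 (mulr_ge0 (ltW Ck0) (ltW Y0)) zz2)) (mulr_ge0 (ltW M0) (exprn_ge0 3 v0)).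
have Z1 : 0 < Z + 1 by rewrite ltr_wpDl.
have [N HN] := inv_sqrt_small (divr_gt0 e80 Z1).
exists N => n Nn.
pose rho : R := Num.sqrt n.+1%:R.
have rho0 : 0 < rho := sqrtSn_gt0 R n.
have rho1 : 1 <= rho := sqrtSn_ge1 R n.
have rho2 : rho ^+ 2 = n.+1%:R := sqr_sqrtSn R n.
have Zr : Z / rho <= e8.
  have := HN n Nn; rewrite -/rho ler_pdivlMr// mulrC => h.
  by apply: le_trans h; rewrite ler_pM2r ?invr_gt0// lerDl.
(* The added 1 keeps t in the range of [propagation] and makes t + n equal to (1 + ka^2) rho^2. *)
pose t := ka ^+ 2 * rho ^+ 2 + 1.
have kr0 : 0 < ka * rho by rewrite mulr_gt0.
have krE : (ka * rho) ^+ 2 = ka ^+ 2 * rho ^+ 2 by rewrite exprMn.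
have t1 : 1 <= t by rewrite /t -krE lerDr sqr_ge0.
have t0 : 0 < t := lt_le_trans ltr01 t1.
have st : Num.sqrt t ^+ 2 = t by rewrite sqr_sqrtr// ltW.
have st0 : 0 < Num.sqrt t by rewrite sqrtr_gt0.
have st' : Num.sqrt t ^+ 2 = (ka * rho) ^+ 2 + 1 by rewrite st /t krE.
have [_ st2 st1] := sqr_succ_bounds (ltW st0) (ltW kr0) st'.
have wle : (Num.sqrt t)^-1 <= (ka * rho)^-1 by rewrite lef_pV2 ?posrE.
have w0 : 0 <= (Num.sqrt t)^-1 by rewrite invr_ge0 ltW.
have wX m : (Num.sqrt t)^-1 ^+ m <= (ka * rho)^-1 ^+ m.
  by apply: lerXn2r; rewrite ?nnegrE// invr_ge0 ltW.
have P1 := HC _ _ _ _ _ HU t n l x y t1 l0; rewrite -/Y -/rho -/v -/U1 in P1.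
set A1 := iter n K _ x y in P1.
have Q1 : rho * `|A1 - he 0 (t + n%:R) v| <= U1 * ((1 + l) / ka ^+ 2 + (ka ^+ 3)^-1) / rho + e8.
  apply: le_trans (ler_wpM2l (ltW rho0) P1) _.
  apply: le_trans (_ : rho * (U1 * ((ka * rho)^-1 ^+ 2 * (1 + l + rho / l) +
     (ka * rho)^-1 ^+ 3 * rho)) <= _).
    apply: ler_wpM2l; first exact: ltW.
    apply: ler_wpM2l => //; apply: lerD.
      apply: ler_wpM2r => //.
      exact: (addr_ge0 (addr_ge0 ler01 (ltW l0)) (divr_ge0 (ltW rho0) (ltW l0))).
    by apply: ler_wpM2r => //; exact: ltW.
  have -> : rho * (U1 * ((ka * rho)^-1 ^+ 2 * (1 + l + rho / l) +
     (ka * rho)^-1 ^+ 3 * rho)) = U1 * ((1 + l) / ka ^+ 2 + (ka ^+ 3)^-1) / rho +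
       U1 / (ka ^+ 2 * l).
    by field; rewrite !gt_eqF.
  by rewrite lerD2l.
have /andP[Q2a Q2b] := HCk de A t de0 A0 t0 HA n x y; rewrite -/A1 -/Y in Q2a Q2b.
have Q2 : rho * (s n x y - A1) <= ka * k1 + Ck * Y * ((A * sg + 3 * B) / d + 1) / rho + e8.
  apply: le_trans (ler_wpM2l (ltW rho0) Q2b) _; rewrite mulrDr; apply: lerD; last first.
    have := HCs n x y; rewrite -/rho -/Y ler_pdivlMr// => h.
    apply: le_trans (_ : de * (Cs * Y) <= _); last first.
      by rewrite /de divfK// gt_eqF// mulr_gt0.
    by rewrite mulrCA; apply: ler_wpM2l; [exact: ltW|rewrite mulrC].
  apply: le_trans (_ : rho * (Ck * ((A * sg * (ka * rho + 1) + 3 * B) / d + 1) * Y / n.+1%:R) <= _).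
    apply: ler_wpM2l; first exact: ltW.
    rewrite ler_pM2r ?invr_gt0// ler_pM2r// ler_pM2l// lerD2r ler_pM2r ?invr_gt0// lerD2r.
    by rewrite ler_pM2l// mulr_gt0.
  apply: eqle; rewrite -rho2 /k1; field; rewrite !gt_eqF//.
have tn : t + n%:R = (1 + ka ^+ 2) * rho ^+ 2 by rewrite /t rho2 -[n.+1%:R]natr1; ring.
pose c := Num.sqrt (1 + ka ^+ 2).
have cc : c ^+ 2 = 1 + ka ^+ 2 by rewrite sqr_sqrtr// addr_ge0// sqr_ge0.
have c0 : 0 <= c by exact: sqrtr_ge0.
have [c1 _] : [/\ 1 <= c, ka <= c & c <= ka + 1].
  by apply: sqr_succ_bounds => //; [exact: ltW|rewrite cc addrC].
rewrite [ka + 1]addrC => cka.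
have cp : 0 < c := lt_le_trans ltr01 c1.
have heE : he 0 (t + n%:R) v = erf (v / (c * rho)).
  rewrite /he expr0 mul1r tn sqrtrM ?addr_ge0 ?sqr_ge0// sqrtr_sqr.
  by rewrite (gtr0_norm rho0) -/c /=.
have Q3 : `|rho * erf (v / (c * rho)) - gs 0 * v| <= M * v ^+ 3 / rho + ka * (gs 0 * v).
  have cr0 : 0 < c * rho by rewrite mulr_gt0.
  have z0 : 0 <= v / (c * rho) by rewrite divr_ge0// ltW.
  have -> : rho * erf (v / (c * rho)) - gs 0 * v =
    rho * (erf (v / (c * rho)) - gs 0 * (v / (c * rho))) - gs 0 * v * (1 - c^-1).
    by field; rewrite !gt_eqF.
  apply: le_trans (ler_normB _ _) _; apply: lerD.
    rewrite normrM (gtr0_norm rho0).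
    apply: le_trans (ler_wpM2l (ltW rho0) (HM _)) _; rewrite (ger0_norm z0).
    have -> : rho * (M * (v / (c * rho)) ^+ 3) = M * v ^+ 3 / rho * (c ^+ 3 * rho)^-1.
      by field; rewrite !gt_eqF.
    rewrite ler_piMr//; first by rewrite divr_ge0 ?(ltW rho0)// mulr_ge0 ?exprn_ge0// ltW.
    rewrite invf_le1 ?mulr_gt0 ?exprn_gt0//.
    by rewrite -[leLHS]mulr1; apply: ler_pM => //; exact: exprn_ege1.
  have ci : 0 <= 1 - c^-1 by rewrite subr_ge0 invf_le1.
  rewrite ger0_norm; last exact: mulr_ge0.
  rewrite mulrC ler_wpM2r//.
  have -> : 1 - c^-1 = (c - 1) / c by field; rewrite gt_eqF.
  rewrite ler_pdivrMr// -[leLHS]mulr1; apply: ler_pM => //; first by rewrite subr_ge0.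
  by rewrite lerBlDl.
rewrite -/rho -/v.
have -> : rho * s n x y - gs 0 * v = rho * (s n x y - A1) + rho * (A1 - he 0 (t + n%:R) v) +
  (rho * erf (v / (c * rho)) - gs 0 * v) by rewrite heE; ring.
apply: le_trans (ler_normD _ _) _; apply: le_trans (lerD (ler_normD _ _) (lexx _)) _.
rewrite !normrM (gtr0_norm rho0) (ger0_norm Q2a).
have eE : e = 8 * e8 by rewrite /e8; field.
apply: le_trans (lerD (lerD Q2 Q1) Q3) _; rewrite eE.
have ZE : Z / rho = U1 * ((1 + l) / ka ^+ 2 + (ka ^+ 3)^-1) / rho +
  Ck * Y * ((A * sg + 3 * B) / d + 1) / rho + M * v ^+ 3 / rho by rewrite /Z; ring.
rewrite ZE in Zr.
exact: asymp_budget.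
Qed.

End KillLat.

(** * Time reversal *)

Section Pairing.
Variables (R : realType) (X : finType).
Variables (Q : X -> X -> R) (nu f : X -> R).
Hypothesis CH : chain Q nu f.

Let SQ := chain_stoch CH.
Let Q0 x x' : 0 <= Q x x'. Proof. by case: SQ. Qed.
Let nup x : 0 < nu x. Proof. exact: (nu_gt0 CH). Qed.
Local Notation K := (kill Q f).
Local Notation Ks := (kill (Pstar Q nu) (fun x => - f x)).

Definition cell (d : R) (psi : X -> R) (z : R) : X -> R -> R :=
  fun x u => psi x * (z < u <= z + d)%R%:R.

(* The reversed chain enters its first step from the virtual successor of [x1]. *)
Definition entry (x1 : X) (x : X) : R := Pstar Q nu x x1 / nu x1.

Lemma nu_entry x1 x : nu x * entry x1 x = Q x1 x.
Proof.
rewrite /entry mulrA (nu_Pstar CH) mulrAC divff ?mul1r//.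
by rewrite gt_eqF.
Qed.

Variables (d : R) (ys : seq R) (g : R -> R) (x1 : X).
Hypothesis d0 : 0 < d.
Hypothesis g0 : forall y, 0 <= g y.

Let shift_cell z c u : (z < u + c <= z + d) = (z - c < u <= z - c + d).
Proof. by congr (_ && _); [rewrite ltrBlDr|rewrite -lerBrDr addrAC]. Qed.

(** A killed path read backwards is a dual path. Its end ranges over a cell, and the dual path is
    started at the top z + d of that cell: raising it by at most d keeps every surviving path, and
    its final height is then the top of a cell containing the true start, whose g-mass [gp]
    dominates. The induction peels off the last step, before which the walk again lies in a cell. *)
Lemma pairing_upper (gp : R -> R) :
  (forall z, \sum_(y <- ys) g y * (z < y <= z + d)%R%:R <= gp (z + d)) ->
  forall m psi z, (forall x, 0 <= psi x) ->
  \sum_(y <- ys) g y * iter m.+1 K (cell d psi z) x1 y <=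
  \sum_x nu x * psi x *
    iter m Ks (fun x v => (0 < v)%R%:R * entry x1 x * gp v) x (z + d - f x).
Proof.
move=> Hg; elim=> [|m IH] psi z psi0.
  rewrite /= /kill /step /cell.
  apply: le_trans (_ : \sum_x' Q x1 x' * psi x' * \sum_(y <- ys)
    g y * ((0 < y)%R%:R * (z - f x' < y <= z - f x' + d)%R%:R) <= _).
    apply: eqle; under [RHS]eq_bigr do rewrite mulr_sumr.
    rewrite exchange_big /=; apply: eq_bigr => y _.
    rewrite 2!mulr_sumr; apply: eq_bigr => x' _; rewrite shift_cell; ring.
  apply: ler_sum => x' _; rewrite -(nu_entry x1 x').
  have -> : nu x' * psi x' * ((0 < z + d - f x')%R%:R * entry x1 x' * gp (z + d - f x')) =
    nu x' * entry x1 x' * psi x' * ((0 < z + d - f x')%R%:R * gp (z + d - f x')) by ring.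
  apply: ler_wpM2l; first by rewrite nu_entry mulr_ge0.
  have E : z + d - f x' = z - f x' + d by ring.
  have [v0|v0] := ltP 0 (z + d - f x').
    rewrite mul1r E; apply: le_trans (Hg _); apply: ler_sum => y _.
    apply: ler_wpM2l => //; rewrite ler_piMl ?ler0n// lern1.
    by case: (0 < y).
  rewrite mul0r big1// => y _; have [y0|y0] := ltP 0 y; last by rewrite mul0r mulr0.
  have [/andP[_ h]|_] := boolP (z - f x' < y <= z - f x' + d); last by rewrite !mulr0.
  by exfalso; move: v0; rewrite E => ?; lra.
pose c x' := psi x' * (0 < z + d - f x')%R%:R.
have c0 x' : 0 <= c x' by rewrite mulr_ge0 ?ler0n.
have KF x y : K (cell d psi z) x y <=
    \sum_x' c x' * cell d (fun x => Q x x') (z - f x') x y.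
  rewrite /kill /step /cell mulr_sumr; apply: ler_sum => x' _; rewrite shift_cell /c.
  have E : z + d - f x' = z - f x' + d by ring.
  have [y0|y0] := ltP 0 y; last first.
    by rewrite mul0r !mulr_ge0 ?ler0n.
  have [/andP[_ h]|_] := boolP (z - f x' < y <= z - f x' + d); last by rewrite !mulr0.
  have -> : 0 < z + d - f x' by rewrite E; lra.
  by apply: eqle; ring.
apply: le_trans (_ : \sum_(y <- ys) g y *
   \sum_x' c x' * iter m.+1 K (cell d (fun x => Q x x') (z - f x')) x1 y <= _).
  apply: ler_sum => y _; apply: ler_wpM2l => //.
  by rewrite iterSr -iter_kill_sum; apply: (iter_kill_le f SQ).
apply: le_trans (_ : \sum_x' c x' * \sum_(y <- ys) g y *
   iter m.+1 K (cell d (fun x => Q x x') (z - f x')) x1 y <= _).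
  apply: eqle; under [RHS]eq_bigr do rewrite mulr_sumr.
  rewrite exchange_big /=; apply: eq_bigr => y _; rewrite mulr_sumr.
  by apply: eq_bigr => x' _; ring.
set n0 := fun x v => (0 < v)%R%:R * entry x1 x * gp v.
apply: ler_sum => x' _.
apply: le_trans (ler_wpM2l (c0 x') (IH _ _ (fun x => Q0 x x'))) _.
apply: eqle; rewrite iterS -/n0 /kill /step /c.
have -> : \sum_x nu x * Q x x' * iter m Ks n0 x (z - f x' + d - f x) =
    nu x' * \sum_x Pstar Q nu x' x * iter m Ks n0 x (z + d - f x' - f x).
  rewrite mulr_sumr; apply: eq_bigr => x _.
  have -> : z - f x' + d - f x = z + d - f x' - f x by ring.
  by rewrite mulrA (nu_Pstar CH).
by ring.
Qed.

(** The mirror image: started at the bottom of the cell, the dual path can only lose survivors. *)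
Lemma pairing_lower (gm : R -> R) :
  (forall z, 0 < z -> gm z <= \sum_(y <- ys) g y * (z < y <= z + d)%R%:R) ->
  forall m psi z, (forall x, 0 <= psi x) ->
  \sum_x nu x * psi x *
    iter m Ks (fun x v => (0 < v)%R%:R * entry x1 x * gm v) x (z - f x) <=
  \sum_(y <- ys) g y * iter m.+1 K (cell d psi z) x1 y.
Proof.
move=> Hg; elim=> [|m IH] psi z psi0.
  rewrite /= /kill /step /cell.
  apply: le_trans (_ : \sum_x' Q x1 x' * psi x' * \sum_(y <- ys)
    g y * ((0 < y)%R%:R * (z - f x' < y <= z - f x' + d)%R%:R) <= _); last first.
    apply: eqle; under [LHS]eq_bigr do rewrite mulr_sumr.
    rewrite exchange_big /=; apply: eq_bigr => y _.
    rewrite 2!mulr_sumr; apply: eq_bigr => x' _; rewrite shift_cell; ring.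
  apply: ler_sum => x' _; rewrite -(nu_entry x1 x').
  have -> : nu x' * psi x' * ((0 < z - f x')%R%:R * entry x1 x' * gm (z - f x')) =
    nu x' * entry x1 x' * psi x' * ((0 < z - f x')%R%:R * gm (z - f x')) by ring.
  apply: ler_wpM2l; first by rewrite nu_entry mulr_ge0.
  have [v0|v0] := ltP 0 (z - f x'); last first.
    by rewrite mul0r sumr_ge0// => y _; rewrite !mulr_ge0 ?ler0n.
  rewrite mul1r; apply: le_trans (Hg _ v0) _; apply: ler_sum => y _.
  apply: ler_wpM2l => //.
  have [/andP[h _]|_] := boolP (z - f x' < y <= z - f x' + d); last by rewrite !mulr0.
  by rewrite (lt_trans v0 h) mulr1.
pose c x' := psi x' * (0 < z - f x')%R%:R.
have c0 x' : 0 <= c x' by rewrite mulr_ge0 ?ler0n.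
have KF x y : \sum_x' c x' * cell d (fun x => Q x x') (z - f x') x y <=
    K (cell d psi z) x y.
  rewrite /kill /step /cell mulr_sumr; apply: ler_sum => x' _; rewrite shift_cell /c.
  have [v0|v0] := ltP 0 (z - f x'); last first.
    by rewrite mulr0 mul0r !mulr_ge0 ?ler0n.
  have [/andP[h _]|_] := boolP (z - f x' < y <= z - f x' + d); last by rewrite !mulr0.
  by rewrite (lt_trans v0 h); apply: eqle; ring.
apply: le_trans (_ : \sum_(y <- ys) g y *
   \sum_x' c x' * iter m.+1 K (cell d (fun x => Q x x') (z - f x')) x1 y <= _); last first.
  apply: ler_sum => y _; apply: ler_wpM2l => //.
  by rewrite [in leRHS]iterSr -iter_kill_sum; apply: (iter_kill_le f SQ).
apply: le_trans (_ : \sum_x' c x' * \sum_(y <- ys) g y *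
   iter m.+1 K (cell d (fun x => Q x x') (z - f x')) x1 y <= _); last first.
  apply: eqle; under [LHS]eq_bigr do rewrite mulr_sumr.
  rewrite exchange_big /=; apply: eq_bigr => y _; rewrite mulr_sumr.
  by apply: eq_bigr => x' _; ring.
set n0 := fun x v => (0 < v)%R%:R * entry x1 x * gm v.
apply: ler_sum => x' _.
apply: le_trans (ler_wpM2l (c0 x') (IH _ _ (fun x => Q0 x x'))).
apply: eqle; rewrite iterS -/n0 /kill /step /c.
have -> : \sum_x nu x * Q x x' * iter m Ks n0 x (z - f x' - f x) =
    nu x' * \sum_x Pstar Q nu x' x * iter m Ks n0 x (z - f x' - f x).
  by rewrite mulr_sumr; apply: eq_bigr => x _; rewrite mulrA (nu_Pstar CH).
by ring.
Qed.

End Pairing.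

(** * A priori bounds for one cell *)

Section Cells.
Variables (R : realType) (X : finType).
Variables (Q : X -> X -> R) (nu f r q rs qs : X -> R) (sg B Bs : R) (V Vs : X -> R -> R).
Hypothesis CH : chain Q nu f.
Hypothesis W : walk Q f r q sg B V.
Hypothesis Ws : walk (Pstar Q nu) (fun x => - f x) rs qs sg Bs Vs.
Variables (d Csm : R).
Hypothesis SM : smoothing Q f d Csm.

Let SQ := chain_stoch CH.
Let nup x : 0 < nu x. Proof. exact: (nu_gt0 CH). Qed.
Let d0 : 0 < d. Proof. by case: SM. Qed.
Let Csm0 : 0 < Csm. Proof. by case: SM. Qed.
Local Notation K := (kill Q f).
Local Notation Ks := (kill (Pstar Q nu) (fun x => - f x)).

Lemma cell_ge0 (psi : X -> R) z x y : (forall x, 0 <= psi x) -> 0 <= cell d psi z x y.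
Proof. by move=> p0; rewrite mulr_ge0 ?ler0n. Qed.

Lemma entry_bound : exists2 E : R, 0 < E & forall x1 x, 0 <= entry Q nu x1 x <= E.
Proof.
have [E E0 HE] := fin_ub (fun p : X * X => entry Q nu p.1 p.2).
exists E => // x1 x; apply/andP; split; last first.
  exact: le_trans (ler_norm _) (HE (x1, x)).
have [SQ0 _] := chain_stoch (dual_chain CH).
by rewrite /entry divr_ge0 ?SQ0// ltW.
Qed.

(** [pairing_upper] with constant weight: a progression puts at most 2 points in a cell, so the
    lattice sum reduces to a survival probability of the dual started near z, of order (1 + |z|) /
    sqrt m. *)
Lemma cell_lat : exists2 C : R, 0 < C & forall (psi : X -> R) M z m, (forall x, 0 <= psi x <= M) ->
  lat d (iter m K (cell d psi z)) (C * M * (1 + `|z|) / Num.sqrt m.+1%:R).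
Proof.
have [E E0 HE] := entry_bound; have [Cs Cs0 HCs] := walk_srv Ws.
have B0 := walk_B Ws; have dp := d0.
exists (2 + 4 * E * Cs * (1 + d + Bs)).
  by rewrite addr_gt0// !mulr_gt0// !addr_gt0.
move=> psi M z m Hpsi x1 y J.
have psi0 x : 0 <= psi x by have /andP[] := Hpsi x.
have psiM x : psi x <= M by have /andP[] := Hpsi x.
have M0 : 0 <= M by apply: le_trans (psi0 x1) (psiM x1).
have zp := normr_ge0 z.
have cnt z' : \sum_(j < J) `|(z' < y + j%:R * d <= z' + d)%R%:R| <= 2 :> R.
  have := @lat_interval R X z' d d dp (ltW dp) x1 y J.
  by rewrite divff ?gt_eqF.
have c4 : 0 <= 4 * E * Cs * (1 + d + Bs).
  by rewrite ltW// !mulr_gt0// !addr_gt0.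
case: m => [|m].
  rewrite /= sqrtr1 divr1.
  apply: le_trans (_ : M * 2 <= _).
    apply: le_trans (ler_wpM2l M0 (cnt z)); rewrite mulr_sumr; apply: ler_sum => j _.
    by rewrite /cell normrM [`|psi x1|]ger0_norm// ler_wpM2r.
  have : 0 <= 4 * E * Cs * (1 + d + Bs) * (M * (1 + `|z|)).
    by rewrite mulr_ge0// mulr_ge0//; lra.
  have : 0 <= M * `|z| by rewrite mulr_ge0.
  by move=> ? ?; lra.
pose ys := [seq y + j%:R * d | j <- iota 0 J].
have sumE (F : R -> R) : \sum_(u <- ys) F u = \sum_(j < J) F (y + j%:R * d).
  by rewrite /ys big_map -{1}(subn0 J) -/(index_iota 0 J) big_mkord.
have Hg z' : \sum_(u <- ys) (fun=> 1 : R) u * (z' < u <= z' + d)%R%:R <= (fun=> 2 : R) (z' + d).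
  rewrite sumE; apply: le_trans (cnt z'); apply: ler_sum => j _.
  by rewrite mul1r ler_norm.
have := @pairing_upper _ _ Q nu f CH d ys (fun=> 1) x1 (fun=> ler01) (fun=> 2) Hg m psi z psi0.
rewrite sumE => H.
apply: le_trans (_ : \sum_(j < J) 1 * iter m.+1 K (cell d psi z) x1 (y + j%:R * d) <= _).
  apply: ler_sum => j _; rewrite mul1r ger0_norm//.
  by apply: iter_kill_ge0 => // x' y'; exact: cell_ge0.
apply: le_trans H _.
have B1 x : iter m Ks (fun x v => (0 < v)%R%:R * entry Q nu x1 x * 2) x (z + d - f x) <=
    2 * E * (Cs * ((1 + d + Bs) * (1 + `|z|)) / Num.sqrt m.+1%:R).
  apply: le_trans (ler_norm _) _.
  apply: le_trans (iter_kill_bound (c := 2 * E) _ (walk_stoch Ws) _ _ _ _) _.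
    move=> x' v; have /andP[e1 e2] := HE x1 x'; rewrite /alive.
    case: (0 < v); rewrite ?mul1r ?mul0r ?mulr1 ?mulr0 ?normr0//.
    by rewrite ger0_norm; lra.
  apply: ler_wpM2l; first by rewrite mulr_ge0// ltW.
  apply: le_trans (HCs m x _) _.
  rewrite ler_pM2r ?invr_gt0 ?sqrtSn_gt0// ler_pM2l//.
  have : `|z + d - f x| <= `|z| + d + Bs.
    apply: le_trans (ler_normB _ _) _; apply: lerD.
      by apply: le_trans (ler_normD _ _) _; rewrite [`|d|]gtr0_norm.
    by have := walk_fB Ws x; rewrite normrN.
  by move=> ?; nra.
apply: le_trans (_ : \sum_x nu x * (M * (2 * E * (Cs * ((1 + d + Bs) * (1 + `|z|)) / Num.sqrt m.+1%:R))) <= _).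
  apply: ler_sum => x _; rewrite -mulrA ler_pM2l//; apply: ler_pM => //.
  apply: (iter_kill_ge0 _ (walk_stoch Ws)) => x' v.
  have /andP[e1 _] := HE x1 x'.
  exact: (mulr_ge0 (mulr_ge0 (ler0n _ _) e1) (ler0n _ 2)).
rewrite -mulr_suml; have [_ [-> _]] := chain_inv CH; rewrite mul1r.
have s1 := sqrtSn_gt0 R m; have s2 := sqrtSn_gt0 R m.+1.
have dbl : (Num.sqrt m.+1%:R)^-1 <= 2 / Num.sqrt m.+2%:R :> R.
  rewrite ler_pdivlMr// mulrC ler_pdivrMr//.
  by apply: sqrtSn_double; clear; lia.
have k0 : 0 <= M * (2 * E * (Cs * ((1 + d + Bs) * (1 + `|z|)))).
  rewrite !mulr_ge0//; try exact: ltW; lra.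
apply: le_trans (_ : M * (2 * E * (Cs * ((1 + d + Bs) * (1 + `|z|)))) * (2 / Num.sqrt m.+2%:R) <= _).
  rewrite [leLHS](_ : _ = M * (2 * E * (Cs * ((1 + d + Bs) * (1 + `|z|)))) *
    (Num.sqrt m.+1%:R)^-1); last by ring.
  exact: ler_wpM2l.
rewrite [leLHS]mulrA ler_pM2r ?invr_gt0//.
have : 0 <= 2 * M * (1 + `|z|) by rewrite !mulr_ge0//; lra.
by move=> ?; lra.
Qed.

Let split_facts m : let m2 := m./2 in let n1 := (m - m2)%N in
  [/\ m = (n1 + m2)%N,
      (Num.sqrt m2.+1%:R)^-1 <= 2 / Num.sqrt m.+1%:R :> R,
      (Num.sqrt n1.+1%:R)^-1 <= 2 / Num.sqrt m.+1%:R :> R &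
      n1.+1%:R^-1 <= 4 / Num.sqrt m.+1%:R ^+ 2 :> R].
Proof.
move=> m2 n1; have r0 := sqrtSn_gt0 R m; have r1 := sqrtSn_gt0 R m2.
have r2 := sqrtSn_gt0 R n1.
have i2 : (Num.sqrt n1.+1%:R)^-1 <= 2 / Num.sqrt m.+1%:R :> R.
  rewrite ler_pdivlMr// mulrC ler_pdivrMr//.
  by apply: sqrtSn_double; rewrite /n1 /m2; lia.
split => //; first by rewrite /n1 /m2; lia.
  rewrite ler_pdivlMr// mulrC ler_pdivrMr//.
  by apply: sqrtSn_double; rewrite /m2; lia.
rewrite -(sqr_sqrtSn R n1) -exprVn.
have -> : 4 / Num.sqrt m.+1%:R ^+ 2 = (2 / Num.sqrt m.+1%:R) ^+ 2 :> R.
  by field; rewrite gt_eqF.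
by apply: lerXn2r; rewrite ?nnegrE ?invr_ge0 ?divr_ge0 ?sqrtr_ge0.
Qed.

(** Half of the time smooths the l1 bound of [cell_lat] into a sup bound and gains 1 / sqrt m. *)
Lemma cell_sup : exists2 C : R, 0 < C & forall (psi : X -> R) M z m, (forall x, 0 <= psi x <= M) ->
  forall x y, iter m K (cell d psi z) x y <= C * M * (1 + `|z|) / Num.sqrt m.+1%:R ^+ 2.
Proof.
have [C C0 HC] := cell_lat; have Cp := Csm0.
exists (4 * (1 + 2 * Csm) * C); first by rewrite !mulr_gt0//; lra.
move=> psi M z m Hpsi x y; have [mE i1 i2 _] := split_facts m.
move: mE i1 i2; set m2 := m./2; set n1 := (m - m2)%N => mE i1 i2.
have psi0 x' : 0 <= psi x' by have /andP[] := Hpsi x'.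
have M0 : 0 <= M by have /andP[a b] := Hpsi x; exact: le_trans a b.
have F0 x' y' : 0 <= iter m2 K (cell d psi z) x' y'.
  by apply: iter_kill_ge0 => // *; exact: cell_ge0.
rewrite [in iter m]mE iterD; apply: le_trans (iter_kill_le_step f SQ n1 F0 x y) _.
apply: le_trans (ler_norm _) _.
apply: le_trans (smoothing_sup CH SM n1 x y (HC psi M z m2 Hpsi)) _.
have c0 : 0 <= (1 + 2 * Csm) * (C * M * (1 + `|z|)).
  by rewrite !mulr_ge0//; try lra; exact: ltW.
apply: le_trans (_ : (1 + 2 * Csm) * (C * M * (1 + `|z|)) *
   ((Num.sqrt n1.+1%:R)^-1 * (Num.sqrt m2.+1%:R)^-1) <= _); first by apply: eqle; ring.
apply: le_trans (_ : (1 + 2 * Csm) * (C * M * (1 + `|z|)) *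
   (2 / Num.sqrt m.+1%:R * (2 / Num.sqrt m.+1%:R)) <= _).
  by apply: ler_wpM2l => //; apply: ler_pM => //; rewrite invr_ge0 sqrtr_ge0.
by apply: eqle; field; rewrite gt_eqF// sqrtSn_gt0.
Qed.

(** As [cell_sup], with [kill_lat_bound] over the first half: the gain is now (1 + |y|) / m. The
    order is already the final one; the uniform bound of the theorem rests on this, as does the
    control near the boundary. *)
Lemma cell_low : exists2 C : R, 0 < C & forall (psi : X -> R) M z m, (forall x, 0 <= psi x <= M) ->
  forall x y, iter m K (cell d psi z) x y <=
    C * M * (1 + `|z|) * (1 + `|y|) / Num.sqrt m.+1%:R ^+ 3.
Proof.
have [C C0 HC] := cell_lat; have [Ck Ck0 HCk] := kill_lat_bound CH W SM.
exists (8 * C * Ck); first by rewrite !mulr_gt0.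
move=> psi M z m Hpsi x y; have [mE i1 _ i2] := split_facts m.
move: mE i1 i2; set m2 := m./2; set n1 := (m - m2)%N => mE i1 i2.
have psi0 x' : 0 <= psi x' by have /andP[] := Hpsi x'.
have M0 : 0 <= M by have /andP[a b] := Hpsi x; exact: le_trans a b.
have F0 x' y' : 0 <= iter m2 K (cell d psi z) x' y'.
  by apply: iter_kill_ge0 => // *; exact: cell_ge0.
rewrite [in iter m]mE iterD; apply: le_trans (HCk _ _ F0 (HC psi M z m2 Hpsi) n1 x y) _.
have c0 : 0 <= Ck * (C * M * (1 + `|z|)) * (1 + `|y|).
  by rewrite !mulr_ge0// ?addr_ge0//; exact: ltW.
apply: le_trans (_ : Ck * (C * M * (1 + `|z|)) * (1 + `|y|) *
   (n1.+1%:R^-1 * (Num.sqrt m2.+1%:R)^-1) <= _); first by apply: eqle; ring.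
apply: le_trans (_ : Ck * (C * M * (1 + `|z|)) * (1 + `|y|) *
   (4 / Num.sqrt m.+1%:R ^+ 2 * (2 / Num.sqrt m.+1%:R)) <= _).
  by apply: ler_wpM2l => //; apply: ler_pM => //; rewrite invr_ge0 ?sqrtr_ge0.
by apply: eqle; field; rewrite gt_eqF// sqrtSn_gt0.
Qed.

End Cells.

(** * Shift regularity of the killed mass *)

Lemma half_split m k : (2 * k <= m.+1)%N -> (3 <= m)%N ->
  [/\ m = (k + (m - k))%N, (0 < m - k)%N & (m < 2 * (m - k).+1)%N].
Proof. by move=> ? ?; split; lia. Qed.

Section CellReg.
Variables (R : realType) (X : finType).

Let shift_budget (a b a' b' E L : R) : `|a - b| <= L -> 0 <= b - b' -> b - b' <= E ->
  0 <= a - a' -> a - a' <= E -> `|a' - b'| <= E + L.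
Proof. by rewrite !ler_norml => /andP[? ?] *; apply/andP; split; lra. Qed.

Variables (Q : X -> X -> R) (nu f r q rs qs : X -> R) (sg B Bs : R) (V Vs : X -> R -> R).
Hypothesis CH : chain Q nu f.
Hypothesis W : walk Q f r q sg B V.
Hypothesis Ws : walk (Pstar Q nu) (fun x => - f x) rs qs sg Bs Vs.
Variables (d Csm : R).
Hypothesis SM : smoothing Q f d Csm.

Let SQ := chain_stoch CH.
Let d0 : 0 < d. Proof. by case: SM. Qed.
Let Csm0 : 0 < Csm. Proof. by case: SM. Qed.
Local Notation T := (step Q f).
Local Notation K := (kill Q f).

Variables (psi : X -> R) (z : R).
Hypothesis psi0 : forall x, 0 <= psi x.
Local Notation H m := (iter m K (cell d psi z)).

Lemma cell_consts : exists2 Cz : R, 0 < Cz & forall m,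
  lat d (H m) (Cz / Num.sqrt m.+1%:R) /\
  forall x y, 0 <= H m x y <= Cz / Num.sqrt m.+1%:R ^+ 2.
Proof.
have [M M0 HM] := fin_ub psi.
have [C1 C10 H1] := cell_lat CH Ws SM; have [C2 C20 H2] := cell_sup CH Ws SM.
have zp := normr_ge0 z.
exists (C1 * M * (1 + `|z|) + C2 * M * (1 + `|z|)).
  by rewrite addr_gt0// !mulr_gt0//; lra.
have c1 : 0 <= C1 * M * (1 + `|z|) by rewrite !mulr_ge0 ?(ltW C10) ?(ltW M0)//; lra.
have c2 : 0 <= C2 * M * (1 + `|z|) by rewrite !mulr_ge0 ?(ltW C20) ?(ltW M0)//; lra.
have Hpsi x : 0 <= psi x <= M.
  by rewrite psi0 /=; apply: le_trans (ler_norm _) (HM x).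
move=> m; split.
  move=> x y J; apply: le_trans (H1 psi M z m Hpsi x y J) _.
  by rewrite ler_pM2r ?invr_gt0 ?sqrtSn_gt0//; lra.
move=> x y; apply/andP; split.
  by apply: iter_kill_ge0 => // *; exact: cell_ge0.
apply: le_trans (H2 psi M z m Hpsi x y) _.
by rewrite ler_pM2r ?invr_gt0 ?exprn_gt0 ?sqrtSn_gt0//; lra.
Qed.

Lemma cell_reg (e1 eta : R) : 0 < e1 -> 0 < eta -> exists C2 N, 0 < C2 /\
  forall m, (N <= m)%N -> forall x w (j : nat), eta * Num.sqrt m.+1%:R <= w ->
  `|H m x (w + j%:R * d) - H m x w| <=
    e1 / Num.sqrt m.+1%:R ^+ 2 + j%:R * (C2 / Num.sqrt m.+1%:R ^+ 3).
Proof.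
move=> e10 eta0; have [Cz Cz0 HCz] := cell_consts.
have B0 := walk_B W; have sg0 := walk_sg W; have dp := d0; have Cp := Csm0.
pose b0 := 9 * B ^+ 2 + 2 * B.
have b00 : 0 < b0 by rewrite /b0 addr_gt0 ?mulr_gt0 ?exprn_gt0.
(* With a1 ka <= 1 the part of the exit bound that grows with k takes at most half of e1. *)
pose a1 := 8 * Cz * sg ^+ 2 / (e1 * eta ^+ 2).
have a10 : 0 < a1 by rewrite divr_gt0 ?mulr_gt0 ?exprn_gt0.
have a1p : 0 < 2 + a1 by rewrite addr_gt0.
pose ka := (2 + a1)^-1.
have ka0 : 0 < ka by rewrite invr_gt0.
have ka2 : ka <= 2^-1 by rewrite lef_pV2 ?posrE// lerDl ltW.
have kaa : a1 * ka <= 1 by rewrite ler_pdivrMr// mul1r lerDr.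
have e20 : 0 < e1 * eta ^+ 2 / (8 * Cz * b0).
  by rewrite divr_gt0 ?mulr_gt0 ?exprn_gt0// /b0.
have [N HN] := inv_sqrt_small e20.
exists (2 * Csm * Cz / ka), (N + 3)%N; split; first by rewrite divr_gt0 ?mulr_gt0.
move=> m Nm x w j; have rho0 := sqrtSn_gt0 R m.
have rho1 := sqrtSn_ge1 R m; have rho2 := sqr_sqrtSn R m.
have HNm := HN m (leq_trans (leq_addr _ _) Nm).
have m3 : (3 <= m)%N by exact: leq_trans (leq_addl _ _) Nm.
set rho := Num.sqrt m.+1%:R in rho0 rho1 rho2 HNm * => wrho.
have kr0 : 0 <= ka * rho ^+ 2 by rewrite mulr_ge0 ?sqr_ge0// ltW.
have [k k1 k2] : exists2 k : nat, k%:R <= ka * rho ^+ 2 & ka * rho ^+ 2 <= k.+1%:R.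
  by exists (Num.truncn (ka * rho ^+ 2)); [rewrite truncn_le|rewrite ltW// truncnS_gt].
have km : (2 * k <= m.+1)%N.
  rewrite -(ler_nat R) natrM -rho2.
  have : ka * rho ^+ 2 <= 2^-1 * rho ^+ 2 by rewrite ler_wpM2r// sqr_ge0.
  by move: k1 => ? ?; lra.
have [] := half_split km m3; move: (m - k)%N => m' mE m'0 mm'.
have i1 : (Num.sqrt m'.+1%:R)^-1 <= 2 / rho.
  rewrite ler_pdivlMr// mulrC ler_pdivrMr ?sqrtSn_gt0//.
  exact: sqrtSn_double.
have i0 : 0 <= (Num.sqrt m'.+1%:R)^-1 :> R by rewrite invr_ge0 sqrtr_ge0.
have [HL HS] := HCz m'.
have F0 x' y' : 0 <= H m' x' y' by have /andP[] := HS x' y'.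
pose c := 4 * Cz / rho ^+ 2.
have c0 : 0 <= c by rewrite divr_ge0 ?sqr_ge0// mulr_ge0// ltW.
have Fc x' y' : H m' x' y' <= c * alive x' y'.
  rewrite /alive; have [y0|y0] := ltP 0 y'; last first.
    by case: (m') m'0 => // n _; rewrite iterS killN// mulr0.
  rewrite mulr1; have /andP[_ h] := HS x' y'; apply: le_trans h _.
  apply: le_trans (_ : Cz * (2 / rho) ^+ 2 <= _).
    rewrite -exprVn ler_pM2l//; apply: lerXn2r => //; rewrite ?nnegrE//.
    by rewrite divr_ge0// ltW.
  by apply: eqle; rewrite /c; field; rewrite gt_eqF.
pose De := c * ((b0 + sg ^+ 2 * (ka * rho ^+ 2)) / (eta * rho) ^+ 2).
have er0 : 0 < eta * rho by rewrite mulr_gt0.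
have del y' : eta * rho <= y' -> 0 <= iter k T (H m') x y' - iter k K (H m') x y' <= De.
  move=> yy; have y'0 : 0 < y' := lt_le_trans er0 yy.
  rewrite subr_ge0 iter_kill_le_step//=.
  apply: le_trans (iter_step_kill_diff f SQ k c0 F0 Fc x y') _.
  apply: ler_wpM2l => //; apply: le_trans (walk_exit W k x y'0) _.
  apply: ler_pM.
  - by rewrite -/b0 addr_ge0 ?(ltW b00)// mulr_ge0 ?sqr_ge0.
  - by rewrite invr_ge0 sqr_ge0.
  - by rewrite -/b0 lerD2l ler_wpM2l// sqr_ge0.
  - rewrite lef_pV2 ?posrE ?exprn_gt0//; apply: lerXn2r => //; rewrite ?nnegrE; exact: ltW.
have Dele : De <= e1 / rho ^+ 2.
  have -> : De = (4 * Cz * b0 / (eta ^+ 2 * rho ^+ 2) + e1 / 2 * (a1 * ka)) / rho ^+ 2.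
    by rewrite /De /c /a1; field; rewrite !gt_eqF.
  rewrite ler_pM2r ?invr_gt0 ?exprn_gt0//.
  have h1 : e1 / 2 * (a1 * ka) <= e1 / 2 by rewrite ler_piMr// ltW// divr_gt0.
  have h2 : 4 * Cz * b0 / (eta ^+ 2 * rho ^+ 2) <= e1 / 2.
    have -> : 4 * Cz * b0 / (eta ^+ 2 * rho ^+ 2) =
      4 * Cz * b0 / eta ^+ 2 * (rho^-1 * rho^-1) by field; rewrite !gt_eqF.
    have g0 : 0 <= 4 * Cz * b0 / eta ^+ 2.
      by rewrite divr_ge0 ?sqr_ge0// !mulr_ge0//; exact: ltW.
    have ri : 0 <= rho^-1 by rewrite invr_ge0 ltW.
    have ri1 : rho^-1 <= 1 by rewrite invf_le1.
    have h3 : rho^-1 * rho^-1 <= e1 * eta ^+ 2 / (8 * Cz * b0).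
      by apply: le_trans HNm; rewrite ler_piMr.
    apply: le_trans (ler_wpM2l g0 h3) _; apply: eqle.
    by field; rewrite !gt_eqF.
  by lra.
have lip := smoothing_shift SM j k x w HL.
have wj : eta * rho <= w + j%:R * d.
  by rewrite (le_trans wrho)// lerDl mulr_ge0// ltW.
have /andP[p1 p2] := del w wrho; have /andP[p3 p4] := del _ wj.
have lip2 : j%:R * (Csm * (Cz / Num.sqrt m'.+1%:R) / k.+1%:R) <=
    j%:R * (2 * Csm * Cz / ka / rho ^+ 3).
  apply: ler_wpM2l => //.
  apply: le_trans (_ : Csm * (Cz * (2 / rho)) / (ka * rho ^+ 2) <= _); last first.
    by apply: eqle; field; rewrite !gt_eqF.
  apply: ler_pM.
  - by rewrite !mulr_ge0//; exact: ltW.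
  - by rewrite invr_ge0.
  - by rewrite ler_pM2l// ler_pM2l.
  - by rewrite lef_pV2 ?posrE// mulr_gt0// exprn_gt0.
have HE y' : H m x y' = iter k K (H m') x y' by rewrite -iterD -mE.
rewrite !HE; move: lip.
set A1 := iter k T _ x (w + _); set A2 := iter k T _ x w => lip.
set D1 := iter k K _ x (w + _) in p3 p4 *; set D2 := iter k K _ x w in p1 p2 *.
rewrite -/A1 in p3 p4; rewrite -/A2 in p1 p2.
exact: (shift_budget (le_trans lip lip2) p1 (le_trans p2 Dele) p3 (le_trans p4 Dele)).
Qed.

(** A leftward shift staying above eta sqrt m / 2 is a rightward shift seen from its other end.
    Otherwise j d exceeds eta sqrt m / 2, and the crude bound of order 1/m is already of the form j
    C3 / m^(3/2). *)
Lemma cell_reg2 (e1 eta : R) : 0 < e1 -> 0 < eta -> exists C2 N, 0 < C2 /\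
  forall m, (N <= m)%N -> forall x w (j : nat), eta * Num.sqrt m.+1%:R <= w ->
  `|H m x (w + j%:R * d) - H m x w| <=
    e1 / Num.sqrt m.+1%:R ^+ 2 + j%:R * (C2 / Num.sqrt m.+1%:R ^+ 3) /\
  `|H m x (w - j%:R * d) - H m x w| <=
    e1 / Num.sqrt m.+1%:R ^+ 2 + j%:R * (C2 / Num.sqrt m.+1%:R ^+ 3).
Proof.
move=> e10 eta0; have [Cz Cz0 HCz] := cell_consts; have dp := d0.
have eta20 : 0 < eta / 2 by rewrite divr_gt0.
have [C2 [N [C20 HN]]] := cell_reg e10 eta20.
pose C3 := 2 * d * Cz / eta.
have C30 : 0 < C3 by rewrite divr_gt0 ?mulr_gt0.
exists (C2 + C3), N; split; first by rewrite addr_gt0.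
move=> m Nm x w j; have rho0 := sqrtSn_gt0 R m.
set rho := Num.sqrt m.+1%:R in rho0 *; move=> wr.
have HNm := HN m Nm x; rewrite -/rho in HNm.
have r3 : 0 < (rho ^+ 3)^-1 by rewrite invr_gt0 exprn_gt0.
have jj : 0 <= j%:R :> R by [].
have mono : j%:R * (C2 / rho ^+ 3) <= j%:R * ((C2 + C3) / rho ^+ 3).
  by rewrite ler_wpM2l// ler_pM2r// lerDl ltW.
have er0 : 0 < eta * rho by rewrite mulr_gt0.
have wr2 : eta / 2 * rho <= w by lra.
split.
  by apply: le_trans (HNm w j wr2) _; rewrite lerD2l.
have [big|small] := leP (eta / 2 * rho) (w - j%:R * d).
  have := HNm (w - j%:R * d) j big; rewrite subrK distrC => h.
  by apply: le_trans h _; rewrite lerD2l.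
have [_ HS] := HCz m; rewrite -/rho in HS.
have /andP[a1 a2] := HS x w; have /andP[b1 b2] := HS x (w - j%:R * d).
have h1 : `|H m x (w - j%:R * d) - H m x w| <= Cz / rho ^+ 2.
  by rewrite ler_norml; apply/andP; split; lra.
apply: le_trans h1 _; rewrite ler_wpDl ?divr_ge0 ?sqr_ge0 ?(ltW e10)//.
have h2 : eta * rho <= 2 * (j%:R * d) by lra.
have -> : Cz / rho ^+ 2 = Cz / eta / rho ^+ 3 * (eta * rho).
  by field; rewrite !gt_eqF.
apply: le_trans (_ : Cz / eta / rho ^+ 3 * (2 * (j%:R * d)) <= _).
  by rewrite ler_wpM2l// !divr_ge0 ?exprn_ge0// ltW.
apply: le_trans (_ : j%:R * (C3 / rho ^+ 3) <= _).
  by apply: eqle; rewrite /C3; ring.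
by rewrite ler_wpM2l// ler_pM2r// lerDr ltW.
Qed.

End CellReg.

(** * Averaging of the state and the Dirichlet kernel *)

Section Mixing.
Variables (R : realType) (X : finType).

Let quarter_time (t k l : R) : 1 <= t -> 0 <= k -> l <= 2 * (k + 1) -> (t + l) / 4 <= t + k.
Proof. by move=> *; lra. Qed.

Variables (Q : X -> X -> R) (nu f r q : X -> R) (sg B : R) (V : X -> R -> R).
Hypothesis CH : chain Q nu f.
Hypothesis W : walk Q f r q sg B V.
Let SQ := chain_stoch CH.
Local Notation K := (kill Q f).
Local Notation s := (srv Q f).
Local Notation nV := (nv sg V).

Lemma nv_step x x' y : 0 < y -> `|nV x' (y + f x') - nV x y| <= stepH sg B.
Proof.
move=> y0; have sg0 := walk_sg W; have B0 := walk_B W.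
rewrite /nv /stepH -mulrBl normrM [`|sg^-1|]gtr0_norm ?invr_gt0//.
rewrite ler_pM2r ?invr_gt0//.
have := walk_rB W x; have := walk_rB W x'; have := walk_fB W x'.
rewrite !ler_norml => /andP[f1 f2] /andP[r1 r2] /andP[r3 r4].
have := walk_dist W x y; rewrite /alive y0 mul1r mulr1 ler_norml => /andP[v1 v2].
have [y'0|y'0] := ltP 0 (y + f x'); last first.
  by rewrite (walk_Vneg W)//; apply/andP; split; lra.
have := walk_dist W x' (y + f x').
rewrite /alive y'0 mul1r mulr1 ler_norml => /andP[v3 v4].
by apply/andP; split; lra.
Qed.

(** In each step the factor g moves by at most its slope times the step bound, while h evolves by
    the chain alone; g 0 = 0 takes care of death. *)
Lemma mix_steps (g : R -> R) (h : X -> R) (Lg Mh : R) : 0 <= Mh -> g 0 = 0 ->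
  (forall v v', `|g v - g v'| <= Lg * `|v - v'|) -> (forall x, `|h x| <= Mh) ->
  forall j x y, `|iter j K (fun x y => h x * g (nV x y)) x y - Piter Q j h x * g (nV x y)|
    <= j%:R * (Mh * (Lg * stepH sg B)) * alive x y.
Proof.
move=> Mh0 g0 HL Hh; have H0 := stepH_gt0 W.
have Lg0 : 0 <= Lg.
  by have := HL 1 0; rewrite subr0 normr1 mulr1 => /(le_trans (normr_ge0 _)).
elim=> [|j IH] x y; first by rewrite /= subrr normr0 !mul0r.
have [y0|y0] := ltP 0 y; last first.
  by rewrite iterS killN// /nv (walk_Vneg W)// mul0r g0 mulr0 subrr normr0 /alive ltNge y0 mulr0.
rewrite iterS killP// /alive y0 mulr1.
have -> : step Q f (iter j K (fun x y => h x * g (nV x y))) x y - Piter Q j.+1 h x * g (nV x y) =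
  \sum_x' Q x x' * ((iter j K (fun x y => h x * g (nV x y)) x' (y + f x') -
     Piter Q j h x' * g (nV x' (y + f x'))) +
    Piter Q j h x' * (g (nV x' (y + f x')) - g (nV x y))).
  rewrite PiterS mulr_suml -sumrB; apply: eq_bigr => x' _; ring.
apply: (sumQ_norm SQ) => x'; apply: le_trans (ler_normD _ _) _.
rewrite -natr1 mulrDl mul1r; apply: lerD.
  apply: le_trans (IH x' (y + f x')) _; rewrite ler_piMr ?alive_le1//.
  exact: (mulr_ge0 (ler0n _ _) (mulr_ge0 Mh0 (mulr_ge0 Lg0 (ltW H0)))).
rewrite normrM; apply: ler_pM => //; first exact: (Piter_norm CH).
apply: le_trans (HL _ _) _; apply: ler_wpM2l => //; exact: nv_step.
Qed.

Lemma Piter_cvg_nu (h : X -> R) (e : R) : 0 < e ->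
  exists L, forall x, `|Piter Q L h x - nu_int nu h| <= e.
Proof.
move=> e0; pose h0 x := 1 * h x + (-1) * nu_int nu h.
have n0 : nu_int nu h0 = 0.
  by rewrite (nu_lin nu 1 (-1) h (fun=> _)) (nu_cst CH); ring.
have [L HL] := Piter_cvg0 CH n0 e0; exists L => x.
have := HL L (leqnn L) x; rewrite (Piter_lin Q L 1 (-1) h (fun=> _)).
by rewrite (Piter_cst CH) mul1r mulN1r.
Qed.

Variables (h : X -> R) (x0 : X) (v0 : R).

(** L last steps, L fixed, replace h by its mean while the kernel, of slope O(1/m), hardly moves;
    the earlier steps carry the kernel by [propagation]. All constants are free of the pole w. *)
Lemma mix_asymp (ka e : R) : 0 < ka -> ka <= 1 -> 0 < e ->
  exists N, forall m, (N <= m)%N ->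
  forall (w : R) (rho := Num.sqrt m.+1%:R : R) (t := ka ^+ 2 * rho ^+ 2 + 1),
  is_true (`|iter m K (fun x y => h x * hd 1 w t (nV x y)) x0 v0 -
    nu_int nu h * hd 1 w (t + m%:R) (nV x0 v0)| <= e / rho ^+ 2).
Proof.
move=> ka0 ka1 e0.
have [Mh Mh0 HMh] := fin_ub h.
have [Cs Cs0 HCs] := walk_srv W.
have [Cu HU] := testfn_hd W.
have Cu0 : 0 <= Cu by have := tf_C (HU 0).
have [C C0 HC] := propagation W.
have [Cv Cv0 HCv] := he_lip_v R 1.
have [Ct Ct0 HCt] := he_lip_t R 1.
have [Cb Cb0 HCb] := he_bound R 1.
have H0 := stepH_gt0 W.
have Y1 : 1 <= 1 + `|v0| by rewrite lerDl.
set Y := 1 + `|v0| in Y1.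
have Y0 : 0 < Y by lra.
have nuh : `|nu_int nu h| <= Mh by exact: (nu_norm CH).
(* The sup of the kernel times the survival bound is D1 / rho^2, so the mixing error takes a quarter
   of e. *)
pose D1 := 4 * Cb * Cs * Y / ka.
have D10 : 0 < D1 by rewrite divr_gt0// !mulr_gt0.
have ee0 : 0 < e / (4 * D1) by rewrite divr_gt0// mulr_gt0.
have [L HL] := Piter_cvg_nu h ee0.
pose U1 := Mh * (Cu * C * Y).
have U10 : 0 <= U1 := mulr_ge0 (ltW Mh0) (mulr_ge0 (mulr_ge0 Cu0 (ltW C0)) (ltW Y0)).
have U1p : 0 < U1 + 1 by rewrite ltr_wpDl.
pose l := 4 * (U1 + 1) / (ka ^+ 3 * e).
have l0 : 0 < l := divr_gt0 (mulr_gt0 (ltr0n _ 4) U1p) (mulr_gt0 (exprn_gt0 _ ka0) e0).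
have lE : U1 / (ka ^+ 3 * l) <= e / 4.
  have -> : U1 / (ka ^+ 3 * l) = U1 * (e / 4) / (U1 + 1).
    by rewrite /l; field; rewrite !gt_eqF.
  by rewrite ler_pdivrMr// mulrC ler_pM2l ?divr_gt0// lerDl.
pose Z1 := L%:R * (Mh * (2 * Cv / ka ^+ 2 * stepH sg B)) * (2 * Cs * Y).
have Z10 : 0 <= Z1.
  apply: mulr_ge0; last exact: (mulr_ge0 (mulr_ge0 (ler0n _ 2) (ltW Cs0)) (ltW Y0)).
  apply: mulr_ge0 => //; apply: mulr_ge0; first exact: ltW.
  apply: mulr_ge0; last exact: ltW.
  by rewrite divr_ge0 ?sqr_ge0// mulr_ge0// ltW.
pose Z2 := U1 * ((1 + l) / ka ^+ 3 + (ka ^+ 4)^-1).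
have Z20 : 0 <= Z2.
  apply: mulr_ge0 => //; rewrite addr_ge0 ?invr_ge0 ?exprn_ge0 ?divr_ge0 ?exprn_ge0 ?(ltW ka0)//.
  by rewrite addr_ge0// ltW.
pose Z3 := Mh * (2 * Ct / ka ^+ 3) * L%:R.
have Z30 : 0 <= Z3.
  apply: mulr_ge0 => //; apply: mulr_ge0; first exact: ltW.
  by rewrite divr_ge0 ?exprn_ge0 ?(ltW ka0)// mulr_ge0// ltW.
pose Z := Z1 + Z2 + Z3.
have Z0 : 0 <= Z := addr_ge0 (addr_ge0 Z10 Z20) Z30.
have Zp : 0 < Z + 1 by rewrite ltr_wpDl.
have e40 : 0 < e / 4 by rewrite divr_gt0.
have [N HN] := inv_sqrt_small (divr_gt0 e40 Zp).
exists (N + 2 * L + 4)%N => m Nm w rho t.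
have mN : (N <= m)%N.
  by apply: leq_trans Nm; rewrite -addnA leq_addr.
have mL : (2 * L <= m)%N.
  by apply: leq_trans Nm; rewrite -addnA addnCA leq_addr.
have rho0 : 0 < rho := sqrtSn_gt0 R m.
have rho1 : 1 <= rho := sqrtSn_ge1 R m.
have rho2 : rho ^+ 2 = m.+1%:R := sqr_sqrtSn R m.
have Zr : Z / rho <= e / 4.
  have := HN m mN; rewrite -/rho ler_pdivlMr// mulrC => hh.
  by apply: le_trans hh; rewrite ler_pM2r ?invr_gt0// lerDl.
have kr0 : 0 < ka * rho := mulr_gt0 ka0 rho0.
have krE : (ka * rho) ^+ 2 = ka ^+ 2 * rho ^+ 2 by rewrite exprMn.
have t1 : 1 <= t by rewrite /t -krE lerDr sqr_ge0.
have t0 : 0 < t := lt_le_trans ltr01 t1.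
have st0 : 0 < Num.sqrt t by rewrite sqrtr_gt0.
have st' : Num.sqrt t ^+ 2 = (ka * rho) ^+ 2 + 1 by rewrite sqr_sqrtr ?(ltW t0)// /t krE.
have [_ st2 _] := sqr_succ_bounds (ltW st0) (ltW kr0) st'.
have w0 : 0 <= (Num.sqrt t)^-1 by rewrite invr_ge0 ltW.
have wle : (Num.sqrt t)^-1 <= (ka * rho)^-1 by rewrite lef_pV2 ?posrE.
have wX n : (Num.sqrt t)^-1 ^+ n <= (ka * rho)^-1 ^+ n.
  by apply: lerXn2r; rewrite ?nnegrE// invr_ge0 ltW.
pose g := hd 1 w t.
have gL v v' : `|g v - g v'| <= 2 * Cv / ka ^+ 2 / rho ^+ 2 * `|v - v'|.
  rewrite /g /hd.
  have a1 := HCv t (v - w) (v' - w) t0; have a2 := HCv t (v + w) (v' + w) t0.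
  have e1 : v - w - (v' - w) = v - v' by ring.
  have e2 : v + w - (v' + w) = v - v' by ring.
  rewrite e1 in a1; rewrite e2 in a2.
  rewrite [X in `|X|](_ : _ = (he 1 t (v - w) - he 1 t (v' - w)) -
    (he 1 t (v + w) - he 1 t (v' + w))); last by ring.
  apply: le_trans (ler_normB _ _) _; apply: le_trans (lerD a1 a2) _.
  apply: le_trans (_ : 2 * (Cv * (ka * rho)^-1 ^+ 2 * `|v - v'|) <= _); last first.
    by apply: eqle; field; rewrite !gt_eqF.
  have : Cv * (Num.sqrt t)^-1 ^+ 2 * `|v - v'| <= Cv * (ka * rho)^-1 ^+ 2 * `|v - v'|.
    by rewrite ler_wpM2r// ler_pM2l.
  by move=> hh; rewrite mulr_natl mulr2n; exact: lerD.
have g0 : g 0 = 0 := tf_0 (HU w) t.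
have gB v : `|g v| <= 2 * Cb / (ka * rho).
  apply: le_trans (ler_normB _ _) _.
  apply: le_trans (lerD (HCb t _ t0) (HCb t _ t0)) _.
  have hh : Cb * (Num.sqrt t)^-1 ^+ 1 <= Cb * (ka * rho)^-1 by rewrite expr1 ler_pM2l.
  have -> : 2 * Cb / (ka * rho) = Cb * (ka * rho)^-1 + Cb * (ka * rho)^-1 by ring.
  exact: lerD.
have [m' mE] : exists m', m = (m' + L)%N.
  by exists (m - L)%N; rewrite subnK//; apply: leq_trans mL; rewrite leq_pmull.
have mm' : (m < 2 * m'.+1)%N by clear -mE mL; lia.
have mR : m%:R = m'%:R + L%:R :> R by rewrite mE natrD.
have i1 : (Num.sqrt m'.+1%:R)^-1 <= 2 / rho.
  rewrite ler_pdivlMr// mulrC ler_pdivrMr ?sqrtSn_gt0//; exact: sqrtSn_double.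
have i2 : Num.sqrt m'.+1%:R <= rho.
  by rewrite ler_wsqrtr// ler_nat ltnS mE leq_addr.
have sm' : s m' x0 v0 <= 2 * Cs * Y / rho.
  apply: le_trans (HCs m' x0 v0) _; rewrite -/Y.
  apply: le_trans (_ : Cs * Y * (2 / rho) <= _); last by apply: eqle; ring.
  by apply: ler_wpM2l => //; exact: (mulr_ge0 (ltW Cs0) (ltW Y0)).
have s0 : 0 <= s m' x0 v0 := srv_ge0 f SQ m' x0 v0.
have MS := mix_steps (ltW Mh0) g0 gL HMh L.
set c1 := L%:R * _ in MS.
have nvneg x y : y <= 0 -> g (nV x y) = 0.
  by move=> yn; rewrite /nv (walk_Vneg W)// mul0r g0.
have S1 : `|iter m K (fun x y => h x * g (nV x y)) x0 v0 -
    nu_int nu h * iter m' K (fun x y => g (nV x y)) x0 v0| <=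
    (c1 + e / (4 * D1) * (2 * Cb / (ka * rho))) * s m' x0 v0.
  rewrite [in iter m]mE iterD.
  have -> : iter m' K (iter L K (fun x y => h x * g (nV x y))) x0 v0 -
     nu_int nu h * iter m' K (fun x y => g (nV x y)) x0 v0 =
    iter m' K (fun x y => 1 * iter L K (fun x y => h x * g (nV x y)) x y +
      (- nu_int nu h) * g (nV x y)) x0 v0.
    by rewrite iter_kill_lin mul1r mulNr.
  apply: (iter_kill_bound f SQ) => x y; rewrite mul1r mulNr.
  have -> : iter L K (fun x y => h x * g (nV x y)) x y - nu_int nu h * g (nV x y) =
    (iter L K (fun x y => h x * g (nV x y)) x y - Piter Q L h x * g (nV x y)) +
    (Piter Q L h x - nu_int nu h) * g (nV x y) by ring.
  apply: le_trans (ler_normD _ _) _; rewrite [leRHS]mulrDl; apply: lerD; first exact: MS.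
  rewrite normrM /alive; have [y0|y0] := ltP 0 y; last first.
    by rewrite nvneg// normr0 !mulr0.
  by rewrite mulr1; apply: ler_pM.
have P1 := HC _ _ _ _ _ (HU w) t m' l x0 v0 t1 l0; rewrite -/Y -/g in P1.
have T1 : `|hd 1 w (t + m'%:R) (nV x0 v0) - hd 1 w (t + m%:R) (nV x0 v0)| <=
   2 * Ct / ka ^+ 3 * L%:R / rho ^+ 3.
  have tm : 0 < t + m%:R by rewrite ltr_wpDr.
  have m4 : (t + m%:R) / 4 <= t + m'%:R.
    apply: (quarter_time t1 (ler0n _ m')); rewrite natr1.
    by rewrite -natrM ler_nat ltnW.
  have a1 u := HCt (t + m%:R) (t + m'%:R) u tm m4.
  have dE : `|t + m'%:R - (t + m%:R)| = L%:R.
    have -> : t + m'%:R - (t + m%:R) = - L%:R by rewrite mR; ring.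
    by rewrite normrN ger0_norm.
  rewrite dE in a1.
  have wm : (Num.sqrt (t + m%:R))^-1 <= (ka * rho)^-1.
    apply: le_trans wle; rewrite lef_pV2 ?posrE ?sqrtr_gt0//.
    by rewrite ler_wsqrtr// lerDl.
  have a2 u : `|he 1 (t + m'%:R) u - he 1 (t + m%:R) u| <= Ct * (ka * rho)^-1 ^+ 3 * L%:R.
    apply: le_trans (a1 u) _; rewrite ler_wpM2r// ler_pM2l//.
    by apply: lerXn2r; rewrite ?nnegrE ?invr_ge0 ?sqrtr_ge0// ltW.
  rewrite /hd [X in `|X|](_ : _ =
    (he 1 (t + m'%:R) (nV x0 v0 - w) - he 1 (t + m%:R) (nV x0 v0 - w)) -
    (he 1 (t + m'%:R) (nV x0 v0 + w) - he 1 (t + m%:R) (nV x0 v0 + w))); last by ring.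
  apply: le_trans (ler_normB _ _) _; apply: le_trans (lerD (a2 _) (a2 _)) _.
  by apply: eqle; field; rewrite !gt_eqF.
have r2i : 0 < (rho ^+ 2)^-1 by rewrite invr_gt0 exprn_gt0.
have B1 : (c1 + e / (4 * D1) * (2 * Cb / (ka * rho))) * s m' x0 v0 <=
    (Z1 / rho + e / 4) / rho ^+ 2.
  apply: le_trans (_ : (c1 + e / (4 * D1) * (2 * Cb / (ka * rho))) * (2 * Cs * Y / rho) <= _).
    apply: ler_wpM2l => //; apply: addr_ge0.
      apply: mulr_ge0 => //; apply: mulr_ge0; first exact: ltW.
      apply: mulr_ge0; last exact: ltW.
      by rewrite !divr_ge0 ?sqr_ge0// mulr_ge0// ltW.
    by apply: mulr_ge0; [exact: ltW|rewrite divr_ge0 ?(ltW kr0)// mulr_ge0// ltW].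
  by apply: eqle; rewrite /c1 /Z1 /D1; field; rewrite !gt_eqF.
have B2 : Mh * `|iter m' K (fun x y => g (nV x y)) x0 v0 - hd 1 w (t + m'%:R) (nV x0 v0)| <=
    (Z2 / rho + e / 4) / rho ^+ 2.
  apply: le_trans (ler_wpM2l (ltW Mh0) P1) _.
  apply: le_trans (_ : U1 * ((ka * rho)^-1 ^+ 3 * (1 + l + rho / l) + (ka * rho)^-1 ^+ 4 * rho) <= _).
    rewrite mulrA -/U1; apply: ler_wpM2l => //; apply: lerD.
      apply: ler_pM; [exact: exprn_ge0| |exact: wX|].
        exact: (addr_ge0 (addr_ge0 ler01 (ltW l0)) (divr_ge0 (sqrtr_ge0 _) (ltW l0))).
      by rewrite lerD2l ler_pM2r ?invr_gt0.
    by apply: ler_pM; [exact: exprn_ge0|exact: sqrtr_ge0|exact: wX|].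
  apply: le_trans (_ : (Z2 / rho + U1 / (ka ^+ 3 * l)) / rho ^+ 2 <= _).
    by apply: eqle; rewrite /Z2; field; rewrite !gt_eqF.
  by rewrite ler_pM2r// lerD2l.
have B3 : Mh * `|hd 1 w (t + m'%:R) (nV x0 v0) - hd 1 w (t + m%:R) (nV x0 v0)| <=
    Z3 / rho / rho ^+ 2.
  apply: le_trans (ler_wpM2l (ltW Mh0) T1) _.
  by apply: eqle; rewrite /Z3; field; rewrite !gt_eqF.
move: S1 B2 B3; rewrite /g.
set I1 := iter m K _ x0 v0; set I2 := iter m' K _ x0 v0.
set h1 := hd 1 w (t + m'%:R) _; set h2 := hd 1 w (t + m%:R) _ => S1 B2 B3.
have -> : I1 - nu_int nu h * h2 = (I1 - nu_int nu h * I2) + nu_int nu h * (I2 - h1) +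
  nu_int nu h * (h1 - h2) by ring.
apply: le_trans (ler_normD _ _) _; apply: le_trans (lerD (ler_normD _ _) (lexx _)) _.
rewrite (normrM _ (I2 - h1)) (normrM _ (h1 - h2)).
have C2 : `|nu_int nu h| * `|I2 - h1| <= (Z2 / rho + e / 4) / rho ^+ 2.
  by apply: le_trans B2; rewrite ler_wpM2r.
have C3 : `|nu_int nu h| * `|h1 - h2| <= Z3 / rho / rho ^+ 2.
  by apply: le_trans B3; rewrite ler_wpM2r.
apply: le_trans (lerD (lerD (le_trans S1 B1) C2) C3) _.
apply: le_trans (_ : (Z / rho + e / 2) / rho ^+ 2 <= _).
  by apply: eqle; rewrite /Z; field; rewrite !gt_eqF.
rewrite ler_pM2r// -lerBrDr; apply: le_trans Zr _; have -> : e - e / 2 = e / 4 + e / 4 by field.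
by rewrite lerDl divr_ge0// ltW.
Qed.

(** [hd] is odd in v: the even Taylor terms of the two images cancel and twice the slope at the pole
    remains. *)
Lemma hd_lin : exists2 C : R, 0 < C & forall T w v : R, 0 < T ->
  `|hd 1 w T v + 2 * v * he 2 T w| <= C * (Num.sqrt T)^-1 ^+ 4 * `|v| ^+ 3.
Proof.
have [C C0 HC] := he_bound R 4; exists (2 * C); first by rewrite mulr_gt0.
move=> T w v T0.
have TT := taylor3 (is_derive_he_v 1 T) (is_derive_he_v 2 T) (is_derive_he_v 3 T)
  (fun z => HC T z T0) w.
have a1 := TT v; have a2 := TT (- v).
rewrite normrN sqrrN in a2.
have E : he 1 T (v - w) = he 1 T (w - v).
  by rewrite -[v - w]opprB he_parity sqrrN expr1n mul1r.
rewrite /hd E.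
have E2 : he 1 T (v + w) = he 1 T (w + v) by rewrite addrC.
rewrite E2 [X in `|X|](_ : _ = (he 1 T (w - v) - he 1 T w - - v * he 2 T w - v ^+ 2 / 2 * he 3 T w) -
  (he 1 T (w + v) - he 1 T w - v * he 2 T w - v ^+ 2 / 2 * he 3 T w)); last by ring.
apply: le_trans (ler_normB _ _) _; apply: le_trans (lerD a2 a1) _.
by apply: eqle; ring.
Qed.

(** The term C ka comes from replacing the heat time (1 + ka^2) rho^2 by rho^2; no choice of m
    removes it. *)
Lemma dual_asymp : exists2 C : R, 0 < C & forall ka e : R, 0 < ka -> ka <= 1 -> 0 < e ->
  exists N, forall m, (N <= m)%N ->
  forall (w : R) (rho := Num.sqrt m.+1%:R : R) (t := ka ^+ 2 * rho ^+ 2 + 1),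
  is_true (`|iter m K (fun x y => h x * hd 1 w t (nV x y)) x0 v0 +
    2 * nu_int nu h * nV x0 v0 * he 2 (rho ^+ 2) w| <= (e + C * ka) / rho ^+ 2).
Proof.
have [C1 C10 H1] := hd_lin; have [C2 C20 H2] := he_lip_t R 2.
pose nh := `|nu_int nu h|; pose v := nV x0 v0.
have c0 : 0 <= 2 * nh * `|v| * C2 :=
  mulr_ge0 (mulr_ge0 (mulr_ge0 (ler0n _ 2) (normr_ge0 _)) (normr_ge0 _)) (ltW C20).
exists (2 * nh * `|v| * C2 + 1); first by rewrite ltr_wpDl.
move=> ka e ka0 ka1 e0; have e20 : 0 < e / 2 by rewrite divr_gt0.
have [N1 HN1] := mix_asymp ka0 ka1 e20.
pose D := nh * C1 * `|v| ^+ 3.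
have D0 : 0 <= D :=
  mulr_ge0 (mulr_ge0 (normr_ge0 _) (ltW C10)) (exprn_ge0 3 (normr_ge0 _)).
have D1 : 0 < D + 1 by rewrite ltr_wpDl.
have [N2 HN2] := inv_sqrt_small (divr_gt0 e20 D1).
exists (N1 + N2)%N => m Nm w rho t.
have S := HN1 m (leq_trans (leq_addr _ _) Nm) w; cbv zeta in S.
have Sm := HN2 m (leq_trans (leq_addl _ _) Nm).
rewrite /= -/rho -/t -/v in S; rewrite -/rho in Sm.
have rho0 : 0 < rho := sqrtSn_gt0 R m.
have rho1 : 1 <= rho := sqrtSn_ge1 R m.
have rho2 : rho ^+ 2 = m.+1%:R := sqr_sqrtSn R m.
have r20 : 0 < rho ^+ 2 by rewrite exprn_gt0.
have tm : t + m%:R = (1 + ka ^+ 2) * rho ^+ 2.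
  by rewrite /t rho2 -[m.+1%:R]natr1; ring.
have T0 : 0 < t + m%:R by rewrite tm mulr_gt0// ltr_wpDr// sqr_ge0.
have srho : Num.sqrt (rho ^+ 2) = rho by rewrite sqrtr_sqr gtr0_norm.
have kr : 0 <= ka ^+ 2 * rho ^+ 2 by rewrite mulr_ge0 ?sqr_ge0.
have Tr : rho <= Num.sqrt (t + m%:R).
  by rewrite -{1}srho ler_wsqrtr// tm mulrDl mul1r lerDl.
have A1 := H1 (t + m%:R) w v T0.
have A2 := H2 (rho ^+ 2) (t + m%:R) w r20.
rewrite srho in A2.
have {}A2 : `|he 2 (t + m%:R) w - he 2 (rho ^+ 2) w| <= C2 * ka ^+ 2 / rho ^+ 2.
  apply: le_trans (A2 _) _.
    by rewrite tm mulrDl mul1r; move: (rho ^+ 2) (ka ^+ 2 * rho ^+ 2) r20 kr => a b ? ?; lra.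
  have -> : t + m%:R - rho ^+ 2 = ka ^+ 2 * rho ^+ 2 by rewrite tm; ring.
  by rewrite (ger0_norm kr); apply: eqle; field; rewrite gt_eqF.
have {}A1 : nh * `|hd 1 w (t + m%:R) v + 2 * v * he 2 (t + m%:R) w| <= (e / 2) / rho ^+ 2.
  apply: le_trans (ler_wpM2l (normr_ge0 _) A1) _.
  apply: le_trans (_ : nh * (C1 * rho^-1 ^+ 4 * `|v| ^+ 3) <= _).
    rewrite ler_wpM2l// ler_wpM2r ?exprn_ge0// ler_pM2l//.
    apply: lerXn2r; rewrite ?nnegrE ?invr_ge0 ?sqrtr_ge0 ?(ltW rho0)//.
    by rewrite lef_pV2 ?posrE ?sqrtr_gt0.
  rewrite (_ : nh * _ = D * rho^-1 ^+ 2 / rho ^+ 2); last by rewrite /D; field; rewrite gt_eqF.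
  rewrite ler_pM2r ?invr_gt0//.
  have ri : 0 <= rho^-1 by rewrite invr_ge0 ltW.
  have ri1 : rho^-1 <= 1 by rewrite invf_le1.
  have : rho^-1 ^+ 2 <= e / 2 / (D + 1).
    by apply: le_trans Sm; rewrite expr2 ler_piMr.
  rewrite ler_pdivlMr// => hh; apply: le_trans hh; rewrite mulrC ler_wpM2l ?sqr_ge0// lerDl//.
set I1 := iter m K _ x0 v0 in S *.
have -> : I1 + 2 * nu_int nu h * nV x0 v0 * he 2 (rho ^+ 2) w =
  (I1 - nu_int nu h * hd 1 w (t + m%:R) v) +
  nu_int nu h * (hd 1 w (t + m%:R) v + 2 * v * he 2 (t + m%:R) w) +
  (- (2 * nu_int nu h * v)) * (he 2 (t + m%:R) w - he 2 (rho ^+ 2) w) by rewrite /v; ring.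
apply: le_trans (ler_normD _ _) _; apply: le_trans (lerD (ler_normD _ _) (lexx _)) _.
rewrite (normrM (nu_int nu h)) -/nh (normrM (- _)) normrN 2!normrM -/nh [`|2|]gtr0_norm//.
have A3 : 2 * nh * `|v| * `|he 2 (t + m%:R) w - he 2 (rho ^+ 2) w| <=
   (2 * nh * `|v| * C2 + 1) * ka / rho ^+ 2.
  apply: le_trans (ler_wpM2l _ A2) _.
    exact: (mulr_ge0 (mulr_ge0 (ler0n _ 2) (normr_ge0 _)) (normr_ge0 _)).
  rewrite mulrA ler_pM2r ?invr_gt0//.
  have k2 : ka ^+ 2 <= ka by rewrite expr2 ler_piMl// ltW.
  apply: le_trans (_ : 2 * nh * `|v| * C2 * ka <= _).
    by rewrite mulrA ler_wpM2l.
  by rewrite ler_pM2r// lerDl.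
apply: le_trans (lerD (lerD S A1) A3) _.
by apply: eqle; field; rewrite gt_eqF.
Qed.

End Mixing.

(** * Gaussian weights on a progression *)

Section Weights.
Variable R : realType.

Lemma gs_decr (a b : R) : 0 <= a -> a <= b -> gs b <= gs a.
Proof.
move=> a0 ab; rewrite /gs ler_pM2l; last by rewrite divr_gt0// sqrt2pi_gt0.
rewrite ler_expR lerN2 ler_pM2r ?invr_gt0//.
by apply: lerXn2r; rewrite ?nnegrE// (le_trans a0).
Qed.

Lemma he1E (t v : R) : he 1 t v = (Num.sqrt t)^-1 * gs (v / Num.sqrt t).
Proof. by rewrite /he expr1. Qed.

Lemma he1_ge0 (t v : R) : 0 <= he 1 t v.
Proof. by rewrite he1E mulr_ge0 ?invr_ge0 ?sqrtr_ge0// ltW// gs_gt0. Qed.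

Lemma he1_decr (t a b : R) : 0 <= a -> a <= b -> he 1 t b <= he 1 t a.
Proof.
move=> a0 ab; rewrite !he1E ler_wpM2l ?invr_ge0 ?sqrtr_ge0//; apply: gs_decr.
  by rewrite divr_ge0 ?sqrtr_ge0.
by rewrite ler_wpM2r ?invr_ge0 ?sqrtr_ge0.
Qed.

Lemma he1_even (t v : R) : he 1 t (- v) = he 1 t v.
Proof. by rewrite he_parity sqrrN expr1n mul1r. Qed.

Variables (t D : R).
Hypothesis t0 : 0 < t.
Hypothesis D0 : 0 < D.

Let he0_mvt (a b : R) : 0 <= a -> a <= b ->
  (b - a) * he 1 t b <= he 0 t b - he 0 t a <= (b - a) * he 1 t a.
Proof.
move=> a0 ab; have [c /andP[ac cb] ->] := mvt_ex ab (fun z _ => is_derive_he_v 0 t z).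
have ba : 0 <= b - a by rewrite subr_ge0.
rewrite mulrC; apply/andP; split.
  by rewrite ler_wpM2r//; apply: he1_decr => //; exact: le_trans ac.
by rewrite [leRHS]mulrC ler_wpM2r//; exact: he1_decr.
Qed.

(** [he 1] is the derivative of [he 0] and decreases on the half-line, so its Riemann sums bracket
    [he 0]. *)
Lemma he1_sum_upper J : D * \sum_(j < J) he 1 t (j.+1%:R * D) <= he 0 t (J%:R * D).
Proof.
elim: J => [|J IH]; first by rewrite big_ord0 mulr0 mul0r he_even0.
rewrite big_ord_recr /= mulrDr.
have JD : 0 <= J%:R * D by rewrite mulr_ge0// ltW.
have le : J%:R * D <= J.+1%:R * D by rewrite ler_wpM2r ?ler_nat// ltW.
have /andP[h _] := he0_mvt JD le.
have E : J.+1%:R * D - J%:R * D = D by rewrite -natr1; ring.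
rewrite E in h; move: IH h.
set a := he 0 t (J%:R * D); set b := he 0 t _; set c := D * he 1 t _.
by move: (D * _) => S ? ?; lra.
Qed.

Lemma he1_sum_lower J : he 0 t (J%:R * D) <= D * \sum_(j < J) he 1 t (j%:R * D).
Proof.
elim: J => [|J IH]; first by rewrite big_ord0 mulr0 mul0r he_even0.
rewrite big_ord_recr /= mulrDr.
have JD : 0 <= J%:R * D by rewrite mulr_ge0// ltW.
have le : J%:R * D <= J.+1%:R * D by rewrite ler_wpM2r ?ler_nat// ltW.
have /andP[_ h] := he0_mvt JD le.
have E : J.+1%:R * D - J%:R * D = D by rewrite -natr1; ring.
rewrite E in h; move: IH h.
set a := he 0 t (J%:R * D); set b := he 0 t _; set c := D * he 1 t _.
by move: (D * bigop _ _ _) => S ? ?; lra.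
Qed.

Lemma he0_le1 v : he 0 t v <= 1.
Proof. by rewrite /he expr0 mul1r /=; exact: erf_le1. Qed.

End Weights.

Section Moment.
Variable R : realType.

(** Since z exp(-z^2 / 4) <= 1, half of the Gaussian exponent pays for the factor v; the other half
    is the Gaussian at time 2 t. *)
Lemma he1_moment_pt (t v : R) : 0 < t -> 0 <= v ->
  v * he 1 t v <= Num.sqrt (2 * t) * he 1 (2 * t) v.
Proof.
move=> t0 v0; rewrite !he1E.
have s0 : 0 < Num.sqrt t by rewrite sqrtr_gt0.
have s20 : 0 < Num.sqrt (2 * t) by rewrite sqrtr_gt0 mulr_gt0.
pose z := v / Num.sqrt t.
have z0 : 0 <= z by rewrite divr_ge0// ltW.
have -> : Num.sqrt (2 * t) * ((Num.sqrt (2 * t))^-1 * gs (v / Num.sqrt (2 * t))) =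
    2 / Num.sqrt (2 * pi) * expR (- (z ^+ 2 / 4)).
  rewrite mulrA divff ?gt_eqF// mul1r /gs; congr (_ * expR (- _)).
  rewrite /z !expr_div_n !sqr_sqrtr ?mulr_ge0 ?(ltW t0)//.
  by field; rewrite gt_eqF.
have -> : v * ((Num.sqrt t)^-1 * gs (v / Num.sqrt t)) =
    2 / Num.sqrt (2 * pi) * (z * expR (- (z ^+ 2 / 2))) by rewrite /gs /z; ring.
rewrite ler_pM2l; last by rewrite divr_gt0// sqrt2pi_gt0.
have -> : - (z ^+ 2 / 2) = - (z ^+ 2 / 4) + - (z ^+ 2 / 4) by field.
rewrite expRD mulrA ler_piMl ?expR_ge0// expRN ler_pdivrMr ?expR_gt0// mul1r.
have := expR_ge1Dx (z ^+ 2 / 4) => h.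
by have := sqr_ge0 (z / 2 - 1) => ?; nra.
Qed.

Lemma he1_moment (t D : R) J : 0 < t -> 0 < D ->
  D * \sum_(j < J) j%:R * D * he 1 t (j%:R * D) <= Num.sqrt (2 * t).
Proof.
move=> t0 D0; have s20 : 0 < Num.sqrt (2 * t) by rewrite sqrtr_gt0 mulr_gt0.
case: J => [|J]; first by rewrite big_ord0 mulr0 ltW.
rewrite big_ord_recl !mul0r add0r.
apply: le_trans (_ : D * (\sum_(j < J) Num.sqrt (2 * t) * he 1 (2 * t) (j.+1%:R * D)) <= _).
  rewrite ler_pM2l//; apply: ler_sum => j _ /=.
  by apply: he1_moment_pt => //; rewrite mulr_ge0// ltW.
rewrite -mulr_sumr mulrCA -[leRHS]mulr1 ler_pM2l//.

have := he1_sum_upper (2 * t) D0 J; have := he0_le1 (2 * t) (J%:R * D) => h1 h2.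
exact: le_trans h2 h1.
Qed.

Lemma he1_far k : exists2 C : R, 0 < C & forall t v : R, 0 < t -> 0 < v ->
  he 1 t v <= C * Num.sqrt t ^+ k / v ^+ k / Num.sqrt t.
Proof.
have [C C0 HC] := pow_gauss_bound R k; exists C => // t v t0 v0.
have s0 : 0 < Num.sqrt t by rewrite sqrtr_gt0.
rewrite he1E mulrC ler_pM2r ?invr_gt0// ler_pdivlMr ?exprn_gt0//.
have := HC (v / Num.sqrt t); rewrite gtr0_norm ?divr_gt0// => h.
rewrite mulrC -ler_pdivrMr ?exprn_gt0// mulrAC -expr_div_n.
exact: h.
Qed.

End Moment.

(** * Progressions meeting cells *)

Section LatticeCount.
Variables (R : realType) (d y0 : R) (n : nat).
Hypothesis d0 : 0 < d.

Let ind (z y : R) : (z < y <= z + d)%R%:R = (z < y)%R%:R - (z < y - d)%R%:R :> R.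
Proof.
have [zy|zy] := ltP z y; have [yz|yz] := leP y (z + d) => /=; rewrite ltrBrDr.
- by rewrite ltNge yz subr0.
- by rewrite yz subrr.
- by rewrite ltNge yz subr0.
- by move: yz; rewrite ltNge (le_trans zy)// lerDl ltW.
Qed.

(** The indicator of a cell is a difference of half-line indicators taken d apart, so the sum
    telescopes: one point per cell, unless the cell is out of range. *)
Lemma lattice_count z : \sum_(j < n.+1) (z < y0 + j%:R * d <= z + d)%R%:R =
  (z < y0 + n%:R * d)%R%:R - (z < y0 - d)%R%:R :> R.
Proof.
have -> : \sum_(j < n.+1) (z < y0 + j%:R * d <= z + d)%R%:R =
    \sum_(j < n.+1) ((z < y0 + j%:R * d)%R%:R - (z < y0 + j%:R * d - d)%R%:R) :> R.
  by apply: eq_bigr => j _; rewrite ind.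
elim: n => [|m IH]; first by rewrite big_ord1 mul0r addr0.
rewrite big_ord_recr /= IH.
have -> : y0 + m.+1%:R * d - d = y0 + m%:R * d by rewrite -natr1; ring.
by ring.
Qed.

Lemma lattice_upper (g : R -> R) (G z : R) : 0 <= G ->
  (forall y, z < y <= z + d -> g y <= G) ->
  \sum_(j < n.+1) g (y0 + j%:R * d) * (z < y0 + j%:R * d <= z + d)%R%:R <= G.
Proof.
move=> G0 Hg.
apply: le_trans (_ : \sum_(j < n.+1) G * (z < y0 + j%:R * d <= z + d)%R%:R <= _).
  apply: ler_sum => j _; have [h|_] := boolP (z < _ <= _); last by rewrite !mulr0.
  by rewrite !mulr1; exact: Hg.
rewrite -mulr_sumr lattice_count ler_piMr//.
by case: (z < y0 + _); case: (z < y0 - _) => /=; lra.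
Qed.

Lemma lattice_lower (g : R -> R) (G z : R) :
  (forall y, z < y <= z + d -> G <= g y) -> (forall y, 0 <= g y) ->
  (~~ (y0 - d <= z < y0 + n%:R * d) -> G <= 0) ->
  G <= \sum_(j < n.+1) g (y0 + j%:R * d) * (z < y0 + j%:R * d <= z + d)%R%:R.
Proof.
move=> Hg g0 Hout; have [/andP[h1 h2]|out] := boolP (y0 - d <= z < y0 + n%:R * d); last first.
  by apply: le_trans (Hout out) _; apply: sumr_ge0 => j _; rewrite mulr_ge0 ?ler0n.
apply: le_trans (_ : \sum_(j < n.+1) G * (z < y0 + j%:R * d <= z + d)%R%:R <= _).
  by rewrite -mulr_sumr lattice_count h2 ltNge h1 /= subr0 mulr1.
apply: ler_sum => j _; have [h|_] := boolP (z < _ <= _); last by rewrite !mulr0.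
by rewrite !mulr1; exact: Hg.
Qed.

End LatticeCount.

(** * Gaussian weights in the height instead of V *)

Section FreeAsymptotics.
Variables (R : realType) (X : finType).

Let budget (z1 z2 z3 z4 z5 E : R) : z1 <= E / 2 -> 0 <= z3 -> 0 <= z4 ->
  z1 + z2 + (E / 2 + z5) <= E + (z5 + z3 + z4 + z2).
Proof. by move=> *; lra. Qed.

Variables (Q : X -> X -> R) (nu f r q : X -> R) (sg B : R) (V : X -> R -> R).
Hypothesis CH : chain Q nu f.
Hypothesis W : walk Q f r q sg B V.
Let SQ := chain_stoch CH.
Local Notation K := (kill Q f).
Local Notation s := (srv Q f).
Local Notation nV := (nv sg V).
Variables (h : X -> R) (x0 : X) (v0 b : R).

(** The pairing produces a Gaussian in the height u, whereas the kernel carried by the walk is [hd]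
    in V / sg. Exchanging u and V costs O(1/t); the missing image is a tail at distance at least eta
    rho / sg, of order ka / (eta^2 rho); survival brings another 1 / rho. The term b / t leaves room
    for rounding to the lattice. *)
Lemma free_asymp : exists2 C : R, 0 < C & forall ka eta e : R,
  0 < ka -> ka <= 1 -> 0 < eta -> 0 < e -> exists N, forall m, (N <= m)%N ->
  forall (w : R) (rho := Num.sqrt m.+1%:R : R) (t := ka ^+ 2 * rho ^+ 2 + 1),
  is_true (eta * rho <= w) ->
  is_true (`|iter m K (fun x u => (0 < u)%R%:R * h x * (he 1 t ((u - w) / sg) + b / t)) x0 v0 +
    2 * nu_int nu h * nV x0 v0 * he 2 (rho ^+ 2) (w / sg)| <=
    (e + C * ka * (1 + (eta ^+ 2)^-1)) / rho ^+ 2).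
Proof.
have [C1 C10 H1] := dual_asymp CH W h x0 v0.
have [Mh Mh0 HMh] := fin_ub h.
have [Cs Cs0 HCs] := walk_srv W.
have [Cv Cv0 HCv] := he_lip_v R 1.
have [Cf Cf0 HCf] := he1_far R 2.
have sg0 := walk_sg W; have B0 := walk_B W.
have Y1 : 1 <= 1 + `|v0| by rewrite lerDl.
set Y := 1 + `|v0| in Y1.
have Y0 : 0 < Y := lt_le_trans ltr01 Y1.
pose P := Mh * Cs * Y.
have P0 : 0 < P := mulr_gt0 (mulr_gt0 Mh0 Cs0) Y0.
pose A1 := 3 * B * Cv / sg + `|b|.
have A10 : 0 <= A1.
  exact: (addr_ge0 (divr_ge0 (mulr_ge0 (mulr_ge0 (ler0n _ 3) (ltW B0)) (ltW Cv0)) (ltW sg0)) (normr_ge0 _)).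
pose A2 := Cf * sg ^+ 2.
have A20 : 0 < A2 := mulr_gt0 Cf0 (exprn_gt0 2 sg0).
exists (C1 + P * A2); first exact: (addr_gt0 C10 (mulr_gt0 P0 A20)).
move=> ka eta e ka0 ka1 eta0 e0; have e20 : 0 < e / 2 by rewrite divr_gt0.
have [N1 HN1] := H1 ka (e / 2) ka0 ka1 e20.
pose Z := P * (A1 / ka ^+ 2 + A2 / eta ^+ 2).
have Z0 : 0 <= Z := mulr_ge0 (ltW P0) (addr_ge0 (divr_ge0 A10 (sqr_ge0 _))
  (divr_ge0 (ltW A20) (sqr_ge0 _))).
have Zp : 0 < Z + 1 by rewrite ltr_wpDl.
have [N2 HN2] := inv_sqrt_small (divr_gt0 e20 Zp).
exists (N1 + N2)%N => m Nm w rho t wr.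
have S := HN1 m (leq_trans (leq_addr _ _) Nm) (w / sg); cbv zeta in S.
have Sm := HN2 m (leq_trans (leq_addl _ _) Nm).
rewrite -/rho -/t in S; rewrite -/rho in Sm.
have rho0 : 0 < rho := sqrtSn_gt0 R m.
have rho1 : 1 <= rho := sqrtSn_ge1 R m.
have Zr : Z / rho <= e / 2.
  move: Sm; rewrite ler_pdivlMr// mulrC => hh.
  by apply: le_trans hh; rewrite ler_pM2r ?invr_gt0// lerDl.
have kr0 : 0 < ka * rho := mulr_gt0 ka0 rho0.
have krE : (ka * rho) ^+ 2 = ka ^+ 2 * rho ^+ 2 by rewrite exprMn.
have t1 : 1 <= t by rewrite /t -krE lerDr sqr_ge0.
have t0 : 0 < t := lt_le_trans ltr01 t1.
have tk : ka ^+ 2 * rho ^+ 2 <= t by rewrite /t lerDl.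
have st0 : 0 < Num.sqrt t by rewrite sqrtr_gt0.
have stt : Num.sqrt t ^+ 2 = t by rewrite sqr_sqrtr// ltW.
have st' : Num.sqrt t ^+ 2 = (ka * rho) ^+ 2 + 1 by rewrite stt /t krE.
have [_ _ st1] := sqr_succ_bounds (ltW st0) (ltW kr0) st'.
have er0 : 0 < eta * rho := mulr_gt0 eta0 rho0.
have w0 : 0 < w := lt_le_trans er0 wr.
have w'0 : 0 < w / sg := divr_gt0 w0 sg0.
have ti : t^-1 <= (ka ^+ 2 * rho ^+ 2)^-1.
  by rewrite lef_pV2 ?posrE// mulr_gt0 ?exprn_gt0.
have far : he 1 t (w / sg) <= A2 * (ka * rho + 1) / (eta * rho) ^+ 2.
  apply: le_trans (HCf t (w / sg) t0 w'0) _.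
  have -> : Cf * Num.sqrt t ^+ 2 / (w / sg) ^+ 2 / Num.sqrt t = A2 * (Num.sqrt t / w ^+ 2).
    by rewrite /A2; field; rewrite !gt_eqF.
  rewrite -mulrA ler_pM2l//; apply: ler_pM; [exact: ltW|by rewrite invr_ge0 sqr_ge0|exact: st1|].
  rewrite lef_pV2 ?posrE ?exprn_gt0//; apply: lerXn2r => //; rewrite ?nnegrE; exact: ltW.
pose c := Mh * (A1 / (ka ^+ 2 * rho ^+ 2) + A2 * (ka * rho + 1) / (eta * rho) ^+ 2).
have pw x u : `|1 * ((0 < u)%R%:R * h x * (he 1 t ((u - w) / sg) + b / t)) +
     (-1) * (h x * hd 1 (w / sg) t (nV x u))| <= c * alive x u.
  rewrite mul1r mulN1r /alive; have [u0|u0] := ltP 0 u; last first.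
    have -> : nV x u = 0 by rewrite /nv (walk_Vneg W)// mul0r.
    have -> : hd 1 (w / sg) t 0 = 0 by rewrite /hd sub0r add0r he1_even subrr.
    by rewrite !mul0r !mulr0 subrr normr0.
  rewrite /= mul1r mulr1.
  have -> : h x * (he 1 t ((u - w) / sg) + b / t) - h x * hd 1 (w / sg) t (nV x u) =
    h x * ((he 1 t ((u - w) / sg) - he 1 t (nV x u - w / sg)) + b / t +
       he 1 t (nV x u + w / sg)) by rewrite /hd; ring.
  rewrite normrM; apply: ler_pM => //.
  apply: le_trans (ler_normD _ _) _; apply: lerD; last first.
    rewrite ger0_norm ?he1_ge0//; apply: le_trans far.
    apply: he1_decr; first exact: ltW.
    by rewrite lerDr divr_ge0 ?(walk_V0 W)// ltW.
  apply: le_trans (ler_normD _ _) _.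
  have a1 : `|he 1 t ((u - w) / sg) - he 1 t (nV x u - w / sg)| <= 3 * B * Cv / sg / t.
    apply: le_trans (HCv t _ _ t0) _.
    have -> : (u - w) / sg - (nV x u - w / sg) = (u - V x u) / sg by rewrite /nv; ring.
    rewrite exprVn stt normrM [`|sg^-1|]gtr0_norm ?invr_gt0//.
    have uV : `|u - V x u| <= 3 * B.
      have := walk_dist W x u; rewrite /alive u0 mul1r mulr1.
      rewrite distrC => dV; have -> : u - V x u = (u + r x - V x u) - r x by ring.
      apply: le_trans (ler_normB _ _) _; apply: le_trans (lerD dV (walk_rB W x)) _.
      by apply: eqle; ring.
    have -> : 3 * B * Cv / sg / t = Cv / t * (3 * B / sg) by ring.
    apply: ler_wpM2l; first by rewrite divr_ge0// ltW.
    by rewrite ler_pM2r ?invr_gt0.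
  have a2 : `|b / t| = `|b| / t by rewrite normrM [`|t^-1|]gtr0_norm ?invr_gt0.
  rewrite a2; apply: le_trans (lerD a1 (lexx _)) _.
  by rewrite -mulrDl -/A1 ler_wpM2l.
have c0 : 0 <= c.
  apply: (mulr_ge0 (ltW Mh0)); apply: addr_ge0.
    by rewrite divr_ge0// mulr_ge0 ?sqr_ge0.
  by rewrite divr_ge0 ?sqr_ge0// mulr_ge0 ?(ltW A20)// addr_ge0// ltW.
have D1 := iter_kill_bound f SQ m pw x0 v0.
rewrite iter_kill_lin mul1r mulN1r in D1.
have D2 : c * s m x0 v0 <= (Z / rho + P * A2 * ka / eta ^+ 2) / rho ^+ 2.
  apply: le_trans (ler_wpM2l c0 (HCs m x0 v0)) _.
  by apply: eqle; rewrite -/rho -/Y /c /Z /P; field; rewrite !gt_eqF.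
move: D1 S; set I1 := iter m K _ x0 v0; set I2 := iter m K _ x0 v0 => D1 S.
have -> : I1 + 2 * nu_int nu h * nV x0 v0 * he 2 (rho ^+ 2) (w / sg) =
  (I1 - I2) + (I2 + 2 * nu_int nu h * nV x0 v0 * he 2 (rho ^+ 2) (w / sg)) by ring.
apply: le_trans (ler_normD _ _) _.
apply: le_trans (lerD (le_trans D1 D2) S) _; rewrite -mulrDl.
rewrite ler_pM2r ?invr_gt0 ?exprn_gt0//.
have ei : 0 <= (eta ^+ 2)^-1 by rewrite invr_ge0 sqr_ge0.
have PA : 0 <= P * A2 := ltW (mulr_gt0 P0 A20).
have -> : (C1 + P * A2) * ka * (1 + (eta ^+ 2)^-1) =
  C1 * ka + C1 * ka * (eta ^+ 2)^-1 + P * A2 * ka + P * A2 * ka / eta ^+ 2 by ring.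
have q1 : 0 <= C1 * ka * (eta ^+ 2)^-1 := mulr_ge0 (mulr_ge0 (ltW C10) (ltW ka0)) ei.
have q2 : 0 <= P * A2 * ka := mulr_ge0 PA (ltW ka0).
exact: budget.
Qed.

End FreeAsymptotics.

(** * Removing the Gaussian average *)

Section LocalFar.
Variables (R : realType) (X : finType).

Let half_mass (a p E P : R) : 0 <= a -> a <= 1 -> 0 <= p -> p <= P -> 1 - E <= p + a -> 0 < E ->
  [/\ `|1 - (a + (p + a)) / 2| <= E + P, (a + (p + a)) / 2 <= 1 + P & 0 <= (a + (p + a)) / 2].
Proof. by move=> *; split; [rewrite ler_norml; apply/andP; split|..]; lra. Qed.

Let budget (z1 z2 z3 E : R) : 0 < E -> z1 + z2 + z3 <= E / 8 ->
  E / 8 + z1 + (E / 8 + z3 + E / 8 + z2) <= E.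
Proof. by move=> *; lra. Qed.

Let sqrt2_le2 : Num.sqrt 2 <= 2 :> R.
Proof. by rewrite -[leRHS](ger0_norm (ler0n _ 2)) -sqrtr_sqr ler_wsqrtr//; lra. Qed.

Variables (Q : X -> X -> R) (nu f r q rs qs : X -> R) (sg B Bs : R) (V Vs : X -> R -> R).
Hypothesis CH : chain Q nu f.
Hypothesis W : walk Q f r q sg B V.
Hypothesis Ws : walk (Pstar Q nu) (fun x => - f x) rs qs sg Bs Vs.
Variables (d Csm : R).
Hypothesis SM : smoothing Q f d Csm.

Let d0 : 0 < d. Proof. by case: SM. Qed.
Local Notation K := (kill Q f).

Variables (psi : X -> R) (z : R).
Hypothesis psi0 : forall x, 0 <= psi x.
Local Notation H m := (iter m K (cell d psi z)).

Lemma sum_sym (F : nat -> R) J : \sum_(j < J + J.+1) F j =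
  \sum_(i < J) F (J - i.+1)%N + \sum_(i < J.+1) F (J + i)%N.
Proof.
rewrite big_split_ord /=; congr (_ + _).
by rewrite (reindex_inj rev_ord_inj).
Qed.

Let D := d / sg.

(** The weights, of width ka sqrt n, have total mass near 2 / D because [he 0] tends to 1 on each
    half-line. By [cell_reg2] the value j d away differs by O(j / n^(3/2)) beyond a small multiple
    of 1/n, and the first moment of the weights turns this into O(ka / n). *)
Lemma avg_approx (eta e : R) : 0 < eta -> 0 < e -> exists ka1 de : R,
  [/\ 0 < ka1, 0 < de & forall ka, 0 < ka -> ka <= ka1 -> exists N, forall n, (N <= n)%N ->
  forall (x : X) (w : R) (J : nat) (rho := Num.sqrt n.+1%:R : R)
    (t := ka ^+ 2 * rho ^+ 2 + 1), is_true (eta * rho <= w) ->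
  is_true (1 - de <= he 0 t (J.+1%:R * D)) ->
  is_true (`|H n.+1 x w - D / 2 * \sum_(j < J + J.+1)
     he 1 t ((w - J%:R * d + j%:R * d - w) / sg) * H n.+1 x (w - J%:R * d + j%:R * d)|
     <= e / rho ^+ 2)].
Proof.
move=> eta0 e0; have [Cz Cz0 HCz] := cell_consts CH Ws SM z psi0.
have [Cb Cb0 HCb] := he_bound R 1.
have dp := d0; have sg0 := walk_sg W.
have Dp : 0 < D := divr_gt0 dp sg0.
have e160 : 0 < e / 8 by rewrite divr_gt0.
have eta20 : 0 < eta / 2 by rewrite divr_gt0.
have [C2 [N1 [C20 HN1]]] := cell_reg2 CH W Ws SM z psi0 e160 eta20.
(* Bounds the first-moment term 2 C2 ka / D by e / 8. *)
pose ka1 := e / 8 / (2 * C2 / D).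
have ka10 : 0 < ka1 := divr_gt0 e160 (divr_gt0 (mulr_gt0 (ltr0n _ 2) C20) Dp).
exists ka1, (e / 8 / Cz); split => //; first exact: divr_gt0.
move=> ka ka0 kale.
pose Z := Cz * (D * Cb / ka) + 2 * C2 / D + e / 8 * (D * Cb / ka).
have Z0 : 0 <= Z.
  have qq : 0 <= D * Cb / ka := divr_ge0 (mulr_ge0 (ltW Dp) (ltW Cb0)) (ltW ka0).
  apply: addr_ge0; [apply: addr_ge0|].
  - exact: (mulr_ge0 (ltW Cz0) qq).
  - exact: (divr_ge0 (mulr_ge0 (ler0n _ 2) (ltW C20)) (ltW Dp)).
  - exact: (mulr_ge0 (ltW e160) qq).
have Zp : 0 < Z + 1 by rewrite ltr_wpDl.
have [N2 HN2] := inv_sqrt_small (divr_gt0 e160 Zp).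
exists (N1 + N2)%N => n Nn x w J rho t wr HJ.
have nN1 : (N1 <= n.+1)%N by apply: leq_trans (leqnSn n); exact: leq_trans (leq_addr _ _) Nn.
have Sm := HN2 n (leq_trans (leq_addl _ _) Nn); rewrite -/rho in Sm.
have rho0 : 0 < rho := sqrtSn_gt0 R n.
have Zr : Z / rho <= e / 8.
  move: Sm; rewrite ler_pdivlMr// mulrC => hh.
  by apply: le_trans hh; rewrite ler_pM2r ?invr_gt0// lerDl.
have rS : rho <= Num.sqrt n.+2%:R by rewrite ler_wsqrtr// ler_nat.
have rS0 : 0 < Num.sqrt n.+2%:R :> R := sqrtSn_gt0 R n.+1.
have wr' : eta / 2 * Num.sqrt n.+2%:R <= w.
  apply: le_trans wr.
  have -> : eta * rho = eta / 2 * (2 * rho) by field.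
  rewrite ler_pM2l//; apply: sqrtSn_double; clear; lia.
have rI k : (Num.sqrt n.+2%:R ^+ k)^-1 <= (rho ^+ k)^-1 :> R.
  rewrite lef_pV2 ?posrE ?exprn_gt0//; apply: lerXn2r => //; rewrite ?nnegrE; exact: ltW.
have reg j : `|H n.+1 x (w + j%:R * d) - H n.+1 x w| <= e / 8 / rho ^+ 2 + j%:R * (C2 / rho ^+ 3) /\
    `|H n.+1 x (w - j%:R * d) - H n.+1 x w| <= e / 8 / rho ^+ 2 + j%:R * (C2 / rho ^+ 3).
  have bnd : e / 8 / Num.sqrt n.+2%:R ^+ 2 + j%:R * (C2 / Num.sqrt n.+2%:R ^+ 3) <=
      e / 8 / rho ^+ 2 + j%:R * (C2 / rho ^+ 3).
    by apply: lerD; [rewrite ler_pM2l|rewrite ler_wpM2l// ler_pM2l].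
  by have [a1 a2] := HN1 n.+1 nN1 x w j wr'; split; [exact: le_trans a1 bnd|exact: le_trans a2 bnd].
have kr0 : 0 < ka * rho := mulr_gt0 ka0 rho0.
have krE : (ka * rho) ^+ 2 = ka ^+ 2 * rho ^+ 2 by rewrite exprMn.
have t1 : 1 <= t by rewrite /t -krE lerDr sqr_ge0.
have t0 : 0 < t := lt_le_trans ltr01 t1.
have st0 : 0 < Num.sqrt t by rewrite sqrtr_gt0.
have stt : Num.sqrt t ^+ 2 = t by rewrite sqr_sqrtr// ltW.
have st' : Num.sqrt t ^+ 2 = (ka * rho) ^+ 2 + 1 by rewrite stt /t krE.
have [_ st2 st1] := sqr_succ_bounds (ltW st0) (ltW kr0) st'.
pose phi (i : nat) := he 1 t (i%:R * D).
have phi0 i : 0 <= phi i := he1_ge0 _ _.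
pose S1 := \sum_(i < J) phi i.+1; pose S2 := \sum_(i < J.+1) phi i.
have S12 : S2 = phi 0%N + S1 by rewrite /S2 big_ord_recl.
have DS1 : D * S1 <= 1 := le_trans (he1_sum_upper t Dp J) (he0_le1 t _).
have DS2 : 1 - e / 8 / Cz <= D * S2 := le_trans HJ (he1_sum_lower t Dp J.+1).
have DS1p : 0 <= D * S1 by rewrite mulr_ge0 ?(ltW Dp)// sumr_ge0.
have p0 : D * phi 0%N <= D * Cb / ka / rho.
  have -> : D * Cb / ka / rho = D * (Cb / (ka * rho)) by field; rewrite !gt_eqF.
  rewrite ler_pM2l//; apply: le_trans (ler_norm _) _.
  apply: le_trans (HCb t _ t0) _; rewrite expr1 ler_pM2l//.
  by rewrite lef_pV2 ?posrE.
have p00 : 0 <= D * phi 0%N by rewrite mulr_ge0// ltW.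
pose S := D / 2 * (S1 + S2).
pose h := H n.+1 x w.
have [_ HS] := HCz n.+1.
have /andP[h0 hC] := HS x w; rewrite -/h in h0 hC.
have hC' : h <= Cz / rho ^+ 2 by apply: le_trans hC _; rewrite ler_pM2l.
have DS2' : D * S2 = D * phi 0%N + D * S1 by rewrite S12 mulrDr.
have SE : S = (D * S1 + D * S2) / 2 by rewrite /S; ring.
have [S1abs Sle Sp] : [/\ `|1 - S| <= e / 8 / Cz + D * Cb / ka / rho,
    S <= 1 + D * Cb / ka / rho & 0 <= S].
  rewrite SE DS2'; rewrite DS2' in DS2.
  exact: (half_mass DS1p DS1 p00 p0 DS2 (divr_gt0 e160 Cz0)).
pose g y := he 1 t ((y - w) / sg).
have gp i : g (w + i%:R * d) = phi i.
  by rewrite /g /phi; congr he; rewrite /D; ring.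
have gm i : g (w - i%:R * d) = phi i.
  by rewrite /g /phi -(he1_even t (i%:R * D)); congr he; rewrite /D; ring.
pose A := \sum_(i < J) phi i.+1 * H n.+1 x (w - i.+1%:R * d) +
  \sum_(i < J.+1) phi i * H n.+1 x (w + i%:R * d).
have AE : \sum_(j < J + J.+1) he 1 t ((w - J%:R * d + j%:R * d - w) / sg) *
     H n.+1 x (w - J%:R * d + j%:R * d) = A.
  rewrite (sum_sym (fun j => g (w - J%:R * d + j%:R * d) * H n.+1 x (w - J%:R * d + j%:R * d))).
  congr (_ + _); apply: eq_bigr => i _.
    have -> : w - J%:R * d + (J - i.+1)%:R * d = w - i.+1%:R * d.
      by rewrite natrB//; ring.
    by rewrite gm.
  have -> : w - J%:R * d + (J + i)%:R * d = w + i%:R * d by rewrite natrD; ring.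
  by rewrite gp.
rewrite AE -/h.
pose M1 := \sum_(i < J.+1) i%:R * phi i.
have M1E : \sum_(i < J) i.+1%:R * phi i.+1 = M1 by rewrite /M1 big_ord_recl mul0r add0r.
have M1b : D * M1 <= Num.sqrt (2 * t) / D.
  rewrite ler_pdivlMr//; apply: le_trans (he1_moment J.+1 t0 Dp).
  apply: eqle; rewrite /M1 -mulrA mulr_suml; congr (_ * _).
  by apply: eq_bigr => i _; rewrite /phi; ring.
have AS : `|A - h * (S1 + S2)| <= (S1 + S2) * (e / 8 / rho ^+ 2) + 2 * M1 * (C2 / rho ^+ 3).
  have -> : A - h * (S1 + S2) = \sum_(i < J) phi i.+1 * (H n.+1 x (w - i.+1%:R * d) - h) +
     \sum_(i < J.+1) phi i * (H n.+1 x (w + i%:R * d) - h).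
    rewrite /A /S1 /S2 mulrDr !mulr_sumr opprD addrACA -!sumrB.
    by congr (_ + _); apply: eq_bigr => i _; ring.
  apply: le_trans (ler_normD _ _) _.
  have -> : (S1 + S2) * (e / 8 / rho ^+ 2) + 2 * M1 * (C2 / rho ^+ 3) =
    \sum_(i < J) phi i.+1 * (e / 8 / rho ^+ 2 + i.+1%:R * (C2 / rho ^+ 3)) +
    \sum_(i < J.+1) phi i * (e / 8 / rho ^+ 2 + i%:R * (C2 / rho ^+ 3)).
    transitivity (S1 * (e / 8 / rho ^+ 2) + (\sum_(i < J) i.+1%:R * phi i.+1) * (C2 / rho ^+ 3) +
      (S2 * (e / 8 / rho ^+ 2) + M1 * (C2 / rho ^+ 3))); first by rewrite M1E; ring.
    rewrite /S1 /S2 /M1 !mulr_suml -!big_split.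
    by congr (_ + _); apply: eq_bigr => i _ /=; ring.
  apply: lerD; apply: le_trans (ler_norm_sum _ _ _) _; apply: ler_sum => i _;
    rewrite normrM (ger0_norm (phi0 _)); apply: ler_wpM2l => //.
    by have [_] := reg i.+1.
  by have [] := reg i.
have E1 : `|h - h * S| <= (e / 8 + Cz * (D * Cb / ka) / rho) / rho ^+ 2.
  have -> : h - h * S = h * (1 - S) by ring.
  rewrite normrM (ger0_norm h0); apply: le_trans (ler_pM h0 (normr_ge0 _) hC' S1abs) _.
  by apply: eqle; field; rewrite !gt_eqF.
have E2 : `|h * S - D / 2 * A| <= (e / 8 + e / 8 * (D * Cb / ka) / rho + e / 8 + 2 * C2 / D / rho) / rho ^+ 2.
  have D20 : 0 <= D / 2 by rewrite divr_ge0// ltW.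
  have -> : h * S - D / 2 * A = - (D / 2 * (A - h * (S1 + S2))) by rewrite /S; ring.
  rewrite normrN normrM (ger0_norm D20); apply: le_trans (ler_wpM2l D20 AS) _.
  have -> : D / 2 * ((S1 + S2) * (e / 8 / rho ^+ 2) + 2 * M1 * (C2 / rho ^+ 3)) =
    S * (e / 8 / rho ^+ 2) + D * M1 * (C2 / rho ^+ 3) by rewrite /S; field; rewrite gt_eqF.
  have er : 0 <= e / 8 / rho ^+ 2 by rewrite divr_ge0 ?sqr_ge0// ltW.
  have cr : 0 <= C2 / rho ^+ 3 by rewrite divr_ge0 ?exprn_ge0// ltW.
  have s2t : Num.sqrt (2 * t) <= 2 * (ka * rho + 1).
    by rewrite sqrtrM//; apply: ler_pM => //; exact: sqrtr_ge0.
  have M2 : D * M1 <= 2 * (ka * rho + 1) / D.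
    by apply: le_trans M1b _; rewrite ler_pM2r ?invr_gt0.
  apply: le_trans (lerD (ler_wpM2r er Sle) (ler_wpM2r cr M2)) _.
  have k2 : 2 * C2 / D * ka <= e / 8.
    by rewrite mulrC -ler_pdivlMr// divr_gt0// mulr_gt0.
  apply: le_trans (_ : (e / 8 + e / 8 * (D * Cb / ka) / rho + 2 * C2 / D * ka + 2 * C2 / D / rho) / rho ^+ 2 <= _).
    by apply: eqle; field; rewrite !gt_eqF.
  rewrite ler_pM2r ?invr_gt0 ?exprn_gt0// lerD2r lerD2l.
  exact: k2.
have -> : h - D / 2 * A = (h - h * S) + (h * S - D / 2 * A) by ring.
apply: le_trans (ler_normD _ _) _; apply: le_trans (lerD E1 E2) _.
rewrite -mulrDl ler_pM2r ?invr_gt0 ?exprn_gt0//.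
have ZE : Z / rho = Cz * (D * Cb / ka) / rho + 2 * C2 / D / rho + e / 8 * (D * Cb / ka) / rho.
  by rewrite /Z; ring.
rewrite ZE in Zr.
exact: budget.
Qed.

End LocalFar.

(** * Killed mass started at height of order sqrt n *)

Section LocalLarge.
Variables (R : realType) (X : finType).

Let dist_right (c y h : R) : c < y -> y <= c + h -> `|y - (c + h)| <= h.
Proof. by move=> *; rewrite ler_norml; apply/andP; split; lra. Qed.

Let dist_left (c y h : R) : c < y -> y <= c + h -> `|c - y| <= h.
Proof. by move=> *; rewrite ler_norml; apply/andP; split; lra. Qed.

Let dist_out (c w j h : R) : 0 <= j -> 0 < h ->
  c < w - j - h \/ w - j + (j + j) <= c -> j <= `|c - w|.
Proof.
move=> j0 h0 [?|?]; last by apply: le_trans (ler_norm _); lra.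
by rewrite ler0_norm; lra.
Qed.

Let budget (E g g' l1 l2 S h : R) : - E <= h - S -> h - S <= E -> l1 + g' <= E -> - E <= l2 + g ->
  S <= l1 -> l2 <= S -> - g - (E + E) <= h /\ h <= - g' + (E + E).
Proof. by move=> *; split; lra. Qed.

Variables (Q : X -> X -> R) (nu f r q rs qs : X -> R) (sg B Bs : R) (V Vs : X -> R -> R).
Hypothesis CH : chain Q nu f.
Hypothesis W : walk Q f r q sg B V.
Hypothesis Ws : walk (Pstar Q nu) (fun x => - f x) rs qs sg Bs Vs.
Variables (d Csm : R).
Hypothesis SM : smoothing Q f d Csm.

Let nup x : 0 < nu x. Proof. exact: (nu_gt0 CH). Qed.
Let d0 : 0 < d. Proof. by case: SM. Qed.
Local Notation K := (kill Q f).
Local Notation Ks := (kill (Pstar Q nu) (fun x => - f x)).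

Variables (psi : X -> R).
Hypothesis psi0 : forall x, 0 <= psi x.

(** The integrand of the theorem with the starting point of the dual summed out, nu being invariant
    for the dual kernel. That [Vs] vanishes at nonpositive heights encodes survival of the first
    dual step. *)
Definition dualW (Vs : X -> R -> R) (psi : X -> R) (u : R) : R :=
  \sum_x nu x * psi x * Vs x (u - f x).

Lemma dual_sum_asymp (b zz : R) : exists2 C : R, 0 < C & forall ka eta e : R,
  0 < ka -> ka <= 1 -> 0 < eta -> 0 < e -> exists N, forall m, (N <= m)%N ->
  forall (x1 : X) (w : R) (rho := Num.sqrt m.+1%:R : R) (t := ka ^+ 2 * rho ^+ 2 + 1),
  is_true (eta * rho <= w) ->
  is_true (`|\sum_x nu x * psi x * iter m Ks (fun x u => (0 < u)%R%:R * entry Q nu x1 x *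
       (he 1 t ((u - w) / sg) + b / t)) x (zz - f x) +
    2 * dualW Vs psi zz / sg * he 2 (rho ^+ 2) (w / sg)| <=
    (e + C * ka * (1 + (eta ^+ 2)^-1)) / rho ^+ 2).
Proof.
have H0 (p : X * X) : exists C : R, 0 < C /\ forall ka eta e : R,
  0 < ka -> ka <= 1 -> 0 < eta -> 0 < e -> exists N, forall m, (N <= m)%N ->
  forall (w : R) (rho := Num.sqrt m.+1%:R : R) (t := ka ^+ 2 * rho ^+ 2 + 1),
  is_true (eta * rho <= w) ->
  is_true (`|iter m Ks (fun x u => (0 < u)%R%:R * entry Q nu p.1 x *
       (he 1 t ((u - w) / sg) + b / t)) p.2 (zz - f p.2) +
    2 * nu_int nu (entry Q nu p.1) * nv sg Vs p.2 (zz - f p.2) * he 2 (rho ^+ 2) (w / sg)| <=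
    (e + C * ka * (1 + (eta ^+ 2)^-1)) / rho ^+ 2).
  have [C C0 HC] := free_asymp (dual_chain CH) Ws (entry Q nu p.1) p.2 (zz - f p.2) b.
  by exists C.
have [Cp HCp] := choice H0.
have [C C0 HC] := fin_ub Cp; have [Mp Mp0 HMp] := fin_ub psi.
exists (Mp * C); first exact: mulr_gt0.
move=> ka eta e ka0 ka1 eta0 e0.
have e'0 : 0 < e / Mp := divr_gt0 e0 Mp0.
have H1 (p : X * X) := (HCp p).2 ka eta (e / Mp) ka0 ka1 eta0 e'0.
have [N HN] := choice H1; clear H0 H1.
exists (\sum_p N p)%N => m Nm x1 w rho t wr.
have I1 : nu_int nu (entry Q nu x1) = 1.
  rewrite /nu_int; under eq_bigr do rewrite mulrC (nu_entry CH).
  by case: (chain_stoch CH).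
have Hp x : `|iter m Ks (fun x u => (0 < u)%R%:R * entry Q nu x1 x *
       (he 1 t ((u - w) / sg) + b / t)) x (zz - f x) +
    2 * nv sg Vs x (zz - f x) * he 2 (rho ^+ 2) (w / sg)| <=
    (e / Mp + C * ka * (1 + (eta ^+ 2)^-1)) / rho ^+ 2.
  have nN : (N (x1, x) <= m)%N.
    by apply: leq_trans Nm; rewrite (bigD1 (x1, x)) //= leq_addr.
  have S := HN (x1, x) m nN w; cbv zeta in S; rewrite -/rho -/t /= I1 mulr1 in S.
  apply: le_trans (S wr) _; rewrite ler_pM2r ?invr_gt0 ?exprn_gt0 ?sqrtSn_gt0//.
  rewrite lerD2l ler_wpM2r ?addr_ge0 ?invr_ge0 ?sqr_ge0//.
  by rewrite ler_pM2r//; apply: le_trans (ler_norm _) (HC _).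
set E := (_ + C * ka * _) / _ in Hp.
have -> : 2 * dualW Vs psi zz / sg * he 2 (rho ^+ 2) (w / sg) =
   \sum_x nu x * psi x * (2 * nv sg Vs x (zz - f x) * he 2 (rho ^+ 2) (w / sg)).
  rewrite /dualW mulr_sumr !mulr_suml; apply: eq_bigr => x _; rewrite /nv; ring.
rewrite -big_split /=; apply: le_trans (ler_norm_sum _ _ _) _.
apply: le_trans (_ : \sum_x nu x * (Mp * E) <= _).
  apply: ler_sum => x _; rewrite -mulrDr normrM.
  have np : 0 <= nu x * psi x by rewrite mulr_ge0// ltW.
  have pM : psi x <= Mp := le_trans (ler_norm _) (HMp x).
  have E0 : 0 <= E := le_trans (normr_ge0 _) (Hp x).
  rewrite (ger0_norm np); apply: le_trans (ler_wpM2l np (Hp x)) _.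
  by rewrite -[leLHS]mulrA; apply: ler_wpM2l; [exact: ltW|exact: ler_wpM2r].
have n1 : \sum_x nu x = 1 by case: (chain_inv CH) => _ [].
rewrite -mulr_suml n1 mul1r /E.
by apply: eqle; field; rewrite !gt_eqF// sqrtSn_gt0.
Qed.

Let D := d / sg.

Lemma he0_near1 (t de A : R) : 0 < t -> 0 < de -> exists J : nat, [/\ (0 < J)%N,
  A <= J%:R * D & 1 - de <= he 0 t (J.+1%:R * D)].
Proof.
move=> t0 de0; have [a a0 Ha] := erf_cvg de0.
have Dp : 0 < D := divr_gt0 d0 (walk_sg W).
have st0 : 0 < Num.sqrt t by rewrite sqrtr_gt0.
pose M := (`|A| + a * Num.sqrt t) / D.
have M0 : 0 <= M := divr_ge0 (addr_ge0 (normr_ge0 A) (mulr_ge0 (ltW a0) (ltW st0))) (ltW Dp).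
have Mb : M <= (Num.bound M)%:R by rewrite ltW// archi_boundP.
exists (Num.bound M).+1.
have h : M * D <= (Num.bound M).+1%:R * D.
  by rewrite ler_pM2r//; apply: le_trans Mb _; rewrite ler_nat.
have h2 : M * D <= (Num.bound M).+2%:R * D.
  by rewrite ler_pM2r//; apply: le_trans Mb _; rewrite ler_nat; apply: leq_trans (leqnSn _).
have ME : M * D = `|A| + a * Num.sqrt t by rewrite /M divfK// gt_eqF.
rewrite ME in h h2; split => //.
  apply: le_trans (ler_norm A) _; apply: le_trans h; rewrite lerDl.
  exact: mulr_ge0 (ltW a0) (ltW st0).
rewrite /he expr0 mul1r /=.
have : a <= (Num.bound M).+2%:R * D * (Num.sqrt t)^-1.
  rewrite ler_pdivlMr//; apply: le_trans h2; by rewrite lerDr.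
by move=> /Ha; rewrite ler_norml => /andP[? _]; lra.
Qed.

Variable z : R.
Local Notation H m := (iter m K (cell d psi z)).

(** [avg_approx] turns the value at w into a Gaussian sum, the pairing lemmas turn this sum into
    dual expectations started from z + d and from z, and [dual_sum_asymp] evaluates these. Moving a
    lattice point to the end of its cell is paid by the terms Cv D / t, added above and subtracted
    below. *)
Lemma local_far (eta e : R) : 0 < eta -> 0 < e -> exists N, forall n, (N <= n)%N ->
  forall (x1 : X) (w : R) (rho := Num.sqrt n.+1%:R : R), is_true (eta * rho <= w) ->
  is_true (- (d / sg ^+ 2) * dualW Vs psi z * he 2 (rho ^+ 2) (w / sg) - e / rho ^+ 2 <=
    H n.+1 x1 w) /\
  is_true (H n.+1 x1 w <=
    - (d / sg ^+ 2) * dualW Vs psi (z + d) * he 2 (rho ^+ 2) (w / sg) + e / rho ^+ 2).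
Proof.
move=> eta0 e0; have sg0 := walk_sg W; have dp := d0.
have Dp : 0 < D := divr_gt0 dp sg0.
have [Cv Cv0 HCv] := he_lip_v R 1; have [Cf Cf0 HCf] := he1_far R 1.
have CvD : 0 < Cv * D := mulr_gt0 Cv0 Dp.
have [C1 C10 HC1] := dual_sum_asymp (Cv * D) (z + d).
have [C2 C20 HC2] := dual_sum_asymp (- (Cv * D)) z.
have e20 : 0 < e / 2 by rewrite divr_gt0.
have [ka1 [de [ka10 de0 HA]]] := avg_approx CH W Ws SM z psi0 eta0 e20.
pose G := D / 2 * (C1 + C2) * (1 + (eta ^+ 2)^-1).
have I0 : 0 < 1 + (eta ^+ 2)^-1 by rewrite ltr_wpDr ?invr_ge0 ?sqr_ge0.
have G0 : 0 < G := mulr_gt0 (mulr_gt0 (divr_gt0 Dp (ltr0n _ 2)) (addr_gt0 C10 C20)) I0.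
have e40 : 0 < e / 4 by rewrite divr_gt0.
have [ka [ka0 kale1 kale2 kale3]] : exists ka : R, [/\ 0 < ka, ka <= 1, ka <= ka1 & G * ka <= e / 4].
  exists (Num.min 1 (Num.min ka1 (e / 4 / G))); split.
  - by rewrite !lt_min ltr01 ka10 divr_gt0.
  - by rewrite ge_min lexx.
  - by rewrite !ge_min lexx orbT.
  - by rewrite mulrC -ler_pdivlMr// !ge_min lexx !orbT.
have eD0 : 0 < e / (2 * D) := divr_gt0 e0 (mulr_gt0 (ltr0n _ 2) Dp).
have [N1 HN1] := HC1 ka eta _ ka0 kale1 eta0 eD0.
have [N2 HN2] := HC2 ka eta _ ka0 kale1 eta0 eD0.
have [N3 HN3] := HA ka ka0 kale2.
exists (N1 + N2 + N3)%N => n Nn x1 w rho wr.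
have nN1 : (N1 <= n)%N := leq_trans (leq_trans (leq_addr _ _) (leq_addr _ _)) Nn.
have nN2 : (N2 <= n)%N := leq_trans (leq_trans (leq_addl _ _) (leq_addr _ _)) Nn.
have nN3 : (N3 <= n)%N := leq_trans (leq_addl _ _) Nn.
have A1 := HN1 n nN1 x1 w; have A2 := HN2 n nN2 x1 w.
have A3 := fun J => HN3 n nN3 x1 w J.
cbv zeta in A1, A2, A3; rewrite -/rho in A1 A2.
have {}A3 J := A3 J wr; rewrite -/rho in A3.
set t := ka ^+ 2 * rho ^+ 2 + 1 in A1 A2 A3.
have {}A1 := A1 wr; have {}A2 := A2 wr.
have rho0 : 0 < rho := sqrtSn_gt0 R n.
have t0 : 0 < t by rewrite /t ltr_wpDl// mulr_ge0 ?sqr_ge0.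
have st0 : 0 < Num.sqrt t by rewrite sqrtr_gt0.
have stt : Num.sqrt t ^+ 2 = t by rewrite sqr_sqrtr// ltW.
(* This threshold makes the Gaussian at most Cv D / t off the range of the progression, as
   [lattice_lower] requires. A large J costs nothing, the error bounds being independent of it. *)
have [J [J0 JA J1]] := he0_near1 (Cf * t / (Cv * D)) t0 de0.
have {}A3 := A3 J J1; rewrite addnS in A3.
pose g y := he 1 t ((y - w) / sg).
have g0 y : 0 <= g y := he1_ge0 _ _.
pose y0 := w - J%:R * d.
pose ys := [seq y0 + j%:R * d | j <- index_iota 0 (J + J).+1].
have ysE (F : R -> R) : \sum_(y <- ys) F y = \sum_(j < (J + J).+1) F (y0 + j%:R * d).
  by rewrite /ys big_map big_mkord.
have lip y y' : `|y - y'| <= d -> g y <= g y' + Cv * D / t.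
  move=> yd; have := HCv t ((y - w) / sg) ((y' - w) / sg) t0.
  have -> : (y - w) / sg - (y' - w) / sg = (y - y') / sg by ring.
  rewrite normrM (@ger0_norm _ sg^-1) ?invr_ge0 ?(ltW sg0)// exprVn stt.
  have yD : `|y - y'| / sg <= D by rewrite ler_pM2r// invr_gt0.
  have c0 : 0 <= Cv * t^-1 by rewrite mulr_ge0 ?invr_ge0 ?(ltW Cv0) ?(ltW t0).
  move=> h1; have h2 := le_trans h1 (ler_wpM2l c0 yD).
  have h3 := le_trans (ler_norm _) h2.
  rewrite -/(g y) -/(g y') in h3; have -> : Cv * D / t = Cv * t^-1 * D by ring.
  by rewrite addrC -lerBlDr.
have Up z' : \sum_(y <- ys) g y * (z' < y <= z' + d)%R%:R <= he 1 t ((z' + d - w) / sg) + Cv * D / t.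
  rewrite (ysE (fun y => g y * (z' < y <= z' + d)%R%:R)); apply: lattice_upper => //.
    by rewrite addr_ge0 ?he1_ge0// divr_ge0 ?ltW.
  by move=> y /andP[? ?]; apply: lip; exact: dist_right.
have Lo z' : 0 < z' -> he 1 t ((z' - w) / sg) + - (Cv * D) / t <=
    \sum_(y <- ys) g y * (z' < y <= z' + d)%R%:R.
  move=> _; rewrite (ysE (fun y => g y * (z' < y <= z' + d)%R%:R)); apply: lattice_lower => //.
    by move=> y /andP[? ?]; rewrite mulNr lerBlDr; apply: lip; exact: dist_left.
  move=> out; rewrite mulNr subr_le0.
  have Jd : J%:R * d <= `|z' - w|.
    move: out; rewrite negb_and -ltNge -leNgt natrD mulrDl /y0 => /orP h.
    exact: (dist_out (mulr_ge0 (ler0n R J) (ltW dp)) dp).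
  have JD : J%:R * D <= `|(z' - w) / sg|.
    rewrite normrM (@ger0_norm _ sg^-1) ?invr_ge0 ?(ltW sg0)// /D mulrA.
    by rewrite ler_pM2r ?invr_gt0.
  have JD0 : 0 < J%:R * D by rewrite mulr_gt0// ltr0n.
  have -> : he 1 t ((z' - w) / sg) = he 1 t `|(z' - w) / sg|.
    by case: (ger0P ((z' - w) / sg)) => // _; rewrite he1_even.
  apply: le_trans (he1_decr t (ltW JD0) JD) _.
  apply: le_trans (HCf t _ t0 JD0) _.
  have -> : Cf * Num.sqrt t ^+ 1 / (J%:R * D) ^+ 1 / Num.sqrt t = Cf / (J%:R * D).
    by rewrite !expr1; field; rewrite !gt_eqF// ltr0n.
  rewrite ler_pdivrMr// mulrAC ler_pdivlMr// -ler_pdivrMl// mulrC.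
  exact: JA.
have PU := @pairing_upper _ _ Q nu f CH d ys g x1 g0 (fun u => he 1 t ((u - w) / sg) + Cv * D / t) Up n psi z psi0.
have PL := @pairing_lower _ _ Q nu f CH d ys g x1 g0 (fun u => he 1 t ((u - w) / sg) + - (Cv * D) / t) Lo n psi z psi0.
rewrite (ysE (fun y => g y * H n.+1 x1 y)) in PU PL.
set S := \sum_(j < _) _ in PU PL.
have {}A3 : `|H n.+1 x1 w - D / 2 * S| <= e / 2 / rho ^+ 2 := A3.
set L1 := \sum_x _ in PU; set L2 := \sum_x _ in PL.
have {}A1 : `|L1 + 2 * dualW Vs psi (z + d) / sg * he 2 (rho ^+ 2) (w / sg)| <=
  (e / (2 * D) + C1 * ka * (1 + (eta ^+ 2)^-1)) / rho ^+ 2 := A1.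
have {}A2 : `|L2 + 2 * dualW Vs psi z / sg * he 2 (rho ^+ 2) (w / sg)| <=
  (e / (2 * D) + C2 * ka * (1 + (eta ^+ 2)^-1)) / rho ^+ 2 := A2.
have D20 : 0 < D / 2 by rewrite divr_gt0.
have ir : 0 <= (rho ^+ 2)^-1 by rewrite invr_ge0 sqr_ge0.
have Er C : 0 < C -> C <= C1 + C2 ->
   D / 2 * ((e / (2 * D) + C * ka * (1 + (eta ^+ 2)^-1)) / rho ^+ 2) <= e / 2 / rho ^+ 2.
  move=> C0 CC; rewrite mulrA; apply: ler_wpM2r => //.
  have -> : D / 2 * (e / (2 * D) + C * ka * (1 + (eta ^+ 2)^-1)) =
    e / 4 + D / 2 * C * (1 + (eta ^+ 2)^-1) * ka by field; rewrite !gt_eqF.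
  have gk : D / 2 * C * (1 + (eta ^+ 2)^-1) * ka <= e / 4.
    by apply: le_trans kale3; rewrite ler_pM2r// /G ler_pM2r// ler_pM2l.
  have -> : e / 2 = e / 4 + e / 4 by field.
  by rewrite lerD2l.
have E1 := Er C1 C10 (ler_wpDr (ltW C20) (lexx _)).
have E2 := Er C2 C20 (ler_wpDl (ltW C10) (lexx _)).
move: A1 A2 A3; rewrite !ler_norml => /andP[_ A1] /andP[A2 _] /andP[A3 A4].
have F1 := le_trans (ler_wpM2l (ltW D20) A1) E1.
have F2 : - (e / 2 / rho ^+ 2) <= D / 2 * (L2 + 2 * dualW Vs psi z / sg * he 2 (rho ^+ 2) (w / sg)).
  by apply: le_trans (ler_wpM2l (ltW D20) A2); rewrite mulrN lerN2.
have P1 := ler_wpM2l (ltW D20) PU; have P2 := ler_wpM2l (ltW D20) PL.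
have X1 : D / 2 * (L1 + 2 * dualW Vs psi (z + d) / sg * he 2 (rho ^+ 2) (w / sg)) = D / 2 * L1 +
  d / sg ^+ 2 * dualW Vs psi (z + d) * he 2 (rho ^+ 2) (w / sg).
  by rewrite /D; field; rewrite gt_eqF.
have X2 : D / 2 * (L2 + 2 * dualW Vs psi z / sg * he 2 (rho ^+ 2) (w / sg)) = D / 2 * L2 +
  d / sg ^+ 2 * dualW Vs psi z * he 2 (rho ^+ 2) (w / sg).
  by rewrite /D; field; rewrite gt_eqF.
rewrite X1 in F1; rewrite X2 in F2; rewrite !mulNr.
have Eh : e / rho ^+ 2 = e / 2 / rho ^+ 2 + e / 2 / rho ^+ 2 by field; rewrite gt_eqF.
rewrite Eh.
exact: budget A3 A4 F1 F2 P1 P2.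
Qed.

End LocalLarge.

(** * The profile near the boundary and the splitting of time *)

Section HeatLimit.
Variable R : realType.

Lemma sqrtSn_quad a b : (a.+1 <= 4 * b.+1)%N ->
  Num.sqrt a.+1%:R <= 2 * Num.sqrt b.+1%:R :> R.
Proof.
move=> ab; rewrite -[2 in leRHS]ger0_norm// -sqrtr_sqr -sqrtrM ?sqr_ge0//.
by rewrite ler_wsqrtr// -natrX -natrM ler_nat.
Qed.

Lemma gs_lip : exists2 C : R, 0 < C & forall z : R, `|gs z - gs 0| <= C * `|z|.
Proof.
have [C C0 HC] := hm_bound R 2; exists C => // z.
by have := mvt_bound_glob (@is_derive_hm R 1) HC 0 z; rewrite subr0.
Qed.

Lemma he2E (t v : R) : 0 < t ->
  - he 2 t v = (Num.sqrt t)^-1 ^+ 3 * (v * gs (v / Num.sqrt t)).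
Proof.
by move=> t0; rewrite /he hmSS mul0r subr0 /=; ring.
Qed.

End HeatLimit.

Lemma half_succ n : (1 <= n)%N -> exists k m : nat,
  [/\ n = (k + m.+1)%N, (n.+1 <= 4 * m.+1)%N, (k.+1 <= 4 * m.+1)%N, (n.+1 <= 4 * k.+1)%N
    & forall N, (2 * N.+1 <= n)%N -> (N <= m)%N].
Proof.
by move=> n1; exists n./2, (n - n./2).-1; split; [lia..|move=> N; lia].
Qed.

(** * The limit for one cell *)

Section LocalLimit.
Variables (R : realType) (X : finType).

Let budget_far (u a1 a2 a1' a2' g : R) : `|a1 - a1'| <= u -> `|a2 - a2'| <= u ->
  a1' - u *+ 2 <= g -> g <= a2' + u *+ 2 -> a1 - u * 4 <= g /\ g <= a2 + u * 4.
Proof. by rewrite !ler_norml => /andP[? ?] /andP[? ?] ? ?; split; lra. Qed.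

Let budget_near (a b u a1 a2 g : R) : 0 <= a -> a + b = u -> 0 <= g -> g <= u + a ->
  - b <= a2 -> a2 <= b -> - b <= a1 -> a1 <= b ->
  - a1 - u *+ 2 <= g /\ g <= - a2 + u *+ 2.
Proof. by move=> *; split; lra. Qed.

Let budget_lim (E a1 a2 w g b1 b2 : R) : w <= E / 2 -> a1 - w <= g -> g <= a2 + w ->
  - (E / 2) <= a2 - b2 -> a2 - b2 <= E / 2 -> - (E / 2) <= a1 - b1 -> a1 - b1 <= E / 2 ->
  b1 - E <= g /\ g <= b2 + E.
Proof. by move=> *; split; lra. Qed.

Variables (Q : X -> X -> R) (nu f r q rs qs : X -> R) (sg B Bs : R) (V Vs : X -> R -> R).
Hypothesis CH : chain Q nu f.
Hypothesis W : walk Q f r q sg B V.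
Hypothesis Ws : walk (Pstar Q nu) (fun x => - f x) rs qs sg Bs Vs.
Variables (d Csm : R).
Hypothesis SM : smoothing Q f d Csm.
Let SQ := chain_stoch CH.
Local Notation K := (kill Q f).
Local Notation nV := (nv sg V).

(** -he 2 has slope gs(0) t^(-3/2) at 0. Carried to time k + m + 1 and read at the fixed value V(x,
    y) / sg, it is linear there at leading order. *)
Lemma he2_propagate x y (e : R) : 0 < e -> exists N, forall k m, (N <= k + m)%N ->
  ((k + m.+1).+1 <= 4 * m.+1)%N -> (k.+1 <= 4 * m.+1)%N ->
  `|Num.sqrt (k + m.+1).+1%:R ^+ 3 * iter k K (fun x u => - he 2 m.+1%:R (nV x u)) x y -
    gs 0 * nV x y| <= e.
Proof.
move=> e0; have [C C0 HC] := propagation W.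
have [Cu U] := @testfn_he _ _ _ _ _ _ _ _ _ W 2 isT.
have [Cg Cg0 HCg] := gs_lip R; have [Ct Ct0 HCt] := he_lip_t R 2.
have Cu0 := tf_C U.
have Y0 : 0 < 1 + `|y| by rewrite ltr_pwDl.
set v := nV x y.
pose A := Cu * C * (1 + `|y|).
have A0 : 0 <= A := mulr_ge0 (mulr_ge0 Cu0 (ltW C0)) (ltW Y0).
pose l := 32 * A / e + 1.
have l0 : 0 < l by rewrite /l ltr_wpDl// divr_ge0 ?mulr_ge0// ltW.
have lA : 16 * A / l <= e / 2.
  rewrite ler_pdivrMr// /l mulrDr mulr1.
  have -> : e / 2 * (32 * A / e) = 16 * A by field; rewrite gt_eqF.
  by rewrite lerDl divr_ge0// ltW.
pose Z := 16 * A * (3 + l) + Ct + Cg * v ^+ 2.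
have Z0 : 0 < Z.
  have a1 : 0 <= 16 * A * (3 + l) := mulr_ge0 (mulr_ge0 (ler0n _ 16) A0) (addr_ge0 (ler0n _ 3) (ltW l0)).
  have a2 : 0 <= Cg * v ^+ 2 by rewrite mulr_ge0 ?sqr_ge0// ltW.
  by rewrite /Z; move: (Cg * v ^+ 2) (16 * A * (3 + l)) a1 a2 => *; lra.
have e20 : 0 < e / 2 by rewrite divr_gt0.
have [N HN] := inv_sqrt_small (divr_gt0 e20 Z0).
exists N => k m Nkm h1 h2.
set n := (k + m.+1)%N in h1 *.
have nE : n.+1%:R = m.+1%:R + k%:R + 1 :> R by rewrite -[LHS]natr1 /n natrD [k%:R + _]addrC.
have Nn : (N <= n)%N by apply: leq_trans Nkm _; rewrite /n addnS.
have Sm := HN n Nn.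
set P := Num.sqrt n.+1%:R in Sm *; set rho := Num.sqrt m.+1%:R : R.
have P0 : 0 < P := sqrtSn_gt0 R n; have rho0 : 0 < rho := sqrtSn_gt0 R m.
have Pr : P <= 2 * rho := sqrtSn_quad R h1.
have kr : Num.sqrt k.+1%:R <= 2 * rho := sqrtSn_quad R h2.
have t1 : 1 <= m.+1%:R :> R by rewrite ler1n.
have S1 := HC 2%N Cu _ _ _ U m.+1%:R k l x y t1 l0.
rewrite -/rho -/v -/A in S1.
have ri i : rho^-1 ^+ i <= 2 ^+ i * P^-1 ^+ i.
  rewrite -exprMn; apply: lerXn2r; rewrite ?nnegrE ?invr_ge0 ?(ltW rho0) ?mulr_ge0 ?invr_ge0 ?(ltW P0)//.
  rewrite -[2]invrK -invfM lef_pV2 ?posrE ?mulr_gt0 ?invr_gt0//.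
  by rewrite mulrC ler_pdivrMr// mulrC.
have S2 : rho^-1 ^+ 4 * (1 + l + Num.sqrt k.+1%:R / l) + rho^-1 ^+ 5 * Num.sqrt k.+1%:R <=
   16 * (3 + l) * P^-1 ^+ 4 + 16 / l * P^-1 ^+ 3.
  apply: le_trans (_ : rho^-1 ^+ 4 * (1 + l + 2 * rho / l) + rho^-1 ^+ 5 * (2 * rho) <= _).
    apply: lerD; apply: ler_wpM2l; rewrite ?exprn_ge0 ?invr_ge0 ?(ltW rho0)//.
    by rewrite lerD2l ler_pM2r ?invr_gt0.
  have -> : rho^-1 ^+ 4 * (1 + l + 2 * rho / l) + rho^-1 ^+ 5 * (2 * rho) =
    (3 + l) * rho^-1 ^+ 4 + 2 / l * rho^-1 ^+ 3 by field; rewrite !gt_eqF.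
  apply: lerD.
    apply: le_trans (ler_wpM2l _ (ri 4%N)) _; first by rewrite addr_ge0// ltW.
    by apply: eqle; ring.
  apply: le_trans (ler_wpM2l _ (ri 3%N)) _; first by rewrite divr_ge0// ltW.
  by apply: eqle; ring.
have S3 := le_trans S1 (ler_wpM2l A0 S2).
set I := iter k K _ x y in S1 S3.
have IE : iter k K (fun x u => - he 2 m.+1%:R (nV x u)) x y = - I.
  rewrite -[RHS]mulN1r /I -iter_kill_scale; apply: iter_kill_ext => ? ?.
  by rewrite mulN1r.
rewrite IE.
have n0 : 0 < n.+1%:R :> R by rewrite ltr0n.
have S4 : `|he 2 (m.+1%:R + k%:R) v - he 2 n.+1%:R v| <= Ct * P^-1 ^+ 4.
  have q4 : n.+1%:R / 4 <= m.+1%:R + k%:R :> R by rewrite nE; move: (ler0n R k) t1 => *; lra.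
  apply: le_trans (HCt _ _ v n0 q4) _; rewrite -/P.
  have -> : m.+1%:R + k%:R - n.+1%:R = -1 :> R by rewrite nE; ring.
  by rewrite normrN1 mulr1.
have S5 : P ^+ 3 * (- he 2 n.+1%:R v) = v * gs (v / P).
  by rewrite he2E// -/P; field; rewrite gt_eqF.
have S6 : `|v * gs (v / P) - gs 0 * v| <= Cg * v ^+ 2 / P.
  have -> : v * gs (v / P) - gs 0 * v = v * (gs (v / P) - gs 0) by ring.
  rewrite normrM; apply: le_trans (ler_wpM2l (normr_ge0 _) (HCg _)) _.
  rewrite [`|v / P|]normrM (@ger0_norm _ P^-1) ?invr_ge0 ?(ltW P0)// -(real_normK (num_real v)).
  by apply: eqle; ring.
have P30 : 0 < P ^+ 3 by rewrite exprn_gt0.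
have -> : P ^+ 3 * - I - gs 0 * v = - (P ^+ 3 * (I - he 2 (m.+1%:R + k%:R) v)) -
   P ^+ 3 * (he 2 (m.+1%:R + k%:R) v - he 2 n.+1%:R v) + (v * gs (v / P) - gs 0 * v).
  by rewrite -S5; ring.
apply: le_trans (ler_normD _ _) _; apply: le_trans (lerD (ler_normB _ _) S6) _.
rewrite normrN [`|P ^+ 3 * (I - _)|]normrM [`|P ^+ 3 * (he _ _ _ - _)|]normrM (ger0_norm (ltW P30)).
apply: le_trans (lerD (lerD (ler_wpM2l (ltW P30) S3) (ler_wpM2l (ltW P30) S4)) (lexx _)) _.
have -> : P ^+ 3 * (A * (16 * (3 + l) * P^-1 ^+ 4 + 16 / l * P^-1 ^+ 3)) +
  P ^+ 3 * (Ct * P^-1 ^+ 4) + Cg * v ^+ 2 / P = Z * P^-1 + 16 * A / l.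
  by rewrite /Z; field; rewrite !gt_eqF.
have ZP : Z * P^-1 <= e / 2 by rewrite mulrC -ler_pdivlMr.
by rewrite [leRHS](splitr e); exact: lerD.
Qed.

Variables (psi : X -> R) (z : R).
Hypothesis psi0 : forall x, 0 <= psi x.
Local Notation H m := (iter m K (cell d psi z)).
Let c1 := d / sg ^+ 2 * dualW nu f Vs psi z.
Let c2 := d / sg ^+ 2 * dualW nu f Vs psi (z + d).

(** Below eta sqrt n, where [local_far] is silent, both members are O(eta / n) up to smaller terms:
    the killed mass by [cell_low], the profile because it is Lipschitz and vanishes at 0. Passing
    from w to V moves the profile by a lower order. *)
Lemma local_all (e : R) : 0 < e -> exists N, forall n, (N <= n)%N -> forall x w,
  c1 * (- he 2 n.+1%:R (nV x w)) - e / n.+1%:R * alive x w <= H n.+1 x w /\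
  H n.+1 x w <= c2 * (- he 2 n.+1%:R (nV x w)) + e / n.+1%:R * alive x w.
Proof.
move=> e0; have sg0 := walk_sg W; have B0 := walk_B W.
have [C1 C10 HC1] := cell_low CH W Ws SM.
have [M M0 HM] := fin_ub psi.
have [C2 C20 HC2] := he_lip_v R 2.
pose L := C1 * M * (1 + `|z|).
have L0 : 0 < L by rewrite /L !mulr_gt0// ltr_pwDl.
pose c := `|c1| + `|c2|.
have c0 : 0 <= c by rewrite addr_ge0.
have c1c : `|c1| <= c by rewrite lerDl.
have c2c : `|c2| <= c by rewrite lerDr.
pose G := L + c * C2 / sg.
have G0 : 0 < G by rewrite /G ltr_pwDl// divr_ge0 ?mulr_ge0// ltW.
pose eta := e / 4 / G.
have e40 : 0 < e / 4 by rewrite divr_gt0.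
have eta0 : 0 < eta := divr_gt0 e40 G0.
have [N1 HN1] := local_far CH W Ws SM psi0 z eta0 e40.
pose Z := L + c * C2 * (3 * B / sg).
have Z0 : 0 < Z.
  by rewrite /Z ltr_pwDl// (mulr_ge0 (mulr_ge0 c0 (ltW C20)))// divr_ge0 ?mulr_ge0// ltW.
have [N2 HN2] := inv_sqrt_small (divr_gt0 e40 Z0).
exists (N1 + N2)%N => n Nn x w.
have nN1 := leq_trans (leq_addr _ _) Nn; have nN2 := leq_trans (leq_addl _ _) Nn.
have A1 := HN1 n nN1 x w; cbv zeta in A1; have Sm := HN2 n nN2; clear HN1 HN2.
set rho := Num.sqrt n.+1%:R in A1 Sm.
have rho0 : 0 < rho := sqrtSn_gt0 R n.
have rr : rho ^+ 2 = n.+1%:R := sqr_sqrtSn R n.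
rewrite -rr in A1 *.
rewrite /alive; have [w0|w0] := ltP 0 w; last first.
  have -> : nV x w = 0 by rewrite /nv (walk_Vneg W)// mul0r.
  by rewrite iterS killN// he_even0// !mulr0 oppr0 !mulr0 !addr0; split.
rewrite mulr1.
have ZP : Z / rho <= e / 4 by rewrite mulrC -ler_pdivlMr.
have r2 : 0 < rho ^+ 2 by rewrite exprn_gt0.
have srE : Num.sqrt (rho ^+ 2) = rho by rewrite rr.
have D1 : `|he 2 (rho ^+ 2) (nV x w) - he 2 (rho ^+ 2) (w / sg)| <= C2 * (3 * B / sg) / rho / rho ^+ 2.
  apply: le_trans (HC2 _ _ _ r2) _; rewrite srE.
  have nd : `|nV x w - w / sg| <= 3 * B / sg.
    rewrite /nv -mulrBl normrM (@ger0_norm _ sg^-1) ?invr_ge0 ?(ltW sg0)// ler_pM2r ?invr_gt0//.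
    have := walk_dist W x w; rewrite /alive w0 mul1r mulr1 => a1.
    have a2 := walk_rB W x.
    have -> : V x w - w = V x w - (w + r x) + r x by ring.
    by apply: le_trans (ler_normD _ _) _; move: a1 a2 => ? ?; lra.
  apply: le_trans (ler_wpM2l _ nd) _.
    by rewrite mulr_ge0 ?exprn_ge0 ?invr_ge0 ?(ltW C20) ?(ltW rho0).
  by apply: eqle; field; rewrite !gt_eqF.
have cD a : `|a| <= c -> `|a * (- he 2 (rho ^+ 2) (nV x w)) - a * (- he 2 (rho ^+ 2) (w / sg))| <= e / 4 / rho ^+ 2.
  move=> ac.
  have -> : a * (- he 2 (rho ^+ 2) (nV x w)) - a * (- he 2 (rho ^+ 2) (w / sg)) =
    - (a * (he 2 (rho ^+ 2) (nV x w) - he 2 (rho ^+ 2) (w / sg))) by ring.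
  rewrite normrN normrM; apply: le_trans (ler_pM _ _ ac D1) _ => //.
  rewrite [leLHS]mulrA ler_pM2r ?invr_gt0//; apply: le_trans ZP.
  rewrite [leLHS]mulrA ler_pM2r ?invr_gt0// /Z [leLHS]mulrA lerDr; exact: ltW.
have B1 := cD c1 c1c; have B2 := cD c2 c2c.
have Eh : e / rho ^+ 2 = e / 4 / rho ^+ 2 * 4 by field; rewrite gt_eqF.
rewrite Eh; set u := e / 4 / rho ^+ 2 in B1 B2 A1 *.
have u0 : 0 < u := divr_gt0 e40 r2.
set h1 := he 2 _ (nV x w) in B1 B2 *; set h2 := he 2 _ (w / sg) in A1 B1 B2 *.
suff [G1 G2] : c1 * (- h2) - u *+ 2 <= H n.+1 x w /\ H n.+1 x w <= c2 * (- h2) + u *+ 2.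
  exact: budget_far B1 B2 G1 G2.
have [we|we] := leP (eta * rho) w.
  have [a b] := A1 we.
  have E1 : c1 * - h2 = - (d / sg ^+ 2) * dualW nu f Vs psi z * h2 by rewrite /c1; ring.
  have E2 : c2 * - h2 = - (d / sg ^+ 2) * dualW nu f Vs psi (z + d) * h2 by rewrite /c2; ring.
  rewrite E1 E2; split; first by apply: le_trans a; rewrite lerD2l lerN2 mulr2n lerDl ltW.
  by apply: le_trans b _; rewrite lerD2l mulr2n lerDl ltW.
have Hp x' : 0 <= psi x' <= M by rewrite psi0 /=; exact: le_trans (ler_norm _) (HM x').
have h0 : 0 <= H n.+1 x w by apply: (iter_kill_ge0 f SQ) => *; exact: cell_ge0.
have h3 : H n.+1 x w <= u + L * eta / rho ^+ 2.
  apply: le_trans (HC1 psi M z n.+1 Hp x w) _; rewrite -/L (ger0_norm (ltW w0)).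
  have rS : rho <= Num.sqrt n.+2%:R by rewrite ler_wsqrtr// ler_nat.
  apply: le_trans (_ : L * (1 + w) / rho ^+ 3 <= _).
    apply: ler_wpM2l; first by rewrite mulr_ge0 ?addr_ge0 ?(ltW L0) ?(ltW w0).
    rewrite lef_pV2 ?posrE ?exprn_gt0 ?(lt_le_trans rho0 rS)//; apply: lerXn2r => //;
      rewrite nnegrE; [exact: ltW|exact: sqrtr_ge0].
  apply: le_trans (_ : L * (1 + eta * rho) / rho ^+ 3 <= _).
    rewrite ler_pM2r ?invr_gt0 ?exprn_gt0// ler_pM2l// lerD2l; exact: ltW.
  have -> : L * (1 + eta * rho) / rho ^+ 3 = (L / rho) / rho ^+ 2 + L * eta / rho ^+ 2.
    by field; rewrite gt_eqF.
  rewrite lerD2r /u ler_pM2r ?invr_gt0//; apply: le_trans ZP.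
  rewrite ler_pM2r ?invr_gt0// /Z lerDl.
  exact: (mulr_ge0 (mulr_ge0 c0 (ltW C20)) (divr_ge0 (mulr_ge0 (ler0n _ 3) (ltW B0)) (ltW sg0))).
have h4 a : `|a| <= c -> `|a * h2| <= c * C2 / sg * eta / rho ^+ 2.
  move=> ac; rewrite normrM; have := HC2 _ (w / sg) 0 r2; rewrite he_even0// !subr0 srE => b.
  have wg : `|w / sg| <= eta * rho / sg.
    rewrite ger0_norm; first by rewrite ler_pM2r ?invr_gt0// ltW.
    by rewrite divr_ge0// ltW.
  have b2 : `|h2| <= C2 * rho^-1 ^+ 3 * (eta * rho / sg).
    apply: le_trans b _; apply: ler_wpM2l => //.
    by rewrite mulr_ge0 ?exprn_ge0 ?invr_ge0 ?(ltW C20) ?(ltW rho0).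
  apply: le_trans (ler_pM (normr_ge0 _) (normr_ge0 _) ac b2) _.
  by apply: eqle; field; rewrite !gt_eqF.
have uE : L * eta / rho ^+ 2 + c * C2 / sg * eta / rho ^+ 2 = u.
  rewrite -!mulrDl /u; congr (_ / _); rewrite -/G /eta mulrC divfK// gt_eqF//.
have := h4 c1 c1c; have := h4 c2 c2c; rewrite !ler_norml !mulrN => /andP[k1 k2] /andP[k3 k4].
have p1 : 0 <= L * eta / rho ^+ 2 by rewrite divr_ge0 ?sqr_ge0// mulr_ge0// ltW.
exact: budget_near p1 uE h0 h3 k1 k2 k3 k4.
Qed.

(** The profile of [local_all], reached over the second half of the time, is carried through the
    first half. Its error e / m counts only on survival, which supplies the missing 1 / sqrt n. *)
Lemma cell_limit x y (e : R) : 0 < e -> exists N, forall n, (N <= n)%N ->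
  c1 * (gs 0 * nV x y) - e <= Num.sqrt n.+1%:R ^+ 3 * H n x y /\
  Num.sqrt n.+1%:R ^+ 3 * H n x y <= c2 * (gs 0 * nV x y) + e.
Proof.
move=> e0; have [Cs Cs0 HCs] := walk_srv W.
have Y0 : 0 < 1 + `|y| by rewrite ltr_pwDl.
(* 8 = 2^3, from comparing sqrt n with twice the square root of each half. *)
pose S := 8 * Cs * (1 + `|y|).
have S0 : 0 < S by rewrite /S !mulr_gt0.
have e20 : 0 < e / 2 by rewrite divr_gt0.
have e10 : 0 < e / 2 / S := divr_gt0 e20 S0.
have [N1 HN1] := local_all e10.
pose c := `|c1| + `|c2| + 1.
have c0 : 0 < c by rewrite ltr_pwDr// addr_ge0.
have [N2 HN2] := he2_propagate x y (divr_gt0 e20 c0).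
exists (2 * N1.+1 + N2.+1)%N => n Nn.
have n1 : (1 <= n)%N by apply: leq_trans Nn; rewrite mulnS.
have [k [m [nE h1 h2 h3 h4]]] := half_succ n1.
have mN : (N1 <= m)%N by apply: h4; apply: leq_trans Nn; exact: leq_addr.
have kN : (N2 <= k + m)%N.
  by rewrite -ltnS -addnS -nE; apply: leq_trans Nn; exact: leq_addl.
rewrite nE in h1.
have A := HN2 k m kN h1 h2; rewrite -nE in A h1.
set P := Num.sqrt n.+1%:R in A *.
have P0 : 0 < P := sqrtSn_gt0 R n.
have P30 : 0 < P ^+ 3 by rewrite exprn_gt0.
set I := iter k K _ x y in A.
have HE : H n x y = iter k K (H m.+1) x y by rewrite nE iterD.
have sv : P ^+ 3 * (e / 2 / S / m.+1%:R * srv Q f k x y) <= e / 2.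
  have Pk : P <= 2 * Num.sqrt k.+1%:R := sqrtSn_quad R h3.
  have Pm : P <= 2 * Num.sqrt m.+1%:R := sqrtSn_quad R h1.
  have := HCs k x y; rewrite -(sqr_sqrtSn R m).
  have := sqrtSn_gt0 R k; have := sqrtSn_gt0 R m.
  move: (Num.sqrt k.+1%:R) (Num.sqrt m.+1%:R) Pk Pm => a b Pa Pb b0 a0 sl.
  have w0 : 0 <= P ^+ 3 * (e / 2 / S / b ^+ 2).
    by rewrite mulr_ge0 ?(ltW P30)// divr_ge0 ?sqr_ge0// ltW.
  rewrite mulrA; apply: le_trans (ler_wpM2l w0 sl) _.
  have -> : P ^+ 3 * (e / 2 / S / b ^+ 2) * (Cs * (1 + `|y|) / a) =
     e / 2 * (P ^+ 3 / (8 * b ^+ 2 * a)) by rewrite /S; field; rewrite !gt_eqF.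
  rewrite -[leRHS]mulr1 ler_pM2l// ler_pdivrMr ?mulr_gt0 ?exprn_gt0// mul1r.
  have -> : 8 * b ^+ 2 * a = (2 * b) ^+ 2 * (2 * a) by ring.
  rewrite exprSr; apply: ler_pM => //; rewrite ?exprn_ge0 ?(ltW P0)//.
  by apply: lerXn2r => //; rewrite nnegrE ?mulr_ge0 ?(ltW P0) ?(ltW b0).
have lin a b : iter k K (fun x w => a * (- he 2 m.+1%:R (nV x w)) + b * alive x w) x y =
  a * I + b * srv Q f k x y by rewrite iter_kill_lin.
have B1 : c1 * I - e / 2 / S / m.+1%:R * srv Q f k x y <= H n x y.
  rewrite HE -mulNr -lin; apply: (iter_kill_le f SQ) => x' w'.
  by rewrite mulNr; have [] := HN1 m mN x' w'.
have B2 : H n x y <= c2 * I + e / 2 / S / m.+1%:R * srv Q f k x y.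
  rewrite HE -lin; apply: (iter_kill_le f SQ) => x' w'.
  by have [] := HN1 m mN x' w'.
have {}B1 := ler_wpM2l (ltW P30) B1; have {}B2 := ler_wpM2l (ltW P30) B2.
rewrite mulrBr in B1; rewrite mulrDr in B2.
have ca a : `|a| <= c -> `|P ^+ 3 * (a * I) - a * (gs 0 * nV x y)| <= e / 2.
  move=> ac.
  have -> : P ^+ 3 * (a * I) - a * (gs 0 * nV x y) = a * (P ^+ 3 * I - gs 0 * nV x y) by ring.
  rewrite normrM; apply: le_trans (ler_pM (normr_ge0 _) (normr_ge0 _) ac A) _.
  by rewrite mulrC divfK// gt_eqF.
have c1c : `|c1| <= c by rewrite /c -addrA lerDl addr_ge0.
have c2c : `|c2| <= c by rewrite /c [`|c1| + _]addrC -addrA lerDl addr_ge0.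
have := ca c1 c1c; have := ca c2 c2c; rewrite !ler_norml => /andP[k1 k2] /andP[k3 k4].
exact: budget_lim sv B1 B2 k1 k2 k3 k4.
Qed.

End LocalLimit.

(** * From trajectories to operators *)

Section Trajectories.
Variables (R : realType) (X : finType).
Variables (Q : X -> X -> R) (f : X -> R).
Local Notation T := (step Q f).
Local Notation K := (kill Q f).

Lemma Xk_cons n (x x' : X) (w : n.-tuple X) i : (i <= n)%N ->
  Xk x [tuple of x' :: w] i.+1 = Xk x' w i.
Proof.
by move=> le_in; rewrite /Xk /=; apply: set_nth_default; rewrite /= size_tuple.
Qed.

Lemma Sk_cons (g : X -> R) n (x x' : X) (w : n.-tuple X) k : (k <= n)%N ->
  Sk g x [tuple of x' :: w] k.+1 = g x' + Sk g x' w k.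
Proof.
move=> kn; rewrite /Sk big_nat_recl//= Xk_cons//; congr (_ + _).
rewrite !big_add1 /=; rewrite !big_nat; apply: eq_bigr => i /andP[_ ik].
by rewrite Xk_cons//; exact: leq_trans ik kn.
Qed.

Lemma surv_cons (g : X -> R) y n (x x' : X) (w : n.-tuple X) :
  surv g y x [tuple of x' :: w] = (0 < y + g x') && surv g (y + g x') x' w.
Proof.
apply/forallP/andP => [H|[H0 /forallP H]].
  split; first by have := H ord0; rewrite Sk_cons//= /Sk big_geq// addr0.
  apply/forallP => k; have := H (lift ord0 k); rewrite lift0 Sk_cons//.
  by rewrite addrA.
move=> k; case: (unliftP ord0 k) => [j ->|->].
  by rewrite lift0 Sk_cons// addrA; exact: H.
by rewrite Sk_cons//= /Sk big_geq// addr0.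
Qed.

Lemma Eexp_cons n x (F : n.+1.-tuple X -> R) : Eexp Q x F =
  \sum_x' Q x x' * Eexp Q x' (fun w : n.-tuple X => F [tuple of x' :: w]).
Proof.
rewrite /Eexp; under [RHS]eq_bigr do rewrite mulr_sumr.
rewrite pair_big /=.
rewrite (reindex (fun p : X * n.-tuple X => [tuple of p.1 :: p.2])) /=; last first.
  exists (fun w : n.+1.-tuple X => (thead w, [tuple of behead w])) => [[x' w] _|w _].
    by congr (_, _); apply: val_inj.
  by rewrite /= -tuple_eta.
apply: eq_bigr => -[x' w] _ /=; rewrite mulrA; congr (_ * _).
rewrite /pathw big_ord_recl /=; congr (_ * _).
by apply: eq_bigr => i _; rewrite /bump /= add1n !Xk_cons// ltnW.
Qed.

(** The stopping time ignores time 0, so the first step is free whatever the sign of y. The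
    departure tests of [kill] then cover times 1 to n, and the indicator in the terminal function
    covers n + 1. *)
Lemma Eexp_kill (g : X -> R -> R) n x y :
  Eexp Q x (fun w : n.+1.-tuple X => g (Xk x w n.+1) (y + Sk f x w n.+1) * (surv f y x w)%:R) =
  T (iter n K (fun x u => (0 < u)%R%:R * g x u)) x y.
Proof.
have E x' (w : 0.-tuple X) : pathw Q x' w = 1 by rewrite /pathw big_ord0.
elim: n x y => [|n IH] x y; rewrite Eexp_cons /step; apply: eq_bigr => x' _; congr (_ * _).
  rewrite /Eexp (bigD1 [tuple])//= big1 ?addr0; last by move=> w; rewrite tuple0.
  rewrite E mul1r Xk_cons// Sk_cons// surv_cons /= /Sk big_geq// addr0.
  have -> : surv f (y + f x') x' [tuple] by apply/forallP => -[].
  by rewrite andbT mulrC /Xk.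
rewrite iterS /kill -IH /Eexp mulr_sumr; apply: eq_bigr => w _.
rewrite Xk_cons// Sk_cons// surv_cons addrA.
by case: (0 < _) => /=; rewrite ?mul1r ?mul0r ?mulr0.
Qed.

Lemma surv_probE n x y : surv_prob Q f x y n.+1 = T (srv Q f n) x y.
Proof.
have := Eexp_kill (fun _ _ => 1) n x y; rewrite /surv_prob.
have -> : Eexp Q x (fun w : n.+1.-tuple X => 1 * (surv f y x w)%:R) =
  Eexp Q x (fun w : n.+1.-tuple X => (surv f y x w)%:R).
  by apply: eq_bigr => w _; rewrite mul1r.
move=> ->; apply: eq_bigr => x' _; congr (_ * _); apply: iter_kill_ext => ? ?.
by rewrite mulr1.
Qed.

End Trajectories.

(** * Identification of the limit V *)

Section HarmonicLimit.
Variables (R : realType) (X : finType).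
Variables (Q : X -> X -> R) (nu f r q : X -> R) (sg B : R) (V : X -> R -> R).
Hypothesis CH : chain Q nu f.
Hypothesis W : walk Q f r q sg B V.
Variables (d Csm : R).
Hypothesis SM : smoothing Q f d Csm.

Lemma cvgn_sum (I : finType) (u : I -> nat -> R) (l : I -> R) :
  (forall i, u i @ \oo --> l i) -> (fun n => \sum_i u i n) @ \oo --> \sum_i l i.
Proof.
move=> H; elim: (index_enum I) => [|i s IH].
  rewrite big_nil; have -> : (fun n => \sum_(i <- [::]) u i n) = cst 0.
    by apply/funext => n; rewrite big_nil.
  exact: cvg_cst.
rewrite big_cons; have -> : (fun n => \sum_(j <- i :: s) u j n) =
    (fun n => u i n + \sum_(j <- s) u j n) by apply/funext => n; rewrite big_cons.
exact: cvgD.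
Qed.

(** The free step accounts for nonpositive y. The normalisation sqrt(2 pi) sigma / 2 cancels the
    slope gs(0) / sg of [srv_asymp], since gs(0) = 2 / sqrt(2 pi). *)
Lemma VfunE x y : Vfun Q f sg x y = step Q f V x y.
Proof.
have sg0 := walk_sg W.
rewrite /Vfun.
have C : (fun n => Num.sqrt n%:R * surv_prob Q f x y n) @ \oo --> gs 0 / sg * step Q f V x y.
  rewrite -cvg_shiftS /=.
  have -> : gs 0 / sg * step Q f V x y = \sum_x' Q x x' * (gs 0 * nv sg V x' (y + f x')).
    by rewrite /step mulr_sumr; apply: eq_bigr => x' _; rewrite /nv; ring.
  have -> : (fun n => Num.sqrt n.+1%:R * surv_prob Q f x y n.+1) =
    (fun n => \sum_x' Q x x' * (Num.sqrt n.+1%:R * srv Q f n x' (y + f x'))).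
    apply/funext => n; rewrite surv_probE /step mulr_sumr.
    by apply: eq_bigr => x' _; rewrite mulrCA.
  apply: cvgn_sum => x'; apply: cvgM; first exact: cvg_cst.
  exact: (srv_asymp CH W SM).
rewrite (cvg_lim _ C)//.
have s2 := sqrt2pi_gt0 R.
rewrite /gs expr0n /= mul0r oppr0 expR0.
by field; rewrite !gt_eqF.
Qed.

Lemma Vfun_pos x y : 0 < y -> Vfun Q f sg x y = V x y.
Proof. by move=> y0; rewrite VfunE; exact: (exp_V W). Qed.

(** Inherited from the survival probabilities, of which V is a rescaled limit. *)
Lemma V_mono x y y' : y <= y' -> V x y <= V x y'.
Proof.
move=> yy; have sg0 := walk_sg W.
have H u : (fun n => Num.sqrt n.+1%:R * srv Q f n x u) @ \oo --> gs 0 * nv sg V x u.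
  exact: (srv_asymp CH W SM).
have : gs 0 * nv sg V x y <= gs 0 * nv sg V x y'.
  apply: (ler_cvg_to (H y) (H y')); apply: nearW => n; apply: ler_wpM2l; first exact: sqrtr_ge0.
  exact: (srv_monoy f (chain_stoch CH)).
by rewrite ler_pM2l ?gs_gt0// /nv ler_pM2r ?invr_gt0.
Qed.

End HarmonicLimit.

(** * Darboux sums of a monotone function *)

Section MonotoneIntegral.
Variables (R : realType) (F : R -> R).

Let fin_step (s j j' fk fk' fz d' : R) : fk * d' <= j' - j -> j' - j <= fk' * d' -> d' * s <= j ->
  j <= d' * s + d' * (fk - fz) -> d' * s + d' * fk <= j' /\ j' <= d' * s + d' * fk + d' * (fk' - fz).
Proof. by move=> *; split; lra. Qed.

Let fin_low (S j j' fr fd d' fz : R) : j <= S + fz -> j' - j <= fr -> fr <= fd * d' -> fz <= d' * fd ->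
  j' - 2 * d' * fd <= S.
Proof. by move=> *; lra. Qed.

Let fin_upp (S j j' fr f1 f2 g d' : R) : S <= j -> fr <= j' - j -> 0 <= fr ->
  f1 <= d' * g -> f2 <= d' * g -> S + f1 + f2 <= j' + 2 * d' * g.
Proof. by move=> *; lra. Qed.

Hypothesis Fmono : forall u v, u <= v -> F u <= F v.
Local Notation mu := (@lebesgue_measure R).
Local Notation J z b := (Rintegral mu `[z, b] F).

Lemma mono_integrable a b : mu.-integrable `[a, b] (EFin \o F).
Proof.
apply: measurable_bounded_integrable => //.
- by rewrite /= lebesgue_measure_itv /=; case: ifP => _; rewrite -?EFinB ?ltry.
- by apply: nondecreasing_measurable => // u v; exact: Fmono.
- exists (`|F a| + `|F b|); split; first exact: num_real.
  move=> M HM x /=; rewrite in_itv /= => /andP[ax xb].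
  apply: ltW; apply: le_lt_trans HM; rewrite ler_norml; apply/andP; split.
    apply: le_trans (Fmono ax); rewrite lerNl; apply: le_trans (ler_norm _) _.
    by rewrite normrN lerDl.
  by apply: le_trans (Fmono xb) _; apply: le_trans (ler_norm _) _; rewrite lerDr.
Qed.

Lemma mono_increment z b c : z <= b -> b <= c ->
  F b * (c - b) <= J z c - J z b <= F c * (c - b).
Proof.
move=> zb bc.
have ic : mu.-integrable `]b, c] (EFin \o F).
  by apply: integrableS (mono_integrable b c) => //; exact: subset_itv_oc_cc.
rewrite Rintegral_itvB ?bnd_simp//; last exact: mono_integrable.
rewrite Rintegral_itv_obnd_cbnd//.
have kI (k : R) : mu.-integrable `[b, c] (EFin \o cst k).
  apply: measurable_bounded_integrable => //.
    by rewrite /= lebesgue_measure_itv /=; case: ifP => _; rewrite -?EFinB ?ltry.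
  exists `|k|; split; first exact: num_real.
  by move=> M HM x _ /=; exact: ltW.
have kE (k : R) : Rintegral mu `[b, c] (cst k) = k * (c - b).
  rewrite Rintegral_cst//; congr (_ * _); rewrite /= lebesgue_measure_itv /= lte_fin.
  move: bc; rewrite le_eqVlt => /predU1P[->|->]//=; by rewrite ltxx subrr.
rewrite -!kE; apply/andP; split; apply: le_Rintegral => //.
- exact: (kI (F b)).
- exact: mono_integrable.
- by move=> x /=; rewrite in_itv /= => /andP[? _]; exact: Fmono.
- exact: mono_integrable.
- exact: (kI (F c)).
- by move=> x /=; rewrite in_itv /= => /andP[_ ?]; exact: Fmono.
Qed.

Hypothesis F0 : forall u, 0 <= F u.

(** Sums over left endpoints. The error 2 d F pays, in the lower bound, for the oscillation of F and
    the incomplete last step; in the upper bound, for the two extra terms. *)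
Lemma mono_darboux z a d m : 0 < d -> m%:R * d <= a -> a <= m.+1%:R * d ->
  Rintegral mu `[z, z + a] F - 2 * d * F (z + a) <= d * \sum_(i < m) F (z + i%:R * d) /\
  d * \sum_(i < m.+2) F (z + i%:R * d) <= Rintegral mu `[z, z + a] F + 2 * d * F (z + a + d).
Proof.
move=> d0 ma am; have md0 k : 0 <= k%:R * d by rewrite mulr_ge0 ?ler0n ?ltW.
have J0 : J z z = 0.
  by rewrite set_itv1 /Rintegral integral_set1.
have S k : k%:R * d <= a -> d * \sum_(i < k) F (z + i%:R * d) <= J z (z + k%:R * d) /\
   J z (z + k%:R * d) <= d * \sum_(i < k) F (z + i%:R * d) + d * (F (z + k%:R * d) - F z).
  elim: k => [|k IH] ka; first by rewrite big_ord0 mul0r addr0 J0 subrr !mulr0 addr0.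
  have kk : k%:R * d <= k.+1%:R * d by rewrite ler_pM2r// ler_nat.
  have [IH1 IH2] := IH (le_trans kk ka).
  have z1 : z <= z + k%:R * d by rewrite lerDl.
  have z2 : z + k%:R * d <= z + k.+1%:R * d by rewrite lerD2l.
  have /andP := mono_increment z1 z2.
  have -> : z + k.+1%:R * d - (z + k%:R * d) = d by rewrite -natr1; ring.
  move=> [h1 h2]; rewrite big_ord_recr /= mulrDr.
  exact: fin_step h1 h2 IH1 IH2.
have [S1 S2] := S m ma.
have z1 : z <= z + m%:R * d by rewrite lerDl.
have z2 : z + m%:R * d <= z + a by rewrite lerD2l.
have /andP[h1 h2] := mono_increment z1 z2.
have rd : a - m%:R * d <= d by rewrite lerBlDl; move: am; rewrite -natr1 mulrDl mul1r.
have rd0 : 0 <= a - m%:R * d by rewrite subr_ge0.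
have E : z + a - (z + m%:R * d) = a - m%:R * d by ring.
rewrite E in h1 h2.
have h3 : F (z + a) * (a - m%:R * d) <= F (z + a) * d by apply: ler_wpM2l.
have h0 : 0 <= F (z + m%:R * d) * (a - m%:R * d) by apply: mulr_ge0.
have f1 := Fmono z2; have fz := F0 z.
have h4 : d * (F (z + m%:R * d) - F z) <= d * F (z + a).
  by apply: ler_wpM2l; [exact: ltW|rewrite lerBlDr; exact: le_trans f1 (ler_wpDr fz (lexx _))].
have f2 : F (z + m%:R * d) <= F (z + a + d).
  by apply: le_trans f1 _; apply: Fmono; rewrite lerDl ltW.
have f3 : F (z + m.+1%:R * d) <= F (z + a + d).
  by apply: Fmono; rewrite -natr1 mulrDl mul1r addrA lerD2r lerD2l.
split.
  exact: fin_low S2 h2 h3 h4.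
rewrite !big_ord_recr /= mulrDr mulrDr.
have g2 := ler_wpM2l (ltW d0) f2; have g3 := ler_wpM2l (ltW d0) f3.
exact: fin_upp S1 h1 h0 g2 g3.
Qed.

End MonotoneIntegral.

(** * Covering a window by cells *)

Section Cover.
Variables (R : realType) (X : finType).

Lemma cells_sum (d : R) (psi : X -> R) z m x u : 0 < d ->
  \sum_(i < m) cell d psi (z + i%:R * d) x u = psi x * (z < u <= z + m%:R * d)%R%:R.
Proof.
move=> d0; rewrite /cell -mulr_sumr; congr (_ * _).
have ind (c c' : R) : c <= c' -> (c < u <= c')%R%:R = (c < u)%R%:R - (c' < u)%R%:R :> R.
  move=> cc; have [cu|cu] := ltP c u; have [uc|uc] := leP u c' => //=; rewrite ?subr0 ?subrr//.
  by move: (lt_le_trans uc cu); rewrite ltNge cc.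
elim: m => [|m IH].
  by rewrite big_ord0 mul0r addr0 ind// subrr.
have mz k : z <= z + k%:R * d by rewrite lerDl mulr_ge0 ?ler0n// ltW.
rewrite big_ord_recr /= IH !ind// ?lerDl ?(ltW d0)//.
have -> : z + m%:R * d + d = z + m.+1%:R * d by rewrite -natr1; ring.
by ring.
Qed.

(** The factor for u > 0 is the terminal survival test; it matters at z = 0, the window being
    closed. *)
Definition window (psi : X -> R) (z a : R) : X -> R -> R :=
  fun x u => (0 < u)%R%:R * (psi x * (z <= u <= z + a)%R%:R).

Variables (psi : X -> R) (d z a : R) (m : nat).
Hypothesis psi0 : forall x, 0 <= psi x.
Hypothesis d0 : 0 < d.

(** Cells are numbered from z - d so that this cover and the next one draw on the same family. *)
Lemma window_ge_cells x u : 0 <= z -> m%:R * d <= a ->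
  \sum_(i < m) 1 * cell d psi (z - d + i.+1%:R * d) x u <= window psi z a x u.
Proof.
move=> z0 ma; have -> : \sum_(i < m) 1 * cell d psi (z - d + i.+1%:R * d) x u =
    \sum_(i < m) cell d psi (z + i%:R * d) x u.
  by apply: eq_bigr => i _; rewrite mul1r; congr cell; rewrite -natr1; ring.
rewrite cells_sum// /window mulrCA; apply: ler_wpM2l => //.
have [/andP[h1 h2]|_] := boolP (z < u <= _); last by rewrite mulr_ge0 ?ler0n.
rewrite (le_lt_trans z0 h1) (ltW h1) /= mul1r.
by rewrite (le_trans h2)// lerD2l.
Qed.

(** The cover starts one cell early: z lies in the closed window but in no half-open cell based at
    z. *)
Lemma window_le_cells x u : a <= m.+1%:R * d ->
  window psi z a x u <= \sum_(i < m.+2) 1 * cell d psi (z - d + i%:R * d) x u.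
Proof.
move=> am; under eq_bigr do rewrite mul1r.
rewrite cells_sum// /window mulrCA; apply: ler_wpM2l => //.
have [/andP[h1 h2]|_] := boolP (z <= u <= _); last by rewrite mulr0 ler0n.
rewrite mulr1.
have -> : z - d < u by apply: lt_le_trans h1; rewrite ltrBlDr ltrDl.
have -> : u <= z - d + m.+2%:R * d.
  apply: le_trans h2 _; have -> : z - d + m.+2%:R * d = z + m.+1%:R * d.
    by rewrite -[m.+2%:R]natr1; ring.
  by rewrite lerD2l.
by case: (0 < u).
Qed.

Lemma exists_floor : 0 <= a -> exists k : nat, k%:R * d <= a /\ a <= k.+1%:R * d.
Proof.
move=> a0.
have ex : exists k : nat, a <= k.+1%:R * d.
  exists (Num.bound (a / d)); rewrite -ler_pdivrMr//.
  apply: le_trans (ltW (archi_boundP _)) _; first by rewrite divr_ge0// ltW.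
  by rewrite ler_nat.
have [k Pk Hk] := ex_minnP ex; exists k; split => //.
case: k Pk Hk => [|k] Pk Hk; first by rewrite mul0r.
by rewrite leNgt; apply/negP => lt; have := Hk k (ltW lt); rewrite ltnn.
Qed.

End Cover.

(** * The limit for a window *)

Section WindowLimit.
Variables (R : realType) (X : finType).
Variables (Q : X -> X -> R) (nu f r q rs qs : X -> R) (sg B Bs : R) (V Vs : X -> R -> R).
Hypothesis CH : chain Q nu f.
Hypothesis W : walk Q f r q sg B V.
Hypothesis Ws : walk (Pstar Q nu) (fun x => - f x) rs qs sg Bs Vs.
Let SQ := chain_stoch CH.
Local Notation K := (kill Q f).
Local Notation nV := (nv sg V).
Variables (psi : X -> R).
Hypothesis psi0 : forall x, 0 <= psi x.

Lemma dualW_ge0 u : 0 <= dualW nu f Vs psi u.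
Proof.
apply: sumr_ge0 => x _; rewrite mulr_ge0 ?(walk_V0 Ws)// mulr_ge0//.
exact/ltW/(nu_gt0 CH).
Qed.

Lemma dualW_mono u v : u <= v -> dualW nu f Vs psi u <= dualW nu f Vs psi v.
Proof.
have [d [C [SM _]]] := exists_smoothing (dual_chain CH) ltr01.
move=> uv; apply: ler_sum => x _; apply: ler_wpM2l.
  by rewrite mulr_ge0//; exact/ltW/(nu_gt0 CH).
by apply: (V_mono (dual_chain CH) Ws SM); rewrite lerD2r.
Qed.

(** The upper estimate for the cell based at z + (i - 1) d and the lower one for the cell based at z
    + i d both involve [dualW] at z + i d. Both covers thus give left-endpoint sums over the same
    points, m + 2 and m in number. *)
Lemma window_limit z a x y : 0 <= z -> 0 < a ->
  (fun n => Num.sqrt n.+1%:R ^+ 3 * iter n K (window psi z a) x y) @ \oo -->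
  gs 0 / sg ^+ 2 * nV x y * Rintegral lebesgue_measure `[z, z + a] (dualW nu f Vs psi).
Proof.
move=> z0 a0; have sg0 := walk_sg W.
pose F := dualW nu f Vs psi; rewrite -/F; set I := Rintegral _ _ _.
pose ka := gs 0 / sg ^+ 2 * nV x y; rewrite -/ka.
have ka0 : 0 <= ka.
  exact: (mulr_ge0 (divr_ge0 (ltW (gs_gt0 _)) (sqr_ge0 _)) (nv_ge0 W x y)).
pose M := 2 * ka * F (z + a + 1).
have M0 : 0 <= M := mulr_ge0 (mulr_ge0 (ler0n _ 2) ka0) (dualW_ge0 _).
apply: cvgn_eps => e e0; have e20 : 0 < e / 2 by rewrite divr_gt0.
have M10 : 0 < M + 1 by rewrite ltr_wpDl.
(* d (M + 1) <= e / 2 makes the Darboux error harmless; d < 1 allows F to be taken at z + a + 1 once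
   and for all in M. *)
have dp : 0 < Num.min 1 (e / 2 / (M + 1)) by rewrite lt_min ltr01 divr_gt0.
have [d [C [SM]]] := exists_smoothing CH dp; rewrite lt_min => /andP[d1 d2].
have d0 : 0 < d by case: SM.
have [m [ma am]] := exists_floor d0 (ltW a0).
have [Dl Du] := mono_darboux dualW_mono dualW_ge0 z d0 ma am.
rewrite -/F -/I in Dl Du.
have dM : ka * (2 * d * F (z + a + d)) <= e / 2.
  apply: le_trans (_ : d * (M + 1) <= _); last by rewrite -ler_pdivlMr// ltW.
  have Fd : F (z + a + d) <= F (z + a + 1) by apply: dualW_mono; rewrite lerD2l ltW.
  apply: le_trans (_ : ka * (2 * d * F (z + a + 1)) <= _).
    by apply: ler_wpM2l => //; apply: ler_wpM2l => //; rewrite mulr_ge0// ltW.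
  have -> : ka * (2 * d * F (z + a + 1)) = d * M by rewrite /M; ring.
  by rewrite ler_pM2l// lerDl.
have dM' : ka * (2 * d * F (z + a)) <= e / 2.
  apply: le_trans dM; apply: ler_wpM2l => //; apply: ler_wpM2l; first by rewrite mulr_ge0// ltW.
  by apply: dualW_mono; rewrite lerDl ltW.
pose e' := e / 2 / m.+2%:R.
have e'0 : 0 < e' by rewrite divr_gt0// ltr0n.
have H1 (i : nat) := cell_limit CH W Ws SM (z - d + i%:R * d) psi0 x y e'0.
have [N HN] := choice H1; clear H1.
exists (\sum_(i < m.+2) N i)%N => n Nn.
have nN (i : nat) : (i < m.+2)%N -> (N i <= n)%N.
  move=> im; apply: leq_trans Nn; rewrite (bigD1 (Ordinal im)) //=; exact: leq_addr.
set P := Num.sqrt n.+1%:R.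
have P30 : 0 <= P ^+ 3 by rewrite exprn_ge0// sqrtr_ge0.
have cE (i : nat) G : d / sg ^+ 2 * G * (gs 0 * nV x y) = ka * (d * G) by rewrite /ka; ring.
have me' : \sum_(i < m.+2) e' = e / 2.
  by rewrite sumr_const card_ord -[LHS]mulr_natr /e' divfK// gt_eqF// ltr0n.
have U : P ^+ 3 * iter n K (window psi z a) x y <= ka * I + e.
  apply: le_trans (_ : P ^+ 3 * \sum_(i < m.+2) 1 * iter n K (cell d psi (z - d + i%:R * d)) x y <= _).
    apply: ler_wpM2l => //; rewrite -iter_kill_sum; apply: (iter_kill_le f SQ) => *.
    exact: window_le_cells.
  apply: le_trans (_ : \sum_(i < m.+2) (ka * (d * F (z + i%:R * d)) + e') <= _).
    rewrite mulr_sumr; apply: ler_sum => i _; rewrite mul1r.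
    have [_ h] := HN i n (nN i (ltn_ord i)); apply: le_trans h _; rewrite cE//.
    by have -> : z - d + i%:R * d + d = z + i%:R * d by ring.
  rewrite big_split /= me' -mulr_sumr -mulr_sumr.
  have := ler_wpM2l ka0 Du; rewrite mulrDr => h.
  move: dM h; move: (ka * (d * _)) (ka * (2 * _ * _)) (ka * I) => *; lra.
have L : ka * I - e <= P ^+ 3 * iter n K (window psi z a) x y.
  apply: le_trans (_ : P ^+ 3 * \sum_(i < m) 1 * iter n K (cell d psi (z - d + i.+1%:R * d)) x y <= _);
    last first.
    apply: ler_wpM2l => //; rewrite -iter_kill_sum; apply: (iter_kill_le f SQ) => *.
    exact: window_ge_cells.
  apply: le_trans (_ : \sum_(i < m) (ka * (d * F (z + i%:R * d)) - e') <= _); last first.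
    rewrite mulr_sumr; apply: ler_sum => i _; rewrite mul1r.
    have im : (i.+1 < m.+2)%N by rewrite !ltnS ltnW.
    have [h _] := HN i.+1 n (nN i.+1 im); apply: le_trans h; rewrite cE//.
    by have -> : z - d + i.+1%:R * d = z + i%:R * d by rewrite -natr1; ring.
  rewrite sumrB -mulr_sumr -mulr_sumr.
  have me2 : \sum_(i < m) e' <= e / 2.
    by rewrite -me' !big_ord_recr /= -addrA lerDl (addr_ge0 (ltW e'0) (ltW e'0)).
  have := ler_wpM2l ka0 Dl; rewrite mulrBr => h.
  move: dM' h me2; move: (ka * (d * _)) (ka * (2 * _ * _)) (ka * I) (\sum_(i < m) e') => *; lra.
rewrite ler_norml; apply/andP; split; [rewrite lerBrDl|rewrite lerBlDl] => //.
Qed.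

End WindowLimit.

(** * The uniform bound *)

Section WindowBound.
Variables (R : realType) (X : finType).
Variables (Q : X -> X -> R) (nu f r q rs qs : X -> R) (sg B Bs : R) (V Vs : X -> R -> R).
Hypothesis CH : chain Q nu f.
Hypothesis W : walk Q f r q sg B V.
Hypothesis Ws : walk (Pstar Q nu) (fun x => - f x) rs qs sg Bs Vs.
Let SQ := chain_stoch CH.
Local Notation K := (kill Q f).

(** Here d is fixed. There are at most a / d + 2 cells, each bounded by [cell_low] at height at most
    z + a + 1; this gives (1 + a)^2 (1 + z), and (1 + a)^2 <= 4 (1 + a^3). The free first step
    raises y by at most B, absorbed in 1 + B. *)
Lemma window_bound : exists2 c : R, 0 < c & forall psi M z a n x y,
  (forall x, 0 <= psi x <= M) -> 0 <= z -> 0 < a ->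
  step Q f (iter n K (window psi z a)) x y <=
    c * M * (1 + a ^+ 3) * (1 + z) * (1 + Num.max y 0) / Num.sqrt n.+1%:R ^+ 3.
Proof.
have [d [Csm [SM d1]]] := exists_smoothing CH ltr01.
have d0 : 0 < d by case: SM.
have [C C0 HC] := cell_low CH W Ws SM.
have B0 := walk_B W.
exists (C * (24 / d) * (1 + B)); first by rewrite !mulr_gt0 ?invr_gt0 ?addr_gt0.
move=> psi M z a n x y Hp z0 a0.
have psi0 x' : 0 <= psi x' by have /andP[] := Hp x'.
have M0 : 0 <= M by have /andP[h1 h2] := Hp x; exact: le_trans h2.
have [m [ma am]] := exists_floor d0 (ltW a0).
set P := Num.sqrt n.+1%:R; have P30 : 0 < P ^+ 3 by rewrite exprn_gt0// sqrtSn_gt0.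
set y1 := Num.max y 0; have y10 : 0 <= y1 by rewrite le_max lexx orbT.
have yy1 : y <= y1 by rewrite le_max lexx.
pose U := C * M * (3 * (1 + z + a)) * ((1 + B) * (1 + y1)) / P ^+ 3.
have U0 : 0 <= U.
  rewrite /U divr_ge0 ?(ltW P30)// mulr_ge0//; last by rewrite mulr_ge0// addr_ge0// ltW.
  by rewrite mulr_ge0 ?mulr_ge0 ?(ltW C0)// addr_ge0 ?addr_ge0// ltW.
have key x' : iter n K (window psi z a) x' (y + f x') <= m.+2%:R * U.
  have [u0|u0] := ltP 0 (y + f x'); last first.
    have -> : iter n K (window psi z a) x' (y + f x') = 0.
      case: n @P P30 @U U0 => [|k] _ _ _ _ /=; last exact: killN.
      by rewrite /window ltNge u0 mul0r.
    by rewrite mulr_ge0.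
  apply: le_trans (_ : \sum_(i < m.+2) 1 * iter n K (cell d psi (z - d + i%:R * d)) x' (y + f x') <= _).
    by rewrite -iter_kill_sum; apply: (iter_kill_le f SQ) => *; exact: window_le_cells.
  have -> : m.+2%:R * U = \sum_(i < m.+2) U by rewrite sumr_const card_ord -[RHS]mulr_natl.
  apply: ler_sum => i _; rewrite mul1r.
  apply: le_trans (HC psi M _ n Hp x' _) _; rewrite -/P /U ler_pM2r ?invr_gt0//.
  have id : i%:R * d <= a + d.
    apply: le_trans (_ : m.+1%:R * d <= _); first by rewrite ler_pM2r// ler_nat -ltnS.
    by rewrite -natr1 mulrDl mul1r lerD2r.
  have id0 : 0 <= i%:R * d by rewrite mulr_ge0 ?ler0n// ltW.
  have CM0 : 0 <= C * M by rewrite mulr_ge0// ltW.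
  apply: ler_pM; [by rewrite mulr_ge0// addr_ge0|by rewrite addr_ge0|apply: ler_wpM2l => //|].
    have : `|z - d + i%:R * d| <= z + a + 1.
      by rewrite ler_norml; move: (i%:R * d) id id0 => ? ? ?; apply/andP; split; lra.
    by move: (`|z - d + i%:R * d|) => ? ?; lra.
  rewrite ger0_norm ?(ltW u0)//.
  have fB := le_trans (ler_norm _) (walk_fB W x').
  have By : 0 <= B * y1 by rewrite mulr_ge0// ltW.
  by move: fB yy1 By => ? ? ?; rewrite mulrDr mulrDl; lra.
have stp : step Q f (iter n K (window psi z a)) x y <= m.+2%:R * U.
  rewrite /step -(sumQ_cst SQ x (m.+2%:R * U)); exact: (sumQ_le SQ).
apply: le_trans stp _.
have m2 : m.+2%:R <= 2 / d * (1 + a).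
  have md : m%:R <= a / d by rewrite ler_pdivlMr.
  have i1 : 1 <= d^-1 by rewrite -[leLHS]invr1 lef_pV2 ?posrE// ltW.
  have ad : 0 <= a / d by rewrite divr_ge0// ltW.
  have -> : m.+2%:R = m%:R + 2 :> R by rewrite -addn2 natrD.
  have -> : 2 / d * (1 + a) = 2 * d^-1 + 2 * (a / d) by ring.
  by move: (a / d) (d^-1) md i1 ad => *; lra.
have cub : (1 + a) ^+ 2 <= 4 * (1 + a ^+ 3).
  have : 0 <= (1 + a) * (a - 1) ^+ 2 by rewrite mulr_ge0 ?sqr_ge0// addr_ge0// ltW.
  have : 0 <= a ^+ 3 by rewrite exprn_ge0// ltW.
  have : 0 <= (a - 1) ^+ 2 by exact: sqr_ge0.
  have aa := a0; rewrite !expr2 !exprSr !expr0 => *; nra.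
apply: le_trans (ler_wpM2r U0 m2) _.
have zz : 1 + z + a <= (1 + z) * (1 + a) by rewrite mulrDr mulr1 lerD2l mulrDl mul1r lerDl mulr_ge0// ltW.
pose A := C * M * ((1 + B) * (1 + y1)) / P ^+ 3 * 6 / d.
have A0 : 0 <= A.
  rewrite /A divr_ge0 ?(ltW d0)// mulr_ge0// divr_ge0 ?(ltW P30)// mulr_ge0//.
    by rewrite mulr_ge0// ltW.
  by rewrite mulr_ge0// addr_ge0// ltW.
have -> : 2 / d * (1 + a) * U = A * ((1 + a) * (1 + z + a)).
  by rewrite /A /U; ring.
apply: le_trans (_ : A * ((1 + z) * (4 * (1 + a ^+ 3))) <= _); last first.
  by apply: eqle; rewrite /A; ring.
apply: ler_wpM2l => //.
apply: le_trans (_ : (1 + a) * ((1 + z) * (1 + a)) <= _).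
  by apply: ler_wpM2l => //; rewrite addr_ge0// ltW.
have -> : (1 + a) * ((1 + z) * (1 + a)) = (1 + z) * (1 + a) ^+ 2 by ring.
by apply: ler_wpM2l => //; rewrite addr_ge0.
Qed.

End WindowBound.

(** * Assembly of the two assertions *)

Lemma powR32 (R : realType) n : n%:R `^ (3 / 2) = Num.sqrt n%:R ^+ 3 :> R.
Proof.
have n0 : 0 <= n%:R :> R by rewrite ler0n.
by rewrite -powR12_sqrt// -powR_mulrn ?powR_ge0// -powRrM mulrC.
Qed.

Lemma le_supnorm (R : realType) (X : finType) (g : X -> R) x : g x <= supnorm g.
Proof.
by apply: le_trans (ler_norm _) _; rewrite /supnorm; exact: (@le_bigmax _ _ _ 0 (fun x => `|g x|) x).
Qed.

Lemma Eexp_window (R : realType) (X : finType) (Q : X -> X -> R) (f psi : X -> R) (z a y : R) n x :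
  Eexp Q x (fun w : n.+1.-tuple X => psi (Xk x w n.+1) *
    ((z <= y + Sk f x w n.+1 <= z + a) && surv f y x w)%:R) =
  step Q f (iter n (kill Q f) (window psi z a)) x y.
Proof.
rewrite -(Eexp_kill Q f (fun x u => psi x * (z <= u <= z + a)%R%:R)).
by apply: eq_bigr => w _; case: (surv _ _ _ _); rewrite ?andbT ?andbF ?mulr1 ?mulr0.
Qed.

Theorem theorem2p5 (R : realType) (X : finType) (P : X -> X -> R) (nu : X -> R)
  (f : X -> R) :
  stochastic P -> invariant_prob P nu ->
  H1 P -> H2 nu f -> H3 P f ->
  let s := sigma P nu f in
  let V := Vfun P f s in
  let Vs := Vfun (Pstar P nu) (fun x => - f x) s in
  (forall (psi : X -> R) (a : R) (x : X) (y z : R),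
     (forall x', 0 <= psi x') -> 0 < a -> 0 <= z ->
     (fun n : nat => n%:R `^ (3 / 2) *
        Eexp P x (fun w : n.-tuple X =>
          psi (Xk x w n) *
          ((z <= y + Sk f x w n <= z + a) && surv f y x w)%:R))
     @ \oo -->
     2 * V x y / (Num.sqrt (2 * pi) * s ^+ 3) *
     Rintegral lebesgue_measure `[z, z + a]
       (fun z' => \sum_(x0 : X) nu x0 *
          Eexp (Pstar P nu) x0 (fun w : 1.-tuple X =>
            psi (Xk x0 w 1) * Vs (Xk x0 w 1) (z' + Sk (fun x => - f x) x0 w 1) *
            (surv (fun x => - f x) z' x0 w)%:R)))
  /\
  (exists c : R, 0 < c /\
     forall (a : R) (psi : X -> R) (y z : R) (n : nat),
       0 < a -> (forall x', 0 <= psi x') -> 0 <= z -> (1 <= n)%N ->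
       forall x : X,
         Eexp P x (fun w : n.-tuple X =>
           psi (Xk x w n) *
           ((z <= y + Sk f x w n <= z + a) && surv f y x w)%:R)
         <= c * supnorm psi / n%:R `^ (3 / 2) * (1 + a ^+ 3) * (1 + z)
            * (1 + Num.max y 0)).
Proof.
move=> SQ inv h1 h2 h3; set s := sigma P nu f; cbv zeta.
have CH : chain P nu f by split.
have [r [q [B [V W]]]] := exists_walk CH.
have [rs [qs [Bs [Vs Ws]]]] := exists_walk (dual_chain CH).
rewrite (sigma_dual CH) in Ws; rewrite -/s in W Ws.
have sg0 : 0 < s := walk_sg W.
split; last first.
  have [c c0 Hc] := window_bound CH W Ws; exists c; split => //.
  move=> a psi y z [|n] // a0 psi0 z0 _ x; rewrite Eexp_window powR32.
  have Hp x' : 0 <= psi x' <= supnorm psi by rewrite psi0 le_supnorm.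
  apply: le_trans (Hc psi (supnorm psi) z a n x y Hp z0 a0) _.
  by apply: eqle; ring.
move=> psi a x y z psi0 a0 z0.
have [d [C [SM _]]] := exists_smoothing CH ltr01.
have [d' [C' [SM' _]]] := exists_smoothing (dual_chain CH) ltr01.
(* Summing over the start against nu, invariant for the dual kernel, removes the first dual step. *)
have EW z' : \sum_(x0 : X) nu x0 *
    Eexp (Pstar P nu) x0 (fun w : 1.-tuple X =>
      psi (Xk x0 w 1) * Vfun (Pstar P nu) (fun x => - f x) s (Xk x0 w 1)
        (z' + Sk (fun x => - f x) x0 w 1) *
      (surv (fun x => - f x) z' x0 w)%:R) = dualW nu f Vs psi z'.
  under eq_bigr => x0 _.
    rewrite (Eexp_kill (Pstar P nu) (fun x => - f x)
      (fun x1 u => psi x1 * Vfun (Pstar P nu) (fun x => - f x) s x1 u)) /step /= mulr_sumr.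
    over.
  rewrite exchange_big /=; apply: eq_bigr => x1 _.
  have [_ [_ <-]] := chain_inv (dual_chain CH).
  rewrite !mulr_suml; apply: eq_bigr => x0 _; 
  transitivity (nu x0 * (Pstar P nu x0 x1 * (psi x1 * Vs x1 (z' - f x1)))); last by rewrite !mulrA.
  congr (_ * (_ * _)).
  (* On survival the arrival height is positive, where [Vfun] is the harmonic function; elsewhere
     the latter is 0. *)
  have [u0|u0] := ltP 0 (z' - f x1); last by rewrite mul0r (walk_Vneg Ws)// mulr0.
  by rewrite mul1r (Vfun_pos (dual_chain CH) Ws SM').
have EWf := funext EW; rewrite EWf; clear EW EWf.
rewrite (VfunE CH W SM) -cvg_shiftS /=.
have -> : (fun n => n.+1%:R `^ (3 / 2) * Eexp P x (fun w : n.+1.-tuple X =>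
    psi (Xk x w n.+1) * ((z <= y + Sk f x w n.+1 <= z + a) && surv f y x w)%:R)) =
  (fun n => \sum_x' P x x' * (Num.sqrt n.+1%:R ^+ 3 *
    iter n (kill P f) (window psi z a) x' (y + f x'))).
  apply/funext => n; rewrite Eexp_window powR32 /step mulr_sumr.
  by apply: eq_bigr => x' _; rewrite mulrCA.
set I := Rintegral _ _ _.
have -> : 2 * step P f V x y / (Num.sqrt (2 * pi) * s ^+ 3) * I =
  \sum_x' P x x' * (gs 0 / s ^+ 2 * nv s V x' (y + f x') * I).
  rewrite /step mulr_sumr !mulr_suml; apply: eq_bigr => x' _.
  rewrite /gs expr0n /= mul0r oppr0 expR0 /nv.
  by field; rewrite !gt_eqF// sqrt2pi_gt0.
apply: cvgn_sum => x'; apply: cvgM; first exact: cvg_cst.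
exact: (window_limit CH W Ws).
Qed.
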